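(* Let $\mu\neq0$ be a transformable measure on $\mathbb{R}$ and $\lambda$ a fourth root of unity. Then the following are equivalent. (1) $\mathrm{supp}(\mu)$ is uniformly discrete and $\mu$ is an eigenmeasure of $\mathcal{F}$ with eigenvalue $\lambda$ (equivalently, under uniform discreteness of the support, a strict eigenmeasure of $\mathcal{F}$ with eigenvalue $\lambda$). (2) There are integers $n,k\in\mathbb{N}$ and numbers $c_1,\dots,c_k\in\mathbb{C}$, $r_1,\dots,r_k,s_1,\dots,s_k\in\mathbb{R}$ such that $$\mu=\nu+\lambda^{-1}\widehat\nu+\lambda^{-2}\widehat{\widehat\nu}+\lambda^{-3}\widehat{\widehat{\widehat\nu}}\quad\text{for}\quad \nu=\sum_{i=1}^k c_i\,\mathcal{Z}_{r_i,s_i,\beta},\ \beta=\sqrt n.$$ (3) There is some $n\in\mathbb{N}$ such that $\mu\in\mathcal{E}_\lambda(n):=\mathrm{span}_{\mathbb{C}}\{\mathcal{Y}_{r,s,\sqrt n,\lambda}: r,s\in\mathbb{R}\}$, where $\mathcal{Y}_{r,s,\sqrt n,\lambda}:=\bigl(\mathrm{id}+\lambda^{-1}\mathcal{F}+\lambda^{-2}\mathcal{F}^2+\lambda^{-3}\mathcal{F}^3\bigr)\mathcal{Z}_{r,s,\sqrt n}$.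
   Context: For $r,s\in\mathbb{R}$ and $\alpha>0$, $\mathcal{Z}_{r,s,\alpha}:=\sum_{m\in\mathbb{Z}}e^{2\pi i r(s+m\alpha)}\delta_{s+m\alpha}$, where $\delta_x$ is the unit point mass at $x$. The Fourier transform $\mathcal{F}$ is $\widehat{g}(y)=\int e^{-2\pi ixy}g(x)\,dx$, extended to tempered distributions by duality; a tempered (Radon) measure is transformable if its distributional transform is a measure (then all iterates $\mathcal{F}^j$ of it are measures). It is strictly transformable if there is a measure $\widehat\mu$ with $\check f\in L^1(|\widehat\mu|)$ and $\mu(f)=\widehat\mu(\check f)$ for all $f$ in the span of $\{g*h:g,h\in C_c(\mathbb{R})\}$, $\check f(y)=\widehat f(-y)$. A non-trivial tempered measure $\mu$ is an eigenmeasure with eigenvalue $\lambda$ if it is transformable with $\mathcal{F}(\mu)=\lambda\mu$; a strict eigenmeasure if strictly transformable with $\widehat\mu=\lambda\mu$ as measures. A set is uniformly discrete if distinct points have distance bounded below by some $r>0$. *)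

(* Defs.v *)
From Stdlib Require Import Reals.
From Coquelicot Require Import Coquelicot.

Local Open Scope R_scope.

Notation CC := Complex.C.

Definition cexpi (t : R) : CC := (cos t, sin t).

Fixpoint csum (k : nat) (u : nat -> CC) : CC :=
  match k with
  | O => 0%C
  | S k' => Cplus (csum k' u) (u k')
  end.

Definition integral (f : R -> CC) : CC :=
  RInt_gen (V := C_R_CompleteNormedModule) f (Rbar_locally m_infty) (Rbar_locally p_infty).

Definition Cc (f : R -> CC) : Prop :=
  (forall x, continuous f x) /\ exists K : R, forall x, K < Rabs x -> f x = 0%C.

Definition smoothR (g : R -> R) : Prop := forall k x, ex_derive_n g k x.

Definition cderiv (f : R -> CC) (k : nat) (x : R) : CC :=
  (Derive_n (fun t => fst (f t)) k x, Derive_n (fun t => snd (f t)) k x).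

Definition smooth (f : R -> CC) : Prop :=
  smoothR (fun t => fst (f t)) /\ smoothR (fun t => snd (f t)).

Definition schwartz (f : R -> CC) : Prop :=
  smooth f /\
  forall m k : nat, exists B : R, forall x, Rabs x ^ m * Cmod (cderiv f k x) <= B.

Definition testfun (f : R -> CC) : Prop := Cc f /\ smooth f.

Definition fourier (g : R -> CC) : R -> CC :=
  fun y => integral (fun x => Cmult (cexpi (- 2 * PI * x * y)) (g x)).

Definition icheck (g : R -> CC) : R -> CC := fun y => fourier g (- y).

(** A (complex Radon) measure is a linear functional on C_c(R) which is
    continuous for the inductive limit topology (local sup-norm bounds). Only
    its values on C_c(R) are meaningful. *)
Definition measure := (R -> CC) -> CC.

Definition is_measure (mu : measure) : Prop :=
  (forall (a : CC) f g, Cc f -> Cc g ->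
      mu (fun x => Cplus (Cmult a (f x)) (g x)) = Cplus (Cmult a (mu f)) (mu g)) /\
  (forall K : R, exists A : R, forall f, Cc f ->
      (forall x, K < Rabs x -> f x = 0%C) ->
      forall B : R, (forall x, Cmod (f x) <= B) -> Cmod (mu f) <= A * B).

Definition meq (mu nu : measure) : Prop := forall f, Cc f -> mu f = nu f.

Definition mscale (a : CC) (mu : measure) : measure := fun f => Cmult a (mu f).

Definition nontrivial (mu : measure) : Prop := exists f, Cc f /\ mu f <> 0%C.

Definition in_supp (mu : measure) (x : R) : Prop :=
  forall eps : R, 0 < eps ->
    exists f, Cc f /\ (forall y, eps <= Rabs (y - x) -> f y = 0%C) /\ mu f <> 0%C.

Definition uniformly_discrete (S : R -> Prop) : Prop :=
  exists r : R, 0 < r /\ forall x y, S x -> S y -> x <> y -> r <= Rabs (x - y).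

Definition tempered_ext (mu : measure) (T : (R -> CC) -> CC) : Prop :=
  (forall (a : CC) f g, schwartz f -> schwartz g ->
      T (fun x => Cplus (Cmult a (f x)) (g x)) = Cplus (Cmult a (T f)) (T g)) /\
  (exists (N : nat) (A : R), forall f, schwartz f ->
      forall B : R, (forall (m k : nat) x, (m <= N)%nat -> (k <= N)%nat ->
                      Rabs x ^ m * Cmod (cderiv f k x) <= B) ->
      Cmod (T f) <= A * B) /\
  (forall f, testfun f -> T f = mu f).

Definition tempered (mu : measure) : Prop := is_measure mu /\ exists T, tempered_ext mu T.

Definition FT_meas (mu nu : measure) : Prop :=
  is_measure mu /\ is_measure nu /\
  exists T, tempered_ext mu T /\ forall f, testfun f -> nu f = T (fourier f).

Definition transformable (mu : measure) : Prop := exists nu, FT_meas mu nu.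

Definition eigenmeasure (mu : measure) (lam : CC) : Prop :=
  nontrivial mu /\ exists nu, FT_meas mu nu /\ meq nu (mscale lam mu).

Definition conv (g h : R -> CC) : R -> CC :=
  fun x => integral (fun y => Cmult (g (x - y)) (h y)).

Definition in_conv_span (f : R -> CC) : Prop :=
  exists (k : nat) (c : nat -> CC) (g h : nat -> R -> CC),
    (forall i, (i < k)%nat -> Cc (g i) /\ Cc (h i)) /\
    forall x, f x = csum k (fun i => Cmult (c i) (conv (g i) (h i) x)).

(** continuous h is in L^1(|mu|): sup { |mu g| : g in C_c, |g| <= |h| } < oo *)
Definition L1_abs (mu : measure) (h : R -> CC) : Prop :=
  exists B : R, forall g, Cc g -> (forall x, Cmod (g x) <= Cmod (h x)) -> Cmod (mu g) <= B.

Definition cutoff (N : nat) (x : R) : R := Rmax 0 (Rmin 1 (INR N + 1 - Rabs x)).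

(** mu(h) for h in L^1(|mu|), as the limit of mu(h chi_N) *)
Definition mext (mu : measure) (h : R -> CC) (v : CC) : Prop :=
  filterlim (fun N : nat => mu (fun x => Cmult (RtoC (cutoff N x)) (h x)))
            eventually (locally v).

Definition strict_FT (mu muh : measure) : Prop :=
  is_measure mu /\ is_measure muh /\
  forall f, in_conv_span f -> L1_abs muh (icheck f) /\ mext muh (icheck f) (mu f).

Definition strict_eigenmeasure (mu : measure) (lam : CC) : Prop :=
  nontrivial mu /\ exists muh, strict_FT mu muh /\ meq muh (mscale lam mu).

(** Z_{r,s,alpha} = sum_{m in Z} e^{2 pi i r (s + m alpha)} delta_{s + m alpha},
    acting on f in C_c as the limit of the symmetric partial sums *)
Definition is_Zcomb (r s alpha : R) (Z : measure) : Prop :=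
  forall f, Cc f ->
    filterlim
      (fun M : nat =>
         csum (2 * M + 1)
           (fun j => let p := s + (INR j - INR M) * alpha in
                     Cmult (cexpi (2 * PI * r * p)) (f p)))
      eventually (locally (Z f)).

(** (id + lam^-1 F + lam^-2 F^2 + lam^-3 F^3) applied to mu, given the iterates *)
Definition proj4 (lam : CC) (mu mu1 mu2 mu3 : measure) : measure :=
  fun f => Cplus (Cplus (Cplus (mu f) (Cmult (Cinv lam) (mu1 f)))
                        (Cmult (Cinv (Cpow lam 2)) (mu2 f)))
                 (Cmult (Cinv (Cpow lam 3)) (mu3 f)).

Definition is_Ycomb (r s alpha : R) (lam : CC) (Y : measure) : Prop :=
  exists Z Z1 Z2 Z3 : measure,
    is_Zcomb r s alpha Z /\ FT_meas Z Z1 /\ FT_meas Z1 Z2 /\ FT_meas Z2 Z3 /\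
    meq Y (proj4 lam Z Z1 Z2 Z3).

Definition lincomb (k : nat) (c : nat -> CC) (mus : nat -> measure) : measure :=
  fun f => csum k (fun i => Cmult (c i) (mus i f)).

(* Main.v *)
Require Import Defs.
From Stdlib Require Import Reals Lra Lia ZArith List.
From Stdlib Require Import Classical ClassicalEpsilon FunctionalExtensionality.
From Coquelicot Require Import Coquelicot.
Import ListNotations.
Open Scope R_scope.

(** Write [mu = sum c_j delta_{p_j}]. The eigen equation (and also its strict form, up to a reflection) says that the
    Fourier transform of [mu] is [kap sum c_j delta_{sig p_j}] with [sig = 1] or [-1], so spectrum and support have the
    same uniformly discrete set of points. Testing against narrow windows shows that the coefficients are bounded, that
    the support [L] is relatively dense, and that [j |-> c_j] is a limit of trigonometric polynomials with frequencies
    in [L]; hence the products [c(x) c(x + h)] have a spectral gap whose size does not depend on [h]. A gap forces a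
    positive density, so for every [h] in [L - L] the set [L /\ (L - h)] has a density bounded below, and by counting
    [L - L] has boundedly many points in each interval of fixed length. Simultaneous approximation on the finitely many
    short differences then yields, for each [eta], some [y > 0] with all of [(L - L) y] within [eta] of the integers.
    For such [y] each [L /\ (x + y Z)] again has a spectral gap, so its density is at least an absolute constant; a
    collision argument gives [N y^2] an integer for an absolute [N], and with [beta = N y] the number [beta^2] is an
    integer [n]. Finitely many classes modulo [beta] cover [L], and since [beta^2] is an integer the coefficients along
    each class are trigonometric polynomials: [mu] is a finite combination of combs [Z_{r,s,beta}]. The Fourier
    transform maps combs to combs with step [1 / beta] and back (Poisson summation); the rest is algebra of the
    operators [F^j]. *)

(** * Complex numbers, sums over the integers *)

(** Why a gap forces density: if few points lay near a given one, a test function could be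
    multiplied by linear factors vanishing at all the others, each paid for by two sinc factors that
    use up only a little of the gap. A single term would survive near that point, while the far
    terms are too small to cancel it. Counted per step of a progression, the density obtained
    depends only on the product of gap width and spacing. A progression of step [y] has gap of order
    [1 / y] and spacing [y], so its density constant [/ 25600] does not involve [y]. This is what
    makes [N] absolute: it is [n!] for some [n > 2 * 25600], so that every index difference supplied
    by the pigeonhole principle divides it. Spectra are never treated as sets or measures: a gap
    means that absolutely convergent series vanish against transforms of test functions of small
    support. The strict equation is known only on the span of convolutions, which need not be
    smooth. Mollifiers lead from it to test functions; conversely, the transform of a convolution is
    summable along every progression, so Poisson summation reaches all of the span. *)

Lemma C_eq (z w : CC) : fst z = fst w -> snd z = snd w -> z = w.
Proof. destruct z, w; simpl; congruence. Qed.

Ltac ceq := apply C_eq; simpl.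

Lemma cexpi_plus a b : cexpi (a + b) = Cmult (cexpi a) (cexpi b).
Proof. ceq; [rewrite cos_plus | rewrite sin_plus]; ring. Qed.

Lemma cexpi_0 : cexpi 0 = 1%C.
Proof. ceq; [apply cos_0 | apply sin_0]. Qed.

Lemma Cmod_cexpi t : Cmod (cexpi t) = 1.
Proof.
  unfold Cmod; simpl. rewrite <- sqrt_1 at 3. f_equal.
  pose proof (sin2_cos2 t) as H; unfold Rsqr in H; lra.
Qed.

Lemma cexpi_opp_l t : Cmult (cexpi (- t)) (cexpi t) = 1%C.
Proof. rewrite <- cexpi_plus, Rplus_opp_l. apply cexpi_0. Qed.

Lemma cexpi_2PI_IZR k : cexpi (2 * PI * IZR k) = 1%C.
Proof.
  assert (Hn : forall n : nat, cexpi (2 * PI * INR n) = 1%C).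
  { intros n. ceq.
    - rewrite <- (Rplus_0_l (2 * PI * INR n)).
      replace (0 + 2 * PI * INR n) with (0 + 2 * INR n * PI) by ring.
      rewrite cos_period. apply cos_0.
    - replace (2 * PI * INR n) with (0 + 2 * INR n * PI) by ring.
      rewrite sin_period. apply sin_0. }
  destruct (Z_le_gt_dec 0 k) as [H|H].
  - rewrite <- (Z2Nat.id k H), <- INR_IZR_INZ. apply Hn.
  - specialize (Hn (Z.to_nat (- k))). rewrite INR_IZR_INZ, Z2Nat.id, opp_IZR in Hn by lia.
    pose proof (cexpi_opp_l (2 * PI * IZR k)) as E.
    replace (- (2 * PI * IZR k)) with (2 * PI * - IZR k) in E by ring.
    rewrite Hn, Cmult_1_l in E. exact E.
Qed.

Lemma Cmod_le_sum (z : CC) : Cmod z <= Rabs (fst z) + Rabs (snd z).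
Proof.
  assert (E : Cmod Ci = 1).
  { unfold Cmod; simpl. replace (0 * (0 * 1) + 1 * (1 * 1)) with 1 by ring. apply sqrt_1. }
  destruct z as [x y]. replace (x, y) with (Cplus (RtoC x) (Cmult Ci (RtoC y))) by (ceq; ring).
  eapply Rle_trans; [apply Cmod_triangle|].
  rewrite Cmod_mult, !Cmod_R, E. cbn [fst snd Cplus Cmult RtoC Ci].
  apply Req_le. f_equal; [f_equal; ring|]. rewrite Rmult_1_l; f_equal; ring.
Qed.

Lemma Rabs_fst_le (z : CC) : Rabs (fst z) <= Cmod z.
Proof. eapply Rle_trans; [apply Rmax_l | apply Rmax_Cmod]. Qed.

Lemma Rabs_snd_le (z : CC) : Rabs (snd z) <= Cmod z.
Proof. eapply Rle_trans; [apply Rmax_r | apply Rmax_Cmod]. Qed.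

Lemma Cmod_minus_sym (z w : CC) : Cmod (z - w)%C = Cmod (w - z)%C.
Proof. rewrite <- Cmod_opp. f_equal. ring. Qed.

Lemma Cmod_le_minus (z w : CC) : Cmod z <= Cmod w + Cmod (z - w)%C.
Proof.
  replace z with (w + (z - w))%C at 1 by ring. apply Cmod_triangle.
Qed.

Lemma Cmod_minus_triang (z w v : CC) : Cmod (z - v)%C <= Cmod (z - w)%C + Cmod (w - v)%C.
Proof. replace (z - v)%C with ((z - w) + (w - v))%C by ring. apply Cmod_triangle. Qed.

Definition clim (u : nat -> CC) (v : CC) : Prop :=
  forall eps, 0 < eps -> exists N, forall n, (N <= n)%nat -> Cmod (u n - v)%C < eps.

(** Balls of the product space test the two components separately. The modulus is at most the sum of
    the components and at least each of them, so passing to [eps / 2] suffices in one direction and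
    nothing is lost in the other. *)
Lemma clim_filterlim (u : nat -> CC) (v : CC) :
  filterlim u eventually (locally v) <-> clim u v.
Proof.
  split.
  - intros H eps He.
    assert (Hl : locally v (fun z : CC => Cmod (z - v)%C < eps)).
    { assert (He2 : 0 < eps / 2) by lra. exists (mkposreal _ He2). intros z [H1 H2].
      unfold ball, AbsRing_ball in H1, H2; simpl in *.
      eapply Rle_lt_trans; [apply Cmod_le_sum|].
      unfold AbsRing_ball, abs, minus, plus, opp in H1, H2; simpl in *.
      unfold Rminus in *; lra. }
    destruct (H _ Hl) as [N HN]. exists N; intros n Hn; exact (HN n Hn).
  - intros H P [eps HP].
    destruct (H eps (cond_pos eps)) as [N HN]. exists N; intros n Hn.
    apply HP. specialize (HN n Hn). split; unfold ball; simpl;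
    unfold AbsRing_ball, abs, minus, plus, opp; simpl.
    + eapply Rle_lt_trans; [apply (Rabs_fst_le (u n - v)%C)|exact HN].
    + eapply Rle_lt_trans; [apply (Rabs_snd_le (u n - v)%C)|exact HN].
Qed.

Lemma clim_unique u v w : clim u v -> clim u w -> v = w.
Proof.
  intros H1 H2. assert (E : Cmod (v - w)%C = 0).
  { destruct (Rle_lt_or_eq_dec 0 _ (Cmod_ge_0 (v - w)%C)) as [L|L]; [|lra].
    destruct (H1 _ (Rmult_lt_0_compat _ _ L (Rinv_0_lt_compat 2 ltac:(lra)))) as [N1 A1].
    destruct (H2 _ (Rmult_lt_0_compat _ _ L (Rinv_0_lt_compat 2 ltac:(lra)))) as [N2 A2].
    specialize (A1 (N1 + N2)%nat ltac:(lia)). specialize (A2 (N1 + N2)%nat ltac:(lia)).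
    pose proof (Cmod_minus_triang v (u (N1 + N2)%nat) w) as T.
    rewrite Cmod_minus_sym in A1. lra. }
  apply Cmod_eq_0 in E. replace v with (w + (v - w))%C by ring. rewrite E. ring.
Qed.

Lemma clim_ext_from u u' v N0 : (forall n, (N0 <= n)%nat -> u n = u' n) -> clim u v -> clim u' v.
Proof.
  intros E H eps He. destruct (H eps He) as [N HN]. exists (N + N0)%nat. intros n Hn.
  rewrite <- E by lia. apply HN; lia.
Qed.

Lemma clim_const v : clim (fun _ => v) v.
Proof.
  intros eps He. exists 0%nat. intros n _. replace (v - v)%C with (RtoC 0) by ring.
  rewrite Cmod_0; lra.
Qed.

Lemma clim_plus u u' v v' : clim u v -> clim u' v' -> clim (fun n => Cplus (u n) (u' n)) (Cplus v v').
Proof.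
  intros H H' eps He.
  destruct (H (eps / 2) ltac:(lra)) as [N HN]. destruct (H' (eps / 2) ltac:(lra)) as [N' HN'].
  exists (N + N')%nat. intros n Hn. specialize (HN n ltac:(lia)). specialize (HN' n ltac:(lia)).
  replace (u n + u' n - (v + v'))%C with ((u n - v) + (u' n - v'))%C by ring.
  eapply Rle_lt_trans; [apply Cmod_triangle|lra].
Qed.

Lemma clim_scal a u v : clim u v -> clim (fun n => Cmult a (u n)) (Cmult a v).
Proof.
  intros H eps He.
  assert (Ha : 0 <= Cmod a) by apply Cmod_ge_0.
  destruct (H (eps / (Cmod a + 1))) as [N HN]. { apply Rdiv_lt_0_compat; lra. }
  exists N. intros n Hn. specialize (HN n Hn).
  replace (a * u n - a * v)%C with (a * (u n - v))%C by ring. rewrite Cmod_mult.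
  apply Rle_lt_trans with ((Cmod a + 1) * Cmod (u n - v)%C).
  { apply Rmult_le_compat_r; [apply Cmod_ge_0|lra]. }
  apply Rmult_lt_reg_r with (/ (Cmod a + 1)). { apply Rinv_0_lt_compat; lra. }
  replace ((Cmod a + 1) * Cmod (u n - v)%C * / (Cmod a + 1)) with (Cmod (u n - v)%C) by (field; lra).
  exact HN.
Qed.

Lemma clim_le u v B : clim u v -> (forall n, Cmod (u n) <= B) -> Cmod v <= B.
Proof.
  intros H Hb. apply Rnot_lt_le; intros L.
  destruct (H (Cmod v - B) ltac:(lra)) as [N HN]. specialize (HN N (Nat.le_refl _)).
  pose proof (Cmod_le_minus v (u N)). rewrite Cmod_minus_sym in HN. specialize (Hb N). lra.
Qed.

Lemma clim_comp u v (k : nat -> nat) : clim u v -> (forall n, (n <= k n)%nat) -> clim (fun n => u (k n)) v.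
Proof.
  intros H Hk eps He. destruct (H eps He) as [N HN]. exists N. intros n Hn. apply HN.
  specialize (Hk n); lia.
Qed.

Lemma csum_ext k u v : (forall i, (i < k)%nat -> u i = v i) -> csum k u = csum k v.
Proof.
  induction k as [|k IH]; intros H; simpl; auto. rewrite IH, H by auto; auto.
Qed.

Lemma csum_plus k u v : csum k (fun i => Cplus (u i) (v i)) = Cplus (csum k u) (csum k v).
Proof. induction k as [|k IH]; simpl; [ring|]. rewrite IH; ring. Qed.

Lemma csum_scal k a u : csum k (fun i => Cmult a (u i)) = Cmult a (csum k u).
Proof. induction k as [|k IH]; simpl; [ring|]. rewrite IH; ring. Qed.

Lemma csum_0 k (u : nat -> CC) : (forall i, (i < k)%nat -> u i = 0%C) -> csum k u = 0%C.
Proof. induction k as [|k IH]; intros H; simpl; auto. rewrite IH, H by auto. ring. Qed.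

Lemma clim_csum k (u : nat -> nat -> CC) v :
  (forall i, (i < k)%nat -> clim (u i) (v i)) -> clim (fun n => csum k (fun i => u i n)) (csum k v).
Proof.
  induction k as [|k IH]; intros H; simpl; [apply clim_const|].
  apply clim_plus; [apply IH; auto|auto].
Qed.

(** Grows by the pair [M], [- M], so its values are the symmetric partial sums of [is_Zcomb] and of
    Dirichlet kernels. *)
Fixpoint zsum (M : nat) (u : Z -> CC) : CC :=
  match M with
  | O => u 0%Z
  | S M' => Cplus (zsum M' u) (Cplus (u (Z.of_nat M)) (u (- Z.of_nat M)%Z))
  end.

Fixpoint zsumR (M : nat) (u : Z -> R) : R :=
  match M with
  | O => u 0%Z
  | S M' => zsumR M' u + (u (Z.of_nat M) + u (- Z.of_nat M)%Z)
  end.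

Lemma csum_shift k u : csum (S k) u = Cplus (u 0%nat) (csum k (fun i => u (S i))).
Proof.
  induction k as [|k IH]; [simpl; ring|].
  change (csum (S (S k)) u) with (Cplus (csum (S k) u) (u (S k))). rewrite IH. simpl. ring.
Qed.

Lemma csum_zsum M (u : Z -> CC) :
  csum (2 * M + 1) (fun j => u (Z.of_nat j - Z.of_nat M)%Z) = zsum M u.
Proof.
  induction M as [|M IH]; [simpl; ring|].
  replace (2 * S M + 1)%nat with (S (S (2 * M + 1)))%nat by lia.
  rewrite csum_shift. cbn [csum zsum].
  rewrite <- IH.
  rewrite (csum_ext _ _ (fun j => u (Z.of_nat j - Z.of_nat M)%Z)).
  2: { intros i _. f_equal. lia. }
  replace (Z.of_nat (S (2 * M + 1)) - Z.of_nat (S M))%Z with (Z.of_nat (S M)) by lia.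
  replace (Z.of_nat 0 - Z.of_nat (S M))%Z with (- Z.of_nat (S M))%Z by lia.
  ring.
Qed.

Lemma zsum_ext M u v : (forall j, (Z.abs j <= Z.of_nat M)%Z -> u j = v j) -> zsum M u = zsum M v.
Proof.
  induction M as [|M IH]; intros H; cbn [zsum].
  - apply H; simpl; lia.
  - rewrite IH, !H by (intros; try apply H; lia). reflexivity.
Qed.

Lemma zsum_plus M u v : zsum M (fun j => Cplus (u j) (v j)) = Cplus (zsum M u) (zsum M v).
Proof. induction M as [|M IH]; cbn [zsum]; [reflexivity|]. rewrite IH; ring. Qed.

Lemma zsum_scal M a u : zsum M (fun j => Cmult a (u j)) = Cmult a (zsum M u).
Proof. induction M as [|M IH]; cbn [zsum]; [reflexivity|]. rewrite IH; ring. Qed.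

Lemma zsum_0 M (u : Z -> CC) : (forall j, (Z.abs j <= Z.of_nat M)%Z -> u j = 0%C) -> zsum M u = 0%C.
Proof.
  intros H. rewrite (zsum_ext M u (fun _ => Cmult 0%C 0%C)).
  - rewrite zsum_scal. ring.
  - intros j Hj. rewrite H by auto. ring.
Qed.

Lemma zsum_csum M k (u : nat -> Z -> CC) :
  zsum M (fun j => csum k (fun i => u i j)) = csum k (fun i => zsum M (u i)).
Proof.
  induction k as [|k IH]; simpl.
  - apply zsum_0; auto.
  - rewrite zsum_plus, IH. reflexivity.
Qed.

Lemma zsumR_ext M u v : (forall j, (Z.abs j <= Z.of_nat M)%Z -> u j = v j) -> zsumR M u = zsumR M v.
Proof.
  induction M as [|M IH]; intros H; cbn [zsumR].
  - apply H; simpl; lia.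
  - rewrite IH, !H by (intros; try apply H; lia). reflexivity.
Qed.

Lemma zsumR_le M u v : (forall j, (Z.abs j <= Z.of_nat M)%Z -> u j <= v j) -> zsumR M u <= zsumR M v.
Proof.
  induction M as [|M IH]; intros H; cbn [zsumR].
  - apply H; simpl; lia.
  - pose proof (H (Z.of_nat (S M)) ltac:(lia)). pose proof (H (- Z.of_nat (S M))%Z ltac:(lia)).
    assert (zsumR M u <= zsumR M v) by (apply IH; intros; apply H; lia). lra.
Qed.

Lemma zsumR_plus M u v : zsumR M (fun j => u j + v j) = zsumR M u + zsumR M v.
Proof. induction M as [|M IH]; cbn [zsumR]; [reflexivity|]. rewrite IH; ring. Qed.

Lemma zsumR_scal M a u : zsumR M (fun j => a * u j) = a * zsumR M u.
Proof. induction M as [|M IH]; cbn [zsumR]; [reflexivity|]. rewrite IH; ring. Qed.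

Lemma zsumR_mono M N u : (forall j, 0 <= u j) -> (M <= N)%nat -> zsumR M u <= zsumR N u.
Proof.
  intros H L. induction L as [|N L IH]; [lra|]. cbn [zsumR].
  pose proof (H (Z.of_nat (S N))). pose proof (H (- Z.of_nat (S N))%Z). lra.
Qed.

Lemma zsumR_pos M u : (forall j, 0 <= u j) -> 0 <= zsumR M u.
Proof.
  intros H. apply Rle_trans with (zsumR 0 u); [apply H|]. apply zsumR_mono; auto; lia.
Qed.

Lemma zsum_Cmod M u : Cmod (zsum M u) <= zsumR M (fun j => Cmod (u j)).
Proof.
  induction M as [|M IH]; cbn [zsum zsumR]; [lra|].
  eapply Rle_trans; [apply Cmod_triangle|].
  apply Rplus_le_compat; auto. apply Cmod_triangle.
Qed.

Lemma zsum_Cmod_diff M N u : (M <= N)%nat ->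
  Cmod (zsum N u - zsum M u)%C <= zsumR N (fun j => Cmod (u j)) - zsumR M (fun j => Cmod (u j)).
Proof.
  intros L. induction L as [|N L IH].
  - replace (zsum M u - zsum M u)%C with (RtoC 0) by ring. rewrite Cmod_0; lra.
  - cbn [zsum zsumR].
    replace (zsum N u + (u (Z.of_nat (S N)) + u (- Z.of_nat (S N))%Z) - zsum M u)%C
      with ((zsum N u - zsum M u) + (u (Z.of_nat (S N)) + u (- Z.of_nat (S N))%Z))%C by ring.
    eapply Rle_trans; [apply Cmod_triangle|].
    pose proof (Cmod_triangle (u (Z.of_nat (S N))) (u (- Z.of_nat (S N))%Z)). lra.
Qed.

Definition summable (u : Z -> CC) : Prop := exists B, forall M, zsumR M (fun j => Cmod (u j)) <= B.

(** Made total by [Lim_seq]; the value is meaningful only where the symmetric partial sums converge,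
    as for [summable] or finitely supported families. *)
Definition Zs (u : Z -> CC) : CC :=
  (real (Lim_seq (fun M => fst (zsum M u))), real (Lim_seq (fun M => snd (zsum M u)))).

Lemma Zs_of_clim u v : clim (fun M => zsum M u) v -> Zs u = v.
Proof.
  intros H. ceq.
  - rewrite (is_lim_seq_unique _ (fst v)); auto.
    apply is_lim_seq_spec. intros eps. destruct (H eps (cond_pos eps)) as [N HN].
    exists N. intros n Hn. eapply Rle_lt_trans; [|apply (HN n Hn)].
    apply (Rabs_fst_le (zsum n u - v)%C).
  - rewrite (is_lim_seq_unique _ (snd v)); auto.
    apply is_lim_seq_spec. intros eps. destruct (H eps (cond_pos eps)) as [N HN].
    exists N. intros n Hn. eapply Rle_lt_trans; [|apply (HN n Hn)].
    apply (Rabs_snd_le (zsum n u - v)%C).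
Qed.

Lemma bounded_tail (g : Z -> R) B : (forall j, 0 <= g j) -> (forall M, zsumR M g <= B) ->
  forall eps, 0 < eps -> exists N, forall M, (N <= M)%nat -> zsumR M g - zsumR N g < eps.
Proof.
  intros Hg HB eps He.
  destruct (ex_finite_lim_seq_incr (fun M => zsumR M g) B) as [l Hl]; auto.
  { intros n. apply zsumR_mono; auto. }
  apply is_lim_seq_spec in Hl. destruct (Hl (mkposreal _ (Rmult_lt_0_compat _ _ He (Rinv_0_lt_compat 2 ltac:(lra))))) as [N HN].
  exists N. intros M HM. pose proof (HN N (Nat.le_refl _)) as A1. pose proof (HN M HM) as A2.
  simpl in A1, A2. apply Rabs_def2 in A1. apply Rabs_def2 in A2. lra.
Qed.

Lemma Zs_correct u : summable u -> clim (fun M => zsum M u) (Zs u).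
Proof.
  intros [B HB].
  assert (T := bounded_tail (fun j => Cmod (u j)) B (fun j => Cmod_ge_0 _) HB).
  assert (X : exists v, clim (fun M => zsum M u) v).
  { assert (C1 : ex_finite_lim_seq (fun M => fst (zsum M u))).
    { apply ex_lim_seq_cauchy_corr. intros eps. destruct (T (eps / 2)) as [N HN].
      { destruct eps; simpl; lra. }
      exists N. intros n m Hn Hm.
      pose proof (Rabs_fst_le (zsum n u - zsum N u)%C) as A. pose proof (zsum_Cmod_diff _ _ u Hn) as A'.
      pose proof (Rabs_fst_le (zsum m u - zsum N u)%C) as D. pose proof (zsum_Cmod_diff _ _ u Hm) as D'.
      pose proof (HN n Hn). pose proof (HN m Hm). simpl in A, D.
      replace (fst (zsum n u) - fst (zsum m u)) with
        ((fst (zsum n u) + - fst (zsum N u)) - (fst (zsum m u) + - fst (zsum N u))) by ring.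
      eapply Rle_lt_trans; [apply Rabs_triang|]. rewrite Rabs_Ropp. lra. }
    assert (C2 : ex_finite_lim_seq (fun M => snd (zsum M u))).
    { apply ex_lim_seq_cauchy_corr. intros eps. destruct (T (eps / 2)) as [N HN].
      { destruct eps; simpl; lra. }
      exists N. intros n m Hn Hm.
      pose proof (Rabs_snd_le (zsum n u - zsum N u)%C) as A. pose proof (zsum_Cmod_diff _ _ u Hn) as A'.
      pose proof (Rabs_snd_le (zsum m u - zsum N u)%C) as D. pose proof (zsum_Cmod_diff _ _ u Hm) as D'.
      pose proof (HN n Hn). pose proof (HN m Hm). simpl in A, D.
      replace (snd (zsum n u) - snd (zsum m u)) with
        ((snd (zsum n u) + - snd (zsum N u)) - (snd (zsum m u) + - snd (zsum N u))) by ring.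
      eapply Rle_lt_trans; [apply Rabs_triang|]. rewrite Rabs_Ropp. lra. }
    destruct C1 as [l1 L1], C2 as [l2 L2]. exists (l1, l2). intros eps He.
    apply is_lim_seq_spec in L1. apply is_lim_seq_spec in L2.
    destruct (L1 (mkposreal _ (Rmult_lt_0_compat _ _ He (Rinv_0_lt_compat 2 ltac:(lra))))) as [N1 H1].
    destruct (L2 (mkposreal _ (Rmult_lt_0_compat _ _ He (Rinv_0_lt_compat 2 ltac:(lra))))) as [N2 H2].
    exists (N1 + N2)%nat. intros n Hn. eapply Rle_lt_trans; [apply Cmod_le_sum|].
    specialize (H1 n ltac:(lia)). specialize (H2 n ltac:(lia)). simpl in *. unfold Rminus in *. lra. }
  destruct X as [v Hv]. now rewrite (Zs_of_clim _ _ Hv).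
Qed.

Lemma summable_le u v : summable v -> (forall j, Cmod (u j) <= Cmod (v j)) -> summable u.
Proof.
  intros [B HB] H. exists B. intros M. eapply Rle_trans; [|apply (HB M)]. apply zsumR_le; auto.
Qed.

Lemma summable_dom u (g : Z -> R) B : (forall M, zsumR M g <= B) -> (forall j, Cmod (u j) <= g j) -> summable u.
Proof. intros HB H. exists B. intros M. eapply Rle_trans; [|apply (HB M)]. apply zsumR_le; auto. Qed.

Lemma summable_plus u v : summable u -> summable v -> summable (fun j => Cplus (u j) (v j)).
Proof.
  intros [B HB] [D HD]. exists (B + D). intros M.
  apply Rle_trans with (zsumR M (fun j => Cmod (u j) + Cmod (v j))).
  - apply zsumR_le; intros; apply Cmod_triangle.
  - rewrite zsumR_plus. specialize (HB M); specialize (HD M); lra.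
Qed.

Lemma summable_scal a u : summable u -> summable (fun j => Cmult a (u j)).
Proof.
  intros [B HB]. exists (Cmod a * B). intros M.
  rewrite (zsumR_ext _ _ (fun j => Cmod a * Cmod (u j))) by (intros; apply Cmod_mult).
  rewrite zsumR_scal. apply Rmult_le_compat_l; [apply Cmod_ge_0|auto].
Qed.

Lemma summable_csum k (u : nat -> Z -> CC) : (forall i, (i < k)%nat -> summable (u i)) ->
  summable (fun j => csum k (fun i => u i j)).
Proof.
  induction k as [|k IH]; intros H; simpl.
  - exists 0. intros M. rewrite (zsumR_ext _ _ (fun _ => 0 * 0)).
    + rewrite zsumR_scal. lra.
    + intros. rewrite Cmod_0. ring.
  - apply summable_plus; [apply IH; auto|apply H; lia].
Qed.

Lemma Zs_ext u v : (forall j, u j = v j) -> Zs u = Zs v.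
Proof. intros H. replace u with v; auto. apply functional_extensionality; auto. Qed.

Lemma Zs_plus u v : summable u -> summable v -> Zs (fun j => Cplus (u j) (v j)) = Cplus (Zs u) (Zs v).
Proof.
  intros H H'. apply Zs_of_clim. eapply clim_ext_from with (N0 := 0%nat).
  - intros n _. symmetry. apply zsum_plus.
  - apply clim_plus; apply Zs_correct; auto.
Qed.

Lemma Zs_scal a u : summable u -> Zs (fun j => Cmult a (u j)) = Cmult a (Zs u).
Proof.
  intros H. apply Zs_of_clim. eapply clim_ext_from with (N0 := 0%nat).
  - intros n _. symmetry. apply zsum_scal.
  - apply clim_scal; apply Zs_correct; auto.
Qed.

Lemma Zs_csum k (u : nat -> Z -> CC) : (forall i, (i < k)%nat -> summable (u i)) ->
  Zs (fun j => csum k (fun i => u i j)) = csum k (fun i => Zs (u i)).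
Proof.
  intros H. apply Zs_of_clim. eapply clim_ext_from with (N0 := 0%nat).
  - intros n _. symmetry. apply zsum_csum.
  - apply (clim_csum k (fun i M => zsum M (u i))). intros; apply Zs_correct; auto.
Qed.

Lemma Zs_finite (u : Z -> CC) M : (forall j, (Z.of_nat M < Z.abs j)%Z -> u j = 0%C) -> Zs u = zsum M u.
Proof.
  intros H. apply Zs_of_clim. eapply clim_ext_from with (N0 := M) (u := fun _ => zsum M u).
  - intros n Hn. induction Hn as [|n Hn IH]; auto. cbn [zsum]. rewrite <- IH.
    rewrite !H by lia. ring.
  - apply clim_const.
Qed.

Lemma summable_finite (u : Z -> CC) M : (forall j, (Z.of_nat M < Z.abs j)%Z -> u j = 0%C) -> summable u.
Proof.
  intros H. exists (zsumR M (fun j => Cmod (u j))). intros N.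
  destruct (Nat.le_gt_cases N M) as [L|L].
  - apply zsumR_mono; auto. intros; apply Cmod_ge_0.
  - apply Req_le. assert (L' : (M <= N)%nat) by lia. clear L.
    induction L' as [|N L' IH]; auto. cbn [zsumR]. rewrite IH, !H by lia. rewrite Cmod_0. ring.
Qed.

Lemma Zs_0 (u : Z -> CC) : (forall j, u j = 0%C) -> Zs u = 0%C.
Proof. intros H. rewrite (Zs_finite u 0) by (intros; apply H). apply H. Qed.

Lemma Zs_bound u (g : Z -> R) B : (forall M, zsumR M g <= B) -> (forall j, Cmod (u j) <= g j) -> Cmod (Zs u) <= B.
Proof.
  intros HB H. eapply clim_le; [apply Zs_correct; eapply summable_dom; eauto|].
  intros M. eapply Rle_trans; [apply zsum_Cmod|]. eapply Rle_trans; [apply zsumR_le; intros; apply H|apply HB].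
Qed.

Lemma zsum_clim M (u : nat -> Z -> CC) v : (forall j, clim (fun n => u n j) (v j)) ->
  clim (fun n => zsum M (u n)) (zsum M v).
Proof.
  intros H. induction M as [|M IH]; cbn [zsum]; auto. repeat apply clim_plus; auto.
Qed.

Lemma Zs_tail u (g : Z -> R) B N M0 eps : (forall M, zsumR M g <= B) ->
  (forall j, Cmod (u j) <= g j) -> (M0 <= N)%nat ->
  (forall M, (M0 <= M)%nat -> zsumR M g - zsumR M0 g < eps) -> Cmod (Zs u - zsum M0 u)%C <= eps.
Proof.
  intros HB H _ HN.
  assert (Hg : forall j, 0 <= g j) by (intros j; eapply Rle_trans; [apply Cmod_ge_0|apply H]).
  apply (clim_le (fun M => (zsum (M0 + M) u - zsum M0 u)%C)).
  - unfold Cminus. apply clim_plus; [|apply clim_const].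
    apply (clim_comp (fun M => zsum M u) _ (fun M => (M0 + M)%nat)).
    + apply Zs_correct. eapply summable_dom; eauto.
    + intros; lia.
  - intros M. eapply Rle_trans; [apply zsum_Cmod_diff; lia|].
    apply Rle_trans with (zsumR (M0 + M) g - zsumR M0 g); [|apply Rlt_le, HN; lia].
    induction M as [|M IH].
    + rewrite Nat.add_0_r. lra.
    + rewrite Nat.add_succ_r. cbn [zsumR]. pose proof (H (Z.of_nat (S (M0 + M)))).
      pose proof (H (- Z.of_nat (S (M0 + M)))%Z). lra.
Qed.

(** Dominated convergence for series: the tail of [g] controls both tails uniformly in [n], and the
    finite middle part converges termwise. *)
Lemma Zs_dominated (u : nat -> Z -> CC) v (g : Z -> R) B :
  (forall M, zsumR M g <= B) -> (forall n j, Cmod (u n j) <= g j) ->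
  (forall j, clim (fun n => u n j) (v j)) -> clim (fun n => Zs (u n)) (Zs v).
Proof.
  intros HB Hu Hv eps He.
  assert (Hv' : forall j, Cmod (v j) <= g j).
  { intros j. apply (clim_le (fun n => u n j)); auto. }
  assert (Hg : forall j, 0 <= g j) by (intros j; eapply Rle_trans; [apply Cmod_ge_0|apply (Hu 0%nat)]).
  destruct (bounded_tail g B Hg HB (eps / 4) ltac:(lra)) as [N HN].
  destruct (zsum_clim N u v Hv (eps / 4) ltac:(lra)) as [n0 Hn0].
  exists n0. intros n Hn. specialize (Hn0 n Hn).
  pose proof (Zs_tail (u n) g B N N _ HB (Hu n) (Nat.le_refl _) HN) as T1.
  pose proof (Zs_tail v g B N N _ HB Hv' (Nat.le_refl _) HN) as T2.
  pose proof (Cmod_minus_triang (Zs (u n)) (zsum N (u n)) (Zs v)) as A1.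
  pose proof (Cmod_minus_triang (zsum N (u n)) (zsum N v) (Zs v)) as A2.
  rewrite (Cmod_minus_sym (zsum N v)) in A2. lra.
Qed.

(** * Smooth functions and bumps *)

(** Carries the derivatives as witnesses, so that closure properties become inductions on [n];
    [smoothR_Ck] translates back to [Derive_n]. *)
Fixpoint Ck (n : nat) (g : R -> R) : Prop :=
  match n with
  | O => True
  | S n' => exists g', (forall x, is_derive g x (g' x)) /\ Ck n' g'
  end.

Lemma Derive_n_S_l g k : Derive_n g (S k) = Derive_n (Derive g) k.
Proof.
  apply functional_extensionality. intros x.
  change (Derive g) with (Derive_n g 1). rewrite Derive_n_comp. now rewrite Nat.add_1_r.
Qed.

Lemma Ck_S n g : Ck (S n) g <-> (forall x, ex_derive g x) /\ Ck n (Derive g).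
Proof.
  split.
  - intros [g' [H1 H2]]. split; [intros x; exists (g' x); auto|].
    replace (Derive g) with g'; auto. apply functional_extensionality. intros x.
    symmetry. apply is_derive_unique; auto.
  - intros [H1 H2]. exists (Derive g). split; auto. intros x. now apply Derive_correct.
Qed.

Lemma smoothR_Ck g : smoothR g <-> forall n, Ck n g.
Proof.
  split.
  - intros H n. revert g H. induction n as [|n IH]; intros g H; [exact I|].
    apply Ck_S. split; [exact (H 1%nat)|]. apply IH. intros k x. destruct k as [|k]; [exact I|].
    pose proof (H (S (S k)) x) as A. simpl in A |- *. rewrite <- Derive_n_S_l. exact A.
  - intros H k. assert (Hk := H k). clear H. revert g Hk.
    induction k as [|k IH]; intros g H x; [exact I|].
    apply Ck_S in H. destruct H as [H1 H2].
    destruct k as [|k]; [apply H1|].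
    specialize (IH _ H2 x). simpl in IH |- *. rewrite <- Derive_n_S_l in IH. exact IH.
Qed.

Lemma smoothR_ex_derive g x : smoothR g -> ex_derive g x.
Proof. intros H. exact (H 1%nat x). Qed.

Lemma smoothR_Derive g : smoothR g -> smoothR (Derive g).
Proof.
  intros H. apply smoothR_Ck. intros n. apply smoothR_Ck with (n := S n) in H.
  now apply Ck_S in H.
Qed.

Lemma smoothR_continuous g x : smoothR g -> continuous g x.
Proof. intros H. apply (ex_derive_continuous (V := R_NormedModule)). now apply smoothR_ex_derive. Qed.

Lemma Ck_le n m g : (n <= m)%nat -> Ck m g -> Ck n g.
Proof.
  revert m g. induction n as [|n IH]; intros m g L H; [exact I|].
  destruct m as [|m]; [lia|]. destruct H as [g' [H1 H2]]. exists g'. split; auto.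
  apply (IH m); auto; lia.
Qed.

Lemma Ck_plus n f g : Ck n f -> Ck n g -> Ck n (fun x => f x + g x).
Proof.
  revert f g. induction n as [|n IH]; intros f g Hf Hg; [exact I|].
  destruct Hf as [f' [F1 F2]], Hg as [g' [G1 G2]].
  exists (fun x => f' x + g' x). split; auto.
  intros x. apply (is_derive_plus (V := R_NormedModule)); auto.
Qed.

Lemma Ck_const n c : Ck n (fun _ => c).
Proof.
  revert c; induction n as [|n IH]; intros c; [exact I|].
  exists (fun _ => 0). split; auto. intros x. apply (is_derive_const (V := R_NormedModule)).
Qed.

Lemma Ck_mult n f g : Ck n f -> Ck n g -> Ck n (fun x => f x * g x).
Proof.
  revert f g. induction n as [|n IH]; intros f g Hf Hg; [exact I|].
  pose proof (Ck_le n _ f (Nat.le_succ_diag_r n) Hf) as Hf0.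
  pose proof (Ck_le n _ g (Nat.le_succ_diag_r n) Hg) as Hg0.
  destruct Hf as [f' [F1 F2]], Hg as [g' [G1 G2]].
  exists (fun x => f' x * g x + f x * g' x). split.
  - intros x. apply (is_derive_mult f g x); auto. intros; apply Rmult_comm.
  - apply Ck_plus; apply IH; auto.
Qed.

Lemma Ck_affine n f a b : Ck n f -> Ck n (fun x => f (a * x + b)).
Proof.
  revert f. induction n as [|n IH]; intros f Hf; [exact I|].
  destruct Hf as [f' [F1 F2]].
  exists (fun x => a * f' (a * x + b)). split.
  - intros x. apply (is_derive_comp f (fun x => a * x + b) x (f' (a * x + b)) a); auto.
    auto_derive; auto. ring.
  - apply (Ck_mult n (fun _ => a)); auto. apply Ck_const.
Qed.

Lemma Ck_cos_sin n : Ck n cos /\ Ck n sin.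
Proof.
  induction n as [|n [IH1 IH2]]; [split; exact I|]. split.
  - exists (fun x => -1 * sin x). split.
    + intros x. auto_derive; auto; ring.
    + apply (Ck_mult n (fun _ => -1)); auto. apply Ck_const.
  - exists cos. split; auto. intros x. auto_derive; auto; ring.
Qed.

Lemma smoothR_plus f g : smoothR f -> smoothR g -> smoothR (fun x => f x + g x).
Proof. rewrite !smoothR_Ck. intros; apply Ck_plus; auto. Qed.
Lemma smoothR_mult f g : smoothR f -> smoothR g -> smoothR (fun x => f x * g x).
Proof. rewrite !smoothR_Ck. intros; apply Ck_mult; auto. Qed.
Lemma smoothR_const c : smoothR (fun _ => c).
Proof. rewrite smoothR_Ck. intros; apply Ck_const. Qed.
Lemma smoothR_affine f a b : smoothR f -> smoothR (fun x => f (a * x + b)).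
Proof. rewrite !smoothR_Ck. intros; apply Ck_affine; auto. Qed.
Lemma smoothR_scal c f : smoothR f -> smoothR (fun x => c * f x).
Proof. apply smoothR_mult, smoothR_const. Qed.
Lemma smoothR_minus f g : smoothR f -> smoothR g -> smoothR (fun x => f x - g x).
Proof.
  intros Hf Hg. replace (fun x => f x - g x) with (fun x => f x + -1 * g x).
  - apply smoothR_plus; auto. now apply smoothR_scal.
  - apply functional_extensionality; intros; ring.
Qed.
Lemma smoothR_cos a b : smoothR (fun x => cos (a * x + b)).
Proof. apply smoothR_affine. apply smoothR_Ck. intros; apply Ck_cos_sin. Qed.
Lemma smoothR_sin a b : smoothR (fun x => sin (a * x + b)).
Proof. apply smoothR_affine. apply smoothR_Ck. intros; apply Ck_cos_sin. Qed.
Lemma smoothR_id : smoothR (fun x => x).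
Proof.
  apply smoothR_Ck. intros [|n]; [exact I|]. exists (fun _ => 1). split.
  - intros x. auto_derive; auto.
  - apply Ck_const.
Qed.

Lemma Derive_n_plus_smooth f g k x : smoothR f -> smoothR g ->
  Derive_n (fun t => f t + g t) k x = Derive_n f k x + Derive_n g k x.
Proof.
  intros Hf Hg. apply Derive_n_plus; apply filter_forall; intros y j _; [apply Hf|apply Hg].
Qed.

(** Every differentiation splits a product into two, so [2 ^ k] terms arise; this coarse form of the
    Leibniz rule suffices for the cutoff estimates. *)
Lemma Derive_n_mult_bound f g k x F G : smoothR f -> smoothR g ->
  (forall i, (i <= k)%nat -> Rabs (Derive_n f i x) <= F) ->
  (forall i, (i <= k)%nat -> Rabs (Derive_n g i x) <= G) ->
  Rabs (Derive_n (fun t => f t * g t) k x) <= 2 ^ k * (F * G).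
Proof.
  revert f g. induction k as [|k IH]; intros f g Hf Hg HF HG.
  - specialize (HF 0%nat (Nat.le_refl _)). specialize (HG 0%nat (Nat.le_refl _)). simpl in *.
    rewrite Rabs_mult, Rmult_1_l. apply Rmult_le_compat; auto; apply Rabs_pos.
  - rewrite Derive_n_S_l.
    replace (Derive (fun t => f t * g t)) with (fun t => Derive f t * g t + f t * Derive g t).
    2: { apply functional_extensionality; intros t. symmetry. apply Derive_mult; now apply smoothR_ex_derive. }
    rewrite (Derive_n_plus_smooth (fun t => Derive f t * g t) (fun t => f t * Derive g t)).
    2, 3: apply smoothR_mult; auto; now apply smoothR_Derive.
    eapply Rle_trans; [apply Rabs_triang|].
    assert (A1 : Rabs (Derive_n (fun t => Derive f t * g t) k x) <= 2 ^ k * (F * G)).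
    { apply IH; auto. now apply smoothR_Derive. intros i Hi. rewrite <- Derive_n_S_l. apply HF; lia. }
    assert (A2 : Rabs (Derive_n (fun t => f t * Derive g t) k x) <= 2 ^ k * (F * G)).
    { apply IH; auto. now apply smoothR_Derive. intros i Hi. rewrite <- Derive_n_S_l. apply HG; lia. }
    simpl. lra.
Qed.

Lemma pow_le_exp k x : 0 <= x -> x ^ k <= INR k ^ k * exp x.
Proof.
  intros Hx. destruct k as [|k].
  - simpl. pose proof (exp_ineq1_le x). lra.
  - set (n := S k). assert (Hn : 0 < INR n) by (apply lt_0_INR; unfold n; lia).
    assert (E : exp x = exp (x / INR n) ^ n).
    { rewrite <- Rpower_pow by apply exp_pos. unfold Rpower. rewrite ln_exp. f_equal. field; lra. }
    rewrite E, <- Rpow_mult_distr. apply pow_incr. split; auto.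
    pose proof (exp_ineq1_le (x / INR n)).
    replace x with (INR n * (x / INR n)) at 1 by (field; lra).
    apply Rmult_le_compat_l; lra.
Qed.

(** The powers of [/ x] are part of the family because derivatives of [exp (- / x)] produce them:
    the span is closed under differentiation ([flat_exp_derive]), and smoothness at 0 follows by
    induction. *)
Definition flat_exp (n : nat) (x : R) : R := if Rle_dec x 0 then 0 else (/ x) ^ n * exp (- / x).

Lemma flat_exp_bound n x : Rabs (flat_exp n x) <= INR (n + 2) ^ (n + 2) * x ^ 2.
Proof.
  unfold flat_exp. assert (H0 : 0 <= INR (n + 2) ^ (n + 2)) by (apply pow_le, pos_INR).
  destruct (Rle_dec x 0) as [H|H].
  - rewrite Rabs_R0. apply Rmult_le_pos; auto. apply pow2_ge_0.
  - assert (Hx : 0 < x) by lra. assert (Hi : 0 < / x) by now apply Rinv_0_lt_compat.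
    rewrite Rabs_pos_eq. 2: { apply Rmult_le_pos; [apply pow_le; lra|apply Rlt_le, exp_pos]. }
    pose proof (pow_le_exp (n + 2) (/ x) ltac:(lra)) as A.
    rewrite pow_add in A. rewrite exp_Ropp.
    apply Rmult_le_reg_r with (exp (/ x) * (/ x) ^ 2).
    { apply Rmult_lt_0_compat; [apply exp_pos|apply pow_lt; auto]. }
    pose proof (exp_pos (/ x)).
    replace ((/ x) ^ n * / exp (/ x) * (exp (/ x) * (/ x) ^ 2)) with ((/ x) ^ n * (/ x) ^ 2) by (field; lra).
    replace (INR (n + 2) ^ (n + 2) * x ^ 2 * (exp (/ x) * (/ x) ^ 2)) with
      (INR (n + 2) ^ (n + 2) * exp (/ x)) by (field; lra).
    exact A.
Qed.

Lemma flat_exp_derive n x : is_derive (flat_exp n) x (- INR n * flat_exp (S n) x + flat_exp (S (S n)) x).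
Proof.
  destruct (Rtotal_order x 0) as [H|[H|H]].
  - apply (is_derive_ext_loc (fun _ => 0)).
    + assert (Hx : 0 < - x) by lra. exists (mkposreal _ Hx). intros y Hy.
      apply Rabs_def2 in Hy. unfold minus, plus, opp in Hy; simpl in Hy.
      unfold flat_exp. destruct (Rle_dec y 0); auto; lra.
    + replace (- INR n * flat_exp (S n) x + flat_exp (S (S n)) x) with 0.
      * apply (is_derive_const (V := R_NormedModule)).
      * unfold flat_exp. destruct (Rle_dec x 0); [ring|lra].
  - subst x. replace (- INR n * flat_exp (S n) 0 + flat_exp (S (S n)) 0) with 0.
    2: { unfold flat_exp. destruct (Rle_dec 0 0); [ring|lra]. }
    apply is_derive_Reals. intros eps He.
    set (C := INR (n + 2) ^ (n + 2)).
    assert (HC : 0 <= C) by (apply pow_le, pos_INR).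
    assert (Hd : 0 < eps / (C + 1)) by (apply Rdiv_lt_0_compat; lra).
    exists (mkposreal _ Hd). intros h Hh Hh'. simpl in Hh'.
    rewrite Rplus_0_l. replace (flat_exp n 0) with 0.
    2: { unfold flat_exp. destruct (Rle_dec 0 0); auto; lra. }
    rewrite !Rminus_0_r. unfold Rdiv. rewrite Rabs_mult, Rabs_inv.
    pose proof (Rabs_pos_lt h Hh) as Hp.
    apply Rle_lt_trans with (C * h ^ 2 * / Rabs h).
    { apply Rmult_le_compat_r; [apply Rlt_le, Rinv_0_lt_compat; auto|apply flat_exp_bound]. }
    rewrite <- (Rabs_pos_eq (h ^ 2)) by apply pow2_ge_0. rewrite <- RPow_abs.
    replace (C * Rabs h ^ 2 * / Rabs h) with (C * Rabs h) by (field; lra).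
    apply Rle_lt_trans with ((C + 1) * Rabs h); [nra|].
    apply Rmult_lt_reg_r with (/ (C + 1)); [apply Rinv_0_lt_compat; lra|].
    replace ((C + 1) * Rabs h * / (C + 1)) with (Rabs h) by (field; lra). exact Hh'.
  - apply (is_derive_ext_loc (fun x => (/ x) ^ n * exp (- / x))).
    + exists (mkposreal _ H). intros y Hy.
      apply Rabs_def2 in Hy. unfold minus, plus, opp in Hy; simpl in Hy.
      unfold flat_exp. destruct (Rle_dec y 0); auto; lra.
    + unfold flat_exp. destruct (Rle_dec x 0) as [L|L]; [lra|].
      auto_derive; [lra|].
      destruct n as [|n]; [simpl; field; lra|].
      rewrite <- !tech_pow_Rmult. simpl pred. field. lra.
Qed.

Lemma Ck_flat_exp k n : Ck k (flat_exp n).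
Proof.
  revert n; induction k as [|k IH]; intros n; [exact I|].
  exists (fun x => - INR n * flat_exp (S n) x + flat_exp (S (S n)) x).
  split; [apply flat_exp_derive|]. apply Ck_plus; auto.
  apply (Ck_mult k (fun _ => - INR n)); auto. apply Ck_const.
Qed.

Definition bump01 (x : R) : R := flat_exp 0 x * flat_exp 0 (-1 * x + 1).

Lemma smoothR_bump01 : smoothR bump01.
Proof.
  apply smoothR_mult; [|apply (smoothR_affine (flat_exp 0))]; apply smoothR_Ck; intros; apply Ck_flat_exp.
Qed.

Lemma flat_exp0_pos x : 0 < x -> 0 < flat_exp 0 x.
Proof.
  intros H. unfold flat_exp. destruct (Rle_dec x 0); [lra|]. simpl. rewrite Rmult_1_l. apply exp_pos.
Qed.

Lemma flat_exp0_ge0 x : 0 <= flat_exp 0 x.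
Proof.
  destruct (Rle_dec x 0) as [H|H].
  - unfold flat_exp. destruct (Rle_dec x 0); lra.
  - apply Rlt_le, flat_exp0_pos; lra.
Qed.

Lemma bump01_ge0 x : 0 <= bump01 x.
Proof. apply Rmult_le_pos; apply flat_exp0_ge0. Qed.

Lemma bump01_out x : x <= 0 \/ 1 <= x -> bump01 x = 0.
Proof.
  intros [H|H]; unfold bump01.
  - unfold flat_exp at 1. destruct (Rle_dec x 0); [ring|lra].
  - unfold flat_exp at 2. destruct (Rle_dec (-1 * x + 1) 0); [ring|lra].
Qed.

Lemma continuous_ex_RInt (g : R -> R) a b : (forall x, continuous g x) -> ex_RInt g a b.
Proof. intros H. apply (ex_RInt_continuous (V := R_CompleteNormedModule)). auto. Qed.

Lemma bump01_cont x : continuous bump01 x.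
Proof. apply smoothR_continuous, smoothR_bump01. Qed.

Definition bump_mass : R := RInt bump01 0 1.

Lemma bump_mass_pos : 0 < bump_mass.
Proof.
  apply RInt_gt_0; [lra| |].
  - intros x Hx. apply Rmult_lt_0_compat; apply flat_exp0_pos; lra.
  - intros x Hx. apply bump01_cont.
Qed.

Definition step (x : R) : R := / bump_mass * RInt bump01 0 x.

Lemma step_derive x : is_derive step x (/ bump_mass * bump01 x).
Proof.
  apply (is_derive_scal (fun x => RInt bump01 0 x)).
  apply (is_derive_RInt (V := R_NormedModule) bump01 (fun x => RInt bump01 0 x) 0 x).
  - apply filter_forall. intros y. apply (RInt_correct (V := R_CompleteNormedModule)).
    apply continuous_ex_RInt, bump01_cont.
  - apply bump01_cont.
Qed.

Lemma smoothR_step : smoothR step.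
Proof.
  apply smoothR_Ck. intros [|n]; [exact I|].
  exists (fun x => / bump_mass * bump01 x). split; [apply step_derive|].
  apply (Ck_mult n (fun _ => / bump_mass)); [apply Ck_const|]. apply smoothR_Ck, smoothR_bump01.
Qed.

Lemma step_mono x y : x <= y -> step x <= step y.
Proof.
  intros H. apply Rmult_le_compat_l; [apply Rlt_le, Rinv_0_lt_compat, bump_mass_pos|].
  rewrite <- (RInt_Chasles bump01 0 x y) by (apply continuous_ex_RInt, bump01_cont).
  unfold plus; simpl. assert (0 <= RInt bump01 x y); [|lra].
  apply RInt_ge_0; auto. apply continuous_ex_RInt, bump01_cont. intros; apply bump01_ge0.
Qed.

Lemma step_le0 x : x <= 0 -> step x = 0.
Proof.
  intros H. unfold step. rewrite (RInt_ext _ (fun _ => 0)).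
  - rewrite RInt_const. unfold scal; simpl; unfold mult; simpl. ring.
  - intros y Hy. rewrite Rmax_left in Hy by lra. apply bump01_out; lra.
Qed.

Lemma step_ge1 x : 1 <= x -> step x = 1.
Proof.
  intros H. unfold step.
  rewrite <- (RInt_Chasles bump01 0 1 x) by (apply continuous_ex_RInt, bump01_cont).
  rewrite (RInt_ext _ (fun _ => 0) 1 x).
  - rewrite RInt_const. unfold plus, scal; simpl; unfold mult; simpl.
    fold bump_mass. pose proof bump_mass_pos. field; lra.
  - intros y Hy. rewrite Rmin_left in Hy by lra. apply bump01_out; lra.
Qed.

Lemma step_bounds x : 0 <= step x <= 1.
Proof.
  split.
  - rewrite <- (step_le0 (Rmin x 0)); [apply step_mono, Rmin_l|apply Rmin_r].
  - rewrite <- (step_ge1 (Rmax x 1)); [apply step_mono, Rmax_l|apply Rmax_r].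
Qed.

Lemma continuous_bounded (g : R -> R) a b : (forall x, continuous g x) ->
  exists B, 0 <= B /\ forall x, a <= x <= b -> Rabs (g x) <= B.
Proof.
  intros H. destruct (Rle_lt_dec a b) as [L|L].
  - destruct (continuity_ab_maj (fun x => Rabs (g x)) a b L) as [m [Hm _]].
    { intros c _. apply continuity_pt_filterlim. apply continuous_comp; auto.
      apply continuous_Rabs. }
    exists (Rabs (g m)). split; [apply Rabs_pos|auto].
  - exists 0. split; [lra|]. intros; lra.
Qed.

(** From the first derivative on, [step] differentiates to smooth functions vanishing off [[0, 1]],
    which are bounded by compactness. *)
Lemma Derive_n_step_bound k : exists B, 0 <= B /\ forall i x, (i <= k)%nat -> Rabs (Derive_n step i x) <= B.
Proof.
  assert (S : forall i, exists B, 0 <= B /\ forall x, Rabs (Derive_n step i x) <= B).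
  { intros [|i].
    - exists 1. split; [lra|]. intros x. simpl. pose proof (step_bounds x). rewrite Rabs_pos_eq; lra.
    - assert (Hd : Derive step = fun x => / bump_mass * bump01 x).
      { apply functional_extensionality. intros x. apply is_derive_unique, step_derive. }
      set (g := fun x => / bump_mass * bump01 x) in *.
      assert (Hg : smoothR g) by (apply smoothR_scal, smoothR_bump01).
      assert (Hgn : smoothR (Derive_n g i)).
      { clear -Hg. induction i as [|i IH]; auto. simpl. now apply smoothR_Derive. }
      destruct (continuous_bounded (Derive_n g i) 0 1) as [B [HB1 HB2]].
      { intros x. now apply smoothR_continuous. }
      exists B. split; auto. intros x. rewrite Derive_n_S_l, Hd.
      destruct (Rle_dec 0 x) as [H0|H0]; [destruct (Rle_dec x 1) as [H1|H1]|].
      + apply HB2; lra.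
      + rewrite (Derive_n_ext_loc _ (fun _ => 0)).
        * destruct i; [simpl; rewrite Rabs_R0; auto|rewrite Derive_n_const, Rabs_R0; auto].
        * assert (Hp : 0 < x - 1) by lra. exists (mkposreal _ Hp). intros y Hy.
          apply Rabs_def2 in Hy. unfold minus, plus, opp in Hy; simpl in Hy.
          unfold g. rewrite bump01_out by lra. ring.
      + rewrite (Derive_n_ext_loc _ (fun _ => 0)).
        * destruct i; [simpl; rewrite Rabs_R0; auto|rewrite Derive_n_const, Rabs_R0; auto].
        * assert (Hp : 0 < - x) by lra. exists (mkposreal _ Hp). intros y Hy.
          apply Rabs_def2 in Hy. unfold minus, plus, opp in Hy; simpl in Hy.
          unfold g. rewrite bump01_out by lra. ring. }
  induction k as [|k [B [HB IH]]].
  - destruct (S 0%nat) as [B [HB H]]. exists B. split; auto. intros i x Hi. replace i with 0%nat by lia. auto.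
  - destruct (S (Datatypes.S k)) as [D [HD H]]. exists (B + D). split; [lra|]. intros i x Hi.
    destruct (Nat.eq_dec i (Datatypes.S k)) as [->|Hn].
    + specialize (H x). lra.
    + specialize (IH i x ltac:(lia)). lra.
Qed.

(** A difference of unit translates of one smooth step: the sum over integer translates telescopes,
    which gives an exact partition of unity ([bump_partition]). *)
Definition bump (x : R) : R := step (x + 1) - step x.

Lemma smoothR_bump : smoothR bump.
Proof.
  apply smoothR_minus; [|apply smoothR_step].
  replace (fun x => step (x + 1)) with (fun x => step (1 * x + 1)).
  - apply smoothR_affine, smoothR_step.
  - apply functional_extensionality; intros; f_equal; ring.
Qed.

Lemma bump_0 : bump 0 = 1.
Proof. unfold bump. rewrite step_ge1, step_le0 by lra. ring. Qed.

Lemma bump_bounds x : 0 <= bump x <= 1.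
Proof.
  unfold bump. pose proof (step_mono x (x + 1) ltac:(lra)).
  pose proof (step_bounds x). pose proof (step_bounds (x + 1)). lra.
Qed.

Lemma bump_out x : 1 <= Rabs x -> bump x = 0.
Proof.
  intros H. unfold bump. destruct (Rle_dec 0 x) as [L|L].
  - rewrite Rabs_pos_eq in H by auto. rewrite !step_ge1 by lra. ring.
  - rewrite Rabs_left in H by lra. rewrite !step_le0 by lra. ring.
Qed.

Lemma bump_partition M x : zsumR M (fun j => bump (x - IZR j)) = step (x + INR M + 1) - step (x - INR M).
Proof.
  induction M as [|M IH].
  - simpl. unfold bump. rewrite Rminus_0_r, Rplus_0_r. reflexivity.
  - cbn [zsumR]. rewrite IH. unfold bump.
    rewrite opp_IZR, <- INR_IZR_INZ, S_INR.
    replace (x - (INR M + 1) + 1) with (x - INR M) by ring.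
    replace (x - - (INR M + 1)) with (x + INR M + 1) by ring.
    replace (x + (INR M + 1) + 1) with (x + INR M + 1 + 1) by ring. ring.
Qed.

(** * Integrals and Fourier transforms of compactly supported functions *)

Definition fre (f : R -> CC) (x : R) : R := fst (f x).
Definition fim (f : R -> CC) (x : R) : R := snd (f x).

Lemma continuous_C (f : R -> CC) x : continuous f x <-> continuous (fre f) x /\ continuous (fim f) x.
Proof.
  split.
  - intros H. split.
    + apply (continuous_comp f fst); auto. destruct (f x). apply continuous_fst.
    + apply (continuous_comp f snd); auto. destruct (f x). apply continuous_snd.
  - intros [H1 H2]. intros P [eps HP].
    assert (A1 := H1 _ (locally_ball (fst (f x)) eps)). assert (A2 := H2 _ (locally_ball (snd (f x)) eps)).
    unfold filtermap in *. generalize (filter_and _ _ A1 A2). apply filter_imp.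
    intros y [B1 B2]. apply HP. split; auto.
Qed.

Lemma continuous_RtoC (g : R -> R) x : continuous g x -> continuous ((fun t => RtoC (g t)) : R -> CC) x.
Proof. intros H. apply continuous_C. split; [exact H|apply continuous_const]. Qed.

Lemma continuous_Cplus (f g : R -> CC) x : continuous f x -> continuous g x ->
  continuous ((fun t => Cplus (f t) (g t)) : R -> CC) x.
Proof.
  rewrite !continuous_C. intros [A B] [C D]. split.
  - apply (continuous_plus (V := R_NormedModule) (fre f) (fre g)); auto.
  - apply (continuous_plus (V := R_NormedModule) (fim f) (fim g)); auto.
Qed.

Lemma continuous_Cmult (f g : R -> CC) x : continuous f x -> continuous g x ->
  continuous ((fun t => Cmult (f t) (g t)) : R -> CC) x.
Proof.
  rewrite !continuous_C. intros [A B] [C D]. split.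
  - apply (continuous_minus (V := R_NormedModule) (fun t => fre f t * fre g t) (fun t => fim f t * fim g t)).
    + apply (continuous_mult (fre f) (fre g)); auto.
    + apply (continuous_mult (fim f) (fim g)); auto.
  - apply (continuous_plus (V := R_NormedModule) (fun t => fre f t * fim g t) (fun t => fim f t * fre g t)).
    + apply (continuous_mult (fre f) (fim g)); auto.
    + apply (continuous_mult (fim f) (fre g)); auto.
Qed.

Lemma continuous_cexpi a x : continuous ((fun t => cexpi (a * t)) : R -> CC) x.
Proof.
  apply continuous_C. split; apply (ex_derive_continuous (V := R_NormedModule)); unfold fre, fim, cexpi; simpl; auto_derive; auto.
Qed.

Lemma continuous_affine (f : R -> CC) a b x : continuous f (a * x + b) -> continuous ((fun t => f (a * t + b)) : R -> CC) x.
Proof.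
  intros H. apply (continuous_comp (fun t => a * t + b) f); auto.
  apply (ex_derive_continuous (V := R_NormedModule)). auto_derive; auto.
Qed.

Lemma Cc_cont f x : Cc f -> continuous f x.
Proof. intros [H _]; auto. Qed.

Lemma Cc_plus f g : Cc f -> Cc g -> Cc (fun x => Cplus (f x) (g x)).
Proof.
  intros [Hf [K HK]] [Hg [L HL]]. split.
  - intros x. apply continuous_Cplus; auto.
  - exists (Rmax K L). intros x Hx. rewrite HK, HL. ring.
    + eapply Rle_lt_trans; [apply Rmax_r|apply Hx].
    + eapply Rle_lt_trans; [apply Rmax_l|apply Hx].
Qed.

Lemma Cc_mult (a f : R -> CC) : (forall x, continuous a x) -> Cc f -> Cc (fun x => Cmult (a x) (f x)).
Proof.
  intros Ha [Hf [K HK]]. split.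
  - intros x. apply continuous_Cmult; auto.
  - exists K. intros x Hx. rewrite HK by auto. ring.
Qed.

Lemma Cc_scal a f : Cc f -> Cc (fun x => Cmult a (f x)).
Proof. apply (Cc_mult (fun _ => a)). intros; apply continuous_const. Qed.

Lemma Cc_minus f g : Cc f -> Cc g -> Cc (fun x => Cminus (f x) (g x)).
Proof.
  intros Hf Hg. replace (fun x => Cminus (f x) (g x)) with (fun x => Cplus (f x) (Cmult (RtoC (-1)) (g x))).
  - apply Cc_plus; auto. now apply Cc_scal.
  - apply functional_extensionality; intros. ceq; ring.
Qed.

Lemma Cc_0 : Cc (fun _ => 0%C).
Proof. split. intros; apply continuous_const. exists 0; auto. Qed.

Lemma Cc_csum k (u : nat -> R -> CC) : (forall i, (i < k)%nat -> Cc (u i)) -> Cc (fun x => csum k (fun i => u i x)).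
Proof.
  induction k as [|k IH]; intros H; simpl; [apply Cc_0|]. apply Cc_plus; auto.
Qed.

Lemma Cc_zsum M (u : Z -> R -> CC) : (forall j, Cc (u j)) -> Cc (fun x => zsum M (fun j => u j x)).
Proof.
  intros H. induction M as [|M IH]; cbn [zsum]; auto.
  apply (Cc_plus (fun x => zsum M (fun j => u j x))); auto. apply (Cc_plus (u _) (u _)); auto.
Qed.

Lemma Cc_affine f a b : a <> 0 -> Cc f -> Cc (fun x => f (a * x + b)).
Proof.
  intros Ha [Hf [K HK]]. split.
  - intros x. apply continuous_affine; auto.
  - exists ((Rabs K + Rabs b) / Rabs a). intros x Hx. apply HK.
    assert (Hp := Rabs_pos_lt a Ha).
    assert (A : Rabs K + Rabs b < Rabs a * Rabs x).
    { apply Rmult_lt_reg_l with (/ Rabs a). now apply Rinv_0_lt_compat.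
      replace (/ Rabs a * (Rabs a * Rabs x)) with (Rabs x) by (field; lra).
      rewrite Rmult_comm. exact Hx. }
    rewrite <- Rabs_mult in A. pose proof (Rabs_triang_inv (a * x) (- b)) as B. rewrite Rabs_Ropp in B.
    replace (a * x - - b) with (a * x + b) in B by ring. pose proof (Rle_abs K). lra.
Qed.

Lemma Cc_support f : Cc f -> exists K, 0 < K /\ forall x, K <= Rabs x -> f x = 0%C.
Proof.
  intros [_ [K HK]]. exists (Rabs K + 1). pose proof (Rabs_pos K). pose proof (Rle_abs K).
  split; [lra|]. intros x Hx. apply HK; lra.
Qed.

Lemma Cc_bounded f : Cc f -> exists B, 0 <= B /\ forall x, Cmod (f x) <= B.
Proof.
  intros Hf. destruct (Cc_support f Hf) as [K [HK0 HK]].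
  destruct (continuous_bounded (fre f) (- K) K) as [B1 [P1 H1]].
  { intros x. apply continuous_C, Hf. }
  destruct (continuous_bounded (fim f) (- K) K) as [B2 [P2 H2]].
  { intros x. apply continuous_C, Hf. }
  exists (B1 + B2). split; [lra|]. intros x. destruct (Rle_dec K (Rabs x)) as [L|L].
  - rewrite HK by auto. rewrite Cmod_0; lra.
  - assert (- K <= x <= K) by (apply Rabs_le_between; lra).
    eapply Rle_trans; [apply Cmod_le_sum|]. specialize (H1 x H). specialize (H2 x H). unfold fre, fim in *; lra.
Qed.

Lemma Cc_unif_cont f : Cc f -> forall eps, 0 < eps -> exists d, 0 < d /\
  forall x y, Rabs (x - y) < d -> Cmod (f x - f y)%C <= eps.
Proof.
  intros Hf eps He. destruct (Cc_support f Hf) as [K [HK0 HK]].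
  assert (U : forall g : R -> R, (forall x, continuous g x) -> exists d : posreal,
    forall x y, - K - 1 <= x <= K + 1 -> - K - 1 <= y <= K + 1 -> Rabs (x - y) < d -> Rabs (g x - g y) < eps / 2).
  { intros g Hg. assert (He2 : 0 < eps / 2) by lra.
    destruct (Heine_cor2 (f := g) (a := - K - 1) (b := K + 1)) with (eps := mkposreal _ He2) as [d Hd].
    - intros x _. apply continuity_pt_filterlim, Hg.
    - exists d. intros x y Hx Hy. apply Hd; auto. }
  destruct (U (fre f)) as [d1 H1]. { intros x; apply continuous_C, Hf. }
  destruct (U (fim f)) as [d2 H2]. { intros x; apply continuous_C, Hf. }
  assert (Hd : 0 < Rmin 1 (Rmin d1 d2)).
  { repeat apply Rmin_case; try lra; apply cond_pos. }
  exists (Rmin 1 (Rmin d1 d2)). split; auto. intros x y Hxy.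
  assert (E1 := Rmin_l 1 (Rmin d1 d2)). assert (E2 := Rmin_r 1 (Rmin d1 d2)).
  assert (E3 := Rmin_l d1 d2). assert (E4 := Rmin_r d1 d2).
  destruct (Rle_dec (Rabs x) (K + 1)) as [Lx|Lx]; [destruct (Rle_dec (Rabs y) (K + 1)) as [Ly|Ly]|].
  - apply Rabs_le_between in Lx. apply Rabs_le_between in Ly.
    eapply Rle_trans; [apply Cmod_le_sum|].
    assert (A1 := H1 x y ltac:(lra) ltac:(lra) ltac:(lra)).
    assert (A2 := H2 x y ltac:(lra) ltac:(lra) ltac:(lra)). unfold fre, fim, Rminus in *; simpl. lra.
  - assert (Rabs y - Rabs x <= Rabs (x - y)) by (rewrite Rabs_minus_sym; apply Rabs_triang_inv).
    rewrite !HK by lra. replace (0 - 0)%C with (RtoC 0) by ring. rewrite Cmod_0; lra.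
  - assert (Rabs x - Rabs y <= Rabs (x - y)) by apply Rabs_triang_inv.
    rewrite !HK by lra. replace (0 - 0)%C with (RtoC 0) by ring. rewrite Cmod_0; lra.
Qed.

(** Improper integrals of compactly supported functions are reduced to this componentwise integral
    by [integral_cint], and all computations take place on a compact interval. *)
Definition cint (a b : R) (f : R -> CC) : CC := (RInt (fre f) a b, RInt (fim f) a b).

Lemma fre_cont (f : R -> CC) : (forall x, continuous f x) -> forall x, continuous (fre f) x.
Proof. intros H x. apply continuous_C, H. Qed.
Lemma fim_cont (f : R -> CC) : (forall x, continuous f x) -> forall x, continuous (fim f) x.
Proof. intros H x. apply continuous_C, H. Qed.

Lemma RInt_vanish (g : R -> R) a b : (forall x, Rmin a b < x < Rmax a b -> g x = 0) -> RInt g a b = 0.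
Proof.
  intros H. rewrite (RInt_ext _ (fun _ => 0)) by auto.
  rewrite RInt_const. unfold scal; simpl; unfold mult; simpl; ring.
Qed.

Lemma RInt_extend (g : R -> R) L a b : (forall x, continuous g x) -> (forall x, L <= Rabs x -> g x = 0) ->
  0 <= L -> a <= - L -> L <= b -> RInt g a b = RInt g (- L) L.
Proof.
  intros Hc Hg HL Ha Hb.
  rewrite <- (RInt_Chasles g a (- L) b), <- (RInt_Chasles g (- L) L b) by (apply continuous_ex_RInt; auto).
  rewrite (RInt_vanish g a (- L)), (RInt_vanish g L b).
  - unfold plus; simpl; ring.
  - intros x Hx. rewrite Rmin_left in Hx by lra. apply Hg. rewrite Rabs_pos_eq; lra.
  - intros x Hx. rewrite Rmax_right in Hx by lra. apply Hg. rewrite Rabs_left1; lra.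
Qed.

Lemma integral_cint (f : R -> CC) L : (forall x, continuous f x) -> (forall x, L <= Rabs x -> f x = 0%C) ->
  0 <= L -> integral f = cint (- L) L f.
Proof.
  intros Hc Hf HL. unfold integral. apply (is_RInt_gen_unique (V := C_R_CompleteNormedModule)).
  intros P [eps HP].
  apply Filter_prod with (Q := fun a => a < - L) (R := fun b => L < b).
  - exists (- L); auto.
  - exists L; auto.
  - intros a b Ha Hb. exists (cint (- L) L f). split.
    + simpl. apply (is_RInt_fct_extend_pair (U := R_NormedModule) (V := R_NormedModule)); simpl.
      * rewrite <- (RInt_extend (fre f) L a b); try lra.
        -- apply (RInt_correct (V := R_CompleteNormedModule)), continuous_ex_RInt, fre_cont, Hc.
        -- apply fre_cont, Hc.
        -- intros x Hx. unfold fre. now rewrite Hf.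
      * rewrite <- (RInt_extend (fim f) L a b); try lra.
        -- apply (RInt_correct (V := R_CompleteNormedModule)), continuous_ex_RInt, fim_cont, Hc.
        -- apply fim_cont, Hc.
        -- intros x Hx. unfold fim. now rewrite Hf.
    + apply HP, ball_center.
Qed.

Lemma RInt_extR (g h : R -> R) a b : (forall x, g x = h x) -> @eq R (RInt g a b) (RInt h a b).
Proof. intros H. apply RInt_ext. auto. Qed.

Lemma RInt_scalR (g : R -> R) c a b : (forall x, continuous g x) ->
  RInt (fun x => c * g x) a b = c * RInt g a b.
Proof.
  intros Hg. apply is_RInt_unique, (is_RInt_scal (V := R_NormedModule) g a b c).
  apply (RInt_correct (V := R_CompleteNormedModule)), continuous_ex_RInt, Hg.
Qed.

Lemma RInt_lin (g h : R -> R) c d a b : (forall x, continuous g x) -> (forall x, continuous h x) ->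
  RInt (fun x => c * g x + d * h x) a b = c * RInt g a b + d * RInt h a b.
Proof.
  intros Hg Hh.
  rewrite (RInt_plus (fun x => c * g x) (fun x => d * h x)).
  - rewrite !RInt_scalR by auto. reflexivity.
  - apply (ex_RInt_scal g), continuous_ex_RInt; auto.
  - apply (ex_RInt_scal h), continuous_ex_RInt; auto.
Qed.

Lemma cint_lin (f g : R -> CC) c a b : (forall x, continuous f x) -> (forall x, continuous g x) ->
  cint a b (fun x => Cplus (Cmult c (f x)) (g x)) = Cplus (Cmult c (cint a b f)) (cint a b g).
Proof.
  intros Hf Hg. destruct c as [c1 c2].
  pose proof (fre_cont f Hf) as F1. pose proof (fim_cont f Hf) as F2.
  pose proof (fre_cont g Hg) as G1. pose proof (fim_cont g Hg) as G2.
  ceq.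
  - rewrite (RInt_ext _ (fun x => 1 * (c1 * fre f x + (- c2) * fim f x) + 1 * fre g x)).
    + rewrite (RInt_lin (fun x => c1 * fre f x + (- c2) * fim f x)); auto.
      * rewrite (RInt_lin (fre f) (fim f)); auto. ring.
      * intros x. apply (continuous_plus (V := R_NormedModule) (fun t => c1 * fre f t) (fun t => - c2 * fim f t));
        apply (continuous_scal_r (V := R_NormedModule)); auto.
    + intros x _. unfold fre, fim; simpl. ring.
  - rewrite (RInt_ext _ (fun x => 1 * (c1 * fim f x + c2 * fre f x) + 1 * fim g x)).
    + rewrite (RInt_lin (fun x => c1 * fim f x + c2 * fre f x)); auto.
      * rewrite (RInt_lin (fim f) (fre f)); auto. ring.
      * intros x. apply (continuous_plus (V := R_NormedModule) (fun t => c1 * fim f t) (fun t => c2 * fre f t));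
        apply (continuous_scal_r (V := R_NormedModule)); auto.
    + intros x _. unfold fre, fim; simpl. ring.
Qed.

Lemma cint_bound (f : R -> CC) a b B : a <= b -> (forall x, continuous f x) -> (forall x, a <= x <= b -> Cmod (f x) <= B) ->
  Cmod (cint a b f) <= 2 * ((b - a) * B).
Proof.
  intros Hab Hc HB. eapply Rle_trans; [apply Cmod_le_sum|]. simpl.
  assert (A1 : Rabs (RInt (fre f) a b) <= (b - a) * B).
  { apply abs_RInt_le_const; auto. apply continuous_ex_RInt, fre_cont, Hc.
    intros t Ht. eapply Rle_trans; [apply Rabs_fst_le|auto]. }
  assert (A2 : Rabs (RInt (fim f) a b) <= (b - a) * B).
  { apply abs_RInt_le_const; auto. apply continuous_ex_RInt, fim_cont, Hc.
    intros t Ht. eapply Rle_trans; [apply Rabs_snd_le|auto]. }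
  lra.
Qed.

Lemma integral_lin f g c : Cc f -> Cc g ->
  integral (fun x => Cplus (Cmult c (f x)) (g x)) = Cplus (Cmult c (integral f)) (integral g).
Proof.
  intros Hf Hg. destruct (Cc_support f Hf) as [K [HK0 HK]], (Cc_support g Hg) as [L [HL0 HL]].
  assert (M1 := Rmax_l K L). assert (M2 := Rmax_r K L). set (M := Rmax K L) in *.
  rewrite (integral_cint f M), (integral_cint g M), (integral_cint _ M); try lra.
  - apply cint_lin; intros; now apply Cc_cont.
  - intros x. apply (Cc_plus (fun x => Cmult c (f x)) g); auto. now apply Cc_scal.
  - intros x Hx. rewrite HK, HL by lra. ring.
  - intros; now apply Cc_cont.
  - intros; apply HL; lra.
  - intros; now apply Cc_cont.
  - intros; apply HK; lra.
Qed.

(** The factor 4 is the length [2 * K] of the interval times the factor 2 lost by bounding real and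
    imaginary parts separately. *)
Lemma integral_bound f K B : Cc f -> 0 <= K -> (forall x, K <= Rabs x -> f x = 0%C) ->
  (forall x, Cmod (f x) <= B) -> Cmod (integral f) <= 4 * (K * B).
Proof.
  intros Hf HK0 HK HB. rewrite (integral_cint f K); auto. 2: intros; now apply Cc_cont.
  eapply Rle_trans; [apply (cint_bound f _ _ B); auto; try lra; intros; now apply Cc_cont|]. lra.
Qed.

Lemma integral_affine f a b : a <> 0 -> Cc f ->
  integral (fun x => f (a * x + b)) = Cmult (RtoC (/ Rabs a)) (integral f).
Proof.
  intros Ha Hf. destruct (Cc_support f Hf) as [K [HK0 HK]].
  set (L := (K + Rabs b) / Rabs a).
  assert (Hp := Rabs_pos_lt a Ha).
  assert (Pb := Rabs_pos b).
  assert (HL : 0 <= L) by (apply Rle_mult_inv_pos; lra).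
  assert (HaL : Rabs a * L = K + Rabs b) by (unfold L; field; lra).
  rewrite (integral_cint (fun x => f (a * x + b)) L); auto.
  2: { intros x. apply (Cc_cont (fun x => f (a * x + b))), Cc_affine; auto. }
  2: { intros x Hx. apply HK.
    assert (A : Rabs a * L <= Rabs a * Rabs x) by (apply Rmult_le_compat_l; lra).
    rewrite <- Rabs_mult in A. pose proof (Rabs_triang_inv (a * x) (- b)) as B. rewrite Rabs_Ropp in B.
    replace (a * x - - b) with (a * x + b) in B by ring. lra. }
  assert (Key : forall g : R -> R, (forall x, continuous g x) -> (forall x, K <= Rabs x -> g x = 0) ->
     @eq R (RInt (fun x => g (a * x + b)) (- L) L) (/ Rabs a * RInt g (- K) K)).
  { intros g Hc Hg.
    assert (E : @eq R (RInt (fun x => a * g (a * x + b)) (- L) L) (RInt g (a * - L + b) (a * L + b))).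
    { apply (RInt_comp_lin (V := R_CompleteNormedModule) g a b (- L) L). apply continuous_ex_RInt, Hc. }
    rewrite (RInt_scalR (fun x => g (a * x + b)) a (- L) L) in E.
    2: { intros x. apply (continuous_comp (fun t => a * t + b) g); auto.
         apply (ex_derive_continuous (V := R_NormedModule)). auto_derive; auto. }
    pose proof (Rle_abs b). pose proof (Rle_abs (- b)) as Q. rewrite Rabs_Ropp in Q.
    destruct (Rle_dec 0 a) as [P|P].
    - rewrite Rabs_pos_eq in * by lra.
      rewrite (RInt_extend g K (a * - L + b)) in E; auto; try lra.
      apply (Rmult_eq_reg_l a); [|lra]. etransitivity; [exact E|].
      rewrite <- Rmult_assoc, Rinv_r, Rmult_1_l by lra. reflexivity.
    - rewrite (Rabs_left a) in * by lra.
      assert (S : @eq R (RInt g (a * - L + b) (a * L + b)) (- RInt g (a * L + b) (a * - L + b))).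
      { symmetry. apply (opp_RInt_swap (V := R_CompleteNormedModule)). apply continuous_ex_RInt, Hc. }
      rewrite S, (RInt_extend g K (a * L + b)) in E; auto; try lra.
      apply (Rmult_eq_reg_l a); [|lra]. etransitivity; [exact E|].
      rewrite <- Rmult_assoc, <- Ropp_inv_permute by lra.
      rewrite Ropp_mult_distr_r_reverse, Rinv_r by lra. ring. }
  rewrite (integral_cint f K); auto; try lra. 2: intros; now apply Cc_cont.
  ceq.
  - change (RInt (fre (fun x => f (a * x + b))) (- L) L) with (RInt (fun x => fre f (a * x + b)) (- L) L).
    rewrite (Key (fre f)). ring.
    + intros; apply continuous_C, Hf. + intros x Hx; unfold fre; now rewrite HK.
  - change (RInt (fim (fun x => f (a * x + b))) (- L) L) with (RInt (fun x => fim f (a * x + b)) (- L) L).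
    rewrite (Key (fim f)). ring.
    + intros; apply continuous_C, Hf. + intros x Hx; unfold fim; now rewrite HK.
Qed.

Lemma Cc_fourier_arg f y : Cc f -> Cc (fun x => Cmult (cexpi (- 2 * PI * x * y)) (f x)).
Proof.
  intros Hf. apply (Cc_mult (fun x => cexpi (- 2 * PI * x * y))); auto.
  intros x. replace (fun x => cexpi (- 2 * PI * x * y)) with (fun x => cexpi ((- 2 * PI * y) * x)).
  - apply continuous_cexpi.
  - apply functional_extensionality; intros; f_equal; ring.
Qed.

Lemma fourier_lin f g c y : Cc f -> Cc g ->
  fourier (fun x => Cplus (Cmult c (f x)) (g x)) y = Cplus (Cmult c (fourier f y)) (fourier g y).
Proof.
  intros Hf Hg. unfold fourier. rewrite <- integral_lin by now apply Cc_fourier_arg.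
  f_equal. apply functional_extensionality; intros x. ring.
Qed.

Lemma fourier_plus f g y : Cc f -> Cc g ->
  fourier (fun x => Cplus (f x) (g x)) y = Cplus (fourier f y) (fourier g y).
Proof.
  intros Hf Hg. replace (fun x => Cplus (f x) (g x)) with (fun x => Cplus (Cmult 1 (f x)) (g x)).
  - rewrite fourier_lin by auto. ring.
  - apply functional_extensionality; intros x. ring.
Qed.

Lemma integral_0 : integral (fun _ => RtoC 0) = RtoC 0.
Proof.
  rewrite (integral_cint _ 0).
  - ceq; apply RInt_vanish; auto.
  - intros; apply continuous_const.
  - auto.
  - lra.
Qed.

Lemma fourier_0 y : fourier (fun _ => RtoC 0) y = RtoC 0.
Proof.
  unfold fourier. replace (fun x => Cmult (cexpi (- 2 * PI * x * y)) (RtoC 0)) with (fun _ : R => RtoC 0).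
  - apply integral_0.
  - apply functional_extensionality; intros. ring.
Qed.

Lemma fourier_scal f c y : Cc f -> fourier (fun x => Cmult c (f x)) y = Cmult c (fourier f y).
Proof.
  intros Hf. replace (fun x => Cmult c (f x)) with (fun x => Cplus (Cmult c (f x)) 0%C).
  - rewrite (fourier_lin f (fun _ => 0%C)), fourier_0; auto. ring. apply Cc_0.
  - apply functional_extensionality; intros x. ring.
Qed.

Lemma fourier_mod f t y : fourier (fun x => Cmult (cexpi (2 * PI * t * x)) (f x)) y = fourier f (y - t).
Proof.
  unfold fourier. f_equal. apply functional_extensionality; intros x.
  replace (- 2 * PI * x * (y - t)) with (- 2 * PI * x * y + 2 * PI * t * x) by ring.
  rewrite cexpi_plus. ring.
Qed.

Lemma fourier_affine f a b y : a <> 0 -> Cc f ->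
  fourier (fun x => f (a * x + b)) y =
  Cmult (RtoC (/ Rabs a)) (Cmult (cexpi (2 * PI * b * (y / a))) (fourier f (y / a))).
Proof.
  intros Ha Hf. unfold fourier.
  set (G := fun u => Cmult (cexpi (2 * PI * b * (y / a))) (Cmult (cexpi (- 2 * PI * u * (y / a))) (f u))).
  replace (fun x => Cmult (cexpi (- 2 * PI * x * y)) (f (a * x + b))) with (fun x => G (a * x + b)).
  - rewrite integral_affine; auto.
    + f_equal. unfold G.
      replace (fun u => Cmult (cexpi (2 * PI * b * (y / a))) (Cmult (cexpi (- 2 * PI * u * (y / a))) (f u)))
       with (fun u => Cplus (Cmult (cexpi (2 * PI * b * (y / a))) (Cmult (cexpi (- 2 * PI * u * (y / a))) (f u))) 0%C).
      * rewrite (integral_lin (fun u => (Cmult (cexpi (- 2 * PI * u * (y / a))) (f u))) (fun _ => 0%C)).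
        -- rewrite integral_0. ring.
        -- now apply Cc_fourier_arg.
        -- apply Cc_0.
      * apply functional_extensionality; intros; ring.
    + apply Cc_scal. now apply Cc_fourier_arg.
  - apply functional_extensionality; intros x. unfold G. rewrite Cmult_assoc, <- cexpi_plus.
    f_equal. f_equal. field; auto.
Qed.

Lemma fourier_reflect f y : Cc f -> fourier (fun x => f (- x)) y = fourier f (- y).
Proof.
  intros Hf. replace (fun x => f (- x)) with (fun x => f (-1 * x + 0)).
  - rewrite fourier_affine by (auto; lra). rewrite Rabs_left by lra.
    replace (y / -1) with (- y) by field. rewrite Rmult_0_r, Rmult_0_l, cexpi_0.
    replace (/ - -1) with 1 by field. ring.
  - apply functional_extensionality; intros; f_equal; ring.
Qed.

Lemma fourier_bound f K B y : Cc f -> 0 <= K -> (forall x, K <= Rabs x -> f x = 0%C) ->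
  (forall x, Cmod (f x) <= B) -> Cmod (fourier f y) <= 4 * (K * B).
Proof.
  intros Hf HK0 HK HB. apply integral_bound; auto.
  - now apply Cc_fourier_arg.
  - intros x Hx. rewrite HK by auto. ring.
  - intros x. rewrite Cmod_mult, Cmod_cexpi, Rmult_1_l. auto.
Qed.

Lemma fourier_bounded f : Cc f -> exists B, 0 <= B /\ forall y, Cmod (fourier f y) <= B.
Proof.
  intros Hf. destruct (Cc_bounded f Hf) as [B [HB0 HB]], (Cc_support f Hf) as [K [HK0 HK]].
  exists (4 * (K * B)). split; [nra|]. intros y. apply fourier_bound; auto; lra.
Qed.

Lemma testfun_Cc f : testfun f -> Cc f.
Proof. intros [H _]; auto. Qed.

Lemma smooth_cont f x : smooth f -> continuous f x.
Proof.
  intros [H1 H2]. apply continuous_C. split.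
  - apply (smoothR_continuous _ _ H1). - apply (smoothR_continuous _ _ H2).
Qed.

Lemma smooth_mult f g : smooth f -> smooth g -> smooth (fun x => Cmult (f x) (g x)).
Proof.
  intros [F1 F2] [G1 G2]. split; simpl.
  - apply smoothR_minus; [apply (smoothR_mult _ _ F1 G1)|apply (smoothR_mult _ _ F2 G2)].
  - apply smoothR_plus; [apply (smoothR_mult _ _ F1 G2)|apply (smoothR_mult _ _ F2 G1)].
Qed.

Lemma smooth_plus f g : smooth f -> smooth g -> smooth (fun x => Cplus (f x) (g x)).
Proof.
  intros [F1 F2] [G1 G2]. split; simpl; apply smoothR_plus; auto.
Qed.

Lemma smooth_RtoC g : smoothR g -> smooth (fun x => RtoC (g x)).
Proof. intros H. split; simpl; auto. apply smoothR_const. Qed.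

Lemma smooth_const c : smooth (fun _ => c).
Proof. split; apply smoothR_const. Qed.

Lemma smooth_cexpi a : smooth (fun x => cexpi (a * x)).
Proof.
  split; simpl.
  - replace (fun t => cos (a * t)) with (fun t => cos (a * t + 0)); [apply smoothR_cos|].
    apply functional_extensionality; intros; f_equal; ring.
  - replace (fun t => sin (a * t)) with (fun t => sin (a * t + 0)); [apply smoothR_sin|].
    apply functional_extensionality; intros; f_equal; ring.
Qed.

Lemma testfun_mult f g : smooth f -> testfun g -> testfun (fun x => Cmult (f x) (g x)).
Proof.
  intros Hf [Hc Hs]. split.
  - apply Cc_mult; auto. intros; now apply smooth_cont.
  - now apply smooth_mult.
Qed.

Lemma testfun_plus f g : testfun f -> testfun g -> testfun (fun x => Cplus (f x) (g x)).
Proof. intros [F1 F2] [G1 G2]. split; [apply Cc_plus; auto|apply smooth_plus; auto]. Qed.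

Lemma testfun_scal c g : testfun g -> testfun (fun x => Cmult c (g x)).
Proof. apply testfun_mult, smooth_const. Qed.

Lemma testfun_zsum M (u : Z -> R -> CC) : (forall j, testfun (u j)) -> testfun (fun x => zsum M (fun j => u j x)).
Proof.
  intros H. induction M as [|M IH]; cbn [zsum]; auto.
  apply (testfun_plus (fun x => zsum M (fun j => u j x))); auto. apply (testfun_plus (u _) (u _)); auto.
Qed.

Lemma testfun_affine f a b : a <> 0 -> testfun f -> testfun (fun x => f (a * x + b)).
Proof.
  intros Ha [Hc [H1 H2]]. split; [now apply Cc_affine|]. split; simpl.
  - apply (smoothR_affine (fun t => fst (f t))); auto.
  - apply (smoothR_affine (fun t => snd (f t))); auto.
Qed.

Lemma Cc_reflect f : Cc f -> Cc (fun x => f (- x)).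
Proof.
  intros H. replace (fun x => f (- x)) with (fun x => f (-1 * x + 0)).
  - apply Cc_affine; auto; lra.
  - apply functional_extensionality; intros; f_equal; ring.
Qed.

Lemma testfun_bump : testfun (fun x => RtoC (bump x)).
Proof.
  split; [|apply smooth_RtoC, smoothR_bump]. split.
  - intros x. apply continuous_RtoC, smoothR_continuous, smoothR_bump.
  - exists 1. intros x Hx. rewrite bump_out by lra. reflexivity.
Qed.

Definition fderiv (f : R -> CC) (x : R) : CC := (Derive (fre f) x, Derive (fim f) x).

Lemma testfun_fderiv f : testfun f -> testfun (fderiv f).
Proof.
  intros [[Hc [K HK]] [H1 H2]].
  assert (S1 : smoothR (Derive (fre f))) by now apply smoothR_Derive.
  assert (S2 : smoothR (Derive (fim f))) by now apply smoothR_Derive.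
  split; [split|].
  - intros x. apply continuous_C. split; now apply smoothR_continuous.
  - exists K. intros x Hx.
    assert (L : locally x (fun y => K < Rabs y)).
    { assert (Hp : 0 < Rabs x - K) by lra. exists (mkposreal _ Hp). intros y Hy.
      unfold ball in Hy; simpl in Hy; unfold AbsRing_ball, abs, minus, plus, opp in Hy; simpl in Hy.
      pose proof (Rabs_triang_inv x y) as T. rewrite Rabs_minus_sym in T. unfold Rminus in *. lra. }
    assert (forall g : R -> R, (forall y, K < Rabs y -> g y = 0) -> Derive g x = 0) as Z.
    { intros g Hg. rewrite (Derive_ext_loc _ (fun _ => 0)).
      - apply Derive_const. - revert L. apply filter_imp; auto. }
    ceq; apply Z; intros y Hy; unfold fre, fim; now rewrite HK.
  - split; auto.
Qed.

Lemma fourier_comps f y K : Cc f -> 0 <= K -> (forall x, K <= Rabs x -> f x = 0%C) ->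
  fourier f y = (RInt (fun x => cos (- 2 * PI * x * y) * fre f x - sin (- 2 * PI * x * y) * fim f x) (- K) K,
                 RInt (fun x => cos (- 2 * PI * x * y) * fim f x + sin (- 2 * PI * x * y) * fre f x) (- K) K).
Proof.
  intros Hf HK0 HK. unfold fourier. rewrite (integral_cint _ K); auto.
  - intros x. now apply Cc_cont, Cc_fourier_arg.
  - intros x Hx. rewrite HK by auto. ring.
Qed.

Lemma fourier_fderiv f y : testfun f ->
  fourier (fderiv f) y = Cmult (Cmult Ci (RtoC (2 * PI * y))) (fourier f y).
Proof.
  intros Hf. pose proof (testfun_fderiv f Hf) as Hd.
  destruct (Cc_support _ (testfun_Cc _ Hf)) as [K1 [HK1 HK1']], (Cc_support _ (testfun_Cc _ Hd)) as [K2 [HK2 HK2']].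
  assert (M1 := Rmax_l K1 K2). assert (M2 := Rmax_r K1 K2). set (K := Rmax K1 K2) in *.
  assert (HfK : forall x, K <= Rabs x -> f x = 0%C) by (intros; apply HK1'; lra).
  assert (HdK : forall x, K <= Rabs x -> fderiv f x = 0%C) by (intros; apply HK2'; lra).
  rewrite (fourier_comps f y K), (fourier_comps (fderiv f) y K); auto using testfun_Cc; try lra.
  destruct Hf as [Hc [S1 S2]].
  assert (E1 : forall x, ex_derive (fre f) x) by (intros; now apply smoothR_ex_derive).
  assert (E2 : forall x, ex_derive (fim f) x) by (intros; now apply smoothR_ex_derive).
  assert (C1 : forall x, continuous (fre f) x) by (intros; now apply continuous_C, Cc_cont).
  assert (C2 : forall x, continuous (fim f) x) by (intros; now apply continuous_C, Cc_cont).
  assert (D1 : forall x, continuous (Derive (fre f)) x) by (intros; now apply smoothR_continuous, smoothR_Derive).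
  assert (D2 : forall x, continuous (Derive (fim f)) x) by (intros; now apply smoothR_continuous, smoothR_Derive).
  assert (CC1 : forall x, continuous (fun x => cos (- 2 * PI * x * y)) x).
  { intros x. apply (ex_derive_continuous (V := R_NormedModule)). auto_derive; auto. }
  assert (CS1 : forall x, continuous (fun x => sin (- 2 * PI * x * y)) x).
  { intros x. apply (ex_derive_continuous (V := R_NormedModule)). auto_derive; auto. }
  assert (CM : forall u v : R -> R, (forall x, continuous u x) -> (forall x, continuous v x) -> forall x, continuous (fun x => u x * v x) x).
  { intros u v Hu Hv x. apply (continuous_mult u v); auto. }
  assert (CP : forall u v : R -> R, (forall x, continuous u x) -> (forall x, continuous v x) -> forall x, continuous (fun x => u x + v x) x).
  { intros u v Hu Hv x. apply (continuous_plus (V := R_NormedModule) u v); auto. }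
  assert (CMi : forall u v : R -> R, (forall x, continuous u x) -> (forall x, continuous v x) -> forall x, continuous (fun x => u x - v x) x).
  { intros u v Hu Hv x. apply (continuous_minus (V := R_NormedModule) u v); auto. }
  (* Integration by parts: [h] is one component of the integrand of the transform, [h'] the same
     component for [fderiv f], and [g] what differentiating the exponential produces. The boundary
     values of [h] vanish. *)
  assert (P : forall h h' g : R -> R, (forall x, is_derive h x (h' x + 2 * PI * y * g x)) ->
     (forall x, continuous h' x) -> (forall x, continuous g x) -> h (- K) = 0 -> h K = 0 ->
     RInt h' (- K) K = - (2 * PI * y) * RInt g (- K) K).
  { intros h h' g Hh Ch' Cg Hk1 Hk2.
    assert (A : @eq R (RInt (fun x => 1 * h' x + 2 * PI * y * g x) (- K) K) (h K - h (- K))).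
    { apply (is_RInt_unique (V := R_CompleteNormedModule)).
      apply (is_RInt_derive (V := R_CompleteNormedModule) h).
      - intros x _. rewrite Rmult_1_l. apply Hh.
      - intros x _. apply CP; auto; apply CM; auto; intros; apply continuous_const. }
    rewrite RInt_lin in A; auto. rewrite Hk1, Hk2 in A. lra. }
  assert (Z1 : fre f K = 0 /\ fim f K = 0).
  { unfold fre, fim. rewrite HfK; auto. rewrite Rabs_pos_eq; lra. }
  assert (Z2 : fre f (- K) = 0 /\ fim f (- K) = 0).
  { unfold fre, fim. rewrite HfK; auto. rewrite Rabs_left1; lra. }
  destruct Z1 as [Z1 Z1'], Z2 as [Z2 Z2'].
  ceq.
  - rewrite (P (fun x => cos (- 2 * PI * x * y) * fre f x - sin (- 2 * PI * x * y) * fim f x) _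
              (fun x => cos (- 2 * PI * x * y) * fim f x + sin (- 2 * PI * x * y) * fre f x)).
    + ring.
    + intros x. unfold fre at 2, fim at 2, fderiv; simpl. auto_derive; [split; auto|].
      change (Derive (fun x0 : R => fre f x0) x) with (Derive (fre f) x).
      change (Derive (fun x0 : R => fim f x0) x) with (Derive (fim f) x). ring.
    + apply CMi; apply CM; auto.
    + apply CP; apply CM; auto.
    + rewrite Z2, Z2'; ring.
    + rewrite Z1, Z1'; ring.
  - rewrite (P (fun x => cos (- 2 * PI * x * y) * fim f x + sin (- 2 * PI * x * y) * fre f x) _
              (fun x => (- 1) * (cos (- 2 * PI * x * y) * fre f x - sin (- 2 * PI * x * y) * fim f x))).
    + rewrite (RInt_scalR (fun x => (cos (- 2 * PI * x * y) * fre f x - sin (- 2 * PI * x * y) * fim f x)) (-1)).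
      * ring.
      * apply CMi; apply CM; auto.
    + intros x. unfold fre at 2, fim at 2, fderiv; simpl. auto_derive; [split; auto|].
      change (Derive (fun x0 : R => fre f x0) x) with (Derive (fre f) x).
      change (Derive (fun x0 : R => fim f x0) x) with (Derive (fim f) x). ring.
    + apply CP; apply CM; auto.
    + apply CM; [intros; apply continuous_const|]. apply CMi; apply CM; auto.
    + rewrite Z2, Z2'; ring.
    + rewrite Z1, Z1'; ring.
Qed.

Lemma cos_sin_transform_derive (phi : R -> R) a b y : (forall x, continuous phi x) ->
  is_derive (fun y => RInt (fun x => cos (- 2 * PI * x * y) * phi x) a b) y
    (RInt (fun x => sin (- 2 * PI * x * y) * (2 * PI * x * phi x)) a b) /\
  is_derive (fun y => RInt (fun x => sin (- 2 * PI * x * y) * phi x) a b) y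
    (RInt (fun x => cos (- 2 * PI * x * y) * (- (2 * PI * x * phi x))) a b).
Proof.
  intros Hc.
  assert (G : forall (F G : R -> R -> R), (forall u v, is_derive (fun z => F z v) u (G u v)) ->
     (forall u v, continuity_2d_pt G u v) -> (forall u, forall v, continuous (fun x => F u x) v) ->
     is_derive (fun y => RInt (fun x => F y x) a b) y (RInt (fun x => G y x) a b)).
  { intros F G HF HG HC.
    assert (E : forall u v, Derive (fun z => F z v) u = G u v) by (intros; apply is_derive_unique; auto).
    rewrite (RInt_ext (G y) (fun x => Derive (fun u => F u x) y)) by (intros; auto).
    apply is_derive_RInt_param.
    - apply filter_forall. intros u t _. exists (G u t). auto.
    - intros t _. apply (continuity_2d_pt_ext G); auto.
    - apply filter_forall. intros u. apply continuous_ex_RInt. auto. }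
  assert (C1 : forall (g : R -> R) u v, (forall x, continuous g x) -> continuity_2d_pt (fun _ v => g v) u v).
  { intros g u v Hg. apply (continuity_1d_2d_pt_comp g (fun _ v => v)).
    - apply continuity_pt_filterlim, Hg. - apply continuity_2d_pt_id2. }
  assert (C2 : forall u v, continuity_2d_pt (fun u v => - 2 * PI * v * u) u v).
  { intros u v. apply continuity_2d_pt_mult; [|apply continuity_2d_pt_id1].
    apply continuity_2d_pt_mult; [apply continuity_2d_pt_const|apply continuity_2d_pt_id2]. }
  assert (C3 : forall x, continuous (fun x => 2 * PI * x * phi x) x).
  { intros x. apply (continuous_mult (fun x => 2 * PI * x) phi); auto.
    apply (ex_derive_continuous (V := R_NormedModule)). auto_derive; auto. }
  assert (CC : forall (h : R -> R) u v, (forall t, ex_derive h t) -> continuous (fun x => h (- 2 * PI * x * u) * phi x) v).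
  { intros h u v Hh. apply (continuous_mult (fun x => h (-2 * PI * x * u)) phi); auto.
    apply (continuous_comp (fun x => -2 * PI * x * u) h).
    - apply (ex_derive_continuous (V := R_NormedModule)). auto_derive; auto.
    - apply (ex_derive_continuous (V := R_NormedModule)). auto. }
  split.
  - apply (G (fun y x => cos (- 2 * PI * x * y) * phi x) (fun y x => sin (- 2 * PI * x * y) * (2 * PI * x * phi x))).
    + intros u v. auto_derive; auto. ring.
    + intros u v. apply (continuity_2d_pt_mult (fun u v => sin (- 2 * PI * v * u)) (fun _ v => 2 * PI * v * phi v)).
      * apply (continuity_1d_2d_pt_comp sin (fun u v => - 2 * PI * v * u)); auto. apply continuity_sin.
      * apply (C1 (fun v => 2 * PI * v * phi v)); auto.
    + intros u v. apply (CC cos). intros t; auto_derive; auto.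
  - apply (G (fun y x => sin (- 2 * PI * x * y) * phi x) (fun y x => cos (- 2 * PI * x * y) * (- (2 * PI * x * phi x)))).
    + intros u v. auto_derive; auto. ring.
    + intros u v. apply (continuity_2d_pt_mult (fun u v => cos (- 2 * PI * v * u)) (fun _ v => - (2 * PI * v * phi v))).
      * apply (continuity_1d_2d_pt_comp cos (fun u v => - 2 * PI * v * u)); auto. apply continuity_cos.
      * apply (C1 (fun v => - (2 * PI * v * phi v))). intros x. apply (continuous_opp (V := R_NormedModule)). auto.
    + intros u v. apply (CC sin). intros t; auto_derive; auto.
Qed.

(** Multiplication by [-2 pi i x], the counterpart of differentiating the transform. *)
Definition xmul (f : R -> CC) (x : R) : CC := Cmult (Cmult Ci (RtoC (- 2 * PI * x))) (f x).

Lemma testfun_xmul f : testfun f -> testfun (xmul f).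
Proof.
  intros Hf. apply (testfun_mult (fun x => Cmult Ci (RtoC (- 2 * PI * x)))); auto.
  apply smooth_mult; [apply smooth_const|apply smooth_RtoC].
  apply (smoothR_scal (- 2 * PI)), smoothR_id.
Qed.

Lemma fourier_is_derive f y : testfun f ->
  is_derive (fre (fourier f)) y (fre (fourier (xmul f)) y) /\
  is_derive (fim (fourier f)) y (fim (fourier (xmul f)) y).
Proof.
  intros Hf. pose proof (testfun_xmul f Hf) as Hd.
  destruct (Cc_support _ (testfun_Cc _ Hf)) as [K [HK0 HK]].
  assert (HdK : forall x, K <= Rabs x -> xmul f x = 0%C).
  { intros x Hx. unfold xmul. rewrite HK by auto. ring. }
  assert (C1 : forall x, continuous (fre f) x) by (intros; now apply continuous_C, Cc_cont, testfun_Cc).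
  assert (C2 : forall x, continuous (fim f) x) by (intros; now apply continuous_C, Cc_cont, testfun_Cc).
  assert (CS : forall (phi : R -> R) y, (forall x, continuous phi x) -> forall x, continuous (fun x => cos (-2 * PI * x * y) * phi x) x).
  { intros phi z Hp x. apply (continuous_mult (fun x => cos (-2 * PI * x * z)) phi); auto.
    apply (ex_derive_continuous (V := R_NormedModule)). auto_derive; auto. }
  assert (SS : forall (phi : R -> R) y, (forall x, continuous phi x) -> forall x, continuous (fun x => sin (-2 * PI * x * y) * phi x) x).
  { intros phi z Hp x. apply (continuous_mult (fun x => sin (-2 * PI * x * z)) phi); auto.
    apply (ex_derive_continuous (V := R_NormedModule)). auto_derive; auto. }
  assert (X : forall (phi : R -> R), (forall x, continuous phi x) -> forall x, continuous (fun x => 2 * PI * x * phi x) x).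
  { intros phi Hp x. apply (continuous_mult (fun x => 2 * PI * x) phi); auto.
    apply (ex_derive_continuous (V := R_NormedModule)). auto_derive; auto. }
  assert (X' : forall (phi : R -> R), (forall x, continuous phi x) -> forall x, continuous (fun x => - (2 * PI * x * phi x)) x).
  { intros phi Hp x. apply (continuous_opp (V := R_NormedModule)). now apply X. }
  destruct (cos_sin_transform_derive (fre f) (- K) K y C1) as [A1 A2].
  destruct (cos_sin_transform_derive (fim f) (- K) K y C2) as [B1 B2].
  split.
  - apply (is_derive_ext (fun y => RInt (fun x => cos (- 2 * PI * x * y) * fre f x) (- K) K - RInt (fun x => sin (- 2 * PI * x * y) * fim f x) (- K) K)).
    + intros t. unfold fre at 2. rewrite (fourier_comps f t K); auto using testfun_Cc; try lra. simpl.
      rewrite (RInt_extR (fun x => cos (-2 * PI * x * t) * fre f x - sin (-2 * PI * x * t) * fim f x)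
         (fun x => 1 * (cos (-2 * PI * x * t) * fre f x) + (-1) * (sin (-2 * PI * x * t) * fim f x))) by (intros; ring).
      rewrite RInt_lin; auto. ring.
    + replace (fre (fourier (xmul f)) y) with
        (minus (RInt (fun x => sin (- 2 * PI * x * y) * (2 * PI * x * fre f x)) (- K) K)
          (RInt (fun x => cos (- 2 * PI * x * y) * (- (2 * PI * x * fim f x))) (- K) K)).
      * apply (is_derive_minus (V := R_NormedModule)); auto.
      * unfold fre at 2. rewrite (fourier_comps (xmul f) y K); auto using testfun_Cc; try lra. simpl.
        rewrite (RInt_extR (fun x => cos (-2 * PI * x * y) * fre (xmul f) x - sin (-2 * PI * x * y) * fim (xmul f) x)
          (fun x => 1 * (sin (- 2 * PI * x * y) * (2 * PI * x * fre f x)) + (-1) * (cos (- 2 * PI * x * y) * (- (2 * PI * x * fim f x))))).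
        2: { intros x. unfold fre, fim, xmul; simpl. ring. }
        rewrite RInt_lin; auto. unfold minus, plus, opp; simpl; ring.
  - apply (is_derive_ext (fun y => RInt (fun x => cos (- 2 * PI * x * y) * fim f x) (- K) K + RInt (fun x => sin (- 2 * PI * x * y) * fre f x) (- K) K)).
    + intros t. unfold fim at 2. rewrite (fourier_comps f t K); auto using testfun_Cc; try lra. simpl.
      rewrite (RInt_extR (fun x => cos (-2 * PI * x * t) * fim f x + sin (-2 * PI * x * t) * fre f x)
         (fun x => 1 * (cos (-2 * PI * x * t) * fim f x) + 1 * (sin (-2 * PI * x * t) * fre f x))) by (intros; ring).
      rewrite RInt_lin; auto. ring.
    + replace (fim (fourier (xmul f)) y) with
        (plus (RInt (fun x => sin (- 2 * PI * x * y) * (2 * PI * x * fim f x)) (- K) K)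
          (RInt (fun x => cos (- 2 * PI * x * y) * (- (2 * PI * x * fre f x))) (- K) K)).
      * apply (is_derive_plus (V := R_NormedModule)); auto.
      * unfold fim at 2. rewrite (fourier_comps (xmul f) y K); auto using testfun_Cc; try lra. simpl.
        rewrite (RInt_extR (fun x => cos (-2 * PI * x * y) * fim (xmul f) x + sin (-2 * PI * x * y) * fre (xmul f) x)
          (fun x => 1 * (sin (- 2 * PI * x * y) * (2 * PI * x * fim f x)) + 1 * (cos (- 2 * PI * x * y) * (- (2 * PI * x * fre f x))))).
        2: { intros x. unfold fre, fim, xmul; simpl. ring. }
        rewrite RInt_lin; auto. unfold plus; simpl; ring.
Qed.

Lemma smooth_fourier f : testfun f -> smooth (fourier f).
Proof.
  intros Hf.
  assert (H : forall n f, testfun f -> Ck n (fre (fourier f)) /\ Ck n (fim (fourier f))).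
  { clear f Hf. induction n as [|n IH]; intros f Hf; [split; exact I|].
    destruct (IH _ (testfun_xmul f Hf)) as [I1 I2].
    split; [exists (fre (fourier (xmul f)))|exists (fim (fourier (xmul f)))]; split; auto;
    intros y; apply fourier_is_derive; auto. }
  split; apply smoothR_Ck; intros n; apply H; auto.
Qed.

Lemma cderiv_fourier_S f k : testfun f -> cderiv (fourier f) (S k) = cderiv (fourier (xmul f)) k.
Proof.
  intros Hf. apply functional_extensionality; intros x. unfold cderiv.
  rewrite !Derive_n_S_l. f_equal; f_equal; apply functional_extensionality; intros y; apply is_derive_unique;
  apply (fourier_is_derive f y Hf).
Qed.

(** Each power of [y] is exchanged for one derivative of [f]. The bound does not deteriorate in the
    induction, since [|2 pi y| >= |y|]. *)
Lemma fourier_decay f m : testfun f -> exists B, 0 <= B /\ forall y, Rabs y ^ m * Cmod (fourier f y) <= B.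
Proof.
  revert f. induction m as [|m IH]; intros f Hf.
  - destruct (fourier_bounded f (testfun_Cc _ Hf)) as [B [H0 H]]. exists B. split; auto.
    intros y. simpl. rewrite Rmult_1_l; auto.
  - destruct (IH _ (testfun_fderiv f Hf)) as [B [H0 H]]. exists B. split; auto. intros y.
    specialize (H y). rewrite fourier_fderiv, !Cmod_mult, Cmod_R in H by auto.
    assert (Cmod Ci = 1) as E.
    { unfold Cmod; simpl. replace (0 * (0 * 1) + 1 * (1 * 1)) with 1 by ring. apply sqrt_1. }
    rewrite E, Rmult_1_l in H. rewrite Rabs_mult in H.
    assert (1 <= Rabs (2 * PI)).
    { pose proof PI2_1. rewrite Rabs_pos_eq; lra. }
    simpl. eapply Rle_trans; [|exact H].
    pose proof (Rabs_pos y). pose proof (pow_le _ m H2). pose proof (Cmod_ge_0 (fourier f y)).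
    assert (0 <= Rabs y ^ m * Rabs y * Cmod (fourier f y)) by (repeat apply Rmult_le_pos; auto).
    replace (Rabs y * Rabs y ^ m * Cmod (fourier f y)) with (1 * (Rabs y ^ m * Rabs y * Cmod (fourier f y))) by ring.
    replace (Rabs y ^ m * (Rabs (2 * PI) * Rabs y * Cmod (fourier f y))) with (Rabs (2 * PI) * (Rabs y ^ m * Rabs y * Cmod (fourier f y))) by ring.
    apply Rmult_le_compat_r; auto.
Qed.

Lemma cderiv_0 f : cderiv f 0 = f.
Proof. apply functional_extensionality; intros x. unfold cderiv; simpl. symmetry. apply surjective_pairing. Qed.

Lemma schwartz_fourier f : testfun f -> schwartz (fourier f).
Proof.
  intros Hf. split; [now apply smooth_fourier|].
  intros m k. revert f Hf. induction k as [|k IH]; intros f Hf.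
  - destruct (fourier_decay f m Hf) as [B [_ HB]]. exists B. intros x. rewrite cderiv_0. apply HB.
  - destruct (IH _ (testfun_xmul f Hf)) as [B HB]. exists B. intros x. rewrite cderiv_fourier_S by auto. apply HB.
Qed.

(** * Density of test functions *)

Lemma measure_lin mu a f g : is_measure mu -> Cc f -> Cc g ->
  mu (fun x => Cplus (Cmult a (f x)) (g x)) = Cplus (Cmult a (mu f)) (mu g).
Proof. intros [H _] Hf Hg. auto. Qed.

Lemma measure_0 mu : is_measure mu -> mu (fun _ => RtoC 0) = RtoC 0.
Proof.
  intros H. pose proof (measure_lin mu (RtoC 1) (fun _ => RtoC 0) (fun _ => RtoC 0) H Cc_0 Cc_0) as E.
  assert (E0 : (fun _ : R => Cplus (Cmult (RtoC 1) (RtoC 0)) (RtoC 0)) = (fun _ : R => RtoC 0)).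
  { apply functional_extensionality; intros; ring. }
  cbv beta in E. rewrite E0 in E. set (z := mu (fun _ => RtoC 0)) in *.
  transitivity (Cminus (Cplus (Cmult (RtoC 1) z) z) z); [ring|]. rewrite <- E. ring.
Qed.

Lemma measure_scal mu a f : is_measure mu -> Cc f -> mu (fun x => Cmult a (f x)) = Cmult a (mu f).
Proof.
  intros H Hf. pose proof (measure_lin mu a f (fun _ => RtoC 0) H Hf Cc_0) as E.
  rewrite measure_0 in E by auto.
  replace (fun x : R => Cplus (Cmult a (f x)) (RtoC 0)) with (fun x : R => Cmult a (f x)) in E.
  - rewrite E; ring.
  - apply functional_extensionality; intros; ring.
Qed.

Lemma measure_plus mu f g : is_measure mu -> Cc f -> Cc g -> mu (fun x => Cplus (f x) (g x)) = Cplus (mu f) (mu g).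
Proof.
  intros H Hf Hg. pose proof (measure_lin mu 1%C f g H Hf Hg) as E.
  replace (fun x : R => Cplus (Cmult 1%C (f x)) (g x)) with (fun x : R => Cplus (f x) (g x)) in E.
  - rewrite E; ring.
  - apply functional_extensionality; intros; ring.
Qed.

Lemma measure_minus mu f g : is_measure mu -> Cc f -> Cc g -> mu (fun x => Cminus (f x) (g x)) = Cminus (mu f) (mu g).
Proof.
  intros H Hf Hg. pose proof (measure_lin mu (RtoC (-1)) g f H Hg Hf) as E.
  replace (fun x : R => Cplus (Cmult (RtoC (-1)) (g x)) (f x)) with (fun x : R => Cminus (f x) (g x)) in E.
  - rewrite E; ring.
  - apply functional_extensionality; intros; ceq; ring.
Qed.

Lemma measure_zsum mu M (u : Z -> R -> CC) : is_measure mu -> (forall j, Cc (u j)) ->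
  mu (fun x => zsum M (fun j => u j x)) = zsum M (fun j => mu (u j)).
Proof.
  intros H Hu. induction M as [|M IH]; cbn [zsum]; auto.
  rewrite (measure_plus mu (fun x => zsum M (fun j => u j x))); auto.
  - rewrite IH. f_equal. apply measure_plus; auto.
  - now apply Cc_zsum.
  - now apply Cc_plus.
Qed.

Lemma measure_bound mu K : is_measure mu -> exists A, 0 <= A /\ forall f, Cc f ->
  (forall x, K < Rabs x -> f x = RtoC 0) -> forall B, 0 <= B -> (forall x, Cmod (f x) <= B) -> Cmod (mu f) <= A * B.
Proof.
  intros [_ H]. destruct (H K) as [A HA]. exists (Rabs A). split; [apply Rabs_pos|].
  intros f Hf HK B HB0 HB. eapply Rle_trans; [apply (HA f Hf HK B HB)|].
  apply Rmult_le_compat_r; auto. apply Rle_abs.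
Qed.

(** Samples [f] at the points [j / n] and glues the samples with the partition of unity of mesh
    [1 / n]; uniform continuity controls the error. The bound [K] is common to all approximants
    because the continuity constant of a measure depends on the support. *)
Lemma Cc_approx f : Cc f -> exists K, (forall x, K < Rabs x -> f x = RtoC 0) /\
  forall eps, 0 < eps -> exists g, testfun g /\ (forall x, K < Rabs x -> g x = RtoC 0) /\
    forall x, Cmod (f x - g x)%C <= eps.
Proof.
  intros Hf. destruct (Cc_support f Hf) as [K [HK0 HK]]. exists (K + 1). split.
  { intros; apply HK; lra. }
  intros eps He. destruct (Cc_unif_cont f Hf eps He) as [d [Hd0 Hd]].
  destruct (archimed_cor1 (Rmin d 1)) as [n [Hn1 Hn2]]. { apply Rmin_case; lra. }
  pose proof (Rmin_l d 1). pose proof (Rmin_r d 1).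
  assert (Hn : 0 < INR n) by (apply lt_0_INR; lia).
  (* [M] exceeds [n * (K + 1) + 2], so that the translates up to [M] sum to 1 for [|x| <= K + 1]. *)
  destruct (archimed_cor1 (/ (INR n * (K + 1) + 2))) as [M [HM1 HM2]].
  { apply Rinv_0_lt_compat. nra. }
  assert (HM : INR n * (K + 1) + 2 < INR M).
  { apply Rinv_lt_cancel; auto. apply lt_0_INR; lia. }
  set (g := fun x => zsum M (fun j => Cmult (f (IZR j / INR n)) (RtoC (bump (INR n * x - IZR j))))).
  assert (Hg0 : forall x j, Rabs (INR n * x - IZR j) < 1 -> Rabs (x - IZR j / INR n) < / INR n).
  { intros x j Hx. replace (x - IZR j / INR n) with ((INR n * x - IZR j) * / INR n) by (field; lra).
    rewrite Rabs_mult, (Rabs_pos_eq (/ INR n)). 2: apply Rlt_le, Rinv_0_lt_compat; auto.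
    rewrite <- (Rmult_1_l (/ INR n)) at 2. apply Rmult_lt_compat_r; auto. now apply Rinv_0_lt_compat. }
  assert (Hterm : forall x j, bump (INR n * x - IZR j) = 0 \/ Rabs (x - IZR j / INR n) < / INR n).
  { intros x j. destruct (Rle_dec 1 (Rabs (INR n * x - IZR j))) as [L|L].
    - left. now apply bump_out. - right. apply Hg0. lra. }
  assert (Hsupp : forall x, K + 1 < Rabs x -> g x = RtoC 0).
  { intros x Hx. apply zsum_0. intros j _. destruct (Hterm x j) as [E|E].
    - rewrite E. ring.
    - rewrite HK; [ring|]. pose proof (Rabs_triang_inv x (x - IZR j / INR n)) as T.
      replace (x - (x - IZR j / INR n)) with (IZR j / INR n) in T by ring. lra. }
  exists g. split; [|split]; auto.
  - apply (testfun_zsum M (fun j x => Cmult (f (IZR j / INR n)) (RtoC (bump (INR n * x - IZR j))))).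
    intros j. apply testfun_scal.
    apply (testfun_affine (fun t => RtoC (bump t)) (INR n) (- IZR j)); [lra|apply testfun_bump].
  - intros x. destruct (Rlt_dec (K + 1) (Rabs x)) as [L|L].
    + rewrite Hsupp, HK by lra. replace (0 - 0)%C with (RtoC 0) by ring. rewrite Cmod_0. lra.
    + assert (Lx : - (K + 1) <= x <= K + 1) by (apply Rabs_le_between; lra).
      assert (P : zsumR M (fun j => bump (INR n * x - IZR j)) = 1).
      { rewrite bump_partition. rewrite step_ge1, step_le0; [ring| |]; nra. }
      assert (E : f x = zsum M (fun j => Cmult (f x) (RtoC (bump (INR n * x - IZR j))))).
      { rewrite zsum_scal. replace (zsum M (fun j => RtoC (bump (INR n * x - IZR j)))) with (RtoC 1); [ring|].
        rewrite <- P. clear. induction M as [|M IH]; cbn [zsum zsumR]; auto.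
        rewrite <- IH, <- !RtoC_plus. reflexivity. }
      replace (f x - g x)%C with (zsum M (fun j => Cmult (Cminus (f x) (f (IZR j / INR n))) (RtoC (bump (INR n * x - IZR j))))).
      * eapply Rle_trans; [apply zsum_Cmod|].
        apply Rle_trans with (zsumR M (fun j => eps * bump (INR n * x - IZR j))).
        -- apply zsumR_le. intros j _. rewrite Cmod_mult, Cmod_R.
           pose proof (bump_bounds (INR n * x - IZR j)) as Hb. rewrite (Rabs_pos_eq (bump _)) by lra.
           destruct (Hterm x j) as [Eb|Eb].
           ++ rewrite Eb; lra.
           ++ apply Rmult_le_compat_r; [lra|]. apply Hd. lra.
        -- rewrite zsumR_scal, P. lra.
      * unfold g. rewrite E at 1.
        assert (Em : forall z w : CC, Cminus z w = Cplus z (Cmult (RtoC (-1)) w)) by (intros; ceq; ring).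
        rewrite (Em (zsum M _)).
        rewrite <- zsum_scal, <- zsum_plus. apply zsum_ext. intros j _. ceq; ring.
Qed.

Lemma measure_eq_of_testfun mu nu : is_measure mu -> is_measure nu ->
  (forall f, testfun f -> mu f = nu f) -> meq mu nu.
Proof.
  intros Hm Hn E f Hf. destruct (Cc_approx f Hf) as [K [HK Ha]].
  destruct (measure_bound mu K Hm) as [A [HA0 HA]]. destruct (measure_bound nu K Hn) as [B [HB0 HB]].
  assert (Z : Cmod (mu f - nu f)%C <= 0).
  { apply le_epsilon. intros eps He.
    destruct (Ha (eps / (A + B + 1))) as [g [Hg [HgK Hd]]]. { apply Rdiv_lt_0_compat; lra. }
    assert (He' : 0 < eps / (A + B + 1)) by (apply Rdiv_lt_0_compat; lra).
    assert (Hgc : Cc g) by now apply testfun_Cc.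
    assert (Hdc : Cc (fun x => (f x - g x)%C)) by now apply Cc_minus.
    assert (HdK : forall x, K < Rabs x -> (f x - g x)%C = RtoC 0).
    { intros x Hx. rewrite HK, HgK by auto. ring. }
    specialize (HA _ Hdc HdK _ (Rlt_le _ _ He') Hd). specialize (HB _ Hdc HdK _ (Rlt_le _ _ He') Hd).
    rewrite measure_minus in HA by auto. rewrite measure_minus in HB by auto. rewrite (E g) in HA by auto.
    pose proof (Cmod_minus_triang (mu f) (nu g) (nu f)) as T. rewrite (Cmod_minus_sym (nu g)) in T.
    assert ((A + B) * (eps / (A + B + 1)) <= eps).
    { apply Rmult_le_reg_r with (A + B + 1); [lra|].
      replace ((A + B) * (eps / (A + B + 1)) * (A + B + 1)) with ((A + B) * eps) by (field; lra). nra. }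
    lra. }
  assert (Z0 : Cmod (mu f - nu f)%C = 0) by (pose proof (Cmod_ge_0 (mu f - nu f)%C); lra).
  apply Cmod_eq_0 in Z0. replace (mu f) with (nu f + (mu f - nu f))%C by ring. rewrite Z0. ring.
Qed.

Lemma Derive_n_locally_0 (g : R -> R) k x : locally x (fun y => g y = 0) -> Derive_n g k x = 0.
Proof.
  intros H. rewrite (Derive_n_ext_loc g (fun _ => 0)) by exact H.
  destruct k; [reflexivity|apply Derive_n_const].
Qed.

Lemma testfun_schwartz f : testfun f -> schwartz f.
Proof.
  intros [[Hc [K HK]] [S1 S2]]. split; [split; auto|]. intros m k.
  assert (B : forall g : R -> R, smoothR g -> (forall x, K < Rabs x -> g x = 0) ->
    exists B, 0 <= B /\ forall x, Rabs x ^ m * Rabs (Derive_n g k x) <= B).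
  { intros g Hg HgK.
    assert (Hgk : smoothR (Derive_n g k)).
    { clear -Hg. induction k as [|k IH]; auto. simpl. now apply smoothR_Derive. }
    destruct (continuous_bounded (Derive_n g k) (- Rabs K) (Rabs K)) as [B [HB0 HB]].
    { intros; now apply smoothR_continuous. }
    exists (Rabs K ^ m * B). split. { apply Rmult_le_pos; auto. apply pow_le, Rabs_pos. }
    intros x. destruct (Rle_dec (Rabs x) (Rabs K)) as [L|L].
    - apply Rmult_le_compat; auto; try apply Rabs_pos. { apply pow_le, Rabs_pos. }
      { apply pow_incr. split; auto. apply Rabs_pos. } apply HB. now apply Rabs_le_between.
    - rewrite Derive_n_locally_0.
      + rewrite Rabs_R0, Rmult_0_r. apply Rmult_le_pos; auto. apply pow_le, Rabs_pos.
      + assert (Hp : 0 < Rabs x - Rabs K) by lra. exists (mkposreal _ Hp). intros y Hy.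
        unfold ball in Hy; simpl in Hy; unfold AbsRing_ball, abs, minus, plus, opp in Hy; simpl in Hy.
        apply HgK. pose proof (Rabs_triang_inv x y) as T. rewrite Rabs_minus_sym in T.
        pose proof (Rle_abs K). unfold Rminus in *. lra. }
  destruct (B _ S1) as [B1 [_ H1]]. { intros; now rewrite HK. }
  destruct (B _ S2) as [B2 [_ H2]]. { intros; now rewrite HK. }
  exists (B1 + B2). intros x. specialize (H1 x). specialize (H2 x).
  apply Rle_trans with (Rabs x ^ m * (Rabs (fst (cderiv f k x)) + Rabs (snd (cderiv f k x)))).
  - apply Rmult_le_compat_l; [apply pow_le, Rabs_pos|apply Cmod_le_sum].
  - simpl. lra.
Qed.

Lemma Derive_n_scal_smooth c g k x : Derive_n (fun t => c * g t) k x = c * Derive_n g k x.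
Proof. apply Derive_n_scal_l. Qed.

Lemma cderiv_lin a f g k x : smooth f -> smooth g ->
  cderiv (fun t => Cplus (Cmult a (f t)) (g t)) k x = Cplus (Cmult a (cderiv f k x)) (cderiv g k x).
Proof.
  intros [F1 F2] [G1 G2]. destruct a as [a1 a2]. unfold cderiv. ceq.
  - rewrite (Derive_n_plus_smooth (fun t => a1 * fst (f t) - a2 * snd (f t)) (fun t => fst (g t))); auto.
    + rewrite (Derive_n_ext (fun t => a1 * fst (f t) - a2 * snd (f t)) (fun t => a1 * fst (f t) + (- a2) * snd (f t))) by (intros; ring).
      rewrite (Derive_n_plus_smooth (fun t => a1 * fst (f t)) (fun t => - a2 * snd (f t))); try now apply smoothR_scal.
      rewrite !Derive_n_scal_smooth. ring.
    + apply smoothR_minus; now apply smoothR_scal.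
  - rewrite (Derive_n_plus_smooth (fun t => a1 * snd (f t) + a2 * fst (f t)) (fun t => snd (g t))); auto.
    + rewrite (Derive_n_plus_smooth (fun t => a1 * snd (f t)) (fun t => a2 * fst (f t))); try now apply smoothR_scal.
      rewrite !Derive_n_scal_smooth. ring.
    + apply smoothR_plus; now apply smoothR_scal.
Qed.

Lemma schwartz_lin a f g : schwartz f -> schwartz g -> schwartz (fun x => Cplus (Cmult a (f x)) (g x)).
Proof.
  intros [Sf Hf] [Sg Hg]. split.
  - apply smooth_plus; auto. apply smooth_mult; auto. apply smooth_const.
  - intros m k. destruct (Hf m k) as [B HB], (Hg m k) as [D HD]. exists (Cmod a * B + D). intros x.
    rewrite cderiv_lin by auto. specialize (HB x). specialize (HD x).
    apply Rle_trans with (Rabs x ^ m * (Cmod a * Cmod (cderiv f k x) + Cmod (cderiv g k x))).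
    + apply Rmult_le_compat_l; [apply pow_le, Rabs_pos|]. rewrite <- Cmod_mult. apply Cmod_triangle.
    + pose proof (Rmult_le_compat_l _ _ _ (Cmod_ge_0 a) HB). lra.
Qed.

Lemma schwartz_bound f N : schwartz f -> exists B, 0 <= B /\
  forall m k x, (m <= N)%nat -> (k <= N)%nat -> Rabs x ^ m * Cmod (cderiv f k x) <= B.
Proof.
  intros [_ H].
  assert (A : forall M L, exists B, 0 <= B /\ forall m k x, (m < M)%nat -> (k < L)%nat -> Rabs x ^ m * Cmod (cderiv f k x) <= B).
  { induction M as [|M IHM]; intros L.
    - exists 0. split; [lra|]. intros; lia.
    - induction L as [|L [B [HB0 IHL]]].
      + exists 0. split; [lra|]. intros; lia.
      + destruct (IHM (S L)) as [D [HD0 HD]]. destruct (H M L) as [E HE].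
        exists (B + D + Rabs E). pose proof (Rabs_pos E). split; [lra|]. intros m k x Hm Hk.
        destruct (Nat.eq_dec m M) as [->|Hm']; [destruct (Nat.eq_dec k L) as [->|Hk']|].
        * specialize (HE x). pose proof (Rle_abs E). lra.
        * specialize (IHL M k x ltac:(lia) ltac:(lia)). lra.
        * specialize (HD m k x ltac:(lia) ltac:(lia)). lra. }
  destruct (A (S N) (S N)) as [B [HB0 HB]]. exists B. split; auto. intros; apply HB; lia.
Qed.

(** * Smooth cutoffs and uniqueness of the tempered extension *)

Definition plateau (n : R) (x : R) : R := step (x + n + 1) - step (x - n).

Lemma smoothR_plateau n : smoothR (plateau n).
Proof.
  apply smoothR_minus.
  - replace (fun x => step (x + n + 1)) with (fun x => step (1 * x + (n + 1))).
    + apply smoothR_affine, smoothR_step. + apply functional_extensionality; intros; f_equal; ring.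
  - replace (fun x => step (x - n)) with (fun x => step (1 * x + - n)).
    + apply smoothR_affine, smoothR_step. + apply functional_extensionality; intros; f_equal; ring.
Qed.

Lemma plateau_1 n x : Rabs x <= n -> plateau n x = 1.
Proof.
  intros H. apply Rabs_le_between in H. unfold plateau. rewrite step_ge1, step_le0 by lra. ring.
Qed.

Lemma plateau_0 n x : 0 <= n -> n + 1 <= Rabs x -> plateau n x = 0.
Proof.
  intros Hn H. unfold plateau. destruct (Rle_dec 0 x) as [L|L].
  - rewrite Rabs_pos_eq in H by auto. rewrite !step_ge1 by lra. ring.
  - rewrite Rabs_left in H by lra. rewrite !step_le0 by lra. ring.
Qed.

Lemma plateau_bounds n x : 0 <= n -> 0 <= plateau n x <= 1.
Proof.
  intros Hn. unfold plateau. pose proof (step_mono (x - n) (x + n + 1) ltac:(lra)).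
  pose proof (step_bounds (x - n)). pose proof (step_bounds (x + n + 1)). lra.
Qed.

Lemma Derive_n_shift g b k x : Derive_n (fun t => g (t + b)) k x = Derive_n g k (x + b).
Proof. apply Derive_n_comp_trans. Qed.

Lemma Derive_n_coplateau_bound k : exists B, 0 <= B /\
  forall n i x, (i <= k)%nat -> Rabs (Derive_n (fun t => 1 - plateau n t) i x) <= B.
Proof.
  destruct (Derive_n_step_bound k) as [B [HB0 HB]]. exists (1 + 2 * B). split; [lra|].
  intros n i x Hi.
  rewrite (Derive_n_ext _ (fun t => (1 + (-1) * step (t + (n + 1))) + step (t + - n))).
  2: { intros t. unfold plateau. replace (t + n + 1) with (t + (n + 1)) by ring. unfold Rminus. ring. }
  assert (Ss : forall b, smoothR (fun t => step (t + b))).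
  { intros b. replace (fun t => step (t + b)) with (fun t => step (1 * t + b)).
    - apply smoothR_affine, smoothR_step. - apply functional_extensionality; intros; f_equal; ring. }
  rewrite (Derive_n_plus_smooth (fun t => 1 + (-1) * step (t + (n + 1))) (fun t => step (t + - n))); auto.
  2: { apply smoothR_plus; [apply smoothR_const|apply smoothR_scal; auto]. }
  rewrite (Derive_n_plus_smooth (fun t => 1) (fun t => (-1) * step (t + (n + 1)))); auto.
  2: { apply smoothR_const. } 2: { apply smoothR_scal; auto. }
  rewrite Derive_n_scal_smooth, !Derive_n_shift.
  pose proof (HB i (x + (n + 1)) Hi). pose proof (HB i (x + - n) Hi).
  assert (Rabs (Derive_n (fun _ => 1) i x) <= 1).
  { destruct i. - simpl. rewrite Rabs_R1; lra. - rewrite Derive_n_const, Rabs_R0; lra. }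
  eapply Rle_trans; [apply Rabs_triang|]. apply Rle_trans with ((1 + B) + B); [|lra].
  apply Rplus_le_compat; auto. eapply Rle_trans; [apply Rabs_triang|].
  apply Rplus_le_compat; auto. rewrite Rabs_mult. replace (Rabs (-1)) with 1; [lra|].
  rewrite Rabs_left by lra. ring.
Qed.

(** Inside the ball of radius [n] the function [1 - plateau n] vanishes locally. Outside, [f] is
    controlled with one power of [x] to spare, which yields the factor [/ n]; the derivatives of
    [1 - plateau n] are bounded uniformly in [n]. *)
Lemma schwartz_cutoff f N : schwartz f -> exists C, 0 <= C /\ forall n, 1 <= n ->
  forall m k x, (m <= N)%nat -> (k <= N)%nat ->
  Rabs x ^ m * Cmod (cderiv (fun t => Cmult (RtoC (1 - plateau n t)) (f t)) k x) <= C / n.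
Proof.
  intros Hf. destruct (schwartz_bound f (S N) Hf) as [B [HB0 HB]].
  destruct (Derive_n_coplateau_bound N) as [G [HG0 HG]].
  exists (2 * (2 ^ N * (B * G))).
  assert (P2 : 0 <= 2 ^ N) by (apply pow_le; lra).
  split. { repeat apply Rmult_le_pos; lra. }
  intros n Hn m k x Hm Hk. destruct (Rlt_dec (Rabs x) n) as [L|L].
  - assert (Z : forall g : R -> R, Derive_n (fun t => (1 - plateau n t) * g t) k x = 0).
    { intros g. apply Derive_n_locally_0.
      assert (Hp : 0 < n - Rabs x) by lra. exists (mkposreal _ Hp). intros y Hy.
        unfold ball in Hy; simpl in Hy; unfold AbsRing_ball, abs, minus, plus, opp in Hy; simpl in Hy.
        rewrite plateau_1; [ring|]. pose proof (Rabs_triang_inv y x) as T. unfold Rminus in *. lra. }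
    assert (E : cderiv (fun t => Cmult (RtoC (1 - plateau n t)) (f t)) k x = RtoC 0).
    { unfold cderiv. ceq.
      - rewrite (Derive_n_ext _ (fun t => (1 - plateau n t) * fst (f t))) by (intros; ring). apply Z.
      - rewrite (Derive_n_ext _ (fun t => (1 - plateau n t) * snd (f t))) by (intros; ring). apply Z. }
    rewrite E, Cmod_0, Rmult_0_r. apply Rle_mult_inv_pos; [|lra]. repeat apply Rmult_le_pos; lra.
  - assert (Hx : 0 < Rabs x) by lra.
    assert (Hxm : 0 < Rabs x ^ m) by now apply pow_lt.
    set (F := B / (Rabs x ^ m * Rabs x)).
    assert (HF0 : 0 <= F). { apply Rle_mult_inv_pos; auto. now apply Rmult_lt_0_compat. }
    assert (HF : forall i, (i <= k)%nat -> Cmod (cderiv f i x) <= F).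
    { intros i Hi. specialize (HB (S m) i x ltac:(lia) ltac:(lia)). simpl in HB.
      unfold F. apply Rmult_le_reg_l with (Rabs x ^ m * Rabs x). { now apply Rmult_lt_0_compat. }
      replace (Rabs x ^ m * Rabs x * (B / (Rabs x ^ m * Rabs x))) with B by (field; lra). lra. }
    assert (Sp : smoothR (fun t => 1 - plateau n t)).
    { apply smoothR_minus; [apply smoothR_const|apply smoothR_plateau]. }
    destruct Hf as [[S1 S2] _].
    assert (A1 : Rabs (Derive_n (fun t => (1 - plateau n t) * fst (f t)) k x) <= 2 ^ k * (G * F)).
    { apply (Derive_n_mult_bound (fun t => 1 - plateau n t) (fun t => fst (f t))); auto.
      - intros i Hi. apply HG; lia.
      - intros i Hi. eapply Rle_trans; [|apply (HF i Hi)]. apply (Rabs_fst_le (cderiv f i x)). }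
    assert (A2 : Rabs (Derive_n (fun t => (1 - plateau n t) * snd (f t)) k x) <= 2 ^ k * (G * F)).
    { apply (Derive_n_mult_bound (fun t => 1 - plateau n t) (fun t => snd (f t))); auto.
      - intros i Hi. apply HG; lia.
      - intros i Hi. eapply Rle_trans; [|apply (HF i Hi)]. apply (Rabs_snd_le (cderiv f i x)). }
    assert (A3 : Cmod (cderiv (fun t => Cmult (RtoC (1 - plateau n t)) (f t)) k x) <= 2 * (2 ^ N * (G * F))).
    { eapply Rle_trans; [apply Cmod_le_sum|]. unfold cderiv; cbn [fst snd].
      rewrite (Derive_n_ext (fun t => fst (Cmult (RtoC (1 - plateau n t)) (f t))) (fun t => (1 - plateau n t) * fst (f t))) by (intros; simpl; ring).
      rewrite (Derive_n_ext (fun t => snd (Cmult (RtoC (1 - plateau n t)) (f t))) (fun t => (1 - plateau n t) * snd (f t))) by (intros; simpl; ring).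
      assert (2 ^ k * (G * F) <= 2 ^ N * (G * F)).
      { apply Rmult_le_compat_r; [now apply Rmult_le_pos|]. apply Rle_pow; auto; lra. }
      lra. }
    apply Rle_trans with (Rabs x ^ m * (2 * (2 ^ N * (G * F)))).
    { apply Rmult_le_compat_l; lra. }
    replace (Rabs x ^ m * (2 * (2 ^ N * (G * F)))) with (2 * (2 ^ N * (B * G)) * / Rabs x) by (unfold F; field; lra).
    apply Rmult_le_compat_l. { repeat apply Rmult_le_pos; lra. }
    apply Rinv_le_contravar; lra.
Qed.

(** Both extensions equal [mu] on the truncated function [g n], and the remainder [d n] tends to 0
    in every seminorm that bounds them. *)
Lemma tempered_ext_unique mu T1 T2 f : tempered_ext mu T1 -> tempered_ext mu T2 -> schwartz f -> T1 f = T2 f.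
Proof.
  intros [L1 [[N1 [A1 B1]] E1]] [L2 [[N2 [A2 B2]] E2]] Hf.
  set (N := (N1 + N2)%nat).
  destruct (schwartz_cutoff f N Hf) as [C [HC0 HC]].
  set (g := fun n t => Cmult (RtoC (plateau n t)) (f t)).
  set (d := fun n t => Cmult (RtoC (1 - plateau n t)) (f t)).
  assert (Hg : forall n, 1 <= n -> testfun (g n)).
  { intros n Hn. assert (Sg : smooth (g n)). { apply smooth_mult; [apply smooth_RtoC, smoothR_plateau|apply Hf]. }
    split; auto. split; [intros; now apply smooth_cont|].
    exists (n + 1). intros x Hx. unfold g. rewrite plateau_0 by lra. ring. }
  assert (Ed : forall n, d n = fun t => Cplus (Cmult (RtoC (-1)) (g n t)) (f t)).
  { intros n. apply functional_extensionality; intros t. unfold d, g. ceq; ring. }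
  assert (Z : Cmod (T1 f - T2 f)%C <= 0).
  { apply le_epsilon. intros eps He.
    pose proof (Rabs_pos A1). pose proof (Rabs_pos A2).
    set (n := 1 + (Rabs A1 + Rabs A2) * C / eps).
    assert (Hn : 1 <= n).
    { unfold n. assert (0 <= (Rabs A1 + Rabs A2) * C / eps); [|lra]. apply Rle_mult_inv_pos; auto. apply Rmult_le_pos; lra. }
    specialize (HC n Hn). fold (d n) in HC.
    assert (Sd : schwartz (d n)). { rewrite Ed. apply schwartz_lin; auto. now apply testfun_schwartz, Hg. }
    assert (X1 : T1 (d n) = (T1 f - T1 (g n))%C).
    { rewrite Ed, L1; auto using testfun_schwartz. ceq; ring. }
    assert (X2 : T2 (d n) = (T2 f - T1 (g n))%C).
    { rewrite Ed, L2; auto using testfun_schwartz. rewrite (E2 (g n)), <- (E1 (g n)) by auto. ceq; ring. }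
    assert (Y1 : Cmod (T1 (d n)) <= Rabs A1 * (C / n)).
    { eapply Rle_trans; [apply (B1 (d n) Sd (C / n))|].
      - intros; apply HC; unfold N; lia.
      - apply Rmult_le_compat_r; [apply Rle_mult_inv_pos; lra|apply Rle_abs]. }
    assert (Y2 : Cmod (T2 (d n)) <= Rabs A2 * (C / n)).
    { eapply Rle_trans; [apply (B2 (d n) Sd (C / n))|].
      - intros; apply HC; unfold N; lia.
      - apply Rmult_le_compat_r; [apply Rle_mult_inv_pos; lra|apply Rle_abs]. }
    replace (T1 f - T2 f)%C with (T1 (d n) - T2 (d n))%C by (rewrite X1, X2; ring).
    apply Rle_trans with (Cmod (T1 (d n)) + Cmod (T2 (d n))).
    { unfold Cminus. eapply Rle_trans; [apply Cmod_triangle|]. rewrite Cmod_opp. lra. }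
    apply Rle_trans with ((Rabs A1 + Rabs A2) * C / n).
    { replace ((Rabs A1 + Rabs A2) * C / n) with (Rabs A1 * (C / n) + Rabs A2 * (C / n)) by (field; lra). lra. }
    rewrite Rplus_0_l. apply Rmult_le_reg_r with n; [lra|].
    replace ((Rabs A1 + Rabs A2) * C / n * n) with ((Rabs A1 + Rabs A2) * C) by (field; lra).
    unfold n. replace (eps * (1 + (Rabs A1 + Rabs A2) * C / eps)) with (eps + (Rabs A1 + Rabs A2) * C) by (field; lra). lra. }
  assert (Z0 : Cmod (T1 f - T2 f)%C = 0) by (pose proof (Cmod_ge_0 (T1 f - T2 f)%C); lra).
  apply Cmod_eq_0 in Z0. replace (T1 f) with (T2 f + (T1 f - T2 f))%C by ring. rewrite Z0. ring.
Qed.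

(** * Invariance, uniqueness and linearity of the transform of measures *)

Lemma is_measure_meq mu nu : meq mu nu -> is_measure mu -> is_measure nu.
Proof.
  intros E [L B]. split.
  - intros a f g Hf Hg. rewrite <- !E; auto. apply Cc_plus; auto. now apply Cc_scal.
  - intros K. destruct (B K) as [A HA]. exists A. intros f Hf HK D HD. rewrite <- E; auto.
Qed.

Lemma tempered_ext_meq mu nu T : meq mu nu -> tempered_ext mu T -> tempered_ext nu T.
Proof.
  intros E [L [B X]]. split; [|split]; auto. intros f Hf. rewrite X by auto. apply E. now apply testfun_Cc.
Qed.

Lemma FT_meas_meq mu mu' nu nu' : meq mu mu' -> meq nu nu' -> FT_meas mu nu -> FT_meas mu' nu'.
Proof.
  intros E E' [H1 [H2 [T [HT HF]]]]. split; [|split].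
  - apply (is_measure_meq mu); auto.
  - apply (is_measure_meq nu); auto.
  - exists T. split; [apply (tempered_ext_meq mu); auto|].
    intros f Hf. rewrite <- E'; auto using testfun_Cc.
Qed.

Lemma FT_meas_unique mu nu nu' : FT_meas mu nu -> FT_meas mu nu' -> meq nu nu'.
Proof.
  intros [H1 [H2 [T [HT HF]]]] [_ [H2' [T' [HT' HF']]]].
  apply measure_eq_of_testfun; auto. intros f Hf. rewrite HF, HF' by auto.
  apply (tempered_ext_unique mu); auto. now apply schwartz_fourier.
Qed.

Lemma is_measure_lin a mu nu : is_measure mu -> is_measure nu ->
  is_measure (fun f => Cplus (Cmult a (mu f)) (nu f)).
Proof.
  intros Hm Hn. split.
  - intros b f g Hf Hg. rewrite !measure_lin by auto. ring.
  - intros K. destruct (measure_bound mu K Hm) as [A [HA0 HA]], (measure_bound nu K Hn) as [B [HB0 HB]].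
    exists (Cmod a * A + B). intros f Hf HK D HD.
    assert (HD0 : 0 <= D) by (eapply Rle_trans; [apply Cmod_ge_0|apply (HD 0)]).
    eapply Rle_trans; [apply Cmod_triangle|]. rewrite Cmod_mult.
    specialize (HA f Hf HK D HD0 HD). specialize (HB f Hf HK D HD0 HD).
    pose proof (Rmult_le_compat_l _ _ _ (Cmod_ge_0 a) HA). lra.
Qed.

Lemma tempered_ext_lin a mu nu T U : tempered_ext mu T -> tempered_ext nu U ->
  tempered_ext (fun f => Cplus (Cmult a (mu f)) (nu f)) (fun f => Cplus (Cmult a (T f)) (U f)).
Proof.
  intros [L1 [[N1 [A1 B1]] E1]] [L2 [[N2 [A2 B2]] E2]]. split; [|split].
  - intros b f g Hf Hg. rewrite L1, L2 by auto. ring.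
  - exists (N1 + N2)%nat, (Cmod a * A1 + A2). intros f Hf B HB.
    eapply Rle_trans; [apply Cmod_triangle|]. rewrite Cmod_mult.
    assert (H1 := B1 f Hf B ltac:(intros; apply HB; lia)).
    assert (H2 := B2 f Hf B ltac:(intros; apply HB; lia)).
    pose proof (Rmult_le_compat_l _ _ _ (Cmod_ge_0 a) H1). lra.
  - intros f Hf. rewrite E1, E2; auto.
Qed.

Lemma FT_meas_lin a mu nu mu' nu' : FT_meas mu mu' -> FT_meas nu nu' ->
  FT_meas (fun f => Cplus (Cmult a (mu f)) (nu f)) (fun f => Cplus (Cmult a (mu' f)) (nu' f)).
Proof.
  intros [H1 [H2 [T [HT HF]]]] [H1' [H2' [T' [HT' HF']]]].
  split; [|split]; try apply is_measure_lin; auto.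
  exists (fun f => Cplus (Cmult a (T f)) (T' f)). split; [now apply tempered_ext_lin|].
  intros f Hf. rewrite HF, HF'; auto.
Qed.

Lemma FT_meas_0 : FT_meas (fun _ => RtoC 0) (fun _ => RtoC 0).
Proof.
  assert (M : is_measure (fun _ => RtoC 0)).
  { split; [intros; ring|]. intros K. exists 0. intros. rewrite Cmod_0. lra. }
  split; [|split]; auto. exists (fun _ => RtoC 0). split; auto. split; [|split]; auto.
  - intros; ring. - exists 0%nat, 0. intros. rewrite Cmod_0. lra.
Qed.

Lemma FT_meas_scal a mu nu : FT_meas mu nu -> FT_meas (mscale a mu) (mscale a nu).
Proof.
  intros H. eapply FT_meas_meq; [| |apply (FT_meas_lin a mu _ nu _ H FT_meas_0)];
  intros f _; unfold mscale; ring.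
Qed.

Lemma FT_meas_lincomb k c mus nus : (forall i, (i < k)%nat -> FT_meas (mus i) (nus i)) ->
  FT_meas (lincomb k c mus) (lincomb k c nus).
Proof.
  induction k as [|k IH]; intros H.
  - apply FT_meas_0.
  - eapply FT_meas_meq; [| |apply (FT_meas_lin (c k) (mus k) (lincomb k c mus) (nus k) (lincomb k c nus)); auto];
    intros f _; unfold lincomb; simpl; ring.
Qed.

Lemma FT_meas_proj4 lam a b c d e : FT_meas a b -> FT_meas b c -> FT_meas c d -> FT_meas d e ->
  FT_meas (proj4 lam a b c d) (proj4 lam b c d e).
Proof.
  intros H1 H2 H3 H4.
  pose proof (FT_meas_lin (Cinv lam) _ _ _ _ H2 H1) as A1.
  pose proof (FT_meas_lin (Cinv (Cpow lam 2)) _ _ _ _ H3 A1) as A2.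
  pose proof (FT_meas_lin (Cinv (Cpow lam 3)) _ _ _ _ H4 A2) as A3.
  eapply FT_meas_meq; [| |apply A3]; intros f _; unfold proj4; ring.
Qed.

(** * Measures with uniformly discrete support *)

Lemma exists_nat_gt (x : R) : exists n : nat, (0 < n)%nat /\ x < INR n.
Proof.
  destruct (INR_unbounded x) as [n Hn]. exists (S n). split; [lia|]. rewrite S_INR; lra.
Qed.

Lemma bump_partition_1 n M K x : 0 <= n -> n * K + 2 <= INR M -> Rabs x <= K ->
  zsumR M (fun j => bump (n * x - IZR j)) = 1.
Proof.
  intros Hn HM Hx. apply Rabs_le_between in Hx.
  rewrite bump_partition, step_ge1, step_le0; [ring| |]; nra.
Qed.

Lemma zsum_RtoC M (u : Z -> R) : zsum M (fun j => RtoC (u j)) = RtoC (zsumR M u).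
Proof.
  induction M as [|M IH]; cbn [zsum zsumR]; auto. rewrite IH, <- !RtoC_plus. reflexivity.
Qed.

(* A smooth partition of unity reduces a vanishing statement to functions of small support. *)
Lemma measure_localize mu g d : is_measure mu -> Cc g -> 0 < d ->
  (forall h y, Cc h -> (forall x, g x = RtoC 0 -> h x = RtoC 0) ->
     (forall x, d <= Rabs (x - y) -> h x = RtoC 0) -> mu h = RtoC 0) -> mu g = RtoC 0.
Proof.
  intros Hm Hg Hd H. destruct (Cc_support g Hg) as [K [HK0 HK]].
  destruct (exists_nat_gt (/ d)) as [n [Hn0 Hn]].
  assert (Hnp : 0 < INR n) by (apply lt_0_INR; lia).
  assert (Hnd : / INR n < d).
  { rewrite <- (Rinv_inv d). apply Rinv_lt_contravar; auto. apply Rmult_lt_0_compat; auto. now apply Rinv_0_lt_compat. }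
  destruct (exists_nat_gt (INR n * K + 2)) as [M [_ HM]].
  set (u := fun j x => Cmult (RtoC (bump (INR n * x - IZR j))) (g x)).
  assert (Hu : forall j, Cc (u j)).
  { intros j. apply Cc_mult; auto. intros x. apply continuous_RtoC.
    apply (continuous_comp (fun t => INR n * t - IZR j) bump).
    - apply (ex_derive_continuous (V := R_NormedModule)). auto_derive; auto.
    - apply smoothR_continuous, smoothR_bump. }
  assert (E : g = fun x => zsum M (fun j => u j x)).
  { apply functional_extensionality; intros x. destruct (Rle_dec K (Rabs x)) as [L|L].
    - rewrite zsum_0; auto. intros j _. unfold u. rewrite HK by auto. ring.
    - unfold u. rewrite (zsum_ext _ _ (fun j => Cmult (g x) (RtoC (bump (INR n * x - IZR j))))) by (intros; ring).
      rewrite zsum_scal, zsum_RtoC, (bump_partition_1 _ _ K); try lra. ring. }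
  rewrite E, measure_zsum by auto. apply zsum_0. intros j _.
  apply (H (u j) (IZR j / INR n)); auto.
  - intros x Hx. unfold u. rewrite Hx. ring.
  - intros x Hx. unfold u. rewrite bump_out; [ring|].
    replace (INR n * x - IZR j) with (INR n * (x - IZR j / INR n)) by (field; lra).
    rewrite Rabs_mult, (Rabs_pos_eq (INR n)) by lra.
    apply Rle_trans with (INR n * / INR n). { rewrite Rinv_r by lra; lra. }
    apply Rmult_le_compat_l; lra.
Qed.

(** Compactness: every point of the interval has a neighbourhood on which [mu] vanishes, and a
    partition finer than a Lebesgue number of this cover cuts [g] into pieces of measure 0. *)
Lemma measure_vanish_off_supp mu g u v : is_measure mu -> Cc g ->
  (forall x, x < u \/ v < x -> g x = RtoC 0) -> (forall x, u <= x <= v -> ~ in_supp mu x) -> mu g = RtoC 0.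
Proof.
  intros Hm Hg Hs Hn.
  (* The radius is [2 * e] because two distances add up: a point of the piece lies within [e] of
     [t], and the piece itself has diameter at most [e]. *)
  assert (Hloc : forall t, exists e : posreal, u <= t <= v ->
     forall f, Cc f -> (forall y, 2 * e <= Rabs (y - t) -> f y = RtoC 0) -> mu f = RtoC 0).
  { intros t. destruct (classic (u <= t <= v)) as [Ht|Ht].
    - apply NNPP. intros C. apply (Hn t Ht). intros eps He. apply NNPP. intros C'.
      apply C. exists (mkposreal (eps / 2) ltac:(lra)). intros _ f Hf Hfs. simpl in Hfs.
      apply NNPP. intros C''. apply C'. exists f. split; [|split]; auto. intros y Hy. apply Hfs. lra.
    - exists (mkposreal 1 Rlt_0_1). intros; contradiction. }
  set (dl := fun t => proj1_sig (constructive_indefinite_description _ (Hloc t))).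
  assert (Hdl : forall t, u <= t <= v -> forall f, Cc f -> (forall y, 2 * dl t <= Rabs (y - t) -> f y = RtoC 0) -> mu f = RtoC 0).
  { intros t. unfold dl. destruct (constructive_indefinite_description _ (Hloc t)) as [e He]. exact He. }
  destruct (compactness_value_1d u v dl) as [d Hd].
  apply (measure_localize mu g (d / 2)); auto. { destruct d; simpl; lra. }
  intros h y Hh Hgh Hy.
  destruct (classic (exists z, h z <> RtoC 0)) as [[z Hz]|Hz].
  - assert (Hzg : g z <> RtoC 0) by (intros C; apply Hz; auto).
    assert (Hzuv : u <= z <= v).
    { split; apply Rnot_lt_le; intros C; apply Hzg; auto. }
    assert (Hzy : Rabs (z - y) < d / 2).
    { apply Rnot_le_lt; intros C; apply Hz; auto. }
    (* [compactness_value_1d] states its covering property under a double negation, which the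
       negated goal absorbs. *)
    apply NNPP. intros C. apply (Hd z Hzuv). intros [t [Ht [Ht1 Ht2]]]. apply C.
    apply (Hdl t Ht h Hh). intros x Hx. apply Hy.
    replace (x - t) with ((x - y) + (- (z - y)) + (z - t)) in Hx by ring.
    pose proof (Rabs_triang ((x - y) + - (z - y)) (z - t)) as T1.
    pose proof (Rabs_triang (x - y) (- (z - y))) as T2. rewrite Rabs_Ropp in T2. lra.
  - replace h with (fun _ : R => RtoC 0); [now apply measure_0|].
    apply functional_extensionality; intros x. symmetry. apply NNPP. intros C. apply Hz. now exists x.
Qed.

Lemma smooth_comp_affine (s : R -> R) a b : smoothR s -> forall x, continuous ((fun t => RtoC (s (a * t + b))) : R -> CC) x.
Proof. intros H x. apply continuous_RtoC, smoothR_continuous, smoothR_affine, H. Qed.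

(** The part of [g] near [x0] is uniformly small because [g] vanishes at [x0]; the rest falls into a
    left and a right part, both away from the support. *)
Lemma measure_vanish_single mu g u v x0 : is_measure mu -> Cc g ->
  (forall x, x < u \/ v < x -> g x = RtoC 0) -> g x0 = RtoC 0 ->
  (forall x, u <= x <= v -> in_supp mu x -> x = x0) -> mu g = RtoC 0.
Proof.
  intros Hm Hg Hs H0 Hn. destruct (Cc_support g Hg) as [K [HK0 HK]].
  destruct (measure_bound mu K Hm) as [A [HA0 HA]].
  assert (Z : Cmod (mu g) <= 0).
  { apply le_epsilon. intros eps He. rewrite Rplus_0_l.
    assert (He' : 0 < eps / (A + 1)) by (apply Rdiv_lt_0_compat; lra).
    destruct (Cc_unif_cont g Hg _ He') as [d [Hd0 Hd]].
    set (b := 3 / d * - x0).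
    assert (Hb : forall y, 3 / d * y + b = 3 / d * (y - x0)) by (intros; unfold b; ring).
    assert (H3d : 0 < 3 / d) by (apply Rdiv_lt_0_compat; lra).
    assert (Hsc : forall y c, 3 / d * (y - x0) = c -> y - x0 = c * d / 3).
    { intros y c Hc. rewrite <- Hc. field; lra. }
    (* At scale [3 / d] the cutoff [w] is 1 within [d / 3] of [x0] and 0 from [2 * d / 3] on; [s]
       increases from 0 at [x0] to 1 at [x0 + d / 3], where the remainder [r] is 0 anyway. *)
    set (w := fun y => plateau 1 (3 / d * y + b)).
    set (s := fun y => step (3 / d * y + b)).
    assert (Hw : forall x, continuous ((fun t => RtoC (w t)) : R -> CC) x) by (apply smooth_comp_affine, smoothR_plateau).
    assert (Hs' : forall x, continuous ((fun t => RtoC (s t)) : R -> CC) x) by (apply smooth_comp_affine, smoothR_step).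
    assert (H1 : forall x, continuous ((fun t => RtoC 1) : R -> CC) x) by (intros; apply continuous_const).
    assert (Hw' : Cc (fun y => Cmult (RtoC (w y)) (g y))) by now apply Cc_mult.
    assert (Hr : Cc (fun y => Cminus (g y) (Cmult (RtoC (w y)) (g y)))) by now apply Cc_minus.
    set (r := fun y => Cminus (g y) (Cmult (RtoC (w y)) (g y))) in *.
    assert (Hrr : Cc (fun y => Cmult (RtoC (s y)) (r y))) by now apply Cc_mult.
    assert (Hrl : Cc (fun y => Cminus (r y) (Cmult (RtoC (s y)) (r y)))) by now apply Cc_minus.
    assert (Hr0 : forall y, Rabs (y - x0) <= d / 3 -> r y = RtoC 0).
    { intros y Hy. unfold r, w. rewrite plateau_1; [ring|]. rewrite Hb, Rabs_mult, (Rabs_pos_eq (3 / d)) by lra.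
      apply Rmult_le_reg_l with (d / 3); [lra|]. replace (d / 3 * (3 / d * Rabs (y - x0))) with (Rabs (y - x0)) by (field; lra). lra. }
    assert (E1 : mu (fun y => Cmult (RtoC (s y)) (r y)) = RtoC 0).
    { apply (measure_vanish_off_supp mu _ (Rmax u (x0 + d / 3)) v); auto.
      - intros x [Hx|Hx].
        + destruct (Rlt_dec x u) as [L|L]. { unfold r. rewrite Hs by auto. ring. }
          assert (Hx' : x < x0 + d / 3). { apply Rnot_le_lt. intros C. apply (Rlt_irrefl x).
            eapply Rlt_le_trans; [exact Hx|]. apply Rmax_lub; lra. }
          destruct (Rle_dec x0 x) as [L'|L'].
          * rewrite Hr0; [ring|]. rewrite Rabs_pos_eq; lra.
          * unfold s. rewrite step_le0; [ring|]. rewrite Hb. nra.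
        + unfold r. rewrite Hs by auto. ring.
      - intros x [Hx1 Hx2] C. pose proof (Rmax_l u (x0 + d / 3)). pose proof (Rmax_r u (x0 + d / 3)).
        apply Hn in C; lra. }
    assert (E2 : mu (fun y => Cminus (r y) (Cmult (RtoC (s y)) (r y))) = RtoC 0).
    { apply (measure_vanish_off_supp mu _ u (Rmin v (x0 - d / 3))); auto.
      - intros x [Hx|Hx].
        + unfold r. rewrite Hs by auto. ring.
        + destruct (Rlt_dec v x) as [L|L]. { unfold r. rewrite Hs by auto. ring. }
          assert (Hx' : x0 - d / 3 < x). { apply Rnot_le_lt. intros C. apply (Rlt_irrefl x).
            eapply Rle_lt_trans; [|exact Hx]. apply Rmin_glb; lra. }
          destruct (Rle_dec x (x0 + d / 3)) as [L'|L'].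
          * rewrite Hr0; [ring|]. apply Rabs_le; lra.
          * unfold s. rewrite step_ge1; [ring|]. rewrite Hb.
            apply Rmult_le_reg_l with (d / 3); [lra|]. replace (d / 3 * (3 / d * (x - x0))) with (x - x0) by (field; lra). lra.
      - intros x [Hx1 Hx2] C. pose proof (Rmin_l v (x0 - d / 3)). pose proof (Rmin_r v (x0 - d / 3)).
        apply Hn in C; lra. }
    rewrite measure_minus, E1 in E2 by auto.
    assert (E3 : mu r = RtoC 0) by (rewrite <- E2; ring).
    unfold r in E3. rewrite measure_minus in E3 by auto.
    assert (E4 : mu g = mu (fun y => Cmult (RtoC (w y)) (g y))).
    { transitivity (Cplus (Cminus (mu g) (mu (fun y => Cmult (RtoC (w y)) (g y)))) (mu (fun y => Cmult (RtoC (w y)) (g y)))); [ring|].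
      rewrite E3. ring. }
    rewrite E4. apply Rle_trans with (A * (eps / (A + 1))).
    - apply HA; auto; [|lra|].
      + intros x Hx. rewrite HK by lra. ring.
      + intros x. rewrite Cmod_mult, Cmod_R.
        pose proof (plateau_bounds 1 (3 / d * x + b) ltac:(lra)) as Hp. fold (w x) in Hp.
        rewrite Rabs_pos_eq by lra.
        destruct (Rlt_dec (Rabs (x - x0)) d) as [L|L].
        * specialize (Hd x x0 L). rewrite H0 in Hd. replace (g x - 0)%C with (g x) in Hd by ring.
          pose proof (Cmod_ge_0 (g x)). nra.
        * unfold w. rewrite plateau_0; try lra. rewrite Hb, Rabs_mult, (Rabs_pos_eq (3 / d)) by lra.
          apply Rmult_le_reg_l with (d / 3); [lra|].
          replace (d / 3 * (3 / d * Rabs (x - x0))) with (Rabs (x - x0)) by (field; lra). lra.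
    - apply Rmult_le_reg_r with (A + 1); [lra|].
      replace (A * (eps / (A + 1)) * (A + 1)) with (A * eps) by (field; lra). nra. }
  apply Cmod_eq_0. pose proof (Cmod_ge_0 (mu g)); lra.
Qed.

(** Pieces supported in intervals of length [2 * r / 3] see at most one point of a support with
    spacing [r]. *)
Lemma measure_vanish_on_supp mu g : is_measure mu -> uniformly_discrete (in_supp mu) -> Cc g ->
  (forall x, in_supp mu x -> g x = RtoC 0) -> mu g = RtoC 0.
Proof.
  intros Hm [r [Hr HU]] Hg H. apply (measure_localize mu g (r / 3)); auto; [lra|].
  intros h y Hh Hgh Hy.
  assert (Hs : forall x, x < y - r / 3 \/ y + r / 3 < x -> h x = RtoC 0).
  { intros x Hx. apply Hy. destruct Hx; [rewrite Rabs_left1|rewrite Rabs_pos_eq]; lra. }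
  destruct (classic (exists x, y - r / 3 <= x <= y + r / 3 /\ in_supp mu x)) as [[x0 [Hx0 Hx0']]|C].
  - apply (measure_vanish_single mu h (y - r / 3) (y + r / 3) x0); auto.
    intros x Hx Hx'. apply NNPP. intros C. specialize (HU x x0 Hx' Hx0' C).
    assert (Rabs (x - x0) <= 2 * (r / 3)) by (apply Rabs_le; lra). lra.
  - apply (measure_vanish_off_supp mu h (y - r / 3) (y + r / 3)); auto.
    intros x Hx Hx'. apply C. now exists x.
Qed.

(* One point of the support, at most, per cell [[j rho, (j+1) rho)]; cells without one carry coefficient 0. *)
Definition cells (rho : R) (p : Z -> R) : Prop :=
  0 < rho /\ forall j, IZR j * rho <= p j < (IZR j + 1) * rho.

Definition separated (rho : R) (p : Z -> R) (c : Z -> CC) : Prop :=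
  forall i j, c i <> RtoC 0 -> c j <> RtoC 0 -> i <> j -> rho <= Rabs (p i - p j).

Lemma cells_far rho p M K : cells rho p -> K <= INR M * rho -> forall j, (Z.of_nat M < Z.abs j)%Z -> K <= Rabs (p j).
Proof.
  intros [Hr Hp] HK j Hj. specialize (Hp j). rewrite INR_IZR_INZ in HK.
  destruct (Z_le_gt_dec 0 j) as [L|L].
  - assert (IZR (Z.of_nat M) <= IZR j) by (apply IZR_le; lia). eapply Rle_trans; [|apply Rle_abs]. nra.
  - assert (IZR (Z.of_nat M) <= IZR (- j - 1)) as A by (apply IZR_le; lia). rewrite minus_IZR, opp_IZR in A.
    rewrite <- Rabs_Ropp. eapply Rle_trans; [|apply Rle_abs]. nra.
Qed.

Lemma Cc_cells_finite rho p f : cells rho p -> Cc f -> exists M, forall j, (Z.of_nat M < Z.abs j)%Z -> f (p j) = RtoC 0.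
Proof.
  intros Hp Hf. destruct (Cc_support f Hf) as [K [HK0 HK]].
  destruct (exists_nat_gt (K / rho)) as [M [_ HM]]. exists M. intros j Hj. apply HK.
  apply (cells_far rho p M); auto. destruct Hp as [Hr _].
  apply Rlt_le. apply Rmult_lt_reg_r with (/ rho). { now apply Rinv_0_lt_compat. }
  rewrite Rmult_assoc, Rinv_r by lra. lra.
Qed.

Definition shifted_bump (r x y : R) : CC := RtoC (bump (/ r * y + - (/ r * x))).

Lemma testfun_shifted_bump r x : 0 < r -> testfun (shifted_bump r x).
Proof.
  intros Hr. apply (testfun_affine (fun t => RtoC (bump t)) (/ r)); [|apply testfun_bump].
  apply Rinv_neq_0_compat; lra.
Qed.

Lemma shifted_bump_center r x : shifted_bump r x x = RtoC 1.
Proof. unfold shifted_bump. replace (/ r * x + - (/ r * x)) with 0 by ring. now rewrite bump_0. Qed.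

Lemma shifted_bump_out r x y : 0 < r -> r <= Rabs (y - x) -> shifted_bump r x y = RtoC 0.
Proof.
  intros Hr H. unfold shifted_bump. rewrite bump_out; auto.
  replace (/ r * y + - (/ r * x)) with (/ r * (y - x)) by ring.
  rewrite Rabs_mult, (Rabs_pos_eq (/ r)) by (apply Rlt_le, Rinv_0_lt_compat; auto).
  apply Rmult_le_reg_l with r; auto. rewrite <- Rmult_assoc, Rinv_r by lra. lra.
Qed.

(** A half-open cell of length [r] contains at most one support point. Subtracting from [f] its
    finite interpolation by bumps at these points leaves a function that vanishes on the support,
    hence has measure 0. The formula for [c j] is kept because it lets temperedness bound the
    coefficients. *)
Lemma ud_measure_rep mu : is_measure mu -> uniformly_discrete (in_supp mu) ->
  exists rho p c, cells rho p /\ separated rho p c /\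
    (forall j, c j <> RtoC 0 -> c j = mu (shifted_bump rho (p j))) /\
    forall f, Cc f -> mu f = Zs (fun j => Cmult (c j) (f (p j))).
Proof.
  intros Hm HU. assert (HU' := HU). destruct HU as [r [Hr HU]].
  set (P := fun j x => IZR j * r <= x < (IZR j + 1) * r /\ in_supp mu x).
  assert (Hex : forall j, exists x, IZR j * r <= x < (IZR j + 1) * r /\ ((exists y, P j y) -> in_supp mu x)).
  { intros j. destruct (classic (exists y, P j y)) as [[y [Hy1 Hy2]]|C].
    - exists y; auto. - exists (IZR j * r). split; [lra|]. intros; contradiction. }
  set (p := fun j => proj1_sig (constructive_indefinite_description _ (Hex j))).
  assert (Hp : forall j, IZR j * r <= p j < (IZR j + 1) * r /\ ((exists y, P j y) -> in_supp mu (p j))).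
  { intros j. unfold p. destruct (constructive_indefinite_description _ (Hex j)) as [x Hx]. exact Hx. }
  set (ind := fun j => if excluded_middle_informative (exists y, P j y) then RtoC 1 else RtoC 0).
  assert (Hind1 : forall j, (exists y, P j y) -> ind j = RtoC 1).
  { intros j H. unfold ind. destruct (excluded_middle_informative _); auto; contradiction. }
  assert (Hind0 : forall j, ~ (exists y, P j y) -> ind j = RtoC 0).
  { intros j H. unfold ind. destruct (excluded_middle_informative _); auto; contradiction. }
  set (c := fun j => Cmult (ind j) (mu (shifted_bump r (p j)))).
  assert (Hc : forall j, c j <> RtoC 0 -> exists y, P j y).
  { intros j Hj. apply NNPP; intros C. apply Hj. unfold c. rewrite Hind0 by auto. ring. }
  assert (Huniq : forall j x, P j x -> x = p j).
  { intros j x Hx. apply NNPP; intros C. destruct (Hp j) as [A1 A2]. destruct Hx as [Hx1 Hx2].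
    assert (Hex' : exists y, P j y) by (exists x; split; auto).
    specialize (HU x (p j) Hx2 (A2 Hex') C). assert (Rabs (x - p j) < r) by (apply Rabs_def1; lra). lra. }
  assert (Hcells : cells r p). { split; auto. intros j; apply Hp. }
  assert (Hsep : forall i j, (exists y, P i y) -> (exists y, P j y) -> i <> j -> r <= Rabs (p i - p j)).
  { intros i j Hi Hj Hij. apply HU; try now apply Hp. intros C. destruct (Hp i) as [A _], (Hp j) as [B _].
    rewrite C in A. apply Hij.
    assert (IZR i < IZR j + 1) by nra. assert (IZR j < IZR i + 1) by nra.
    rewrite <- plus_IZR in *. apply lt_IZR in H. apply lt_IZR in H0. lia. }
  exists r, p, c. split; [|split; [|split]]; auto.
  - intros i j Hi Hj Hij. apply Hsep; auto.
  - intros j Hj. unfold c. rewrite Hind1 by auto. ring.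
  - intros f Hf. destruct (Cc_cells_finite r p f Hcells Hf) as [M HM].
    rewrite (Zs_finite _ M). 2: { intros j Hj. rewrite HM by auto. ring. }
    set (u := fun j x => Cmult (Cmult (ind j) (f (p j))) (shifted_bump r (p j) x)).
    assert (Hu : forall j, Cc (u j)).
    { intros j. apply Cc_scal, testfun_Cc, testfun_shifted_bump; auto. }
    assert (Hs : Cc (fun x => zsum M (fun j => u j x))) by now apply Cc_zsum.
    assert (Z : mu (fun x => Cminus (f x) (zsum M (fun j => u j x))) = RtoC 0).
    { apply measure_vanish_on_supp; auto. { now apply Cc_minus. }
      intros x Hx.
      destruct (archimed (x / r)) as [A1 A2]. set (j0 := (up (x / r) - 1)%Z).
      assert (Hj0 : IZR j0 * r <= x < (IZR j0 + 1) * r).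
      { assert (Eq : x = x / r * r) by (field; lra).
        unfold j0. rewrite minus_IZR. set (q := x / r) in *. rewrite Eq. split.
        - apply Rmult_le_compat_r; lra.
        - apply Rmult_lt_compat_r; lra. }
      assert (Px : P j0 x) by (split; auto).
      assert (Ex : x = p j0) by now apply Huniq.
      assert (Hother : forall j, j <> j0 -> u j x = RtoC 0).
      { intros j Hj. unfold u. destruct (classic (exists y, P j y)) as [Cy|Cy].
        - rewrite shifted_bump_out; auto; [ring|]. rewrite Ex. apply Hsep; auto. now exists x.
        - rewrite Hind0 by auto. ring. }
      assert (Hself : u j0 x = f x).
      { unfold u. rewrite Hind1 by (now exists x). rewrite <- Ex, shifted_bump_center. ring. }
      assert (Sum : zsum M (fun j => u j x) = f x).
      { destruct (Z_le_gt_dec (Z.abs j0) (Z.of_nat M)) as [L|L].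
        - clear -Hother Hself L. induction M as [|M IH].
          + cbn [zsum]. simpl in L. replace 0%Z with j0 by lia. exact Hself.
          + cbn [zsum]. destruct (Z.eq_dec (Z.abs j0) (Z.of_nat (S M))) as [E|E].
            * rewrite zsum_0. 2: { intros j Hj. apply Hother. lia. }
              destruct (Z_le_gt_dec 0 j0) as [L'|L'].
              -- replace (Z.of_nat (S M)) with j0 by lia. rewrite Hself, (Hother (- j0)%Z) by lia. ring.
              -- replace (- Z.of_nat (S M))%Z with j0 by lia. rewrite Hself, (Hother (Z.of_nat (S M))) by lia. ring.
            * rewrite IH by lia. rewrite !Hother by lia. ring.
        - rewrite zsum_0.
          + rewrite Ex. symmetry. apply HM. lia.
          + intros j Hj. apply Hother. lia. }
      rewrite Sum. ring. }
    rewrite measure_minus in Z by auto. rewrite measure_zsum in Z by auto.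
    transitivity (zsum M (fun j => mu (u j))).
    + transitivity (Cplus (Cminus (mu f) (zsum M (fun j => mu (u j)))) (zsum M (fun j => mu (u j)))); [ring|].
      rewrite Z. ring.
    + apply zsum_ext. intros j _. unfold u.
      rewrite measure_scal by (auto; apply testfun_Cc, testfun_shifted_bump; auto). unfold c. ring.
Qed.

(** An inequality of Peetre type: [|y|] is at most [(1 + |x|) * (1 + |y - x|)]. *)
Lemma pow_shift_le x y N m : (m <= N)%nat -> Rabs y ^ m <= (1 + Rabs x) ^ N * (2 ^ N * (1 + Rabs (y - x) ^ N)).
Proof.
  intros Hm. set (t := Rabs (y - x)). assert (Ht : 0 <= t) by apply Rabs_pos.
  assert (Hx : 0 <= Rabs x) by apply Rabs_pos.
  assert (Hy : Rabs y <= (1 + Rabs x) * (1 + t)).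
  { replace y with (x + (y - x)) by ring. eapply Rle_trans; [apply Rabs_triang|]. fold t.
    pose proof (Rmult_le_pos _ _ Hx Ht). lra. }
  apply Rle_trans with (((1 + Rabs x) * (1 + t)) ^ m). { apply pow_incr. split; auto. apply Rabs_pos. }
  apply Rle_trans with (((1 + Rabs x) * (1 + t)) ^ N). { apply Rle_pow; auto. pose proof (Rmult_le_pos _ _ Hx Ht). lra. }
  rewrite Rpow_mult_distr. apply Rmult_le_compat_l. { apply pow_le; lra. }
  assert (P2 : 0 < 2 ^ N) by (apply pow_lt; lra).
  destruct (Rle_dec t 1) as [L|L].
  - apply Rle_trans with (2 ^ N * 1). { rewrite Rmult_1_r. apply pow_incr; lra. }
    apply Rmult_le_compat_l; [lra|]. pose proof (pow_le t N Ht). lra.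
  - apply Rle_trans with ((2 * t) ^ N). { apply pow_incr; lra. }
    rewrite Rpow_mult_distr. apply Rmult_le_compat_l; lra.
Qed.

(** Translating a fixed bump by [x] multiplies each Schwartz seminorm by at most a constant times
    [(1 + |x|) ^ N]. *)
Lemma tempered_bump_growth mu T r : tempered_ext mu T -> 0 < r ->
  exists C N, 0 <= C /\ forall x, Cmod (mu (shifted_bump r x)) <= C * (1 + Rabs x) ^ N.
Proof.
  intros [L [[N [A HA]] E]] Hr.
  set (b0 := shifted_bump r 0).
  assert (Hb0 : testfun b0) by now apply testfun_shifted_bump.
  destruct (schwartz_bound b0 N (testfun_schwartz _ Hb0)) as [B [HB0 HB]].
  exists (Rabs A * (2 ^ N * (2 * B))), N.
  assert (P2 : 0 < 2 ^ N) by (apply pow_lt; lra).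
  split. { pose proof (Rabs_pos A). repeat apply Rmult_le_pos; lra. }
  intros x. rewrite <- E by now apply testfun_shifted_bump.
  assert (Px : 0 < (1 + Rabs x) ^ N) by (apply pow_lt; pose proof (Rabs_pos x); lra).
  set (D := (1 + Rabs x) ^ N * (2 ^ N * (2 * B))).
  assert (HD : 0 <= D) by (repeat apply Rmult_le_pos; lra).
  eapply Rle_trans; [apply (HA _ (testfun_schwartz _ (testfun_shifted_bump r x Hr)) D)|].
  - intros m k y Hm Hk.
    assert (Ec : cderiv (shifted_bump r x) k y = cderiv b0 k (y - x)).
    { unfold cderiv, b0. change (y - x) with (y + - x). f_equal.
      - rewrite <- (Derive_n_shift (fun t => fst (shifted_bump r 0 t)) (- x)). apply Derive_n_ext. intros t.
        unfold shifted_bump; simpl. f_equal; ring.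
      - rewrite <- (Derive_n_shift (fun t => snd (shifted_bump r 0 t)) (- x)). apply Derive_n_ext. intros t. reflexivity. }
    rewrite Ec. pose proof (HB 0%nat k (y - x) ltac:(lia) Hk) as B1. pose proof (HB N k (y - x) (Nat.le_refl _) Hk) as B2.
    simpl in B1. rewrite Rmult_1_l in B1.
    pose proof (pow_shift_le x y N m Hm) as Hp. set (w := Cmod (cderiv b0 k (y - x))) in *.
    assert (Hw : 0 <= w) by apply Cmod_ge_0.
    apply Rle_trans with ((1 + Rabs x) ^ N * (2 ^ N * (1 + Rabs (y - x) ^ N)) * w).
    { apply Rmult_le_compat_r; auto. }
    unfold D. rewrite !Rmult_assoc. apply Rmult_le_compat_l; [lra|]. apply Rmult_le_compat_l; [lra|]. lra.
  - apply Rle_trans with (Rabs A * D). { apply Rmult_le_compat_r; auto. apply Rle_abs. }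
    unfold D. apply Req_le. ring.
Qed.

(** * Discrete tempered measures *)

Definition zweight (j : Z) : R := / (1 + Rabs (IZR j)) ^ 2.

Lemma zweight_pos j : 0 < zweight j.
Proof. apply Rinv_0_lt_compat, pow_lt. pose proof (Rabs_pos (IZR j)). lra. Qed.

Lemma zweight_sum M : zsumR M zweight <= 3.
Proof.
  (* The deficit [2 / (M + 1)] makes the induction telescope, as each new pair is at most twice
     [/ (M + 1) - / (M + 2)]. *)
  assert (H : zsumR M zweight <= 3 - 2 / (INR M + 1)).
  { induction M as [|M IH].
    - simpl. unfold zweight. rewrite Rabs_R0. lra.
    - cbn [zsumR]. assert (E : zweight (- Z.of_nat (S M)) = zweight (Z.of_nat (S M))).
      { unfold zweight. now rewrite opp_IZR, Rabs_Ropp. }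
      rewrite E. unfold zweight at 2 3. rewrite <- INR_IZR_INZ, Rabs_pos_eq by apply pos_INR.
      rewrite S_INR. pose proof (pos_INR M) as P. set (x := INR M) in *.
      assert (A : / (1 + (x + 1)) ^ 2 <= / (x + 1) - / (x + 1 + 1)).
      { replace (/ (x + 1) - / (x + 1 + 1)) with (/ ((x + 1) * (x + 2))) by (field; lra).
        apply Rinv_le_contravar; nra. }
      unfold Rdiv in *. lra. }
  assert (0 <= 2 / (INR M + 1)). { pose proof (pos_INR M). apply Rle_mult_inv_pos; lra. }
  lra.
Qed.

(** Weaker than [cells], in order to include combs, whose offset need not lie in the cell of index
    0. *)
Definition spread (rho : R) (p : Z -> R) : Prop :=
  0 < rho /\ exists K, forall j, Rabs (p j - IZR j * rho) <= K.

Lemma cells_spread rho p : cells rho p -> spread rho p.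
Proof.
  intros [Hr Hp]. split; auto. exists rho. intros j. specialize (Hp j). apply Rabs_le; lra.
Qed.

Lemma spread_index rho p : spread rho p -> exists C, 0 < C /\ forall j, 1 + Rabs (IZR j) <= C * (1 + Rabs (p j)).
Proof.
  intros [Hr [K HK]]. assert (K0 : 0 <= K) by (eapply Rle_trans; [apply Rabs_pos|apply (HK 0%Z)]).
  assert (Hi : 0 < / rho) by now apply Rinv_0_lt_compat.
  exists (1 + (1 + K) * / rho). split; [nra|]. intros j. specialize (HK j).
  assert (A : Rabs (IZR j) * rho <= K + Rabs (p j)).
  { rewrite <- (Rabs_pos_eq rho) by lra. rewrite <- Rabs_mult.
    replace (IZR j * rho) with (- (p j - IZR j * rho) + p j) by ring.
    eapply Rle_trans; [apply Rabs_triang|]. rewrite Rabs_Ropp. lra. }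
  assert (B : Rabs (IZR j) <= (K + Rabs (p j)) * / rho).
  { apply Rmult_le_reg_r with rho; auto. rewrite Rmult_assoc, Rinv_l by lra. lra. }
  pose proof (Rabs_pos (p j)).
  assert (0 <= (K * Rabs (p j)) * / rho) by (apply Rmult_le_pos; [apply Rmult_le_pos; lra|lra]).
  replace ((1 + (1 + K) * / rho) * (1 + Rabs (p j))) with
    (1 + Rabs (p j) + (K + Rabs (p j)) * / rho + / rho + K * Rabs (p j) * / rho) by ring.
  lra.
Qed.

Lemma Cc_spread_finite rho p f : spread rho p -> Cc f -> exists M, forall j, (Z.of_nat M < Z.abs j)%Z -> f (p j) = RtoC 0.
Proof.
  intros Hp Hf. destruct (Cc_support f Hf) as [K [HK0 HK]].
  destruct (spread_index rho p Hp) as [C [HC H]].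
  destruct (exists_nat_gt (C * (1 + K))) as [M [_ HM]]. exists M. intros j Hj. apply HK.
  specialize (H j). apply Rnot_lt_le; intros L.
  assert (IZR (Z.of_nat M) < IZR (Z.abs j)) by now apply IZR_lt.
  rewrite <- INR_IZR_INZ, abs_IZR in H0. nra.
Qed.

Lemma summable_Cc rho p (c : Z -> CC) f : spread rho p -> Cc f -> summable (fun j => Cmult (c j) (f (p j))).
Proof.
  intros Hp Hf. destruct (Cc_spread_finite rho p f Hp Hf) as [M HM]. apply (summable_finite _ M).
  intros j Hj. rewrite HM by auto. ring.
Qed.

(** Also evaluated at rapidly decreasing functions, where the same series is the tempered extension
    ([tempered_ext_dmeas]). *)
Definition dmeas (p : Z -> R) (c : Z -> CC) : measure := fun f => Zs (fun j => Cmult (c j) (f (p j))).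

Lemma is_measure_dmeas rho p c : spread rho p -> is_measure (dmeas p c).
Proof.
  intros Hp. split.
  - intros a f g Hf Hg. unfold dmeas.
    rewrite <- Zs_scal by (apply (summable_Cc rho); auto).
    rewrite <- Zs_plus.
    + apply Zs_ext; intros; ring.
    + apply summable_scal, (summable_Cc rho); auto.
    + apply (summable_Cc rho); auto.
  - intros K. destruct (spread_index rho p Hp) as [C [HC H]].
    destruct (exists_nat_gt (C * (1 + Rabs K))) as [M [_ HM]].
    assert (Hfar : forall j, (Z.of_nat M < Z.abs j)%Z -> K < Rabs (p j)).
    { intros j Hj. specialize (H j). apply Rnot_le_lt; intros L. pose proof (Rle_abs K).
      assert (IZR (Z.of_nat M) < IZR (Z.abs j)) by now apply IZR_lt.
      rewrite <- INR_IZR_INZ, abs_IZR in H1. nra. }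
    exists (zsumR M (fun j => Cmod (c j))). intros f Hf HK B HB.
    unfold dmeas. rewrite (Zs_finite _ M).
    2: { intros j Hj. rewrite HK by auto. ring. }
    eapply Rle_trans; [apply zsum_Cmod|]. rewrite Rmult_comm, <- zsumR_scal. apply zsumR_le.
    intros j _. rewrite Cmod_mult, Rmult_comm. apply Rmult_le_compat_r; auto. apply Cmod_ge_0.
Qed.

Definition tame (p : Z -> R) (c : Z -> CC) : Prop :=
  exists A N, 0 <= A /\ forall j, Cmod (c j) <= A * (1 + Rabs (p j)) ^ N.

(** Decay without smoothness is all that the series require, and it survives multiplication by
    bounded factors such as indicators of progressions. *)
Definition rapid (f : R -> CC) : Prop :=
  forall m, exists B, 0 <= B /\ forall x, (1 + Rabs x) ^ m * Cmod (f x) <= B.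

(** [N] powers absorb the growth of the coefficients; the other two turn into the summable weight
    [zweight]. *)
Lemma rapid_dom rho p c A N : spread rho p -> (forall j, Cmod (c j) <= A * (1 + Rabs (p j)) ^ N) -> 0 <= A ->
  exists D, 0 <= D /\ forall f B, 0 <= B -> (forall x, (1 + Rabs x) ^ (N + 2) * Cmod (f x) <= B) ->
    forall j, Cmod (Cmult (c j) (f (p j))) <= D * B * zweight j.
Proof.
  intros Hp Hc HA. destruct (spread_index rho p Hp) as [C [HC H]].
  exists (A * C ^ 2). split. { apply Rmult_le_pos; auto. apply pow_le; lra. }
  intros f B HB0 HB j. specialize (HB (p j)). specialize (Hc j). specialize (H j).
  rewrite Cmod_mult, pow_add in *. set (y := 1 + Rabs (p j)) in *. set (x := 1 + Rabs (IZR j)) in *.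
  assert (Hy : 0 < y) by (unfold y; pose proof (Rabs_pos (p j)); lra).
  assert (Hx : 0 < x) by (unfold x; pose proof (Rabs_pos (IZR j)); lra).
  unfold zweight. fold x.
  assert (Hx2 : 0 < x ^ 2) by now apply pow_lt.
  apply Rmult_le_reg_r with (x ^ 2); auto.
  rewrite Rmult_assoc with (r3 := x ^ 2), Rmult_assoc with (r3 := x ^ 2), Rinv_l, Rmult_1_r by lra.
  assert (Hxy : x ^ 2 <= C ^ 2 * y ^ 2).
  { rewrite <- Rpow_mult_distr. apply pow_incr; lra. }
  pose proof (Cmod_ge_0 (f (p j))) as Hf0. pose proof (Cmod_ge_0 (c j)) as Hc0.
  apply Rle_trans with ((A * y ^ N) * (Cmod (f (p j)) * (C ^ 2 * y ^ 2))).
  - apply Rmult_le_compat; auto; [apply Rmult_le_pos; lra|]. apply Rmult_le_compat_l; lra.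
  - replace (A * y ^ N * (Cmod (f (p j)) * (C ^ 2 * y ^ 2))) with (A * C ^ 2 * (y ^ N * y ^ 2 * Cmod (f (p j)))) by ring.
    apply Rmult_le_compat_l; auto. apply Rmult_le_pos; auto. apply pow_le; lra.
Qed.

Lemma summable_zweight (u : Z -> CC) D : (forall j, Cmod (u j) <= D * zweight j) -> summable u.
Proof.
  intros H. apply (summable_dom _ (fun j => Rabs D * zweight j) (Rabs D * 3)).
  - intros M. rewrite zsumR_scal. apply Rmult_le_compat_l; [apply Rabs_pos|apply zweight_sum].
  - intros j. eapply Rle_trans; [apply H|]. apply Rmult_le_compat_r; [apply Rlt_le, zweight_pos|apply Rle_abs].
Qed.

Lemma Zs_zweight_bound (u : Z -> CC) D : 0 <= D -> (forall j, Cmod (u j) <= D * zweight j) -> Cmod (Zs u) <= D * 3.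
Proof.
  intros HD H. apply (Zs_bound u (fun j => D * zweight j)); auto.
  intros M. rewrite zsumR_scal. apply Rmult_le_compat_l; auto. apply zweight_sum.
Qed.

Lemma summable_rapid rho p c f : spread rho p -> tame p c -> rapid f -> summable (fun j => Cmult (c j) (f (p j))).
Proof.
  intros Hp [A [N [HA Hc]]] Hf. destruct (rapid_dom rho p c A N Hp Hc HA) as [D [HD H]].
  destruct (Hf (N + 2)%nat) as [B [HB0 HB]]. apply (summable_zweight _ (D * B)). apply H; auto.
Qed.

Lemma one_plus_pow_le t m : 0 <= t -> (1 + t) ^ m <= 2 ^ m * (1 + t ^ m).
Proof.
  intros Ht. pose proof (pow_le t m Ht). assert (0 < 2 ^ m) by (apply pow_lt; lra).
  destruct (Rle_dec t 1).
  - apply Rle_trans with (2 ^ m * 1). { rewrite Rmult_1_r. apply pow_incr; lra. } apply Rmult_le_compat_l; lra.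
  - apply Rle_trans with ((2 * t) ^ m). { apply pow_incr; lra. }
    rewrite Rpow_mult_distr. apply Rmult_le_compat_l; lra.
Qed.

Lemma rapid_of_moments f m B : (forall i x, (i <= m)%nat -> Rabs x ^ i * Cmod (f x) <= B) ->
  forall x, (1 + Rabs x) ^ m * Cmod (f x) <= 2 ^ m * (2 * B).
Proof.
  intros H x. pose proof (one_plus_pow_le (Rabs x) m (Rabs_pos x)) as A.
  pose proof (H 0%nat x ltac:(lia)) as H0. pose proof (H m x (Nat.le_refl _)) as H1. simpl in H0. rewrite Rmult_1_l in H0.
  pose proof (Cmod_ge_0 (f x)). assert (0 < 2 ^ m) by (apply pow_lt; lra).
  apply Rle_trans with (2 ^ m * (1 + Rabs x ^ m) * Cmod (f x)). { apply Rmult_le_compat_r; auto. }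
  rewrite Rmult_assoc. apply Rmult_le_compat_l; lra.
Qed.

Lemma rapid_schwartz f : schwartz f -> rapid f.
Proof.
  intros Hf m. destruct (schwartz_bound f m Hf) as [B [HB0 HB]].
  exists (2 ^ m * (2 * B)). split. { apply Rmult_le_pos; [apply pow_le|]; lra. }
  apply rapid_of_moments. intros i x Hi. specialize (HB i 0%nat x Hi ltac:(lia)). now rewrite cderiv_0 in HB.
Qed.

Lemma rapid_fourier f : testfun f -> rapid (fourier f).
Proof. intros H. apply rapid_schwartz, schwartz_fourier, H. Qed.

Lemma rapid_mult (a f : R -> CC) : (exists B, forall x, Cmod (a x) <= B) -> rapid f -> rapid (fun x => Cmult (a x) (f x)).
Proof.
  intros [B HB] Hf m. destruct (Hf m) as [D [HD0 HD]]. exists (Rabs B * D).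
  split. { apply Rmult_le_pos; auto. apply Rabs_pos. }
  intros x. rewrite Cmod_mult. specialize (HB x). specialize (HD x). pose proof (Rle_abs B).
  replace ((1 + Rabs x) ^ m * (Cmod (a x) * Cmod (f x))) with (Cmod (a x) * ((1 + Rabs x) ^ m * Cmod (f x))) by ring.
  apply Rmult_le_compat; auto; try lra; [apply Cmod_ge_0|].
  apply Rmult_le_pos; [apply pow_le; pose proof (Rabs_pos x); lra|apply Cmod_ge_0].
Qed.

Lemma tempered_ext_dmeas rho p c : spread rho p -> tame p c -> tempered_ext (dmeas p c) (dmeas p c).
Proof.
  intros Hp Hc. split; [|split]; auto.
  - intros a f g Hf Hg. unfold dmeas.
    assert (Sf : summable (fun j => Cmult (c j) (f (p j)))) by (apply (summable_rapid rho); auto using rapid_schwartz).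
    assert (Sg : summable (fun j => Cmult (c j) (g (p j)))) by (apply (summable_rapid rho); auto using rapid_schwartz).
    rewrite <- Zs_scal, <- Zs_plus; auto using summable_scal. apply Zs_ext; intros; ring.
  - destruct Hc as [A [N [HA Hc]]]. destruct (rapid_dom rho p c A N Hp Hc HA) as [D [HD H]].
    exists (N + 2)%nat, (D * (2 ^ (N + 2) * 2) * 3). intros f Hf B HB.
    assert (HB0 : 0 <= B).
    { eapply Rle_trans; [|apply (HB 0%nat 0%nat 0); lia]. apply Rmult_le_pos; [apply pow_le, Rabs_pos|apply Cmod_ge_0]. }
    assert (P2 : 0 < 2 ^ (N + 2)) by (apply pow_lt; lra).
    apply Rle_trans with (D * (2 ^ (N + 2) * (2 * B)) * 3).
    + apply Zs_zweight_bound. { repeat apply Rmult_le_pos; lra. }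
      apply H. { apply Rmult_le_pos; lra. }
      apply rapid_of_moments. intros i x Hi. specialize (HB i 0%nat x Hi ltac:(lia)). now rewrite cderiv_0 in HB.
    + apply Req_le. ring.
Qed.

(** * Poisson summation by Fejer kernels *)

Definition dirichlet (N : nat) (u : R) : R := zsumR N (fun m => cos (2 * PI * IZR m * u)).

(** The Fejer kernel without normalization: its integral over a period is [n], and the division by
    [n] takes place where it is used. *)
Fixpoint fejer (n : nat) (u : R) : R :=
  match n with O => 0 | S n' => fejer n' u + dirichlet n' u end.

Lemma dirichlet_S N u : dirichlet (S N) u = dirichlet N u + 2 * cos (2 * PI * INR (S N) * u).
Proof.
  unfold dirichlet. cbn [zsumR]. rewrite opp_IZR, <- INR_IZR_INZ.
  replace (2 * PI * - INR (S N) * u) with (- (2 * PI * INR (S N) * u)) by ring. rewrite cos_neg. ring.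
Qed.

Lemma dirichlet_sin N u : dirichlet N u * sin (PI * u) = sin ((2 * INR N + 1) * (PI * u)).
Proof.
  induction N as [|N IH].
  - unfold dirichlet. simpl. replace (2 * PI * 0 * u) with 0 by ring. rewrite cos_0. rewrite Rmult_1_l. f_equal; ring.
  - rewrite dirichlet_S, Rmult_plus_distr_r, IH. rewrite S_INR.
    set (t := PI * u). set (a := 2 * PI * (INR N + 1) * u).
    replace ((2 * INR N + 1) * t) with (a - t) by (unfold a, t; ring).
    replace ((2 * (INR N + 1) + 1) * t) with (a + t) by (unfold a, t; ring).
    rewrite sin_minus, sin_plus. ring.
Qed.

Lemma fejer_sin n u : fejer n u * sin (PI * u) ^ 2 = sin (INR n * (PI * u)) ^ 2.
Proof.
  induction n as [|n IH].
  - cbn [fejer]. replace (INR 0 * (PI * u)) with 0 by (simpl; ring). rewrite sin_0. ring.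
  - cbn [fejer]. rewrite Rmult_plus_distr_r, IH.
    replace (dirichlet n u * sin (PI * u) ^ 2) with (dirichlet n u * sin (PI * u) * sin (PI * u)) by ring.
    rewrite dirichlet_sin, S_INR. set (t := PI * u). set (a := INR n * t).
    replace ((2 * INR n + 1) * t) with (a + (a + t)) by (unfold a; ring).
    replace ((INR n + 1) * t) with (a + t) by (unfold a; ring).
    rewrite (sin_plus a (a + t)), !sin_plus, !cos_plus.
    pose proof (sin2_cos2 t) as A1. pose proof (sin2_cos2 a) as A2. unfold Rsqr in A1, A2.
    set (sa := sin a) in *. set (ca := cos a) in *. set (st := sin t) in *. set (ct := cos t) in *.
    assert (C1 : ct * ct = 1 - st * st) by lra.
    assert (C2 : sa * sa = 1 - ca * ca) by lra.
    replace ((sa * ct + ca * st) ^ 2) with ((sa * sa) * (ct * ct) + 2 * sa * ct * ca * st + ca * ca * (st * st)) by ring.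
    replace (sa ^ 2) with (sa * sa) by ring.
    replace ((sa * (ca * ct - sa * st) + ca * (sa * ct + ca * st)) * st) with
       (2 * sa * ct * ca * st - (sa * sa) * (st * st) + ca * ca * (st * st)) by ring.
    rewrite C1. ring.
Qed.

(** Where [sin (PI * u)] vanishes, [fejer_sin] gives no information, but there every cosine in the
    kernel equals 1. *)
Lemma fejer_pos n u : 0 <= fejer n u.
Proof.
  destruct (Req_dec (sin (PI * u)) 0) as [H|H].
  - assert (A : forall m, cos (2 * PI * INR m * u) = 1 /\ sin (2 * PI * INR m * u) = 0).
    { induction m as [|m [I1 I2]].
      - simpl. replace (2 * PI * 0 * u) with 0 by ring. rewrite cos_0, sin_0; auto.
      - rewrite S_INR. replace (2 * PI * (INR m + 1) * u) with (2 * PI * INR m * u + 2 * (PI * u)) by ring.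
        rewrite cos_plus, sin_plus, I1, I2, cos_2a_sin, sin_2a, H. split; ring. }
    assert (B : forall N, 0 <= dirichlet N u).
    { induction N as [|N IH].
      - unfold dirichlet; simpl. replace (2 * PI * 0 * u) with 0 by ring. rewrite cos_0; lra.
      - rewrite dirichlet_S. rewrite (proj1 (A (S N))). lra. }
    induction n as [|n IH]; simpl; [lra|]. specialize (B n); lra.
  - pose proof (fejer_sin n u) as E. assert (0 < sin (PI * u) ^ 2). { now apply pow2_gt_0. }
    pose proof (pow2_ge_0 (sin (INR n * (PI * u)))). rewrite <- E in H1.
    apply Rnot_lt_le; intros C. nra.
Qed.

Lemma dirichlet_cont N x : continuous (dirichlet N) x.
Proof.
  apply (ex_derive_continuous (V := R_NormedModule)). unfold dirichlet.
  induction N as [|N IH]; cbn [zsumR].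
  - auto_derive; auto.
  - apply (ex_derive_plus (V := R_NormedModule) (fun u => zsumR N (fun m => cos (2 * PI * IZR m * u)))); auto.
    auto_derive; auto.
Qed.

Lemma fejer_cont n x : continuous (fejer n) x.
Proof.
  induction n as [|n IH]; simpl; [apply continuous_const|].
  apply (continuous_plus (V := R_NormedModule) (fejer n) (dirichlet n)); auto. apply dirichlet_cont.
Qed.

Lemma fejer_integral n k : @eq R (RInt (fejer n) (IZR k - / 2) (IZR k + / 2)) (INR n).
Proof.
  assert (C : forall m : nat, (0 < m)%nat -> @eq R (RInt (fun u => cos (2 * PI * INR m * u)) (IZR k - / 2) (IZR k + / 2)) 0).
  { intros m Hm. assert (Hp : 0 < 2 * PI * INR m). { apply Rmult_lt_0_compat; [pose proof PI_RGT_0; lra|]. apply lt_0_INR; lia. }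
    apply (is_RInt_unique (V := R_CompleteNormedModule)).
    replace 0 with (minus (sin (2 * PI * INR m * (IZR k + / 2)) / (2 * PI * INR m)) (sin (2 * PI * INR m * (IZR k - / 2)) / (2 * PI * INR m))).
    - apply (is_RInt_derive (V := R_CompleteNormedModule) (fun u => sin (2 * PI * INR m * u) / (2 * PI * INR m))).
      + intros x _. assert (INR m <> 0) by (apply not_0_INR; lia).
        auto_derive; auto. field. repeat split; auto using PI_neq0.
      + intros x _. apply (ex_derive_continuous (V := R_NormedModule)). auto_derive; auto.
    - unfold minus, plus, opp; simpl.
      replace (2 * PI * INR m * (IZR k + / 2)) with (2 * PI * INR m * (IZR k - / 2) + 2 * INR m * PI) by field.
      rewrite sin_period. ring. }
  assert (D : forall N, @eq R (RInt (dirichlet N) (IZR k - / 2) (IZR k + / 2)) 1).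
  { induction N as [|N IH].
    - rewrite (RInt_extR _ (fun _ => 1)).
      + rewrite RInt_const. unfold scal; simpl; unfold mult; simpl. lra.
      + intros x. unfold dirichlet; simpl. replace (2 * PI * 0 * x) with 0 by ring. apply cos_0.
    - rewrite (RInt_extR _ (fun x => 1 * dirichlet N x + 2 * cos (2 * PI * INR (S N) * x))).
      + rewrite RInt_lin.
        * rewrite IH, C by lia. ring.
        * apply dirichlet_cont.
        * intros x. apply (ex_derive_continuous (V := R_NormedModule)). auto_derive; auto.
      + intros x. rewrite dirichlet_S. ring. }
  induction n as [|n IH].
  - rewrite (RInt_extR _ (fun _ => 0)) by reflexivity. rewrite RInt_const.
    unfold scal; simpl; unfold mult; simpl. ring.
  - rewrite (RInt_extR _ (fun x => 1 * fejer n x + 1 * dirichlet n x)) by (intros; simpl; ring).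
    rewrite RInt_lin by (apply fejer_cont || apply dirichlet_cont). rewrite IH, D, S_INR. ring.
Qed.

(** An approximate identity on one period: near [k] the continuity of [phi] acts, and at distance at
    least [d] the kernel is bounded by [/ sin (PI * d) ^ 2], which is negligible after division by
    [n]. *)
Lemma fejer_approx (phi : R -> R) B k : (forall x, continuous phi x) -> (forall x, Rabs (phi x) <= B) ->
  is_lim_seq (fun n => RInt (fun u => phi u * fejer (S n) u) (IZR k - / 2) (IZR k + / 2) / INR (S n)) (phi (IZR k)).
Proof.
  intros Hc HB. apply is_lim_seq_spec. intros eps.
  assert (He : 0 < eps / 2) by (destruct eps; simpl; lra).
  assert (HB0 : 0 <= B) by (eapply Rle_trans; [apply Rabs_pos|apply (HB 0)]).
  assert (Hloc := Hc (IZR k) _ (locally_ball (phi (IZR k)) (mkposreal _ He))).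
  destruct Hloc as [d0 Hd0].
  set (d := Rmin d0 (/ 2)). assert (Hd : 0 < d) by (unfold d; apply Rmin_case; [apply cond_pos|lra]).
  assert (Hd2 : d <= / 2) by apply Rmin_r. assert (Hdd : d <= d0) by apply Rmin_l.
  assert (Hs : 0 < sin (PI * d)). { apply sin_gt_0; pose proof PI_RGT_0; nra. }
  assert (Hs2 : 0 < sin (PI * d) ^ 2) by now apply pow_lt.
  set (Q := 2 * B / sin (PI * d) ^ 2). assert (HQ : 0 <= Q) by (apply Rle_mult_inv_pos; lra).
  destruct (exists_nat_gt (Q / (eps / 2))) as [N [HN0 HN]].
  exists N. intros n Hn.
  assert (Hn1 : 0 < INR (S n)) by (apply lt_0_INR; lia).
  assert (HNn : Q / (eps / 2) < INR (S n)). { eapply Rlt_trans; [apply HN|]. apply lt_INR; lia. }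
  set (a := IZR k - / 2) in *. set (b := IZR k + / 2) in *.
  assert (Cphi : forall x, continuous (fun u => phi u * fejer (S n) u) x).
  { intros x. apply (continuous_mult phi (fejer (S n))); auto. apply fejer_cont. }
  assert (E : RInt (fun u => phi u * fejer (S n) u) a b / INR (S n) - phi (IZR k) =
     RInt (fun u => 1 * (phi u * fejer (S n) u) + (- phi (IZR k)) * fejer (S n) u) a b / INR (S n)).
  { rewrite RInt_lin; auto. 2: apply fejer_cont. unfold a, b. rewrite fejer_integral. field; lra. }
  rewrite E. unfold Rdiv. rewrite Rabs_mult, (Rabs_pos_eq (/ _)) by (apply Rlt_le, Rinv_0_lt_compat; lra).
  assert (Bd : Rabs (RInt (fun u => 1 * (phi u * fejer (S n) u) + - phi (IZR k) * fejer (S n) u) a b) <= eps / 2 * INR (S n) + Q * 1).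
  { assert (Cg : forall x, continuous (fun u => 1 * (phi u * fejer (S n) u) + - phi (IZR k) * fejer (S n) u) x).
    { intros x. apply (continuous_plus (V := R_NormedModule) (fun u => 1 * (phi u * fejer (S n) u)) (fun u => - phi (IZR k) * fejer (S n) u)).
      - apply (continuous_scal_r (V := R_NormedModule)); auto.
      - apply (continuous_scal_r (V := R_NormedModule)), fejer_cont. }
    eapply Rle_trans; [apply abs_RInt_le; [unfold a, b; lra|apply continuous_ex_RInt, Cg]|].
    apply Rle_trans with (RInt (fun u => eps / 2 * fejer (S n) u + Q * 1) a b).
    - apply RInt_le; [unfold a, b; lra| | |].
      + apply continuous_ex_RInt. intros x. apply (continuous_comp _ Rabs); auto. apply continuous_Rabs.
      + apply continuous_ex_RInt. intros x. apply (continuous_plus (V := R_NormedModule) (fun u => eps / 2 * fejer (S n) u) (fun _ => Q * 1)).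
        * apply (continuous_scal_r (V := R_NormedModule)), fejer_cont. * apply continuous_const.
      + intros x Hx. replace (1 * (phi x * fejer (S n) x) + - phi (IZR k) * fejer (S n) x) with ((phi x - phi (IZR k)) * fejer (S n) x) by ring.
        rewrite Rabs_mult, (Rabs_pos_eq (fejer _ _)) by apply fejer_pos.
        pose proof (fejer_pos (S n) x) as Fp.
        destruct (Rlt_dec (Rabs (x - IZR k)) d) as [L|L].
        * assert (A : Rabs (phi x - phi (IZR k)) < eps / 2).
          { apply (Hd0 x). unfold ball; simpl; unfold AbsRing_ball, abs, minus, plus, opp; simpl. unfold Rminus in L. lra. }
          assert (Rabs (phi x - phi (IZR k)) * fejer (S n) x <= eps / 2 * fejer (S n) x) by (apply Rmult_le_compat_r; lra). lra.
        * assert (A : Rabs (phi x - phi (IZR k)) <= 2 * B).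
          { unfold Rminus. eapply Rle_trans; [apply Rabs_triang|]. rewrite Rabs_Ropp.
            pose proof (HB x). pose proof (HB (IZR k)). lra. }
          assert (F : fejer (S n) x * sin (PI * d) ^ 2 <= 1).
          { apply Rle_trans with (fejer (S n) x * sin (PI * x) ^ 2).
            - apply Rmult_le_compat_l; auto.
              assert (S1 : sin (PI * x) ^ 2 = sin (PI * Rabs (x - IZR k)) ^ 2).
              { assert (S2 : sin (PI * x) ^ 2 = sin (PI * (x - IZR k)) ^ 2).
                { pose proof (cexpi_2PI_IZR k) as Ek.
                  assert (c1 : cos (2 * (PI * x)) = cos (2 * (PI * (x - IZR k)))).
                  { replace (2 * (PI * x)) with (2 * (PI * (x - IZR k)) + 2 * PI * IZR k) by ring.
                    assert (Ec := f_equal fst Ek). assert (Es := f_equal snd Ek). simpl in Ec, Es.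
                    rewrite cos_plus, Ec, Es. ring. }
                  rewrite !cos_2a_sin in c1. lra. }
                rewrite S2. unfold Rabs. destruct (Rcase_abs (x - IZR k)); auto.
                replace (PI * - (x - IZR k)) with (- (PI * (x - IZR k))) by ring. rewrite sin_neg. ring. }
              rewrite S1. apply pow_incr. split; [lra|].
              assert (Rabs (x - IZR k) <= / 2) by (apply Rabs_le; unfold a, b in Hx; lra).
              pose proof PI_RGT_0. apply sin_incr_1; nra.
            - rewrite fejer_sin. pose proof (SIN_bound (INR (S n) * (PI * x))). nra. }
          assert (F' : fejer (S n) x <= / sin (PI * d) ^ 2).
          { apply Rmult_le_reg_r with (sin (PI * d) ^ 2); auto. rewrite Rinv_l by lra. exact F. }
          assert (Rabs (phi x - phi (IZR k)) * fejer (S n) x <= 2 * B * / sin (PI * d) ^ 2).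
          { apply Rmult_le_compat; auto. apply Rabs_pos. }
          unfold Q, Rdiv. assert (0 <= eps / 2 * fejer (S n) x) by (apply Rmult_le_pos; lra). lra.
    - rewrite (RInt_lin (fejer (S n)) (fun _ => 1)); [|apply fejer_cont|intros; apply continuous_const].
      unfold a, b. rewrite fejer_integral, RInt_const. unfold scal; simpl; unfold mult; simpl. apply Req_le. field. }
  apply Rle_lt_trans with ((eps / 2 * INR (S n) + Q * 1) * / INR (S n)).
  { apply Rmult_le_compat_r; auto. apply Rlt_le, Rinv_0_lt_compat; lra. }
  replace ((eps / 2 * INR (S n) + Q * 1) * / INR (S n)) with (eps / 2 + Q / INR (S n)) by (field; lra).
  assert (Q / INR (S n) < eps / 2); [|lra].
  apply Rmult_lt_reg_r with (INR (S n)); auto. replace (Q / INR (S n) * INR (S n)) with Q by (field; lra).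
  apply Rmult_lt_reg_r with (/ (eps / 2)). { apply Rinv_0_lt_compat; lra. }
  replace (eps / 2 * INR (S n) * / (eps / 2)) with (INR (S n)) by (field; lra). exact HNn.
Qed.

Lemma clim_of_components (u : nat -> CC) (v : CC) : is_lim_seq (fun n => fst (u n)) (fst v) -> is_lim_seq (fun n => snd (u n)) (snd v) -> clim u v.
Proof.
  intros L1 L2 eps He. apply is_lim_seq_spec in L1. apply is_lim_seq_spec in L2.
  destruct (L1 (mkposreal _ (Rmult_lt_0_compat _ _ He (Rinv_0_lt_compat 2 ltac:(lra))))) as [N1 H1].
  destruct (L2 (mkposreal _ (Rmult_lt_0_compat _ _ He (Rinv_0_lt_compat 2 ltac:(lra))))) as [N2 H2].
  exists (N1 + N2)%nat. intros n Hn. eapply Rle_lt_trans; [apply Cmod_le_sum|].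
  specialize (H1 n ltac:(lia)). specialize (H2 n ltac:(lia)). simpl in *. unfold Rminus in *. lra.
Qed.

Lemma is_lim_seq_zsumR M (u : Z -> nat -> R) (v : Z -> R) : (forall k, is_lim_seq (u k) (v k)) ->
  is_lim_seq (fun n => zsumR M (fun k => u k n)) (zsumR M v).
Proof.
  intros H. induction M as [|M IH]; cbn [zsumR]; auto.
  apply (is_lim_seq_plus' (fun n => zsumR M (fun k => u k n))); auto.
  apply (is_lim_seq_plus' (u _) (u _)); auto.
Qed.

Lemma fst_zsum M (u : Z -> CC) : fst (zsum M u) = zsumR M (fun j => fst (u j)).
Proof. induction M as [|M IH]; cbn [zsum zsumR]; auto. simpl. now rewrite IH. Qed.
Lemma snd_zsum M (u : Z -> CC) : snd (zsum M u) = zsumR M (fun j => snd (u j)).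
Proof. induction M as [|M IH]; cbn [zsum zsumR]; auto. simpl. now rewrite IH. Qed.

Lemma RInt_split_cells (g : R -> R) M : (forall x, continuous g x) ->
  @eq R (RInt g (- (INR M + / 2)) (INR M + / 2)) (zsumR M (fun k => RInt g (IZR k - / 2) (IZR k + / 2))).
Proof.
  intros Hc. assert (E : forall a b, ex_RInt g a b) by (intros; apply continuous_ex_RInt; auto).
  induction M as [|M IH].
  - simpl. f_equal; lra.
  - cbn [zsumR]. rewrite <- IH. rewrite opp_IZR, <- !INR_IZR_INZ, S_INR.
    rewrite <- (RInt_Chasles g (- (INR M + 1 + / 2)) (- (INR M + / 2)) (INR M + 1 + / 2)) by auto.
    rewrite <- (RInt_Chasles g (- (INR M + / 2)) (INR M + / 2) (INR M + 1 + / 2)) by auto.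
    replace (INR M + 1 - / 2) with (INR M + / 2) by field.
    replace (- (INR M + 1) - / 2) with (- (INR M + 1 + / 2)) by field.
    replace (- (INR M + 1) + / 2) with (- (INR M + / 2)) by field.
    unfold plus; simpl. ring.
Qed.

Definition partial_poisson (G : R -> CC) (N : nat) : CC := zsum N (fun m => fourier G (IZR m)).

Lemma partial_poisson_kernel G K N : Cc G -> 0 <= K -> (forall x, K <= Rabs x -> G x = RtoC 0) ->
  partial_poisson G N = (RInt (fun x => dirichlet N x * fre G x) (- K) K, RInt (fun x => dirichlet N x * fim G x) (- K) K).
Proof.
  intros Hf HK0 HK.
  assert (C1 : forall x, continuous (fre G) x) by (intros; now apply continuous_C, Cc_cont).
  assert (C2 : forall x, continuous (fim G) x) by (intros; now apply continuous_C, Cc_cont).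
  assert (CT : forall (h phi : R -> R) y, (forall t, ex_derive h t) -> (forall x, continuous phi x) -> forall v, continuous (fun x => h (- 2 * PI * x * y) * phi x) v).
  { intros h phi y Hh Hp v. apply (continuous_mult (fun x => h (-2 * PI * x * y)) phi); auto.
    apply (continuous_comp (fun x => -2 * PI * x * y) h).
    - apply (ex_derive_continuous (V := R_NormedModule)). auto_derive; auto.
    - apply (ex_derive_continuous (V := R_NormedModule)). auto. }
  assert (Ec : forall t, ex_derive cos t) by (intros; auto_derive; auto).
  assert (Es : forall t, ex_derive sin t) by (intros; auto_derive; auto).
  assert (CD : forall N phi, (forall x, continuous phi x) -> forall v, continuous (fun x => dirichlet N x * phi x) v).
  { intros n phi Hp v. apply (continuous_mult (dirichlet n) phi); auto. apply dirichlet_cont. }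
  (* In the terms of index [m] and [- m] the sines cancel and the cosines double, which is how the
     Dirichlet kernel builds up. *)
  assert (Pair : forall m, Cplus (fourier G (INR m)) (fourier G (- INR m)) =
     (2 * RInt (fun x => cos (- 2 * PI * x * INR m) * fre G x) (- K) K, 2 * RInt (fun x => cos (- 2 * PI * x * INR m) * fim G x) (- K) K)).
  { intros m. rewrite !(fourier_comps G _ K) by auto. ceq.
    - rewrite (RInt_extR (fun x => cos (-2 * PI * x * INR m) * fre G x - sin (-2 * PI * x * INR m) * fim G x)
        (fun x => 1 * (cos (-2 * PI * x * INR m) * fre G x) + (-1) * (sin (-2 * PI * x * INR m) * fim G x))) by (intros; ring).
      rewrite (RInt_extR (fun x => cos (-2 * PI * x * - INR m) * fre G x - sin (-2 * PI * x * - INR m) * fim G x)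
        (fun x => 1 * (cos (-2 * PI * x * INR m) * fre G x) + 1 * (sin (-2 * PI * x * INR m) * fim G x))).
      + rewrite !RInt_lin by (apply CT; auto). ring.
      + intros x. replace (-2 * PI * x * - INR m) with (- (-2 * PI * x * INR m)) by ring. rewrite cos_neg, sin_neg. ring.
    - rewrite (RInt_extR (fun x => cos (-2 * PI * x * INR m) * fim G x + sin (-2 * PI * x * INR m) * fre G x)
        (fun x => 1 * (cos (-2 * PI * x * INR m) * fim G x) + 1 * (sin (-2 * PI * x * INR m) * fre G x))) by (intros; ring).
      rewrite (RInt_extR (fun x => cos (-2 * PI * x * - INR m) * fim G x + sin (-2 * PI * x * - INR m) * fre G x)
        (fun x => 1 * (cos (-2 * PI * x * INR m) * fim G x) + (-1) * (sin (-2 * PI * x * INR m) * fre G x))).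
      + rewrite !RInt_lin by (apply CT; auto). ring.
      + intros x. replace (-2 * PI * x * - INR m) with (- (-2 * PI * x * INR m)) by ring. rewrite cos_neg, sin_neg. ring. }
  assert (Step : forall n phi, (forall x, continuous phi x) ->
    @eq R (RInt (fun x => dirichlet (S n) x * phi x) (- K) K)
     (RInt (fun x => dirichlet n x * phi x) (- K) K + 2 * RInt (fun x => cos (- 2 * PI * x * INR (S n)) * phi x) (- K) K)).
  { intros n phi Hp.
    rewrite (RInt_extR _ (fun x => 1 * (dirichlet n x * phi x) + 2 * (cos (- 2 * PI * x * INR (S n)) * phi x))).
    - rewrite RInt_lin; auto. ring.
    - intros x. rewrite dirichlet_S. replace (-2 * PI * x * INR (S n)) with (- (2 * PI * INR (S n) * x)) by ring.
      rewrite cos_neg. ring. }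
  unfold partial_poisson. induction N as [|N IH].
  - cbn [zsum]. rewrite (fourier_comps G _ K) by auto. f_equal; apply RInt_extR; intros x; unfold dirichlet; simpl;
    replace (2 * PI * 0 * x) with 0 by ring; replace (-2 * PI * x * 0) with 0 by ring; rewrite cos_0, sin_0; ring.
  - cbn [zsum]. rewrite IH, !Step by auto. rewrite opp_IZR, <- INR_IZR_INZ, Pair. reflexivity.
Qed.

Lemma csum_partial_poisson G K n : Cc G -> 0 <= K -> (forall x, K <= Rabs x -> G x = RtoC 0) ->
  csum n (partial_poisson G) = (RInt (fun x => fre G x * fejer n x) (- K) K, RInt (fun x => fim G x * fejer n x) (- K) K).
Proof.
  intros Hf HK0 HK.
  assert (C1 : forall x, continuous (fre G) x) by (intros; now apply continuous_C, Cc_cont).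
  assert (C2 : forall x, continuous (fim G) x) by (intros; now apply continuous_C, Cc_cont).
  assert (CD : forall N phi, (forall x, continuous phi x) -> forall v, continuous (fun x => dirichlet N x * phi x) v).
  { intros m phi Hp v. apply (continuous_mult (dirichlet m) phi); auto. apply dirichlet_cont. }
  assert (CF : forall N phi, (forall x, continuous phi x) -> forall v, continuous (fun x => phi x * fejer N x) v).
  { intros m phi Hp v. apply (continuous_mult phi (fejer m)); auto. apply fejer_cont. }
  induction n as [|n IH].
  - simpl. ceq.
    + symmetry. apply RInt_vanish. intros; ring.
    + symmetry. apply RInt_vanish. intros; ring.
  - cbn [csum]. rewrite IH, (partial_poisson_kernel G K n) by auto. ceq.
    + rewrite (RInt_extR (fun x => fre G x * (fejer n x + dirichlet n x)) (fun x => 1 * (fre G x * fejer n x) + 1 * (dirichlet n x * fre G x))) by (intros; ring).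
      rewrite RInt_lin by auto. ring.
    + rewrite (RInt_extR (fun x => fim G x * (fejer n x + dirichlet n x)) (fun x => 1 * (fim G x * fejer n x) + 1 * (dirichlet n x * fim G x))) by (intros; ring).
      rewrite RInt_lin by auto. ring.
Qed.

(** Averaged partial sums are integrals against Fejer kernels, so they converge for every continuous
    [G] of compact support. This version therefore also serves to prove summability
    ([poisson_summable_nonneg]). *)
Lemma poisson_cesaro G : Cc G ->
  clim (fun n => Cmult (RtoC (/ INR (S n))) (csum (S n) (partial_poisson G))) (Zs (fun k => G (IZR k))).
Proof.
  intros Hf. destruct (Cc_support G Hf) as [K0 [HK0 HK]]. destruct (Cc_bounded G Hf) as [B [HB0 HB]].
  destruct (exists_nat_gt K0) as [M [_ HM]]. set (K := INR M + / 2).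
  assert (HKp : 0 <= K) by (unfold K; lra).
  assert (HKv : forall x, K <= Rabs x -> G x = RtoC 0) by (intros; apply HK; unfold K in *; lra).
  rewrite (Zs_finite _ M).
  2: { intros j Hj. apply HKv. rewrite <- abs_IZR. assert (IZR (Z.of_nat (S M)) <= IZR (Z.abs j)) by (apply IZR_le; lia).
       rewrite <- INR_IZR_INZ, S_INR in H. unfold K. lra. }
  assert (Comp : forall phi : R -> R, (forall x, continuous phi x) -> (forall x, Rabs (phi x) <= B) ->
     is_lim_seq (fun n => / INR (S n) * RInt (fun x => phi x * fejer (S n) x) (- K) K) (zsumR M (fun k => phi (IZR k)))).
  { intros phi Hc Hb.
    apply is_lim_seq_ext with (fun n => zsumR M (fun k => RInt (fun u => phi u * fejer (S n) u) (IZR k - / 2) (IZR k + / 2) / INR (S n))).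
    - intros n. unfold K. rewrite RInt_split_cells.
      + rewrite <- zsumR_scal. apply zsumR_ext. intros; unfold Rdiv; ring.
      + intros x. apply (continuous_mult phi (fejer (S n))); auto. apply fejer_cont.
    - apply (is_lim_seq_zsumR M (fun k n => RInt (fun u => phi u * fejer (S n) u) (IZR k - / 2) (IZR k + / 2) / INR (S n)) (fun k => phi (IZR k))).
      intros k. apply (fejer_approx phi B k); auto. }
  apply clim_of_components.
  - rewrite fst_zsum. eapply is_lim_seq_ext; [|apply (Comp (fre G))].
    + intros n. rewrite (csum_partial_poisson G K) by auto. simpl. ring.
    + intros; now apply continuous_C, Cc_cont.
    + intros x. eapply Rle_trans; [apply Rabs_fst_le|apply HB].
  - rewrite snd_zsum. eapply is_lim_seq_ext; [|apply (Comp (fim G))].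
    + intros n. rewrite (csum_partial_poisson G K) by auto. simpl. ring.
    + intros; now apply continuous_C, Cc_cont.
    + intros x. eapply Rle_trans; [apply Rabs_snd_le|apply HB].
Qed.

Lemma csum_Cmod k u B : (forall i, (i < k)%nat -> Cmod (u i) <= B) -> Cmod (csum k u) <= INR k * B.
Proof.
  induction k as [|k IH]; intros H.
  - simpl. rewrite Cmod_0. lra.
  - cbn [csum]. eapply Rle_trans; [apply Cmod_triangle|]. rewrite S_INR.
    specialize (H k ltac:(lia)) as Hk. assert (Cmod (csum k u) <= INR k * B) by auto. lra.
Qed.

Lemma csum_add k l u : csum (k + l) u = Cplus (csum k u) (csum l (fun i => u (k + i)%nat)).
Proof.
  induction l as [|l IH].
  - rewrite Nat.add_0_r. simpl. ring.
  - rewrite Nat.add_succ_r. cbn [csum]. rewrite IH. ring.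
Qed.

Lemma csum_const k a : csum k (fun _ => a) = Cmult (RtoC (INR k)) a.
Proof.
  induction k as [|k IH]; [simpl; ring|]. cbn [csum]. rewrite IH, S_INR, RtoC_plus. ring.
Qed.

Lemma clim_cesaro u v : clim u v -> clim (fun n => Cmult (RtoC (/ INR (S n))) (csum (S n) u)) v.
Proof.
  intros H eps He. destruct (H (eps / 2) ltac:(lra)) as [N HN].
  set (w := fun i => Cminus (u i) v).
  destruct (exists_nat_gt (Cmod (csum N w) / (eps / 2))) as [N' [_ HN']].
  exists (N + N')%nat. intros n Hn.
  assert (Hp : 0 < INR (S n)) by (apply lt_0_INR; lia).
  assert (E : Cminus (Cmult (RtoC (/ INR (S n))) (csum (S n) u)) v = Cmult (RtoC (/ INR (S n))) (csum (S n) w)).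
  { unfold w, Cminus. rewrite csum_plus, csum_const, Cmult_plus_distr_l. f_equal.
    rewrite Cmult_assoc, <- RtoC_mult, Rinv_l by lra. ring. }
  rewrite E, Cmod_mult, Cmod_R, Rabs_pos_eq by (apply Rlt_le, Rinv_0_lt_compat; auto).
  replace (S n) with (N + (S n - N))%nat at 2 by lia. rewrite csum_add.
  assert (A : Cmod (csum (S n - N) (fun i => w (N + i)%nat)) <= INR (S n - N) * (eps / 2)).
  { apply csum_Cmod. intros i _. apply Rlt_le. apply HN. lia. }
  assert (A' : INR (S n - N) <= INR (S n)) by (apply le_INR; lia).
  assert (A'' : Cmod (csum N w) < eps / 2 * INR (S n)).
  { apply Rmult_lt_reg_r with (/ (eps / 2)). { apply Rinv_0_lt_compat; lra. }
    replace (eps / 2 * INR (S n) * / (eps / 2)) with (INR (S n)) by (field; lra).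
    eapply Rlt_le_trans; [apply HN'|]. apply le_INR; lia. }
  apply Rmult_lt_reg_l with (INR (S n)); auto. rewrite <- Rmult_assoc, Rinv_r, Rmult_1_l by lra.
  eapply Rle_lt_trans; [apply Cmod_triangle|]. nra.
Qed.

Lemma poisson_summation G : Cc G -> summable (fun m => fourier G (IZR m)) ->
  Zs (fun m => fourier G (IZR m)) = Zs (fun k => G (IZR k)).
Proof.
  intros HG Hs. eapply clim_unique; [|apply poisson_cesaro; auto].
  apply (clim_cesaro (partial_poisson G)). now apply Zs_correct.
Qed.

(** For nonnegative terms the partial sums increase. In the mean of [2 * (M + 1)] of them, the last
    half are at least the [M]-th one, which is therefore at most twice a bounded mean. *)
Lemma poisson_summable_nonneg G (a : Z -> R) : Cc G -> (forall m, 0 <= a m) ->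
  (forall m, fourier G (IZR m) = RtoC (a m)) -> exists B, forall M, zsumR M a <= B.
Proof.
  intros HG Ha E. destruct (poisson_cesaro G HG 1 Rlt_0_1) as [N HN].
  set (v := Zs (fun k => G (IZR k))) in *. exists (2 * (Cmod v + 1)). intros M0.
  set (M := (M0 + N)%nat). apply Rle_trans with (zsumR M a). { apply zsumR_mono; auto; unfold M; lia. }
  assert (P : forall n, partial_poisson G n = RtoC (zsumR n a)).
  { intros n. unfold partial_poisson. rewrite <- zsum_RtoC. apply zsum_ext; auto. }
  set (n := (2 * M + 1)%nat). specialize (HN n ltac:(unfold n, M; lia)).
  set (w := Cmult (RtoC (/ INR (S n))) (csum (S n) (partial_poisson G))) in *.
  assert (Hw : Cmod w <= Cmod v + 1). { pose proof (Cmod_le_minus w v). lra. }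
  assert (Hf : fst w = / INR (S n) * fst (csum (S n) (partial_poisson G))) by (unfold w; simpl; ring).
  assert (Mono : forall k, 0 <= fst (csum k (partial_poisson G)) /\
     forall l, (l * 1 <= k)%nat -> (forall i, (k - l <= i < k)%nat -> zsumR M a <= zsumR i a) -> INR l * zsumR M a <= fst (csum k (partial_poisson G))).
  { induction k as [|k [I1 I2]].
    - split; [simpl; lra|]. intros l Hl _. replace l with 0%nat by lia. simpl. lra.
    - cbn [csum]. rewrite P. simpl fst. split.
      + pose proof (zsumR_pos k a Ha). lra.
      + intros [|l] Hl Hi.
        * simpl INR. pose proof (zsumR_pos k a Ha). lra.
        * rewrite S_INR. assert (INR l * zsumR M a <= fst (csum k (partial_poisson G))).
          { apply I2; [lia|]. intros i Hik. apply Hi. lia. }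
          assert (zsumR M a <= zsumR k a) by (apply Hi; lia). lra. }
  destruct (Mono (S n)) as [_ Mn]. specialize (Mn (M + 1)%nat ltac:(unfold n; lia)).
  assert (Hb : INR (M + 1) * zsumR M a <= fst (csum (S n) (partial_poisson G))).
  { apply Mn. intros i Hi. apply zsumR_mono; auto. unfold n in Hi. lia. }
  assert (Hn : INR (S n) = 2 * INR (M + 1)).
  { unfold n. replace (S (2 * M + 1)) with (2 * (M + 1))%nat by lia. rewrite mult_INR. reflexivity. }
  assert (HM : 0 < INR (M + 1)) by (apply lt_0_INR; lia).
  assert (X : zsumR M a <= 2 * fst w).
  { rewrite Hf, Hn. apply Rmult_le_reg_l with (INR (M + 1)); auto.
    replace (INR (M + 1) * (2 * (/ (2 * INR (M + 1)) * fst (csum (S n) (partial_poisson G))))) with (fst (csum (S n) (partial_poisson G))) by (field; lra).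
    exact Hb. }
  pose proof (Rabs_fst_le w). pose proof (Rle_abs (fst w)). lra.
Qed.

(** * Modulated Dirac combs *)

Definition comb_pt (s alpha : R) (m : Z) : R := s + IZR m * alpha.
Definition comb_cf (r s alpha : R) (m : Z) : CC := cexpi (2 * PI * r * comb_pt s alpha m).
Definition comb (r s alpha : R) : measure := dmeas (comb_pt s alpha) (comb_cf r s alpha).

Lemma spread_comb s alpha : 0 < alpha -> spread alpha (comb_pt s alpha).
Proof.
  intros H. split; auto. exists (Rabs s). intros j. unfold comb_pt.
  replace (s + IZR j * alpha - IZR j * alpha) with s by ring. lra.
Qed.

Lemma tame_comb r s alpha : tame (comb_pt s alpha) (comb_cf r s alpha).
Proof.
  exists 1, 0%nat. split; [lra|]. intros j. unfold comb_cf. rewrite Cmod_cexpi. simpl. lra.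
Qed.

Lemma is_Zcomb_comb r s alpha : 0 < alpha -> is_Zcomb r s alpha (comb r s alpha).
Proof.
  intros Ha f Hf. apply clim_filterlim.
  eapply clim_ext_from with (N0 := 0%nat); [|apply Zs_correct, (summable_Cc alpha (comb_pt s alpha) (comb_cf r s alpha) f); auto; now apply spread_comb].
  intros n _. cbv beta. rewrite <- csum_zsum. apply csum_ext. intros i _. cbv zeta. unfold comb_cf, comb_pt.
  now rewrite minus_IZR, <- !INR_IZR_INZ.
Qed.

Lemma is_Zcomb_meq r s alpha Z : 0 < alpha -> is_Zcomb r s alpha Z -> meq Z (comb r s alpha).
Proof.
  intros Ha H f Hf. pose proof (H f Hf) as A. pose proof (is_Zcomb_comb r s alpha Ha f Hf) as B.
  apply clim_filterlim in A. apply clim_filterlim in B. apply (clim_unique _ _ _ A B).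
Qed.

(** Rescaling [f] to step 1 turns the offset [s] into a modulation and the modulation [r] into an
    offset; the phase is the price of interchanging them. Summability stands as a hypothesis so that
    the formula applies to convolutions of continuous functions as well as to test functions. *)
Lemma comb_poisson r s alpha f : 0 < alpha -> Cc f ->
  summable (fun m => Cmult (comb_cf r s alpha m) (fourier f (comb_pt s alpha m))) ->
  dmeas (comb_pt s alpha) (comb_cf r s alpha) (fourier f) =
  Cmult (Cmult (cexpi (2 * PI * r * s)) (RtoC (/ alpha))) (comb (- s) r (/ alpha) f).
Proof.
  intros Ha Hf Hs.
  assert (Hia : / alpha <> 0) by (apply Rinv_neq_0_compat; lra).
  assert (Hip : 0 < / alpha) by now apply Rinv_0_lt_compat.
  set (H := fun x => Cmult (cexpi (2 * PI * (- s) * x)) (f x)).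
  assert (HH : Cc H). { apply Cc_mult; auto. intros x. apply (continuous_cexpi (2 * PI * - s)). }
  set (G := fun u => H (/ alpha * u + r)).
  assert (HG : Cc G) by now apply Cc_affine.
  set (k := Cmult (RtoC alpha) (cexpi (- (2 * PI * r * s)))).
  assert (EG : forall m, fourier G (IZR m) = Cmult k (Cmult (comb_cf r s alpha m) (fourier f (comb_pt s alpha m)))).
  { intros m. unfold G. rewrite fourier_affine by auto. rewrite Rabs_pos_eq, Rinv_inv by lra.
    unfold H. rewrite fourier_mod. replace (IZR m / / alpha - - s) with (comb_pt s alpha m) by (unfold comb_pt; field; lra).
    unfold k, comb_cf. rewrite Cmult_assoc, Cmult_assoc. f_equal.
    rewrite <- Cmult_assoc. f_equal. rewrite <- cexpi_plus. f_equal. unfold comb_pt. field; lra. }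
  assert (HGs : summable (fun m => fourier G (IZR m))).
  { replace (fun m => fourier G (IZR m)) with (fun m => Cmult k (Cmult (comb_cf r s alpha m) (fourier f (comb_pt s alpha m)))).
    - now apply summable_scal. - apply functional_extensionality; intros; now rewrite EG. }
  pose proof (poisson_summation G HG HGs) as P.
  rewrite (Zs_ext _ _ EG), Zs_scal in P by auto.
  assert (E2 : Zs (fun j => G (IZR j)) = comb (- s) r (/ alpha) f).
  { apply Zs_ext. intros j. unfold G, H, comb_cf. replace (/ alpha * IZR j + r) with (comb_pt r (/ alpha) j) by (unfold comb_pt; ring). reflexivity. }
  rewrite E2 in P. rewrite <- P. unfold dmeas, k.
  transitivity (Cmult (Cmult (RtoC (/ alpha)) (RtoC alpha)) (Cmult (Cmult (cexpi (- (2 * PI * r * s))) (cexpi (2 * PI * r * s))) (Zs (fun m => Cmult (comb_cf r s alpha m) (fourier f (comb_pt s alpha m)))))).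
  - rewrite cexpi_opp_l, <- RtoC_mult, Rinv_l by lra. ring.
  - ring.
Qed.

Definition comb_phase (r s alpha : R) : CC := Cmult (cexpi (2 * PI * r * s)) (RtoC (/ alpha)).

Lemma FT_comb r s alpha : 0 < alpha ->
  FT_meas (comb r s alpha) (mscale (comb_phase r s alpha) (comb (- s) r (/ alpha))).
Proof.
  intros Ha. pose proof (Rinv_0_lt_compat _ Ha) as Hi.
  split; [|split].
  - apply (is_measure_dmeas alpha), spread_comb; auto.
  - apply (is_measure_meq (fun f => Cplus (Cmult (comb_phase r s alpha) (comb (- s) r (/ alpha) f)) ((fun _ => RtoC 0) f))).
    + intros f _. unfold mscale. ring.
    + apply is_measure_lin; [apply (is_measure_dmeas (/ alpha)), spread_comb; auto|apply FT_meas_0].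
  - exists (comb r s alpha). split.
    + apply (tempered_ext_dmeas alpha); [now apply spread_comb|apply tame_comb].
    + intros f Hf. unfold mscale, comb_phase. symmetry. apply comb_poisson; auto using testfun_Cc.
      apply (summable_rapid alpha); auto using rapid_fourier, tame_comb, spread_comb.
Qed.

Lemma meq_refl mu : meq mu mu.
Proof. intros f _; auto. Qed.
Lemma meq_sym mu nu : meq mu nu -> meq nu mu.
Proof. intros H f Hf. symmetry; auto. Qed.
Lemma meq_trans mu nu rho : meq mu nu -> meq nu rho -> meq mu rho.
Proof. intros H1 H2 f Hf. rewrite H1; auto. Qed.

(* The orbit of a comb under the Fourier transform: [Z], [comb_F1], [comb_F2], [comb_F3], back to [Z]. *)
Definition comb_F1 (r s alpha : R) : measure := mscale (comb_phase r s alpha) (comb (- s) r (/ alpha)).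
Definition comb_F2 (r s alpha : R) : measure := comb (- r) (- s) alpha.
Definition comb_F3 (r s alpha : R) : measure := mscale (comb_phase r s alpha) (comb s (- r) (/ alpha)).

(** The pair [(r, s)] becomes [(- s, r)] and [alpha] its inverse, so the phase of the second
    transform is inverse to that of the first. *)
Lemma FT_comb_F1 r s alpha : 0 < alpha -> FT_meas (comb_F1 r s alpha) (comb_F2 r s alpha).
Proof.
  intros Ha. pose proof (Rinv_0_lt_compat _ Ha) as Hi.
  eapply FT_meas_meq; [apply meq_refl| |apply FT_meas_scal, (FT_comb (- s) r (/ alpha)); auto].
  intros f _. unfold mscale, comb_phase, comb_F2. rewrite Rinv_inv.
  replace (2 * PI * - s * r) with (- (2 * PI * r * s)) by ring.
  transitivity (Cmult (Cmult (RtoC (/ alpha)) (RtoC alpha)) (Cmult (Cmult (cexpi (- (2 * PI * r * s))) (cexpi (2 * PI * r * s))) (comb (- r) (- s) alpha f))).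
  - ring.
  - rewrite cexpi_opp_l, <- RtoC_mult, Rinv_l by lra. ring.
Qed.

Lemma FT_comb_F2 r s alpha : 0 < alpha -> FT_meas (comb_F2 r s alpha) (comb_F3 r s alpha).
Proof.
  intros Ha. eapply FT_meas_meq; [apply meq_refl| |apply (FT_comb (- r) (- s) alpha); auto].
  intros f _. unfold comb_F3, mscale, comb_phase. rewrite Ropp_involutive.
  now replace (2 * PI * - r * - s) with (2 * PI * r * s) by ring.
Qed.

Lemma FT_comb_F3 r s alpha : 0 < alpha -> FT_meas (comb_F3 r s alpha) (comb r s alpha).
Proof.
  intros Ha. pose proof (FT_comb_F1 (- r) (- s) alpha Ha) as H.
  unfold comb_F1, comb_F2 in H. rewrite !Ropp_involutive in H.
  eapply FT_meas_meq; [|apply meq_refl|apply H].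
  intros f _. unfold comb_F3, mscale, comb_phase.
  now replace (2 * PI * - r * - s) with (2 * PI * r * s) by ring.
Qed.

(** Symmetric partial sums are invariant under reversing the index. Hence [comb_F2] is the
    reflection of the original comb. *)
Lemma comb_reflect r s alpha f : 0 < alpha -> Cc f -> comb (- r) (- s) alpha f = comb r s alpha (fun x => f (- x)).
Proof.
  intros Ha Hf.
  assert (Hs := spread_comb (- s) alpha Ha). unfold comb, dmeas.
  apply Zs_of_clim.
  eapply clim_ext_from with (N0 := 0%nat).
  2: apply Zs_correct, (summable_Cc alpha (comb_pt s alpha) (comb_cf r s alpha) (fun x => f (- x))).
  - intros n _. cbv beta.
    assert (R : forall u, zsum n (fun j => u (- j)%Z) = zsum n u).
    { intros u. induction n as [|n IH]; cbn [zsum]; auto. rewrite IH, Z.opp_involutive. ring. }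
    rewrite <- R. apply zsum_ext. intros j _. unfold comb_cf, comb_pt. rewrite opp_IZR. f_equal; f_equal; ring.
  - now apply spread_comb.
  - now apply Cc_reflect.
Qed.

(** * Self-dual discrete measures: windows *)

(* [sum_j c_j delta_{p_j}] has Fourier transform [kap sum_j c_j delta_{sig p_j}]. *)
Definition selfdual (rho : R) (p : Z -> R) (c : Z -> CC) (sig : R) (kap : CC) : Prop :=
  cells rho p /\ separated rho p c /\ tame p c /\ sig * sig = 1 /\ kap <> RtoC 0 /\
  forall f, testfun f -> dmeas p c (fourier f) = Cmult kap (Zs (fun j => Cmult (c j) (f (sig * p j)))).

Lemma zsum_single M (u : Z -> CC) l : (Z.abs l <= Z.of_nat M)%Z -> (forall j, j <> l -> u j = RtoC 0) -> zsum M u = u l.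
Proof.
  intros L H. induction M as [|M IH]; cbn [zsum].
  - simpl in L. replace l with 0%Z by lia. reflexivity.
  - destruct (Z.eq_dec (Z.abs l) (Z.of_nat (S M))) as [E|E].
    + rewrite zsum_0. 2: { intros j Hj. apply H. lia. }
      assert (Hl0 : l <> 0%Z) by lia.
      destruct (Z_le_gt_dec 0 l) as [L'|L'].
      * replace (Z.of_nat (S M)) with l by lia. rewrite (H (- l)%Z) by lia. ring.
      * replace (- Z.of_nat (S M))%Z with l by lia. rewrite (H (Z.of_nat (S M))) by lia. ring.
    + rewrite IH, (H (Z.of_nat (S M))), (H (- Z.of_nat (S M))%Z) by lia. ring.
Qed.

Lemma Zs_single (u : Z -> CC) l : (forall j, j <> l -> u j = RtoC 0) -> Zs u = u l.
Proof.
  intros H. rewrite (Zs_finite u (Z.to_nat (Z.abs l))).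
  - apply zsum_single; auto. lia.
  - intros j Hj. apply H. lia.
Qed.

Lemma zsumR_shift1 M (g : Z -> R) :
  zsumR M (fun j => g (j + 1)%Z) = zsumR M g - g (- Z.of_nat M)%Z + g (Z.of_nat M + 1)%Z.
Proof.
  induction M as [|M IH]; [simpl; ring|]. cbn [zsumR]. rewrite IH.
  replace (- Z.of_nat (S M) + 1)%Z with (- Z.of_nat M)%Z by lia.
  replace (Z.of_nat M + 1)%Z with (Z.of_nat (S M)) by lia. ring.
Qed.

Lemma zsumR_opp M (g : Z -> R) : zsumR M (fun j => g (- j)%Z) = zsumR M g.
Proof. induction M as [|M IH]; cbn [zsumR]; auto. rewrite IH, Z.opp_involutive. ring. Qed.

(** A shift by one keeps the symmetric sum of order [M] below the one of order [S M]; negative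
    shifts follow by reflection. *)
Lemma zsumR_shift_le (g : Z -> R) B : (forall j, 0 <= g j) -> (forall M, zsumR M g <= B) ->
  forall k M, zsumR M (fun j => g (j + k)%Z) <= B.
Proof.
  assert (N : forall (k : nat) (g : Z -> R), (forall j, 0 <= g j) -> (forall M, zsumR M g <= B) -> forall M, zsumR M (fun j => g (j + Z.of_nat k)%Z) <= B).
  { induction k as [|k IH]; intros h Hh HB M.
    - rewrite (zsumR_ext _ _ h); auto. intros; f_equal; lia.
    - rewrite (zsumR_ext _ _ (fun j => (fun i => h (i + 1)%Z) (j + Z.of_nat k)%Z)).
      2: { intros; cbv beta; f_equal; lia. }
      apply (IH (fun i => h (i + 1)%Z)); auto. intros M'. rewrite zsumR_shift1.
      specialize (HB (S M')). cbn [zsumR] in HB. replace (Z.of_nat M' + 1)%Z with (Z.of_nat (S M')) by lia.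
      pose proof (Hh (- Z.of_nat M')%Z). pose proof (Hh (- Z.of_nat (S M'))%Z). lra. }
  intros Hg HB k M. destruct (Z_le_gt_dec 0 k) as [L|L].
  - rewrite <- (Z2Nat.id k) by lia. apply N; auto.
  - rewrite <- zsumR_opp. rewrite (zsumR_ext _ _ (fun j => (fun i => g (- i)%Z) (j + Z.of_nat (Z.to_nat (- k)))%Z)).
    2: { intros; cbv beta; f_equal; lia. }
    apply (N _ (fun i => g (- i)%Z)); auto. intros M'. now rewrite zsumR_opp.
Qed.

Lemma floor_cell rho z : 0 < rho -> exists k : Z, IZR k * rho <= z < (IZR k + 1) * rho.
Proof.
  intros Hr. destruct (archimed (z / rho)) as [A1 A2]. exists (up (z / rho) - 1)%Z.
  assert (Eq : z = z / rho * rho) by (field; lra). rewrite minus_IZR. set (q := z / rho) in *. rewrite Eq. split.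
  - apply Rmult_le_compat_r; lra.
  - apply Rmult_lt_compat_r; lra.
Qed.

(** The point is that [C] does not depend on the centre [z]: after moving the index to the cell of
    [z], distances to [z] dominate index differences up to a factor. *)
Lemma cells_weight_sum rho p : cells rho p -> exists C, 0 < C /\ forall z, exists g : Z -> R,
  (forall j, 0 <= g j) /\ (forall M, zsumR M g <= C) /\ forall j, / (1 + Rabs (p j - z)) ^ 2 <= g j.
Proof.
  intros [Hr Hp]. set (D := 2 + / rho). assert (Hi : 0 < / rho) by now apply Rinv_0_lt_compat.
  assert (HD : 0 < D) by (unfold D; lra). assert (HD2 : 0 < D ^ 2) by now apply pow_lt.
  exists (D ^ 2 * 3). split; [lra|]. intros z. destruct (floor_cell rho z Hr) as [k Hk].
  exists (fun j => D ^ 2 * zweight (j + - k)). split; [|split].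
  - intros j. apply Rmult_le_pos; [lra|apply Rlt_le, zweight_pos].
  - intros M. rewrite (zsumR_scal M (D ^ 2) (fun j => zweight (j + - k))). apply Rmult_le_compat_l; [lra|].
    apply (zsumR_shift_le zweight 3); [intros; apply Rlt_le, zweight_pos|apply zweight_sum].
  - intros j. specialize (Hp j). unfold zweight. set (y := 1 + Rabs (p j - z)). set (x := 1 + Rabs (IZR (j + - k))).
    assert (Hy : 0 < y) by (unfold y; pose proof (Rabs_pos (p j - z)); lra).
    assert (Hx : 0 < x) by (unfold x; pose proof (Rabs_pos (IZR (j + - k))); lra).
    assert (Hxy : x <= D * y).
    { unfold x, y, D. rewrite plus_IZR, opp_IZR.
      assert (A : Rabs (IZR j + - IZR k) * rho <= Rabs (p j - z) + rho).
      { rewrite <- (Rabs_pos_eq rho) at 1 by lra. rewrite <- Rabs_mult.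
        replace ((IZR j + - IZR k) * rho) with ((p j - z) + (((IZR j + - IZR k) * rho) - (p j - z))) by ring.
        eapply Rle_trans; [apply Rabs_triang|]. apply Rplus_le_compat_l, Rabs_le. lra. }
      assert (B : Rabs (IZR j + - IZR k) <= (Rabs (p j - z) + rho) * / rho).
      { apply Rmult_le_reg_r with rho; auto. rewrite Rmult_assoc, Rinv_l by lra. lra. }
      rewrite Rmult_plus_distr_r, Rinv_r in B by lra. pose proof (Rabs_pos (p j - z)). nra. }
    assert (H2 : x ^ 2 <= D ^ 2 * y ^ 2). { rewrite <- Rpow_mult_distr. apply pow_incr; lra. }
    assert (Hx2 : 0 < x ^ 2) by now apply pow_lt. assert (Hy2 : 0 < y ^ 2) by now apply pow_lt.
    apply Rmult_le_reg_r with (x ^ 2 * y ^ 2); [now apply Rmult_lt_0_compat|].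
    replace (/ y ^ 2 * (x ^ 2 * y ^ 2)) with (x ^ 2) by (field; lra).
    replace (D ^ 2 * / x ^ 2 * (x ^ 2 * y ^ 2)) with (D ^ 2 * y ^ 2) by (field; lra). exact H2.
Qed.

Lemma cells_inj rho p i j : cells rho p -> p i = p j -> i = j.
Proof.
  intros [Hr Hp] E. pose proof (Hp i) as A. pose proof (Hp j) as B. rewrite E in A.
  assert (IZR i < IZR j + 1) by nra. assert (IZR j < IZR i + 1) by nra.
  rewrite <- plus_IZR in *. apply lt_IZR in H. apply lt_IZR in H0. lia.
Qed.

(** * Coefficients as a function of position, and the windows that detect them *)

Definition val (p : Z -> R) (c : Z -> CC) (u : R) : CC :=
  match excluded_middle_informative (exists j, p j = u) with
  | left H => c (proj1_sig (constructive_indefinite_description _ H))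
  | right _ => RtoC 0
  end.

Lemma val_p rho p c j : cells rho p -> val p c (p j) = c j.
Proof.
  intros Hp. unfold val. destruct (excluded_middle_informative _) as [H|H].
  - destruct (constructive_indefinite_description _ H) as [i Hi]. simpl. f_equal. now apply (cells_inj rho p).
  - exfalso. apply H. now exists j.
Qed.

Lemma val_nonzero p c u : val p c u <> RtoC 0 -> exists j, p j = u /\ c j <> RtoC 0.
Proof.
  unfold val. destruct (excluded_middle_informative _) as [H|H]; [|congruence].
  destruct (constructive_indefinite_description _ H) as [i Hi]. simpl. intros; exists i; auto.
Qed.

Lemma val_bound p c u A : 0 <= A -> (forall j, Cmod (c j) <= A) -> Cmod (val p c u) <= A.
Proof.
  intros HA Hc. unfold val. destruct (excluded_middle_informative _); auto. rewrite Cmod_0; auto.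
Qed.

Definition bump_sum (p : Z -> R) (c : Z -> CC) (eps u : R) : CC :=
  Zs (fun j => Cmult (c j) (shifted_bump eps u (p j))).

(** Since [eps <= rho / 2], two points with nonzero coefficients cannot both lie within [eps] of
    [u]. *)
Lemma bump_sum_cases rho p c eps u : cells rho p -> separated rho p c -> 0 < eps -> eps <= rho / 2 ->
  bump_sum p c eps u = RtoC 0 \/
  exists l, c l <> RtoC 0 /\ Rabs (p l - u) < eps /\ bump_sum p c eps u = Cmult (c l) (shifted_bump eps u (p l)).
Proof.
  intros Hp Hs He He2.
  destruct (classic (exists l, c l <> RtoC 0 /\ Rabs (p l - u) < eps)) as [[l [Hl1 Hl2]]|C].
  - right. exists l. split; [|split]; auto. apply (Zs_single (fun j => Cmult (c j) (shifted_bump eps u (p j)))).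
    intros j Hj. destruct (classic (c j = RtoC 0)) as [E|E]; [rewrite E; ring|].
    rewrite shifted_bump_out; auto; [ring|]. specialize (Hs j l E Hl1 Hj).
    replace (p j - p l) with ((p j - u) - (p l - u)) in Hs by ring.
    pose proof (Rabs_triang (p j - u) (- (p l - u))) as T. rewrite Rabs_Ropp in T. unfold Rminus in *. lra.
  - left. apply Zs_0. intros j. destruct (classic (c j = RtoC 0)) as [E|E]; [rewrite E; ring|].
    rewrite shifted_bump_out; auto; [ring|]. apply Rnot_lt_le. intros L. apply C. now exists j.
Qed.

Lemma Cmod_shifted_bump eps u x : Cmod (shifted_bump eps u x) <= 1.
Proof. unfold shifted_bump. rewrite Cmod_R. pose proof (bump_bounds (/ eps * x + - (/ eps * u))). rewrite Rabs_pos_eq; lra. Qed.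

Lemma bump_sum_bound rho p c eps u A : cells rho p -> separated rho p c -> 0 < eps -> eps <= rho / 2 ->
  0 <= A -> (forall j, Cmod (c j) <= A) -> Cmod (bump_sum p c eps u) <= A.
Proof.
  intros Hp Hs He He2 HA Hc. destruct (bump_sum_cases rho p c eps u Hp Hs He He2) as [E|[l [_ [_ E]]]]; rewrite E.
  - rewrite Cmod_0; auto.
  - rewrite Cmod_mult. pose proof (Cmod_shifted_bump eps u (p l)). specialize (Hc l).
    pose proof (Cmod_ge_0 (c l)). pose proof (Cmod_ge_0 (shifted_bump eps u (p l))). nra.
Qed.

Lemma bump_sum_val rho p c eps u : cells rho p -> separated rho p c -> 0 < eps -> eps <= rho / 2 ->
  (forall j, c j <> RtoC 0 -> Rabs (p j - u) < eps -> p j = u) -> bump_sum p c eps u = val p c u.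
Proof.
  intros Hp Hs He He2 H. destruct (bump_sum_cases rho p c eps u Hp Hs He He2) as [E|[l [Hl1 [Hl2 E]]]]; rewrite E.
  - apply NNPP. intros C. assert (C' : val p c u <> RtoC 0) by congruence.
    destruct (val_nonzero p c u C') as [j [Hj1 Hj2]].
    assert (E' : bump_sum p c eps u = c j).
    { unfold bump_sum. rewrite (Zs_single _ j).
      - rewrite Hj1, shifted_bump_center. ring.
      - intros i Hi. destruct (classic (c i = RtoC 0)) as [Ei|Ei]; [rewrite Ei; ring|].
        rewrite shifted_bump_out; auto; [ring|]. rewrite <- Hj1. specialize (Hs i j Ei Hj2 Hi). lra. }
    congruence.
  - assert (E1 : p l = u) by auto. rewrite <- E1, shifted_bump_center, (val_p rho) by auto. ring.
Qed.

(** At most one point with nonzero coefficient lies within [rho / 2] of [u]; if it is not [u]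
    itself, its distance to [u] is the threshold. *)
Lemma bump_sum_eventually rho p c u : cells rho p -> separated rho p c ->
  exists e0, 0 < e0 /\ forall eps, 0 < eps -> eps <= e0 -> bump_sum p c eps u = val p c u.
Proof.
  intros Hp Hs. assert (Hr : 0 < rho) by apply Hp.
  destruct (classic (exists l, c l <> RtoC 0 /\ Rabs (p l - u) < rho / 2 /\ p l <> u)) as [[l [Hl1 [Hl2 Hl3]]]|C].
  - exists (Rabs (p l - u)). split. { apply Rabs_pos_lt. lra. }
    intros eps He He'. apply (bump_sum_val rho); auto; try lra.
    intros j Hj Hju. destruct (Z.eq_dec j l) as [->|Hn]; [lra|]. exfalso.
    specialize (Hs j l Hj Hl1 Hn). replace (p j - p l) with ((p j - u) - (p l - u)) in Hs by ring.
    pose proof (Rabs_triang (p j - u) (- (p l - u))) as T. rewrite Rabs_Ropp in T. unfold Rminus in *. lra.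
  - exists (rho / 2). split; [lra|]. intros eps He He'. apply (bump_sum_val rho); auto.
    intros j Hj Hju. apply NNPP. intros Hn. apply C. exists j. repeat split; auto; lra.
Qed.

(* The Fourier transform of a bump of width [eps] at [sig u], up to a phase. *)
Definition window (sig eps : R) (y : R) : CC :=
  Cmult (RtoC eps) (fourier (fun x => RtoC (bump x)) (eps * sig * y)).

(** The factor [sig] undoes the reflection on the spectral side, so that the bump detects [p j] near
    [u]; the modulation recentres the transform at [z]. *)
Definition win_fun (sig eps u z : R) (v : R) : CC := Cmult (cexpi (2 * PI * z * v)) (shifted_bump eps u (sig * v)).

Lemma testfun_win_fun sig eps u z : sig * sig = 1 -> 0 < eps -> testfun (win_fun sig eps u z).
Proof.
  intros Hs He. apply testfun_mult; [apply (smooth_cexpi (2 * PI * z))|].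
  assert (sig <> 0) by (intros E; rewrite E in Hs; lra).
  replace (fun x => shifted_bump eps u (sig * x)) with (fun x => shifted_bump eps u (sig * x + 0)).
  - apply (testfun_affine (shifted_bump eps u)); auto. now apply testfun_shifted_bump.
  - apply functional_extensionality; intros; f_equal; ring.
Qed.

Lemma fourier_win_fun sig eps u z y : sig * sig = 1 -> 0 < eps ->
  fourier (win_fun sig eps u z) y = Cmult (cexpi (- (2 * PI * sig * u * (y - z)))) (window sig eps (y - z)).
Proof.
  intros Hs He. unfold win_fun. rewrite fourier_mod. unfold shifted_bump.
  assert (H0 : sig <> 0) by (intros E; rewrite E in Hs; lra).
  replace (fun x => RtoC (bump (/ eps * (sig * x) + - (/ eps * u)))) with (fun x => (fun t => RtoC (bump t)) (/ eps * sig * x + - (/ eps * u))).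
  2: { apply functional_extensionality; intros; cbv beta; do 2 f_equal; ring. }
  assert (Ha : / eps * sig <> 0). { apply Rmult_integral_contrapositive. split; auto. apply Rinv_neq_0_compat; lra. }
  rewrite (fourier_affine (fun t => RtoC (bump t)) (/ eps * sig) (- (/ eps * u))) by (auto; apply testfun_Cc, testfun_bump).
  assert (Es : Rabs sig = 1).
  { assert (Rabs sig * Rabs sig = 1) by (rewrite <- Rabs_mult, Hs; apply Rabs_R1). pose proof (Rabs_pos sig). nra. }
  rewrite Rabs_mult, Es, Rmult_1_r, Rabs_pos_eq, Rinv_inv by (apply Rlt_le, Rinv_0_lt_compat; auto).
  assert (Eq : (y - z) / (/ eps * sig) = eps * sig * (y - z)).
  { apply Rmult_eq_reg_r with (/ eps * sig); auto. unfold Rdiv.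
    rewrite Rmult_assoc, Rinv_l, Rmult_1_r by auto.
    replace (eps * sig * (y - z) * (/ eps * sig)) with ((eps * / eps) * (sig * sig) * (y - z)) by ring. rewrite Hs, Rinv_r by lra. ring. }
  rewrite Eq. unfold window.
  replace (2 * PI * - (/ eps * u) * (eps * sig * (y - z))) with (- (2 * PI * sig * u * (y - z)) * (/ eps * eps)) by ring.
  rewrite Rinv_l, Rmult_1_r by lra. ring.
Qed.

Lemma rapid_window sig eps : sig * sig = 1 -> 0 < eps -> rapid (window sig eps).
Proof.
  intros Hs He.
  pose proof (rapid_fourier _ (testfun_win_fun sig eps 0 0 Hs He)) as H.
  replace (window sig eps) with (fourier (win_fun sig eps 0 0)); auto.
  apply functional_extensionality; intros y. rewrite fourier_win_fun by auto.
  replace (- (2 * PI * sig * 0 * (y - 0))) with 0 by ring. rewrite cexpi_0, Rminus_0_r. ring.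
Qed.

(** Relates a local sum at [u] to a sum concentrated near [z]. Moving [z] changes the local side
    only by unimodular factors, and moving [u] changes the other side only by phases. *)
Lemma window_identity rho p c sig kap eps u z : selfdual rho p c sig kap -> 0 < eps ->
  Zs (fun j => Cmult (c j) (Cmult (cexpi (- (2 * PI * sig * u * (p j - z)))) (window sig eps (p j - z)))) =
  Cmult kap (Zs (fun j => Cmult (c j) (Cmult (cexpi (2 * PI * z * (sig * p j))) (shifted_bump eps u (p j))))).
Proof.
  intros [Hp [Hs [Ht [Hsig [Hk Hid]]]]] He.
  specialize (Hid _ (testfun_win_fun sig eps u z Hsig He)). unfold dmeas in Hid.
  transitivity (Zs (fun j => Cmult (c j) (fourier (win_fun sig eps u z) (p j)))).
  - apply Zs_ext. intros j. now rewrite fourier_win_fun.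
  - rewrite Hid. f_equal. apply Zs_ext. intros j. unfold win_fun.
    replace (sig * (sig * p j)) with (p j); auto. rewrite <- Rmult_assoc, Hsig. ring.
Qed.

Lemma window_identity0 rho p c sig kap eps u : selfdual rho p c sig kap -> 0 < eps ->
  Zs (fun j => Cmult (c j) (Cmult (cexpi (- (2 * PI * sig * u * p j))) (window sig eps (p j)))) = Cmult kap (bump_sum p c eps u).
Proof.
  intros H He. pose proof (window_identity rho p c sig kap eps u 0 H He) as E.
  transitivity (Zs (fun j => Cmult (c j) (Cmult (cexpi (- (2 * PI * sig * u * (p j - 0)))) (window sig eps (p j - 0))))).
  - apply Zs_ext. intros j. now rewrite Rminus_0_r.
  - rewrite E. f_equal. apply Zs_ext. intros j. replace (2 * PI * 0 * (sig * p j)) with 0 by ring. rewrite cexpi_0. ring.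
Qed.

Lemma Cmod_pos (z : CC) : z <> RtoC 0 -> 0 < Cmod z.
Proof. apply Cmod_gt_0. Qed.

(** For [eps = rho / 2] and [u = p l] the local side of the window identity is exactly [c l]; the
    other side is bounded independently of [l], because [u] enters it through a phase only. *)
Lemma selfdual_bounded rho p c sig kap : selfdual rho p c sig kap -> exists A, 0 <= A /\ forall j, Cmod (c j) <= A.
Proof.
  intros H. assert (H' := H). destruct H' as [Hp [Hs [Ht [Hsig [Hk Hid]]]]].
  assert (Hr : 0 < rho) by apply Hp. assert (He : 0 < rho / 2) by lra.
  destruct Ht as [A [N [HA Hc]]].
  destruct (rapid_dom rho p c A N (cells_spread _ _ Hp) Hc HA) as [D [HD Hdom]].
  destruct (rapid_window sig (rho / 2) Hsig He (N + 2)%nat) as [B [HB0 HB]].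
  pose proof (Cmod_pos kap Hk) as Hkp.
  exists (/ Cmod kap * (D * B * 3)). split.
  { apply Rmult_le_pos; [apply Rlt_le, Rinv_0_lt_compat; auto|]. repeat apply Rmult_le_pos; lra. }
  intros l. destruct (classic (c l = RtoC 0)) as [E|E].
  { rewrite E, Cmod_0. apply Rmult_le_pos; [apply Rlt_le, Rinv_0_lt_compat; auto|]. repeat apply Rmult_le_pos; lra. }
  pose proof (window_identity0 rho p c sig kap (rho / 2) (p l) H He) as W.
  rewrite (bump_sum_val rho), (val_p rho) in W; auto; try lra.
  2: { intros j Hj Hjl. destruct (Z.eq_dec j l) as [->|Hn]; auto. specialize (Hs j l Hj E Hn). lra. }
  apply Rmult_le_reg_l with (Cmod kap); auto. rewrite <- Cmod_mult, <- W, <- Rmult_assoc, Rinv_r, Rmult_1_l by lra.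
  apply Zs_zweight_bound. { apply Rmult_le_pos; lra. }
  intros j. specialize (Hdom _ B HB0 HB j). rewrite !Cmod_mult, Cmod_cexpi, Rmult_1_l in *. exact Hdom.
Qed.

(** If no point with nonzero coefficient were within [R0] of [z], a window centred at [z] would see
    only distant points, and any common bound of the coefficients could be halved. Iteration would
    make them all 0. *)
Lemma selfdual_relatively_dense rho p c sig kap : selfdual rho p c sig kap -> (exists j, c j <> RtoC 0) ->
  exists R0, 0 < R0 /\ forall z, exists j, c j <> RtoC 0 /\ Rabs (p j - z) <= R0.
Proof.
  intros H [j0 Hj0]. assert (H' := H). destruct H' as [Hp [Hs [Ht [Hsig [Hk Hid]]]]].
  assert (Hr : 0 < rho) by apply Hp. assert (He : 0 < rho / 2) by lra.
  destruct (selfdual_bounded _ _ _ _ _ H) as [A0 [HA0 HcA0]].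
  destruct (cells_weight_sum rho p Hp) as [C [HC Hw]].
  (* Of the three powers of decay, two are needed for summation and the third gains the factor
     [/ R0]. *)
  destruct (rapid_window sig (rho / 2) Hsig He 3%nat) as [B [HB0 HB]].
  pose proof (Cmod_pos kap Hk) as Hkp.
  (* Chosen so that [B * C / R0] is at most half of [Cmod kap], which is the halving. *)
  set (R0 := 2 * (B * C) / Cmod kap + 1).
  assert (HBC : 0 <= B * C) by (apply Rmult_le_pos; lra).
  assert (HR0 : 1 <= R0). { unfold R0. assert (0 <= 2 * (B * C) / Cmod kap) by (apply Rle_mult_inv_pos; lra). lra. }
  exists R0. split; [lra|]. intros z. apply NNPP. intros Hole.
  assert (Hfar : forall j, c j <> RtoC 0 -> R0 < Rabs (p j - z)).
  { intros j Hj. apply Rnot_le_lt. intros L. apply Hole. now exists j. }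
  destruct (Hw z) as [g [Hg0 [HgC Hgj]]].
  assert (Half : forall A, 0 <= A -> (forall j, Cmod (c j) <= A) -> forall l, Cmod (c l) <= A / 2).
  { intros A HA HcA l. destruct (classic (c l = RtoC 0)) as [E|E]. { rewrite E, Cmod_0. lra. }
    pose proof (window_identity rho p c sig kap (rho / 2) (p l) z H He) as W.
    rewrite (Zs_single (fun j => Cmult (c j) (Cmult (cexpi (2 * PI * z * (sig * p j))) (shifted_bump (rho / 2) (p l) (p j)))) l) in W.
    2: { intros j Hj. destruct (classic (c j = RtoC 0)) as [Ej|Ej]; [rewrite Ej; ring|].
         rewrite shifted_bump_out; auto; [ring|]. specialize (Hs j l Ej E Hj). lra. }
    rewrite shifted_bump_center, Cmult_1_r in W.
    apply Rmult_le_reg_l with (Cmod kap); auto.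
    replace (Cmod kap * Cmod (c l)) with (Cmod (Cmult kap (Cmult (c l) (cexpi (2 * PI * z * (sig * p l)))))) by (rewrite !Cmod_mult, Cmod_cexpi; ring).
    rewrite <- W.
    apply Rle_trans with (A * (B / R0) * C).
    - apply (Zs_bound _ (fun j => A * (B / R0) * g j)).
      + intros M. rewrite zsumR_scal. apply Rmult_le_compat_l; auto. apply Rmult_le_pos; auto. apply Rle_mult_inv_pos; lra.
      + intros j. rewrite !Cmod_mult, Cmod_cexpi, Rmult_1_l.
        assert (HBR : 0 <= B / R0) by (apply Rle_mult_inv_pos; lra).
        destruct (classic (c j = RtoC 0)) as [Ej|Ej].
        { rewrite Ej, Cmod_0, Rmult_0_l. apply Rmult_le_pos; auto. now apply Rmult_le_pos. }
        rewrite Rmult_assoc. apply Rmult_le_compat; auto; try apply Cmod_ge_0.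
        specialize (HB (p j - z)). specialize (Hgj j). specialize (Hfar j Ej).
        set (y := Rabs (p j - z)) in *. set (k := Cmod (window sig (rho / 2) (p j - z))) in *.
        assert (Hk0 : 0 <= k) by apply Cmod_ge_0.
        apply Rle_trans with (B / R0 * / (1 + y) ^ 2); [|now apply Rmult_le_compat_l].
        assert (Hy2 : 0 < (1 + y) ^ 2) by (apply pow_lt; lra).
        apply Rmult_le_reg_r with (R0 * (1 + y) ^ 2); [apply Rmult_lt_0_compat; lra|].
        replace (B / R0 * / (1 + y) ^ 2 * (R0 * (1 + y) ^ 2)) with B by (field; split; lra).
        apply Rle_trans with ((1 + y) ^ 3 * k); auto.
        replace (k * (R0 * (1 + y) ^ 2)) with (R0 * ((1 + y) ^ 2 * k)) by ring.
        replace ((1 + y) ^ 3 * k) with ((1 + y) * ((1 + y) ^ 2 * k)) by ring.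
        apply Rmult_le_compat_r; [apply Rmult_le_pos; lra|lra].
    - replace (A * (B / R0) * C) with (A * (B * C / R0)) by (field; lra).
      replace (Cmod kap * (A / 2)) with (A * (Cmod kap / 2)) by field. apply Rmult_le_compat_l; auto.
      apply Rmult_le_reg_r with R0; [lra|]. replace (B * C / R0 * R0) with (B * C) by (field; lra).
      unfold R0. replace (Cmod kap / 2 * (2 * (B * C) / Cmod kap + 1)) with (B * C + Cmod kap / 2) by (field; lra). lra. }
  assert (Iter : forall n : nat, forall l, Cmod (c l) <= A0 / 2 ^ n).
  { induction n as [|n IH]; intros l.
    - simpl. rewrite Rdiv_1_r. auto.
    - assert (P2 : 0 < 2 ^ n) by (apply pow_lt; lra).
      replace (A0 / 2 ^ S n) with ((A0 / 2 ^ n) / 2) by (simpl; field; lra). apply Half; auto.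
      apply Rle_mult_inv_pos; lra. }
  pose proof (Cmod_pos _ Hj0) as Hpos.
  destruct (exists_nat_gt (A0 / Cmod (c j0))) as [n [_ Hn]].
  specialize (Iter n j0). assert (P2 : 0 < 2 ^ n) by (apply pow_lt; lra).
  assert (Hn2 : INR n < 2 ^ n).
  { clear. induction n as [|n IH]; [simpl; lra|]. rewrite S_INR. simpl. assert (1 <= 2 ^ n) by (apply pow_R1_Rle; lra). lra. }
  assert (A0 < 2 ^ n * Cmod (c j0)).
  { apply Rmult_lt_reg_r with (/ Cmod (c j0)). { now apply Rinv_0_lt_compat. }
    replace (2 ^ n * Cmod (c j0) * / Cmod (c j0)) with (2 ^ n) by (field; lra). unfold Rdiv in Hn. lra. }
  apply (Rmult_le_compat_l (2 ^ n)) in Iter; [|lra].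
  replace (2 ^ n * (A0 / 2 ^ n)) with A0 in Iter by (field; lra). lra.
Qed.

(** * A spectral gap forces positive density *)

(** The series is the value at frequency [t] of the transform of the measure with masses
    [b j * psi (p j)] at [p j]; the weight [psi] makes it converge absolutely. *)
Definition gap_at (p : Z -> R) (b : Z -> CC) (psi : R -> CC) (t : R) : Prop :=
  Zs (fun j => Cmult (b j) (Cmult (psi (p j)) (cexpi (- (2 * PI * p j * t))))) = RtoC 0.

Definition gap_on (p : Z -> R) (b : Z -> CC) (psi : R -> CC) (t0 w : R) : Prop :=
  rapid psi /\ forall t, Rabs (t - t0) < w -> gap_at p b psi t.

Lemma tame_bounded p b A : 0 <= A -> (forall j, Cmod (b j) <= A) -> tame p b.
Proof. intros HA H. exists A, 0%nat. split; auto. intros j. simpl. rewrite Rmult_1_r. auto. Qed.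

Lemma summable_gap rho p b psi t : cells rho p -> tame p b -> rapid psi ->
  summable (fun j => Cmult (b j) (Cmult (psi (p j)) (cexpi (- (2 * PI * p j * t))))).
Proof.
  intros Hp Hb Hr. apply (summable_le _ (fun j => Cmult (b j) (psi (p j)))).
  - apply (summable_rapid rho); auto. now apply cells_spread.
  - intros j. rewrite !Cmod_mult, Cmod_cexpi. lra.
Qed.

(** Multiplying the weight by a character of frequency [eta] translates the spectrum by [eta]. *)
Lemma gap_at_trig rho p b psi t eta al be : cells rho p -> tame p b -> rapid psi ->
  gap_at p b psi (t - eta) -> gap_at p b psi (t + eta) ->
  gap_at p b (fun x => Cmult (psi x) (Cplus (Cmult al (cexpi (2 * PI * eta * x))) (Cmult be (cexpi (- (2 * PI * eta * x)))))) t.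
Proof.
  intros Hp Hb Hr H1 H2. unfold gap_at in *.
  pose proof (summable_gap rho p b psi (t - eta) Hp Hb Hr) as S1.
  pose proof (summable_gap rho p b psi (t + eta) Hp Hb Hr) as S2.
  transitivity (Cplus (Cmult al (Zs (fun j => Cmult (b j) (Cmult (psi (p j)) (cexpi (- (2 * PI * p j * (t - eta))))))))
                      (Cmult be (Zs (fun j => Cmult (b j) (Cmult (psi (p j)) (cexpi (- (2 * PI * p j * (t + eta))))))))).
  - rewrite <- !Zs_scal, <- Zs_plus by (auto using summable_scal). apply Zs_ext. intros j.
    replace (- (2 * PI * p j * (t - eta))) with (- (2 * PI * p j * t) + 2 * PI * eta * p j) by ring.
    replace (- (2 * PI * p j * (t + eta))) with (- (2 * PI * p j * t) + - (2 * PI * eta * p j)) by ring.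
    rewrite !cexpi_plus. ring.
  - rewrite H1, H2. ring.
Qed.

Lemma rapid_le psi phi : rapid psi -> (forall x, Cmod (phi x) <= Cmod (psi x)) -> rapid phi.
Proof.
  intros H L m. destruct (H m) as [B [HB0 HB]]. exists B. split; auto. intros x.
  eapply Rle_trans; [|apply (HB x)]. apply Rmult_le_compat_l; auto. apply pow_le. pose proof (Rabs_pos x); lra.
Qed.

Lemma rapid_RtoC_mult (a : R -> R) psi B : (forall x, Rabs (a x) <= B) -> rapid psi -> rapid (fun x => Cmult (psi x) (RtoC (a x))).
Proof.
  intros Ha H. apply (rapid_le (fun x => Cmult (RtoC B) (psi x))).
  - apply (rapid_mult (fun _ => RtoC B)); auto. exists (Cmod (RtoC B)). intros; lra.
  - intros x. rewrite !Cmod_mult, !Cmod_R, Rmult_comm. apply Rmult_le_compat_r; [apply Cmod_ge_0|].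
    eapply Rle_trans; [apply Ha|apply Rle_abs].
Qed.

Lemma rapid_linear u0 psi : rapid psi -> rapid (fun x => Cmult (psi x) (RtoC (x - u0))).
Proof.
  intros H m. destruct (H (S m)) as [B [HB0 HB]]. exists ((1 + Rabs u0) * B).
  pose proof (Rabs_pos u0) as Hu. split; [nra|]. intros x. specialize (HB x).
  rewrite Cmod_mult, Cmod_R. pose proof (Rabs_pos x) as Hx.
  assert (A : Rabs (x - u0) <= (1 + Rabs u0) * (1 + Rabs x)).
  { unfold Rminus. eapply Rle_trans; [apply Rabs_triang|]. rewrite Rabs_Ropp. nra. }
  set (k := (1 + Rabs x) ^ m * Cmod (psi x)).
  assert (Hk : 0 <= k) by (apply Rmult_le_pos; [apply pow_le; lra|apply Cmod_ge_0]).
  replace ((1 + Rabs x) ^ m * (Cmod (psi x) * Rabs (x - u0))) with (k * Rabs (x - u0)) by (unfold k; ring).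
  apply Rle_trans with (k * ((1 + Rabs u0) * (1 + Rabs x))). { now apply Rmult_le_compat_l. }
  replace (k * ((1 + Rabs u0) * (1 + Rabs x))) with ((1 + Rabs u0) * ((1 + Rabs x) ^ S m * Cmod (psi x))) by (unfold k; simpl; ring).
  apply Rmult_le_compat_l; lra.
Qed.

Lemma gap_at_limit rho p b (psin : nat -> R -> CC) psi Psi t : cells rho p -> tame p b -> rapid Psi ->
  (forall n x, Cmod (psin n x) <= Cmod (Psi x)) -> (forall x, clim (fun n => psin n x) (psi x)) ->
  (exists N, forall n, (N <= n)%nat -> gap_at p b (psin n) t) -> gap_at p b psi t.
Proof.
  intros Hp Hb HP Hd Hl [N HN]. unfold gap_at in *.
  destruct (summable_gap rho p b Psi t Hp Hb HP) as [B HB].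
  eapply clim_unique; [|apply clim_const].
  apply (clim_ext_from (fun n => Zs (fun j => Cmult (b j) (Cmult (psin n (p j)) (cexpi (- (2 * PI * p j * t)))))) _ _ N).
  - exact HN.
  - eapply Zs_dominated; [exact HB| |].
    + intros n j. cbv beta. rewrite !Cmod_mult, Cmod_cexpi. apply Rmult_le_compat_l; [apply Cmod_ge_0|].
      apply Rmult_le_compat_r; [lra|auto].
    + intros j. apply clim_scal.
      eapply clim_ext_from with (N0 := 0%nat) (u := fun n => Cmult (cexpi (- (2 * PI * p j * t))) (psin n (p j))).
      * intros; ring.
      * replace (Cmult (psi (p j)) (cexpi (- (2 * PI * p j * t)))) with (Cmult (cexpi (- (2 * PI * p j * t))) (psi (p j))) by ring.
        apply clim_scal; auto.
Qed.

Lemma gap_on_scal rho p b psi t0 w (a : CC) : cells rho p -> tame p b -> gap_on p b psi t0 w ->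
  gap_on p b (fun x => Cmult a (psi x)) t0 w.
Proof.
  intros Hp Hb [H1 H2]. split.
  - apply (rapid_mult (fun _ => a)); auto. exists (Cmod a). intros; lra.
  - intros t Ht. unfold gap_at. specialize (H2 t Ht). unfold gap_at in H2.
    transitivity (Cmult a (RtoC 0)); [|ring]. rewrite <- H2, <- Zs_scal by now apply (summable_gap rho).
    apply Zs_ext. intros; ring.
Qed.

Lemma gap_on_cos_sin rho p b psi t0 w eta u0 : cells rho p -> tame p b -> 0 <= eta -> gap_on p b psi t0 w ->
  gap_on p b (fun x => Cmult (psi x) (RtoC (cos (2 * PI * eta * (x - u0))))) t0 (w - eta) /\
  gap_on p b (fun x => Cmult (psi x) (RtoC (sin (2 * PI * eta * (x - u0))))) t0 (w - eta).
Proof.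
  intros Hp Hb He [H1 H2].
  set (c := cos (2 * PI * eta * u0)). set (s := sin (2 * PI * eta * u0)).
  assert (G : forall t al be, Rabs (t - t0) < w - eta ->
    gap_at p b (fun x => Cmult (psi x) (Cplus (Cmult al (cexpi (2 * PI * eta * x))) (Cmult be (cexpi (- (2 * PI * eta * x)))))) t).
  { intros t al be Ht. apply (gap_at_trig rho); auto; apply H2; apply Rabs_def2 in Ht; apply Rabs_def1; lra. }
  split; split.
  - apply (rapid_RtoC_mult (fun x => cos (2 * PI * eta * (x - u0))) psi 1); auto.
    intros x. pose proof (COS_bound (2 * PI * eta * (x - u0))). apply Rabs_le; lra.
  - intros t Ht. specialize (G t (c / 2, - s / 2) (c / 2, s / 2) Ht).
    match type of G with gap_at _ _ ?f _ => replace (fun x => Cmult (psi x) (RtoC (cos (2 * PI * eta * (x - u0))))) with f; auto end.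
    apply functional_extensionality; intros x. f_equal. rewrite Rmult_minus_distr_l, cos_minus. fold c s. unfold cexpi.
    rewrite cos_neg, sin_neg. ceq; field.
  - apply (rapid_RtoC_mult (fun x => sin (2 * PI * eta * (x - u0))) psi 1); auto.
    intros x. pose proof (SIN_bound (2 * PI * eta * (x - u0))). apply Rabs_le; lra.
  - intros t Ht. specialize (G t (- s / 2, - c / 2) (- s / 2, c / 2) Ht).
    match type of G with gap_at _ _ ?f _ => replace (fun x => Cmult (psi x) (RtoC (sin (2 * PI * eta * (x - u0))))) with f; auto end.
    apply functional_extensionality; intros x. f_equal. rewrite Rmult_minus_distr_l, sin_minus. fold c s. unfold cexpi.
    rewrite cos_neg, sin_neg. ceq; field.
Qed.

Lemma Rabs_sin_le x : Rabs (sin x) <= Rabs x.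
Proof.
  assert (P : forall y, 0 <= y -> Rabs (sin y) <= y).
  { intros y Hy. destruct (Req_dec y 0) as [->|Hn]; [rewrite sin_0, Rabs_R0; lra|].
    destruct (Rle_dec y 1) as [L|L].
    - rewrite Rabs_pos_eq. apply Rlt_le, sin_lt_x; lra. apply sin_ge_0; auto. pose proof PI2_1. lra.
    - pose proof (SIN_bound y). apply Rabs_le; lra. }
  destruct (Rle_dec 0 x) as [H|H].
  - rewrite (Rabs_pos_eq x) by auto. auto.
  - rewrite (Rabs_left x) by lra. rewrite <- (P (- x)) by lra. rewrite sin_neg, Rabs_Ropp. lra.
Qed.

Lemma sin_scaled_lim y (h : nat -> R) : (forall n, 0 < h n) -> is_lim_seq h 0 ->
  is_lim_seq (fun n => sin (y * h n) / h n) y.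
Proof.
  intros Hh Hl. destruct (Req_dec y 0) as [->|Hy].
  - apply is_lim_seq_ext with (fun _ => 0); [|apply is_lim_seq_const].
    intros n. rewrite Rmult_0_l, sin_0. field. specialize (Hh n); lra.
  - apply is_lim_seq_spec. intros eps. apply is_lim_seq_spec in Hl.
    assert (Hay : 0 < Rabs y) by now apply Rabs_pos_lt.
    assert (He : 0 < eps / Rabs y) by (apply Rdiv_lt_0_compat; auto; apply cond_pos).
    destruct (derivable_pt_lim_sin_0 _ He) as [d Hd].
    assert (Hdy : 0 < d / Rabs y) by (apply Rdiv_lt_0_compat; auto; apply cond_pos).
    destruct (Hl (mkposreal _ Hdy)) as [N HN]. exists N. intros n Hn.
    specialize (HN n Hn). simpl in HN. rewrite Rminus_0_r in HN. specialize (Hh n).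
    assert (Hyh : y * h n <> 0) by (apply Rmult_integral_contrapositive; split; lra).
    assert (Hs : Rabs (y * h n) < d).
    { rewrite Rabs_mult. apply Rmult_lt_reg_r with (/ Rabs y). now apply Rinv_0_lt_compat.
      replace (Rabs y * Rabs (h n) * / Rabs y) with (Rabs (h n)) by (field; lra). exact HN. }
    specialize (Hd (y * h n) Hyh Hs). rewrite Rplus_0_l, sin_0, Rminus_0_r in Hd.
    replace (sin (y * h n) / h n - y) with (y * (sin (y * h n) / (y * h n) - 1)) by (field; lra).
    rewrite Rabs_mult. apply Rmult_lt_reg_r with (/ Rabs y). now apply Rinv_0_lt_compat.
    replace (Rabs y * Rabs (sin (y * h n) / (y * h n) - 1) * / Rabs y) with (Rabs (sin (y * h n) / (y * h n) - 1)) by (field; lra).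
    exact Hd.
Qed.

Lemma clim_RtoC_mult z (u : nat -> R) (v : R) : is_lim_seq u v -> clim (fun n => Cmult z (RtoC (u n))) (Cmult z (RtoC v)).
Proof.
  intros H. apply clim_scal, clim_of_components; [exact H|apply is_lim_seq_const].
Qed.

(** A linear factor costs no width: [x - u0] is the limit of [sin (h * (x - u0)) / h] as [h] tends
    to 0, and these factors shift the spectrum by arbitrarily little. *)
Lemma gap_on_linear rho p b psi t0 w u0 : cells rho p -> tame p b -> gap_on p b psi t0 w ->
  gap_on p b (fun x => Cmult (psi x) (RtoC (x - u0))) t0 w.
Proof.
  intros Hp Hb [H1 H2]. split; [now apply rapid_linear|]. intros t Ht.
  set (eta := fun n : nat => / INR (S n)).
  assert (Heta : forall n, 0 < eta n) by (intros n; apply Rinv_0_lt_compat, lt_0_INR; lia).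
  assert (Hel : is_lim_seq eta 0).
  { apply (is_lim_seq_incr_1 (fun n => / INR n)).
    replace (Finite 0) with (Rbar_inv p_infty) by reflexivity.
    apply is_lim_seq_inv; [apply is_lim_seq_INR|discriminate]. }
  assert (P2 : 0 < 2 * PI) by (pose proof PI_RGT_0; lra).
  set (h := fun n => 2 * PI * eta n).
  assert (Hh : forall n, 0 < h n) by (intros; apply Rmult_lt_0_compat; auto).
  apply (gap_at_limit rho p b (fun n x => Cmult (psi x) (RtoC (sin ((x - u0) * h n) / h n))) _ (fun x => Cmult (psi x) (RtoC (x - u0)))); auto.
  - now apply rapid_linear.
  - intros n x. rewrite !Cmod_mult, !Cmod_R. apply Rmult_le_compat_l; [apply Cmod_ge_0|].
    unfold Rdiv. rewrite Rabs_mult, (Rabs_pos_eq (/ h n)) by (apply Rlt_le, Rinv_0_lt_compat; auto).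
    apply Rmult_le_reg_r with (h n); auto. rewrite Rmult_assoc, Rinv_l, Rmult_1_r by (specialize (Hh n); lra).
    eapply Rle_trans; [apply Rabs_sin_le|]. rewrite Rabs_mult, (Rabs_pos_eq (h n)); [lra|]. apply Rlt_le; auto.
  - intros x. apply clim_RtoC_mult. apply sin_scaled_lim; auto.
    unfold h. replace (Finite 0) with (Rbar_mult (2 * PI) 0) by (simpl; f_equal; ring).
    apply is_lim_seq_scal_l; auto.
  - apply is_lim_seq_spec in Hel. assert (Hw : 0 < w - Rabs (t - t0)) by lra.
    destruct (Hel (mkposreal _ Hw)) as [N HN]. exists N. intros n Hn. specialize (HN n Hn). simpl in HN.
    rewrite Rminus_0_r, Rabs_pos_eq in HN by (apply Rlt_le; auto).
    destruct (gap_on_cos_sin rho p b psi t0 w (eta n) u0 Hp Hb (Rlt_le _ _ (Heta n)) (conj H1 H2)) as [_ G].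
    apply (gap_on_scal rho p b _ _ _ (RtoC (/ h n)) Hp Hb) in G. destruct G as [_ G].
    specialize (G t ltac:(lra)).
    match type of G with gap_at _ _ ?f _ => replace (fun x => Cmult (psi x) (RtoC (sin ((x - u0) * h n) / h n))) with f; auto end.
    apply functional_extensionality; intros x. unfold h. replace (2 * PI * eta n * (x - u0)) with ((x - u0) * (2 * PI * eta n)) by ring.
    unfold Rdiv. rewrite RtoC_mult. ring.
Qed.

(** * Multipliers of small spectrum that kill prescribed points *)

Fixpoint cosprod (J : nat) (x : R) : R :=
  match J with O => 1 | S J' => cosprod J' x * cos (x / 2 ^ J) end.

Definition sincl (x : R) : R := if Req_EM_T x 0 then 1 else sin x / x.

Lemma cosprod_sin J x : 2 ^ J * sin (x / 2 ^ J) * cosprod J x = sin x.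
Proof.
  induction J as [|J IH].
  - simpl. rewrite Rdiv_1_r. ring.
  - rewrite <- IH. cbn [cosprod]. assert (P2 : 0 < 2 ^ J) by (apply pow_lt; lra).
    replace (x / 2 ^ J) with (2 * (x / 2 ^ S J)) by (simpl; field; lra).
    rewrite sin_2a. change (2 ^ S J) with (2 * 2 ^ J) at 1. ring.
Qed.

Lemma cosprod_bound J x : Rabs (cosprod J x) <= 1.
Proof.
  induction J as [|J IH]; cbn [cosprod]; [rewrite Rabs_R1; lra|].
  rewrite Rabs_mult. assert (Rabs (cos (x / 2 ^ S J)) <= 1) by (pose proof (COS_bound (x / 2 ^ S J)); apply Rabs_le; lra).
  pose proof (Rabs_pos (cosprod J x)). pose proof (Rabs_pos (cos (x / 2 ^ S J))). nra.
Qed.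

Lemma cosprod_lim x : is_lim_seq (fun J => cosprod J x) (sincl x).
Proof.
  unfold sincl. destruct (Req_EM_T x 0) as [->|Hx].
  - apply is_lim_seq_ext with (fun _ => 1); [|apply is_lim_seq_const].
    induction n as [|n IH]; cbn [cosprod]; auto. rewrite <- IH. unfold Rdiv. rewrite Rmult_0_l, cos_0. ring.
  - assert (Hh : forall n : nat, 0 < / 2 ^ n) by (intros; apply Rinv_0_lt_compat, pow_lt; lra).
    assert (Hl : is_lim_seq (fun n => / 2 ^ n) 0).
    { apply is_lim_seq_ext with (fun n => (/ 2) ^ n). - intros; now rewrite pow_inv.
      - apply is_lim_seq_geom. rewrite Rabs_pos_eq; lra. }
    pose proof (sin_scaled_lim x _ Hh Hl) as L.
    assert (Lx : is_lim_seq (fun n => sin x / (sin (x * / 2 ^ n) / / 2 ^ n)) (sin x / x)).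
    { apply is_lim_seq_div'; auto. apply is_lim_seq_const. }
    apply is_lim_seq_spec in L. assert (Hax : 0 < Rabs x) by now apply Rabs_pos_lt.
    destruct (L (mkposreal _ Hax)) as [N HN].
    apply (is_lim_seq_ext_loc (fun n => sin x / (sin (x * / 2 ^ n) / / 2 ^ n))); auto.
    exists N. intros n Hn. specialize (HN n Hn). simpl in HN.
    assert (P2 : 0 < 2 ^ n) by (apply pow_lt; lra).
    pose proof (cosprod_sin n x) as E. unfold Rdiv in E.
    assert (Hs : sin (x * / 2 ^ n) <> 0).
    { intros C. rewrite C in HN. unfold Rdiv in HN. rewrite Rmult_0_l in HN. unfold Rminus in HN. rewrite Rplus_0_l, Rabs_Ropp in HN. lra. }
    rewrite <- E. field. split; lra.
Qed.

Lemma sincl_bound x : Rabs (sincl x) <= 1.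
Proof.
  unfold sincl. destruct (Req_EM_T x 0); [rewrite Rabs_R1; lra|].
  unfold Rdiv. rewrite Rabs_mult, Rabs_inv. assert (H := Rabs_pos_lt x n).
  apply Rmult_le_reg_r with (Rabs x); auto. rewrite Rmult_assoc, Rinv_l, Rmult_1_r, Rmult_1_l by lra. apply Rabs_sin_le.
Qed.

Lemma sincl_decay x : x <> 0 -> Rabs (sincl x) <= / Rabs x.
Proof.
  intros n. unfold sincl. destruct (Req_EM_T x 0); [contradiction|].
  unfold Rdiv. rewrite Rabs_mult, Rabs_inv. assert (H := Rabs_pos_lt x n).
  rewrite <- (Rmult_1_l (/ Rabs x)) at 2. apply Rmult_le_compat_r; [apply Rlt_le, Rinv_0_lt_compat; auto|].
  pose proof (SIN_bound x). apply Rabs_le; lra.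
Qed.

Lemma sincl_0 : sincl 0 = 1.
Proof. unfold sincl. destruct (Req_EM_T 0 0); auto. contradiction. Qed.

(** By Viete's product the cardinal sine is a limit of products of cosines of frequencies
    [kappa / 2], [kappa / 4], and so on; their sum is below [kappa], which is the total cost. *)
Lemma gap_on_sinc rho p b psi t0 w kappa u0 : cells rho p -> tame p b -> 0 <= kappa -> gap_on p b psi t0 w ->
  gap_on p b (fun x => Cmult (psi x) (RtoC (sincl (2 * PI * kappa * (x - u0))))) t0 (w - kappa).
Proof.
  intros Hp Hb Hk H. assert (H' := H). destruct H' as [H1 _]. split.
  { apply (rapid_RtoC_mult (fun x => sincl (2 * PI * kappa * (x - u0))) psi 1); auto. intros; apply sincl_bound. }
  intros t Ht.
  assert (G : forall J, gap_on p b (fun x => Cmult (psi x) (RtoC (cosprod J (2 * PI * kappa * (x - u0))))) t0 (w - kappa * (1 - / 2 ^ J))).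
  { induction J as [|J IH].
    - replace (w - kappa * (1 - / 2 ^ 0)) with w by (simpl; field).
      replace (fun x => Cmult (psi x) (RtoC (cosprod 0 (2 * PI * kappa * (x - u0))))) with psi; auto.
      apply functional_extensionality; intros. simpl. ring.
    - assert (P2 : 0 < 2 ^ J) by (apply pow_lt; lra).
      assert (He : 0 <= kappa / 2 ^ S J) by (apply Rle_mult_inv_pos; auto; apply pow_lt; lra).
      destruct (gap_on_cos_sin rho p b _ t0 _ (kappa / 2 ^ S J) u0 Hp Hb He IH) as [G _].
      replace (w - kappa * (1 - / 2 ^ J) - kappa / 2 ^ S J) with (w - kappa * (1 - / 2 ^ S J)) in G by (simpl; field; lra).
      match type of G with gap_on _ _ ?f _ _ => replace (fun x => Cmult (psi x) (RtoC (cosprod (S J) (2 * PI * kappa * (x - u0))))) with f; auto end.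
      apply functional_extensionality; intros x. cbn [cosprod]. rewrite RtoC_mult.
      replace (2 * PI * (kappa / 2 ^ S J) * (x - u0)) with (2 * PI * kappa * (x - u0) / 2 ^ S J) by (field; apply pow_nonzero; lra). ring. }
  apply (gap_at_limit rho p b (fun J x => Cmult (psi x) (RtoC (cosprod J (2 * PI * kappa * (x - u0))))) _ psi); auto.
  - intros n x. rewrite Cmod_mult, Cmod_R. pose proof (cosprod_bound n (2 * PI * kappa * (x - u0))). pose proof (Cmod_ge_0 (psi x)). nra.
  - intros x. apply clim_RtoC_mult, cosprod_lim.
  - exists 0%nat. intros n _. apply G. assert (0 < / 2 ^ n) by (apply Rinv_0_lt_compat, pow_lt; lra). nra.
Qed.

(** For each [v] a linear factor with zero [v] and value 1 at [u0], times the square of a cardinal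
    sine centred at [u0]: one power compensates the growth of the linear factor, the other gives
    decay. *)
Definition killer (kappa u0 : R) (vs : list R) (x : R) : R :=
  fold_right (fun v acc => (x - v) / (u0 - v) * (sincl (2 * PI * kappa * (x - u0)) ^ 2 * acc)) 1 vs.

Lemma gap_on_killer rho p b psi t0 w kappa u0 vs : cells rho p -> tame p b -> 0 <= kappa -> gap_on p b psi t0 w ->
  gap_on p b (fun x => Cmult (psi x) (RtoC (killer kappa u0 vs x))) t0 (w - 2 * kappa * INR (length vs)).
Proof.
  intros Hp Hb Hk H. induction vs as [|v vs IH].
  - simpl. rewrite Rmult_0_r, Rminus_0_r.
    replace (fun x => Cmult (psi x) (RtoC 1)) with psi; auto. apply functional_extensionality; intros; ring.
  - apply (gap_on_linear rho p b _ t0 _ v Hp Hb) in IH.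
    apply (gap_on_scal rho p b _ t0 _ (RtoC (/ (u0 - v))) Hp Hb) in IH.
    apply (gap_on_sinc rho p b _ t0 _ kappa u0 Hp Hb Hk) in IH.
    apply (gap_on_sinc rho p b _ t0 _ kappa u0 Hp Hb Hk) in IH.
    replace (w - 2 * kappa * INR (length vs) - kappa - kappa) with (w - 2 * kappa * INR (length (v :: vs))) in IH.
    2: { simpl length. rewrite S_INR. ring. }
    match type of IH with gap_on _ _ ?f _ _ => replace (fun x => Cmult (psi x) (RtoC (killer kappa u0 (v :: vs) x))) with f; auto end.
    apply functional_extensionality; intros x. unfold killer; cbn [fold_right]. fold (killer kappa u0 vs x).
    unfold Rdiv. simpl pow. rewrite !RtoC_mult. ring.
Qed.

Definition dist_prod (u0 : R) (vs : list R) : R := fold_right (fun v acc => Rabs (v - u0) * acc) 1 vs.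

Lemma killer_center kappa u0 vs : ~ In u0 vs -> killer kappa u0 vs u0 = 1.
Proof.
  induction vs as [|v vs IH]; intros H; [reflexivity|]. unfold killer; cbn [fold_right]. fold (killer kappa u0 vs u0).
  rewrite IH by (intros C; apply H; right; auto). replace (2 * PI * kappa * (u0 - u0)) with 0 by ring. rewrite sincl_0.
  field. intros C. apply H. left. lra.
Qed.

Lemma killer_zero kappa u0 vs x : In x vs -> killer kappa u0 vs x = 0.
Proof.
  induction vs as [|v vs IH]; intros H; [destruct H|]. unfold killer; cbn [fold_right]. fold (killer kappa u0 vs x).
  destruct H as [->|H]; [unfold Rdiv; ring|]. rewrite IH by auto. ring.
Qed.

(** Factor by factor: at distance [X >= T] from [u0] the linear part is at most [2 * X / |v - u0|],
    and the squared sinc at most [(2 * kappa * X) ^ (-2)]. *)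
Lemma killer_far kappa u0 vs x T : 0 < kappa -> 0 < T -> T <= Rabs (x - u0) ->
  (forall v, In v vs -> 0 < Rabs (v - u0) <= T) ->
  Rabs (killer kappa u0 vs x) * ((kappa ^ 2 * T) ^ length vs * dist_prod u0 vs) <= 1.
Proof.
  intros Hk HT Hx. induction vs as [|v vs IH]; intros H.
  - simpl. rewrite Rabs_R1. lra.
  - specialize (IH (fun v' Hv => H v' (or_intror Hv))).
    destruct (H v (or_introl eq_refl)) as [V1 V2].
    unfold killer, dist_prod; cbn [fold_right length]. fold (killer kappa u0 vs x). fold (dist_prod u0 vs).
    set (D := (kappa ^ 2 * T) ^ length vs * dist_prod u0 vs) in *. set (Kv := killer kappa u0 vs x) in *.
    set (X := Rabs (x - u0)) in *. set (V := Rabs (v - u0)) in *.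
    rewrite Rabs_mult, Rabs_mult, <- RPow_abs.
    set (s := Rabs (sincl (2 * PI * kappa * (x - u0)))).
    assert (Hs0 : 0 <= s) by apply Rabs_pos.
    assert (Hq : Rabs ((x - v) / (u0 - v)) <= 2 * X / V).
    { unfold Rdiv. rewrite Rabs_mult, Rabs_inv. replace (Rabs (u0 - v)) with V by (unfold V; apply Rabs_minus_sym).
      apply Rmult_le_compat_r; [apply Rlt_le, Rinv_0_lt_compat; auto|].
      replace (x - v) with ((x - u0) + - (v - u0)) by ring. eapply Rle_trans; [apply Rabs_triang|]. rewrite Rabs_Ropp. fold X V. lra. }
    assert (HkX : 0 < kappa * X) by (apply Rmult_lt_0_compat; lra).
    assert (Hs' : s * 2 <= / (kappa * X)).
    { assert (P1 : 2 <= 2 * PI) by (pose proof PI2_1; pose proof PI_RGT_0; lra).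
      assert (Hn : 2 * PI * kappa * (x - u0) <> 0).
      { intros C. assert (X = 0); [|lra]. unfold X. replace (x - u0) with 0; [apply Rabs_R0|].
        apply Rmult_integral in C. destruct C as [C|C]; auto. nra. }
      assert (A : s <= / (2 * (kappa * X))).
      { eapply Rle_trans; [apply sincl_decay; auto|]. rewrite !Rabs_mult. fold X.
        rewrite (Rabs_pos_eq kappa), <- Rabs_mult, (Rabs_pos_eq (2 * PI)) by lra.
        apply Rinv_le_contravar; [lra|]. rewrite Rmult_assoc. apply Rmult_le_compat_r; lra. }
      rewrite Rinv_mult in A. lra. }
    assert (P3 : s * 2 * s <= / (kappa * X) * / (kappa * X)).
    { apply Rmult_le_compat; auto; lra. }
    assert (HD : 0 <= Rabs Kv * D).
    { apply Rmult_le_pos; [apply Rabs_pos|]. apply Rmult_le_pos; [apply pow_le; apply Rmult_le_pos; [apply pow_le|]; lra|].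
      clear. unfold dist_prod. induction vs as [|a vs IH]; simpl; [lra|]. apply Rmult_le_pos; auto. apply Rabs_pos. }
    assert (Hc : Rabs ((x - v) / (u0 - v)) * s ^ 2 * (kappa ^ 2 * T * V) <= 1).
    { apply Rle_trans with (2 * X / V * s ^ 2 * (kappa ^ 2 * T * V)).
      - apply Rmult_le_compat_r. { repeat apply Rmult_le_pos; lra. }
        apply Rmult_le_compat_r; auto. apply pow_le; auto.
      - replace (2 * X / V * s ^ 2 * (kappa ^ 2 * T * V)) with ((s * 2 * s) * (X * kappa ^ 2 * T)) by (field; lra).
        apply Rle_trans with ((/ (kappa * X) * / (kappa * X)) * (X * kappa ^ 2 * T)).
        + apply Rmult_le_compat_r; auto. repeat apply Rmult_le_pos; lra.
        + replace (/ (kappa * X) * / (kappa * X) * (X * kappa ^ 2 * T)) with (T / X) by (field; lra).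
          apply Rmult_le_reg_r with X; [lra|]. unfold Rdiv. rewrite Rmult_assoc, Rinv_l; lra. }
    match goal with |- ?g <= 1 => replace g with ((Rabs ((x - v) / (u0 - v)) * s ^ 2 * (kappa ^ 2 * T * V)) * (Rabs Kv * D)) end.
    + apply Rle_trans with (1 * (Rabs Kv * D)); [apply Rmult_le_compat_r; auto|lra].
    + unfold D, s. simpl. ring.
Qed.

Definition abs_prod (l : list Z) : R := fold_right (fun k acc => Rabs (IZR k) * acc) 1 l.

Lemma abs_prod_mid l1 k l2 : abs_prod (l1 ++ k :: l2) = Rabs (IZR k) * abs_prod (l1 ++ l2).
Proof.
  induction l1 as [|a l1 IH]; [reflexivity|]. unfold abs_prod in *. simpl. rewrite IH. ring.
Qed.

(** Fewer than [n] nonzero integers have modulus less than [n / 2]. *)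
Lemma exists_large_of_NoDup (l : list Z) : NoDup l -> (forall k, In k l -> k <> 0%Z) -> l <> [] ->
  exists k, In k l /\ (Z.of_nat (length l) <= 2 * Z.abs k)%Z.
Proof.
  intros Hnd Hnz Hne. apply NNPP. intros C.
  set (m := ((length l - 1) / 2)%nat).
  set (L := map (fun i => Z.of_nat (S i)) (seq 0 m) ++ map (fun i => (- Z.of_nat (S i))%Z) (seq 0 m)).
  assert (Hlen : (1 <= length l)%nat) by (destruct l; [contradiction|simpl; lia]).
  assert (Hm : (2 * m <= length l - 1)%nat) by (unfold m; apply Nat.Div0.mul_div_le).
  assert (Hm2 : (length l - 1 < 2 * m + 2)%nat).
  { unfold m. pose proof (Nat.mod_upper_bound (length l - 1) 2 ltac:(lia)). pose proof (Nat.div_mod_eq (length l - 1) 2). lia. }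
  assert (Hincl : incl l L).
  { intros k Hk. specialize (Hnz k Hk).
    assert (Hk2 : (2 * Z.abs k < Z.of_nat (length l))%Z).
    { apply Z.nle_gt. intros C'. apply C. now exists k. }
    apply in_or_app. destruct (Z_lt_ge_dec 0 k).
    - left. apply in_map_iff. exists (Z.to_nat (k - 1)). split; [lia|]. apply in_seq. lia.
    - right. apply in_map_iff. exists (Z.to_nat (- k - 1)). split; [lia|]. apply in_seq. lia. }
  pose proof (NoDup_incl_length Hnd Hincl) as Hl. unfold L in Hl.
  rewrite length_app, !length_map, length_seq in Hl. lia.
Qed.

Lemma pow_succ_le_3 n : (0 < n)%nat -> (1 + / INR n) ^ n <= 3.
Proof.
  intros Hn. assert (Hp : 0 < INR n) by now apply lt_0_INR.
  apply Rle_trans with (exp (/ INR n) ^ n).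
  - apply pow_incr. split; [|apply exp_ineq1_le]. assert (0 < / INR n) by now apply Rinv_0_lt_compat. lra.
  - rewrite <- Rpower_pow by apply exp_pos. unfold Rpower. rewrite ln_exp, Rinv_r by lra. apply exp_le_3.
Qed.

(** A crude factorial bound. Among [n] distinct nonzero integers one has modulus at least [n / 2];
    removing it changes [(n / 6) ^ n] by a further factor of at most 3, as [(1 + / n) ^ n <= 3].
    This is where [6 = 2 * 3] comes from. *)
Lemma abs_prod_lower n (l : list Z) : length l = n -> NoDup l -> (forall k, In k l -> k <> 0%Z) ->
  (INR n / 6) ^ n <= abs_prod l.
Proof.
  revert l. induction n as [|n IH]; intros l Hl Hnd Hnz.
  - destruct l; [simpl; lra|discriminate].
  - destruct (exists_large_of_NoDup l Hnd Hnz) as [k [Hk Hk2]]. { intros ->; discriminate. }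
    destruct (in_split k l Hk) as [l1 [l2 E]]. subst l.
    rewrite abs_prod_mid.
    assert (Hl' : length (l1 ++ l2) = n). { rewrite length_app in *. simpl in Hl. lia. }
    assert (Hnd' : NoDup (l1 ++ l2)) by now apply NoDup_remove_1 in Hnd.
    assert (Hin : forall a, In a (l1 ++ l2) -> In a (l1 ++ k :: l2)).
    { intros a Ha. apply in_app_or in Ha. apply in_or_app. destruct Ha; auto. right; right; auto. }
    specialize (IH (l1 ++ l2) Hl' Hnd' (fun a Ha => Hnz a (Hin a Ha))).
    assert (Hkn : INR (S n) / 2 <= Rabs (IZR k)).
    { rewrite Hl in Hk2. apply IZR_le in Hk2. rewrite mult_IZR, <- INR_IZR_INZ, abs_IZR in Hk2. lra. }
    assert (P : (INR (S n) / 6) ^ n <= 3 * (INR n / 6) ^ n).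
    { destruct n as [|m]; [rewrite !pow_O; lra|]. set (n := S m) in *.
      assert (Hp : 0 < INR n) by (apply lt_0_INR; unfold n; lia).
      replace (INR (S n) / 6) with ((1 + / INR n) * (INR n / 6)) by (rewrite S_INR; field; lra).
      rewrite Rpow_mult_distr. apply Rmult_le_compat_r; [apply pow_le; lra|]. apply pow_succ_le_3. unfold n; lia. }
    assert (P0 : 0 <= (INR n / 6) ^ n) by (apply pow_le; pose proof (pos_INR n); lra).
    assert (P1 : 0 <= INR (S n)) by apply pos_INR.
    rewrite <- tech_pow_Rmult. apply Rle_trans with (INR (S n) / 6 * (3 * (INR n / 6) ^ n)).
    + apply Rmult_le_compat_l; lra.
    + replace (INR (S n) / 6 * (3 * (INR n / 6) ^ n)) with (INR (S n) / 2 * (INR n / 6) ^ n) by field.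
      apply Rmult_le_compat; lra.
Qed.

Definition zrange (M : nat) : list Z := map (fun i => (Z.of_nat i - Z.of_nat M)%Z) (seq 0 (2 * M + 1)).

Lemma In_zrange M j : In j (zrange M) <-> (Z.abs j <= Z.of_nat M)%Z.
Proof.
  unfold zrange. rewrite in_map_iff. split.
  - intros [i [<- Hi]]. apply in_seq in Hi. lia.
  - intros H. exists (Z.to_nat (j + Z.of_nat M)). split; [lia|]. apply in_seq. lia.
Qed.

Lemma NoDup_zrange M : NoDup (zrange M).
Proof.
  unfold zrange. apply NoDup_map_NoDup_ForallPairs; [|apply seq_NoDup]. intros i j _ _ H. lia.
Qed.

Definition decide (P : Prop) : bool := if excluded_middle_informative P then true else false.

Lemma decide_true P : decide P = true <-> P.
Proof. unfold decide. destruct (excluded_middle_informative P); split; auto; discriminate. Qed.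

Lemma finite_enum (P : Z -> Prop) M : (forall j, P j -> (Z.abs j <= Z.of_nat M)%Z) ->
  exists l, NoDup l /\ forall j, In j l <-> P j.
Proof.
  intros H. exists (filter (fun j => decide (P j)) (zrange M)). split.
  - apply NoDup_filter, NoDup_zrange.
  - intros j. rewrite filter_In, In_zrange, decide_true. split; [tauto|auto].
Qed.

(** Used in place of [bump] because its integral [w * bump_mass] is explicit and positive, so its
    transform does not vanish at 0. *)
Definition mass_fun (w : R) (x : R) : CC := RtoC (bump01 (/ w * x + 0)).

Lemma testfun_mass_fun w : 0 < w -> testfun (mass_fun w).
Proof.
  intros Hw. apply (testfun_affine (fun t => RtoC (bump01 t)) (/ w) 0).
  - apply Rinv_neq_0_compat; lra.
  - split; [split|].
    + intros x. apply continuous_RtoC, bump01_cont.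
    + exists 1. intros x Hx. rewrite bump01_out; auto. unfold Rabs in Hx. destruct (Rcase_abs x); lra.
    + apply smooth_RtoC, smoothR_bump01.
Qed.

Lemma mass_fun_out w x : 0 < w -> w <= Rabs x -> mass_fun w x = RtoC 0.
Proof.
  intros Hw H. unfold mass_fun. rewrite bump01_out; auto. rewrite Rplus_0_r.
  assert (Hi : 0 < / w) by now apply Rinv_0_lt_compat.
  unfold Rabs in H. destruct (Rcase_abs x).
  - left. nra.
  - right. apply Rmult_le_reg_l with w; auto. rewrite <- Rmult_assoc, Rinv_r by lra. lra.
Qed.

Lemma fourier_mass_fun_0 w : 0 < w -> fourier (mass_fun w) 0 <> RtoC 0.
Proof.
  intros Hw. assert (Hi : 0 < / w) by now apply Rinv_0_lt_compat.
  assert (H1 : Cc (fun t => RtoC (bump01 t))).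
  { split. intros x; apply continuous_RtoC, bump01_cont.
    exists 1. intros x Hx. rewrite bump01_out; auto. unfold Rabs in Hx. destruct (Rcase_abs x); lra. }
  unfold mass_fun. rewrite (fourier_affine (fun t => RtoC (bump01 t)) (/ w) 0) by (auto; lra).
  replace (0 / / w) with 0 by (field; lra). replace (2 * PI * 0 * 0) with 0 by ring. rewrite cexpi_0.
  assert (E : fourier (fun t => RtoC (bump01 t)) 0 = RtoC bump_mass).
  { rewrite (fourier_comps _ 0 1); auto; try lra.
    2: { intros x Hx. rewrite bump01_out; auto. unfold Rabs in Hx. destruct (Rcase_abs x); lra. }
    ceq.
    - rewrite (RInt_extR _ bump01).
      + rewrite <- (RInt_Chasles bump01 (-(1)) 0 1) by (apply continuous_ex_RInt, bump01_cont).
        rewrite (RInt_vanish bump01 (- (1)) 0). unfold plus; simpl; unfold bump_mass; ring.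
        intros x Hx. rewrite Rmax_right in Hx by lra. apply bump01_out; lra.
      + intros x. replace (- 2 * PI * x * 0) with 0 by ring. rewrite cos_0, sin_0. unfold fre, fim; simpl. ring.
    - apply RInt_vanish. intros x _. replace (- 2 * PI * x * 0) with 0 by ring. rewrite cos_0, sin_0. unfold fre, fim; simpl. ring. }
  rewrite E. pose proof bump_mass_pos. rewrite Rabs_pos_eq, Rinv_inv by lra.
  intros C. apply (f_equal fst) in C. simpl in C. nra.
Qed.

Lemma Zs_split (u : Z -> CC) j0 : summable u ->
  Zs u = Cplus (u j0) (Zs (fun j => if Z.eq_dec j j0 then RtoC 0 else u j)).
Proof.
  intros Hs.
  assert (S1 : summable (fun j => if Z.eq_dec j j0 then u j else RtoC 0)).
  { apply (summable_le _ u); auto. intros j. destruct (Z.eq_dec j j0); [lra|]. rewrite Cmod_0. apply Cmod_ge_0. }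
  assert (S2 : summable (fun j => if Z.eq_dec j j0 then RtoC 0 else u j)).
  { apply (summable_le _ u); auto. intros j. destruct (Z.eq_dec j j0); [|lra]. rewrite Cmod_0. apply Cmod_ge_0. }
  transitivity (Cplus (Zs (fun j => if Z.eq_dec j j0 then u j else RtoC 0)) (Zs (fun j => if Z.eq_dec j j0 then RtoC 0 else u j))).
  - rewrite <- Zs_plus by auto. apply Zs_ext. intros j. destruct (Z.eq_dec j j0); ring.
  - f_equal. rewrite (Zs_single _ j0).
    + destruct (Z.eq_dec j0 j0); congruence.
    + intros j Hj. destruct (Z.eq_dec j j0); congruence.
Qed.

(** Amounts to a gap of radius [2 * w] about [t0], shared equally between the width of the smoothing
    function and the freedom in [t]. *)
Definition spectral_gap (p : Z -> R) (b : Z -> CC) (t0 w : R) : Prop :=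
  forall f t, testfun f -> (forall x, w <= Rabs x -> f x = RtoC 0) -> Rabs (t - t0) < w -> gap_at p b (fourier f) t.

(* The labels [q] let the constant scale with the spacing of the support of [b] rather than with the cells. *)
Lemma gap_density rho p b A t0 w r q j0 : cells rho p -> 0 <= A -> (forall j, Cmod (b j) <= A) -> 0 < w -> 0 < r ->
  spectral_gap p b t0 w ->
  (forall i j, b i <> RtoC 0 -> b j <> RtoC 0 -> i <> j -> q i <> q j /\ r * Rabs (IZR (q i - q j)) <= Rabs (p i - p j)) ->
  b j0 <> RtoC 0 ->
  exists T0, 0 < T0 /\ forall T, T0 <= T -> exists l, NoDup l /\
    (forall j, In j l -> b j <> RtoC 0 /\ Rabs (p j - p j0) <= T) /\ w ^ 2 * r * T / 400 <= INR (length l).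
Proof.
  intros Hp HA Hb Hw Hr Hgap Hq Hj0.
  assert (Hrho : 0 < rho) by apply Hp.
  set (u0 := p j0).
  (* The modulation moves the known nonzero value of the transform from 0 to [u0]. *)
  set (f := fun x => Cmult (cexpi (2 * PI * u0 * x)) (mass_fun w x)).
  assert (Hf : testfun f) by (apply testfun_mult; [apply (smooth_cexpi (2 * PI * u0))|now apply testfun_mass_fun]).
  set (psi := fourier f).
  assert (Epsi : forall y, psi y = fourier (mass_fun w) (y - u0)) by (intros; apply fourier_mod).
  assert (Hpsi0 : 0 < Cmod (psi u0)).
  { apply Cmod_pos. rewrite Epsi. replace (u0 - u0) with 0 by ring. now apply fourier_mass_fun_0. }
  assert (Hb' : tame p b) by now apply (tame_bounded p b A).
  assert (G : gap_on p b psi t0 w).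
  { split; [now apply rapid_fourier|]. intros t Ht. apply Hgap; auto.
    intros x Hx. unfold f. rewrite mass_fun_out by auto. ring. }
  destruct (rapid_fourier _ (testfun_mass_fun w Hw) 3%nat) as [B [HB0 HB]].
  destruct (cells_weight_sum rho p Hp) as [C [HC Hwt]]. destruct (Hwt u0) as [g [Hg0 [HgC Hgj]]].
  (* From this radius on, the far terms add up to less than the modulus of the term at [j0]. *)
  set (T0 := 2 * (A * (B * C)) / (Cmod (psi u0) * Cmod (b j0)) + 1).
  assert (Hbp : 0 < Cmod (b j0)) by now apply Cmod_pos.
  assert (Hpb : 0 < Cmod (psi u0) * Cmod (b j0)) by now apply Rmult_lt_0_compat.
  assert (HABC : 0 <= A * (B * C)) by (repeat apply Rmult_le_pos; lra).
  assert (HT0 : 1 <= T0). { unfold T0. assert (0 <= 2 * (A * (B * C)) / (Cmod (psi u0) * Cmod (b j0))) by (apply Rle_mult_inv_pos; lra). lra. }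
  exists T0. split; [lra|]. intros T HT.
  destruct (exists_nat_gt ((T + Rabs u0 + 1) / rho)) as [M [_ HM]].
  assert (HM' : T + Rabs u0 + 1 <= INR M * rho).
  { apply Rlt_le. apply Rmult_lt_reg_r with (/ rho). now apply Rinv_0_lt_compat. rewrite Rmult_assoc, Rinv_r, Rmult_1_r by lra. exact HM. }
  assert (Hnear : forall j, Rabs (p j - u0) <= T -> (Z.abs j <= Z.of_nat M)%Z).
  { intros j Hj. apply Z.nlt_ge. intros L. pose proof (cells_far rho p M _ Hp HM' j L).
    pose proof (Rabs_triang (p j - u0) u0) as Q. replace (p j - u0 + u0) with (p j) in Q by ring. lra. }
  destruct (finite_enum (fun j => b j <> RtoC 0 /\ Rabs (p j - u0) <= T) M) as [l [Hnd Hl]]. { intros j [_ Hj]; auto. }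
  exists l. split; [auto|]. split; [intros j; apply Hl|].
  (* With too few points within [T], all of them except [j0] are killed, and the gap then equates
     the term at [j0] with the sum of the far terms. *)
  apply Rnot_lt_le. intros Hsmall.
  set (l' := filter (fun j => negb (Z.eqb j j0)) l).
  assert (Hl' : forall j, In j l' <-> j <> j0 /\ b j <> RtoC 0 /\ Rabs (p j - u0) <= T).
  { intros j. unfold l'. rewrite filter_In, Hl, Bool.negb_true_iff, Z.eqb_neq. tauto. }
  assert (Hnd' : NoDup l') by now apply NoDup_filter.
  assert (Hlen : (length l' <= length l)%nat) by apply filter_length_le.
  set (N := length l'). set (vs := map p l').
  (* The [N] killing factors cost [2 * kappa * N < w / 2], so the gap at [t0] survives. *)
  set (kappa := w / (4 * (INR N + 1))).
  assert (HN0 : 0 <= INR N) by apply pos_INR.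
  assert (Hk : 0 < kappa) by (apply Rdiv_lt_0_compat; lra).
  pose proof (gap_on_killer rho p b psi t0 w kappa u0 vs Hp Hb' (Rlt_le _ _ Hk) G) as [Hrap HG].
  assert (Hwpos : 0 < w - 2 * kappa * INR (length vs)).
  { unfold vs. rewrite length_map. fold N. unfold kappa.
    assert (2 * (w / (4 * (INR N + 1))) * INR N < w); [|lra].
    apply Rmult_lt_reg_r with (2 * (INR N + 1)); [lra|].
    replace (2 * (w / (4 * (INR N + 1))) * INR N * (2 * (INR N + 1))) with (w * INR N) by (field; lra). nra. }
  specialize (HG t0). replace (t0 - t0) with 0 in HG by ring. rewrite Rabs_R0 in HG. specialize (HG Hwpos).
  unfold gap_at in HG.
  pose proof (summable_gap rho p b _ t0 Hp Hb' Hrap) as Hsum.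
  rewrite (Zs_split _ j0 Hsum) in HG. cbv beta in HG. fold u0 in HG.
  assert (Hnin : ~ In u0 vs).
  { intros Hin. apply in_map_iff in Hin. destruct Hin as [j [Ej Hj]]. apply Hl' in Hj. destruct Hj as [Hj _].
    apply Hj. now apply (cells_inj rho p). }
  rewrite killer_center in HG by auto.
  assert (Hvs : forall v, In v vs -> 0 < Rabs (v - u0) <= T).
  { intros v Hv. apply in_map_iff in Hv. destruct Hv as [j [<- Hj]]. apply Hl' in Hj. destruct Hj as [H1 [H2 H3]].
    split; auto. apply Rabs_pos_lt. intros E. apply H1. apply (cells_inj rho p); auto. unfold u0 in E. lra. }
  assert (Hprod : 1 <= (kappa ^ 2 * T) ^ length vs * dist_prod u0 vs).
  { destruct (Nat.eq_dec N 0) as [HN|HN].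
    - assert (l' = []) as E. { apply length_zero_iff_nil. exact HN. } unfold vs. rewrite E. simpl. lra.
    - assert (HN1 : 1 <= INR N) by (replace 1 with (INR 1) by reflexivity; apply le_INR; lia).
      set (ks := map (fun j => (q j - q j0)%Z) l').
      assert (Hks : NoDup ks).
      { unfold ks. clear -Hnd' Hq Hl'. induction l' as [|a m IH]; [constructor|]. simpl.
        inversion Hnd'; subst. constructor.
        - intros Hin. apply in_map_iff in Hin. destruct Hin as [i [Ei Hi]].
          assert (i <> a) by (intros ->; auto).
          destruct (Hl' a) as [Ha _]. destruct (Hl' i) as [Hi' _].
          destruct (Ha (or_introl eq_refl)) as [_ [A1 _]]. destruct (Hi' (or_intror Hi)) as [_ [A2 _]].
          destruct (Hq i a A2 A1 H). lia.
        - assert (Sub : forall k, In k m -> b k <> RtoC 0) by (intros k Hk; apply (Hl' k); right; auto).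
          clear IH Hl' Hnd' H1. induction m as [|c m IHm]; [constructor|]. simpl. inversion H2; subst. constructor.
          + intros Hin. apply in_map_iff in Hin. destruct Hin as [i [Ei Hi]].
            assert (i <> c) by (intros ->; auto). destruct (Hq i c) as [Hc _]; auto. apply Sub; right; auto. apply Sub; left; auto. lia.
          + apply IHm; auto. intros k Hk. apply Sub. right; auto. }
      assert (Hnz : forall k, In k ks -> k <> 0%Z).
      { intros k Hk'. apply in_map_iff in Hk'. destruct Hk' as [j [<- Hj]]. apply Hl' in Hj. destruct Hj as [H1 [H2 _]].
        destruct (Hq j j0 H2 Hj0 H1). lia. }
      assert (Hlk : length ks = N) by (unfold ks; now rewrite length_map).
      pose proof (abs_prod_lower N ks Hlk Hks Hnz) as Hap.
      assert (Hdp : r ^ N * abs_prod ks <= dist_prod u0 vs).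
      { unfold ks, vs, N. assert (Sub : forall j, In j l' -> r * Rabs (IZR (q j - q j0)) <= Rabs (p j - u0)).
        { intros j Hj. apply Hl' in Hj. destruct Hj as [H1 [H2 _]]. apply Hq; auto. }
        clear -Sub Hr. induction l' as [|a m IH]; [simpl; lra|]. unfold abs_prod, dist_prod in *. simpl.
        replace (r * r ^ length m * (Rabs (IZR (q a - q j0)) * fold_right (fun k acc => Rabs (IZR k) * acc) 1 (map (fun j => (q j - q j0)%Z) m)))
         with ((r * Rabs (IZR (q a - q j0))) * (r ^ length m * fold_right (fun k acc => Rabs (IZR k) * acc) 1 (map (fun j => (q j - q j0)%Z) m))) by ring.
        assert (P : 0 <= fold_right (fun k acc => Rabs (IZR k) * acc) 1 (map (fun j => (q j - q j0)%Z) m)).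
        { clear. induction m as [|a m IH]; simpl; [lra|]. apply Rmult_le_pos; auto. apply Rabs_pos. }
        apply Rmult_le_compat.
        - apply Rmult_le_pos; [lra|apply Rabs_pos].
        - apply Rmult_le_pos; auto. apply pow_le; lra.
        - apply Sub; left; auto.
        - apply IH. intros j Hj. apply Sub; right; auto. }
      assert (Hvl : length vs = N) by (unfold vs; now rewrite length_map).
      rewrite Hvl.
      assert (Hk2T : 0 <= kappa ^ 2 * T) by (apply Rmult_le_pos; [apply pow_le|]; lra).
      apply Rle_trans with ((kappa ^ 2 * T) ^ N * (r ^ N * (INR N / 6) ^ N)).
      + rewrite <- !Rpow_mult_distr. apply pow_R1_Rle.
        assert (HsN : INR N <= w ^ 2 * r * T / 400). { apply Rle_trans with (INR (length l)); [now apply le_INR|lra]. }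
        (* From [N + 1 <= 2 * N] one gets [kappa >= w / (8 * N)]. With the divisor 6 of
           [abs_prod_lower] this gives [64 * 6 = 384], which is below the constant 400 of the
           statement. *)
        assert (K2 : w ^ 2 / (64 * INR N ^ 2) <= kappa ^ 2).
        { unfold kappa. replace ((w / (4 * (INR N + 1))) ^ 2) with (w ^ 2 / (16 * (INR N + 1) ^ 2)) by (field; lra).
          apply Rmult_le_compat_l; [apply pow_le; lra|]. apply Rinv_le_contravar; nra. }
        apply Rle_trans with (w ^ 2 / (64 * INR N ^ 2) * T * (r * (INR N / 6))).
        * replace (w ^ 2 / (64 * INR N ^ 2) * T * (r * (INR N / 6))) with ((w ^ 2 * r * T / 384) / INR N) by (field; lra).
          apply Rmult_le_reg_r with (INR N); [lra|].
          replace (w ^ 2 * r * T / 384 / INR N * INR N) with (w ^ 2 * r * T / 384) by (field; lra). lra.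
        * apply Rmult_le_compat_r; [apply Rmult_le_pos; lra|]. apply Rmult_le_compat_r; lra.
      + apply Rmult_le_compat_l; [now apply pow_le|].
        eapply Rle_trans; [|apply Hdp]. apply Rmult_le_compat_l; [apply pow_le; lra|auto]. }
  assert (Hkf : forall x, T <= Rabs (x - u0) -> Rabs (killer kappa u0 vs x) <= 1).
  { intros x Hx. pose proof (killer_far kappa u0 vs x T Hk ltac:(lra) Hx Hvs) as K.
    pose proof (Rabs_pos (killer kappa u0 vs x)). nra. }
  set (rest := Zs (fun j => if Z.eq_dec j j0 then RtoC 0 else
      Cmult (b j) (Cmult (Cmult (psi (p j)) (RtoC (killer kappa u0 vs (p j)))) (cexpi (- (2 * PI * p j * t0)))))) in *.
  assert (Hrest : Cmod rest <= A * (B / T) * C).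
  { unfold rest. apply (Zs_bound _ (fun j => A * (B / T) * g j)).
    - intros K. rewrite zsumR_scal. apply Rmult_le_compat_l; auto. apply Rmult_le_pos; auto. apply Rle_mult_inv_pos; lra.
    - intros j. assert (HBT : 0 <= B / T) by (apply Rle_mult_inv_pos; lra).
      assert (Pos : 0 <= A * (B / T) * g j) by (apply Rmult_le_pos; auto; now apply Rmult_le_pos).
      destruct (Z.eq_dec j j0) as [Ej|Ej]; [rewrite Cmod_0; auto|].
      destruct (classic (b j = RtoC 0)) as [Eb|Eb].
      { rewrite Eb, Cmult_0_l, Cmod_0; auto. }
      destruct (Rle_dec (Rabs (p j - u0)) T) as [L|L].
      { rewrite killer_zero. 2: { apply in_map. apply Hl'. auto. }
        rewrite Cmult_0_r, Cmult_0_l, Cmult_0_r, Cmod_0; auto. }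
      rewrite !Cmod_mult, Cmod_cexpi, Cmod_R, Rmult_1_r, Rmult_assoc.
      apply Rmult_le_compat; auto; try apply Cmod_ge_0.
      { apply Rmult_le_pos; [apply Cmod_ge_0|apply Rabs_pos]. }
      specialize (HB (p j - u0)). rewrite <- Epsi in HB. specialize (Hgj j). specialize (Hkf (p j) ltac:(lra)).
      set (y := Rabs (p j - u0)) in *. set (k := Cmod (psi (p j))) in *.
      assert (Hk0 : 0 <= k) by apply Cmod_ge_0.
      apply Rle_trans with k. { pose proof (Rabs_pos (killer kappa u0 vs (p j))). nra. }
      apply Rle_trans with (B / T * / (1 + y) ^ 2); [|now apply Rmult_le_compat_l].
      assert (Hy2 : 0 < (1 + y) ^ 2) by (apply pow_lt; lra).
      apply Rmult_le_reg_r with (T * (1 + y) ^ 2); [apply Rmult_lt_0_compat; lra|].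
      replace (B / T * / (1 + y) ^ 2 * (T * (1 + y) ^ 2)) with B by (field; split; lra).
      apply Rle_trans with ((1 + y) ^ 3 * k); auto.
      replace (k * (T * (1 + y) ^ 2)) with (T * ((1 + y) ^ 2 * k)) by ring.
      replace ((1 + y) ^ 3 * k) with ((1 + y) * ((1 + y) ^ 2 * k)) by ring.
      apply Rmult_le_compat_r; [apply Rmult_le_pos; lra|lra]. }
  assert (Hmain : Cmod (psi u0) * Cmod (b j0) = Cmod rest).
  { assert (E : Cmult (b j0) (Cmult (Cmult (psi u0) (RtoC 1)) (cexpi (- (2 * PI * u0 * t0)))) = Copp rest).
    { transitivity (Cplus (Copp rest) (Cplus (Cmult (b j0) (Cmult (Cmult (psi u0) (RtoC 1)) (cexpi (- (2 * PI * u0 * t0))))) rest)); [ring|].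
      rewrite HG. ring. }
    apply (f_equal Cmod) in E. rewrite Cmod_opp, !Cmod_mult, Cmod_cexpi, Cmod_R, Rabs_R1 in E. lra. }
  assert (T * (Cmod (psi u0) * Cmod (b j0)) <= A * (B * C)).
  { rewrite Hmain. apply Rle_trans with (T * (A * (B / T) * C)); [apply Rmult_le_compat_l; lra|]. apply Req_le. field. lra. }
  assert (2 * (A * (B * C)) + Cmod (psi u0) * Cmod (b j0) <= T * (Cmod (psi u0) * Cmod (b j0))).
  { apply Rle_trans with (T0 * (Cmod (psi u0) * Cmod (b j0))); [|apply Rmult_le_compat_r; lra].
    apply Req_le. unfold T0. field. lra. }
  lra.
Qed.

(** * Spectral gaps of autocorrelations and of arithmetic progressions *)

(** The function [f] translated to [t] vanishes at every spectral point [sig * p s]. *)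
Lemma selfdual_gap rho p c sig kap f t w : selfdual rho p c sig kap -> testfun f ->
  (forall x, w <= Rabs x -> f x = RtoC 0) -> (forall s, c s <> RtoC 0 -> w <= Rabs (sig * p s - t)) ->
  gap_at p c (fourier f) t.
Proof.
  intros [Hp [Hs [Ht [Hsig [Hk Hid]]]]] Hf Hfw Hw. unfold gap_at.
  assert (Hft : testfun (fun x => f (1 * x + - t))) by (apply testfun_affine; auto; lra).
  specialize (Hid _ Hft). unfold dmeas in Hid.
  transitivity (Zs (fun j => Cmult (c j) (fourier (fun x => f (1 * x + - t)) (p j)))).
  - apply Zs_ext. intros j. rewrite (fourier_affine f 1 (- t)) by (auto using testfun_Cc; lra).
    rewrite Rabs_R1, Rinv_1, Rdiv_1_r. replace (2 * PI * - t * p j) with (- (2 * PI * p j * t)) by ring. ring.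
  - rewrite Hid, Zs_0; [ring|]. intros j. destruct (classic (c j = RtoC 0)) as [E|E]; [rewrite E; ring|].
    rewrite Hfw; [ring|]. replace (1 * (sig * p j) + - t) with (sig * p j - t) by ring. auto.
Qed.

Lemma Zs_zsum M (u : Z -> Z -> CC) : (forall l, summable (u l)) ->
  summable (fun j => zsum M (fun l => u l j)) /\ Zs (fun j => zsum M (fun l => u l j)) = zsum M (fun l => Zs (u l)).
Proof.
  intros H. induction M as [|M [I1 I2]]; cbn [zsum]; [split; auto; apply H|].
  assert (S2 : summable (fun j => Cplus (u (Z.of_nat (S M)) j) (u (- Z.of_nat (S M))%Z j))) by (apply summable_plus; auto).
  split.
  - apply (summable_plus (fun j => zsum M (fun l => u l j))); auto.
  - rewrite (Zs_plus (fun j => zsum M (fun l => u l j))), I2 by auto. f_equal. apply Zs_plus; auto.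
Qed.

Lemma sig_abs sig x : sig * sig = 1 -> Rabs (sig * x) = Rabs x.
Proof.
  intros H. assert (Rabs sig * Rabs sig = 1) by (rewrite <- Rabs_mult, H; apply Rabs_R1).
  assert (Rabs sig = 1) by (pose proof (Rabs_pos sig); nra). rewrite Rabs_mult, H1. ring.
Qed.

(** Bump sums of shrinking width converge to [val p c], and by the window identity each is an
    absolutely convergent trigonometric series in [u]. Truncation gives the polynomials; their
    coefficients carry the factor [c l], so only frequencies from the support occur. *)
Lemma selfdual_trig_approx rho p c sig kap : selfdual rho p c sig kap ->
  exists (M : nat -> nat) (d : nat -> Z -> CC) (A : R), 0 <= A /\ (forall n l, c l = RtoC 0 -> d n l = RtoC 0) /\
    (forall n u, Cmod (zsum (M n) (fun l => Cmult (d n l) (cexpi (- (2 * PI * sig * u * p l))))) <= A) /\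
    (forall u, clim (fun n => zsum (M n) (fun l => Cmult (d n l) (cexpi (- (2 * PI * sig * u * p l))))) (val p c u)).
Proof.
  intros H. assert (H' := H). destruct H' as [Hp [Hs [Ht [Hsig [Hk Hid]]]]].
  assert (Hr : 0 < rho) by apply Hp.
  destruct (selfdual_bounded _ _ _ _ _ H) as [A [HA HcA]].
  set (eps := fun n : nat => rho / 2 / INR (S n)).
  assert (Hinv : forall n : nat, 0 < / INR (S n)) by (intros; apply Rinv_0_lt_compat, lt_0_INR; lia).
  assert (Hinv1 : forall n : nat, / INR (S n) <= 1).
  { intros n. rewrite <- Rinv_1. apply Rinv_le_contravar; [lra|]. rewrite S_INR. pose proof (pos_INR n). lra. }
  assert (He : forall n, 0 < eps n) by (intros n; unfold eps, Rdiv; apply Rmult_lt_0_compat; [lra|apply Hinv]).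
  assert (He2 : forall n, eps n <= rho / 2).
  { intros n. unfold eps, Rdiv. rewrite <- (Rmult_1_r (rho * / 2)) at 2. apply Rmult_le_compat_l; [lra|apply Hinv1]. }
  set (d := fun n l => Cmult (Cinv kap) (Cmult (c l) (window sig (eps n) (p l)))).
  set (term := fun n u l => Cmult (d n l) (cexpi (- (2 * PI * sig * u * p l)))).
  assert (Eterm : forall n u, Zs (term n u) = bump_sum p c (eps n) u).
  { intros n u. pose proof (window_identity0 rho p c sig kap (eps n) u H (He n)) as W.
    transitivity (Cmult (Cinv kap) (Cmult kap (bump_sum p c (eps n) u))).
    - rewrite <- W, <- Zs_scal.
      + apply Zs_ext. intros j. unfold term, d. ring.
      + apply (summable_le _ (fun j => Cmult (c j) (window sig (eps n) (p j)))).
        * apply (summable_rapid rho); auto using cells_spread. apply rapid_window; auto.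
        * intros j. rewrite !Cmod_mult, Cmod_cexpi. lra.
    - rewrite Cmult_assoc, Cinv_l by auto. ring. }
  assert (Hsum : forall n, summable (d n)).
  { intros n. apply summable_scal. apply (summable_rapid rho); auto using cells_spread. apply rapid_window; auto. }
  (* The truncation error is uniform in [u] because [u] enters the series only through unimodular
     factors. *)
  assert (HM : forall n, exists M, forall u, Cmod (zsum M (term n u) - bump_sum p c (eps n) u)%C <= / INR (S n)).
  { intros n. destruct (Hsum n) as [B HB].
    destruct (bounded_tail (fun j => Cmod (d n j)) B (fun j => Cmod_ge_0 _) HB _ (Hinv n)) as [M HM].
    exists M. intros u. rewrite <- Eterm, Cmod_minus_sym.
    apply (Zs_tail _ (fun j => Cmod (d n j)) B M M); auto.
    intros j. unfold term. rewrite Cmod_mult, Cmod_cexpi. lra. }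
  set (M := fun n => proj1_sig (constructive_indefinite_description _ (HM n))).
  assert (HM' : forall n u, Cmod (zsum (M n) (term n u) - bump_sum p c (eps n) u)%C <= / INR (S n)).
  { intros n. unfold M. destruct (constructive_indefinite_description _ (HM n)) as [m Hm]. exact Hm. }
  exists M, d, (A + 1). split; [lra|]. split; [|split].
  - intros n l E. unfold d. rewrite E. ring.
  - intros n u. change (Cmod (zsum (M n) (term n u)) <= A + 1).
    pose proof (Cmod_le_minus (zsum (M n) (term n u)) (bump_sum p c (eps n) u)).
    pose proof (bump_sum_bound rho p c (eps n) u A Hp Hs (He n) (He2 n) HA HcA). specialize (HM' n u). specialize (Hinv1 n). lra.
  - intros u. change (clim (fun n => zsum (M n) (term n u)) (val p c u)).
    destruct (bump_sum_eventually rho p c u Hp Hs) as [e0 [He0 Hev]].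
    intros e Hepos. destruct (exists_nat_gt (Rmax (rho / 2 / e0) (/ e))) as [N [HN0 HN]].
    exists N. intros n Hn.
    assert (HnN : INR N <= INR (S n)) by (apply le_INR; lia).
    assert (HSn : 0 < INR (S n)) by (apply lt_0_INR; lia).
    pose proof (Rmax_l (rho / 2 / e0) (/ e)). pose proof (Rmax_r (rho / 2 / e0) (/ e)).
    rewrite <- (Hev (eps n)); auto.
    + eapply Rle_lt_trans; [apply HM'|]. rewrite <- (Rinv_inv e). apply Rinv_lt_contravar; [|lra].
      apply Rmult_lt_0_compat; auto. now apply Rinv_0_lt_compat.
    + unfold eps. apply Rmult_le_reg_r with (INR (S n)); auto.
      replace (rho / 2 / INR (S n) * INR (S n)) with (rho / 2) by (field; lra).
      apply Rmult_le_reg_l with (/ e0). now apply Rinv_0_lt_compat.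
      replace (/ e0 * (e0 * INR (S n))) with (INR (S n)) by (field; lra). unfold Rdiv in *. lra.
Qed.

(* The coefficients are bounded limits of trigonometric polynomials with spectrum in the support, so the product has
   spectrum in the difference set of the support, which avoids [(0, rho)]. *)
Lemma selfdual_product_gap rho p c sig kap h : selfdual rho p c sig kap ->
  spectral_gap p (fun j => Cmult (c j) (val p c (p j + h))) (rho / 2) (rho / 4).
Proof.
  intros H f t Hf Hfw Htw. assert (H' := H). destruct H' as [Hp [Hs [Ht [Hsig [Hk Hid]]]]].
  assert (Hr : 0 < rho) by apply Hp.
  destruct (selfdual_trig_approx _ _ _ _ _ H) as [M [d [A [HA [Hd0 [HdA Hdl]]]]]].
  set (e := fun j => cexpi (- (2 * PI * p j * t))).
  set (psi := fourier f). assert (Hpsi : rapid psi) by now apply rapid_fourier.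
  assert (Sc : summable (fun j => Cmult (c j) (psi (p j)))) by (apply (summable_rapid rho); auto using cells_spread).
  unfold gap_at. eapply clim_unique; [|apply clim_const].
  apply (clim_ext_from (fun n => Zs (fun j => Cmult (Cmult (c j) (Cmult (psi (p j)) (e j)))
      (zsum (M n) (fun l => Cmult (d n l) (cexpi (- (2 * PI * sig * (p j + h) * p l)))))))
      _ _ 0%nat).
  - intros n _.
    set (u := fun l j => Cmult (Cmult (d n l) (cexpi (- (2 * PI * sig * h * p l)))) (Cmult (c j) (Cmult (psi (p j)) (cexpi (- (2 * PI * p j * (t + sig * p l))))))).
    assert (Su : forall l, summable (u l)).
    { intros l. apply summable_scal, (summable_gap rho); auto. }
    transitivity (Zs (fun j => zsum (M n) (fun l => u l j))).
    + apply Zs_ext. intros j. rewrite <- zsum_scal. apply zsum_ext. intros l _. unfold u, e.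
      replace (- (2 * PI * sig * (p j + h) * p l)) with (- (2 * PI * sig * h * p l) + - (2 * PI * p j * (sig * p l))) by ring.
      replace (- (2 * PI * p j * (t + sig * p l))) with (- (2 * PI * p j * t) + - (2 * PI * p j * (sig * p l))) by ring.
      rewrite !cexpi_plus. ring.
    + destruct (Zs_zsum (M n) u Su) as [_ E]. rewrite E. apply zsum_0. intros l _. unfold u.
      rewrite Zs_scal by now apply (summable_gap rho).
      destruct (classic (c l = RtoC 0)) as [El|El]; [rewrite Hd0 by auto; ring|].
      (* Expanding the second factor replaces the frequency [t] by [t + sig * p l]. As
         [rho / 4 < t < 3 * rho / 4], while differences of spectral points are 0 or at least [rho]
         in modulus, a margin of [rho / 4] remains. *)
      assert (G : gap_at p c (fourier f) (t + sig * p l)).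
      { apply (selfdual_gap rho p c sig kap f _ (rho / 4)); auto. intros s Es.
        apply Rabs_def2 in Htw.
        destruct (Z.eq_dec s l) as [->|Hsl].
        - replace (sig * p l - (t + sig * p l)) with (- t) by ring. rewrite Rabs_Ropp, Rabs_pos_eq; lra.
        - specialize (Hs s l Es El Hsl). rewrite <- (sig_abs sig) in Hs by auto.
          replace (sig * p s - (t + sig * p l)) with (sig * (p s - p l) - t) by ring.
          pose proof (Rabs_triang_inv (sig * (p s - p l)) t) as T. rewrite (Rabs_pos_eq t) in T by lra. lra. }
      unfold gap_at in G. fold psi in G. rewrite G. ring.
  - destruct (summable_scal (RtoC A) _ Sc) as [B HB].
    eapply Zs_dominated; [exact HB| |].
    + intros n j. cbv beta. rewrite !Cmod_mult. unfold e. rewrite Cmod_cexpi, Cmod_R, (Rabs_pos_eq A), Rmult_1_r by lra.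
      rewrite Rmult_comm. apply Rmult_le_compat_r; [apply Rmult_le_pos; apply Cmod_ge_0|apply HdA].
    + intros j. cbv beta.
      replace (Cmult (Cmult (c j) (val p c (p j + h))) (Cmult (psi (p j)) (cexpi (- (2 * PI * p j * t)))))
        with (Cmult (Cmult (c j) (Cmult (psi (p j)) (e j))) (val p c (p j + h))) by (unfold e; ring).
      exact (clim_scal (Cmult (c j) (Cmult (psi (p j)) (e j))) _ _ (Hdl (p j + h))).
Qed.

Lemma gap_at_plus rho p b psi phi t : cells rho p -> tame p b -> rapid psi -> rapid phi ->
  gap_at p b psi t -> gap_at p b phi t -> gap_at p b (fun x => Cplus (psi x) (phi x)) t.
Proof.
  intros Hp Hb R1 R2 G1 G2. unfold gap_at in *.
  transitivity (Cplus (RtoC 0) (RtoC 0)); [|ring]. rewrite <- G1 at 1. rewrite <- G2, <- Zs_plus by now apply (summable_gap rho).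
  apply Zs_ext. intros; ring.
Qed.

Definition in_progression (x0 y u : R) : Prop := exists k : Z, u = x0 + IZR k * y.

Definition restrict (P : R -> Prop) (p : Z -> R) (c : Z -> CC) (j : Z) : CC := if decide (P (p j)) then c j else RtoC 0.

Lemma restrict_nonzero P p c j : restrict P p c j <> RtoC 0 -> P (p j) /\ c j <> RtoC 0.
Proof.
  unfold restrict. destruct (decide (P (p j))) eqn:E; intros H; [|congruence].
  apply (proj1 (decide_true _)) in E. split; assumption.
Qed.

(* [cos^(2n)] converges to the indicator of the progression, and multiplication by it only shifts the spectrum by multiples of [1/y]. *)
Lemma selfdual_progression_gap rho p c sig kap x0 y t0 w : selfdual rho p c sig kap -> y <> 0 ->
  (forall s (m : Z) t, c s <> RtoC 0 -> Rabs (t - t0) < w -> w <= Rabs (sig * p s - (t + IZR m / y))) ->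
  spectral_gap p (restrict (in_progression x0 y) p c) t0 w.
Proof.
  intros H Hy Hgap f t Hf Hfw Htw. assert (H' := H). destruct H' as [Hp [Hs [Ht [Hsig [Hk Hid]]]]].
  set (K := fun x => cos (PI * (x - x0) / y) ^ 2).
  assert (HK : forall x, 0 <= K x <= 1).
  { intros x. unfold K. split; [apply pow2_ge_0|]. pose proof (COS_bound (PI * (x - x0) / y)). nra. }
  set (psi := fourier f). assert (Hpsi : rapid psi) by now apply rapid_fourier.
  assert (Kn : forall n x, 0 <= K x ^ n <= 1).
  { intros n x. specialize (HK x). split; [apply pow_le; lra|]. rewrite <- (pow1 n). apply pow_incr; lra. }
  (* Since [K x] is 1/2 plus a quarter of the characters of frequency [/ y] and [- / y], one more
     factor uses the gaps at three neighbouring frequencies; hence the induction carries all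
     [t + m / y] at once. *)
  assert (P : forall n, rapid (fun x => Cmult (psi x) (RtoC (K x ^ n))) /\ forall m : Z, gap_at p c (fun x => Cmult (psi x) (RtoC (K x ^ n))) (t + IZR m / y)).
  { induction n as [|n [I1 I2]].
    - assert (E : (fun x => Cmult (psi x) (RtoC (K x ^ 0))) = psi) by (apply functional_extensionality; intros; simpl; ring).
      rewrite E. split; auto. intros m. apply (selfdual_gap rho p c sig kap f _ w); auto.
    - split.
      + apply (rapid_RtoC_mult (fun x => K x ^ S n) psi 1); auto. intros x. specialize (Kn (S n) x). rewrite Rabs_pos_eq; lra.
      + intros m. set (phi := fun x => Cmult (psi x) (RtoC (K x ^ n))) in *.
        set (al := Cmult (RtoC (/ 4)) (cexpi (- (2 * PI / y * x0)))). set (be := Cmult (RtoC (/ 4)) (cexpi (2 * PI / y * x0))).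
        assert (G1 : gap_at p c (fun x => Cmult (phi x) (Cplus (Cmult al (cexpi (2 * PI * (/ y) * x))) (Cmult be (cexpi (- (2 * PI * (/ y) * x)))))) (t + IZR m / y)).
        { apply (gap_at_trig rho); auto.
          - replace (t + IZR m / y - / y) with (t + IZR (m - 1) / y) by (rewrite minus_IZR; field; auto). apply I2.
          - replace (t + IZR m / y + / y) with (t + IZR (m + 1) / y) by (rewrite plus_IZR; field; auto). apply I2. }
        (* The constant 1/2 in [K], written as two quarters of the character of frequency 0. *)
        assert (G2 : gap_at p c (fun x => Cmult (phi x) (Cplus (Cmult (RtoC (/ 4)) (cexpi (2 * PI * 0 * x))) (Cmult (RtoC (/ 4)) (cexpi (- (2 * PI * 0 * x)))))) (t + IZR m / y)).
        { apply (gap_at_trig rho); auto; [rewrite Rminus_0_r|rewrite Rplus_0_r]; apply I2. }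
        assert (R0 : forall al be eta, rapid (fun x => Cmult (phi x) (Cplus (Cmult al (cexpi (2 * PI * eta * x))) (Cmult be (cexpi (- (2 * PI * eta * x))))))).
        { intros a b eta. apply (rapid_le (fun x => Cmult (RtoC (Cmod a + Cmod b)) (phi x))).
          - apply (rapid_mult (fun _ => RtoC (Cmod a + Cmod b))); auto. exists (Cmod (RtoC (Cmod a + Cmod b))). intros; lra.
          - intros x. rewrite !Cmod_mult, Cmod_R, Rabs_pos_eq, Rmult_comm by (pose proof (Cmod_ge_0 a); pose proof (Cmod_ge_0 b); lra).
            apply Rmult_le_compat_r; [apply Cmod_ge_0|]. eapply Rle_trans; [apply Cmod_triangle|].
            rewrite !Cmod_mult, !Cmod_cexpi. lra. }
        pose proof (gap_at_plus rho p c _ _ _ Hp Ht (R0 _ _ _) (R0 _ _ _) G1 G2) as G.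
        match type of G with gap_at _ _ ?g _ => replace (fun x => Cmult (psi x) (RtoC (K x ^ S n))) with g; auto end.
        apply functional_extensionality; intros x. unfold phi.
        replace (2 * PI * 0 * x) with 0 by ring. rewrite Ropp_0, cexpi_0.
        assert (EK : K x = / 2 + / 2 * cos (2 * PI / y * x + - (2 * PI / y * x0))).
        { unfold K. replace (2 * PI / y * x + - (2 * PI / y * x0)) with (2 * (PI * (x - x0) / y)) by (field; auto).
          rewrite cos_2a_cos. field. }
        assert (EC : Cplus (Cmult al (cexpi (2 * PI * / y * x))) (Cmult be (cexpi (- (2 * PI * / y * x)))) = RtoC (/ 2 * cos (2 * PI / y * x + - (2 * PI / y * x0)))).
        { unfold al, be. rewrite <- !Cmult_assoc, <- !cexpi_plus.
          replace (- (2 * PI / y * x0) + 2 * PI * / y * x) with (2 * PI / y * x + - (2 * PI / y * x0)) by (unfold Rdiv; ring).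
          replace (2 * PI / y * x0 + - (2 * PI * / y * x)) with (- (2 * PI / y * x + - (2 * PI / y * x0))) by (unfold Rdiv; ring).
          unfold cexpi. rewrite cos_neg, sin_neg. ceq; field. }
        rewrite EC. rewrite <- tech_pow_Rmult. set (v := K x ^ n). rewrite EK. ceq; field. }
  assert (Lim : forall x, is_lim_seq (fun n => K x ^ n) (Finite (if decide (in_progression x0 y x) then 1 else 0))).
  { intros x. destruct (decide (in_progression x0 y x)) eqn:E.
    - apply (proj1 (decide_true _)) in E. destruct E as [k ->].
      assert (EK : K (x0 + IZR k * y) = 1).
      { unfold K. replace (PI * (x0 + IZR k * y - x0) / y) with (IZR k * PI) by (field; auto).
        assert (Hsin : sin (IZR k * PI) = 0) by (apply sin_eq_0_1; now exists k).
        pose proof (sin2_cos2 (IZR k * PI)) as Q. rewrite Hsin in Q. unfold Rsqr in Q. simpl. lra. }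
      apply is_lim_seq_ext with (fun _ => 1); [|apply is_lim_seq_const]. intros n. now rewrite EK, pow1.
    - apply is_lim_seq_geom. rewrite Rabs_pos_eq by apply HK.
      apply Rnot_le_lt. intros L. assert (EK : K x = 1) by (specialize (HK x); lra).
      assert (Hsin : sin (PI * (x - x0) / y) = 0).
      { unfold K in EK. pose proof (sin2_cos2 (PI * (x - x0) / y)) as Q. unfold Rsqr in Q. simpl in EK. nra. }
      apply sin_eq_0_0 in Hsin. destruct Hsin as [k Hk'].
      assert (in_progression x0 y x).
      { exists k. apply Rmult_eq_reg_r with (PI / y).
        - replace ((x0 + IZR k * y) * (PI / y)) with (x0 * (PI / y) + IZR k * PI) by (field; auto). rewrite <- Hk'. field; auto.
        - apply Rmult_integral_contrapositive. split; [apply PI_neq0|now apply Rinv_neq_0_compat]. }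
      rewrite (proj2 (decide_true _) H0) in E; congruence. }
  assert (G : gap_at p c (fun x => Cmult (psi x) (RtoC (if decide (in_progression x0 y x) then 1 else 0))) t).
  { apply (gap_at_limit rho p c (fun n x => Cmult (psi x) (RtoC (K x ^ n))) _ psi); auto.
    - intros n x. rewrite Cmod_mult, Cmod_R. specialize (Kn n x). rewrite Rabs_pos_eq by lra. pose proof (Cmod_ge_0 (psi x)). nra.
    - intros x. apply clim_RtoC_mult, Lim.
    - exists 0%nat. intros n _. destruct (P n) as [_ Pn]. specialize (Pn 0%Z).
      replace (t + 0 / y) with t in Pn by (unfold Rdiv; ring). exact Pn. }
  unfold gap_at in *. rewrite <- G. apply Zs_ext. intros j. unfold restrict.
  destruct (decide (in_progression x0 y (p j))); fold psi; ring.
Qed.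

(** * Counting *)

(** Lower density of a set of indices. The slack [B] and the restriction to large [T] absorb
    translations and the passage from positions to indices. *)
Definition dense (c a : R) (K : Z -> Prop) : Prop :=
  exists T0 B, forall T, T0 <= T -> exists l, NoDup l /\ (forall j, In j l -> K j /\ Rabs (IZR j) <= a * T + B) /\
    c * T <= INR (length l).

Lemma dense_union n c a (K : nat -> Z -> Prop) : (forall i, (i < n)%nat -> dense c a (K i)) ->
  exists T0 B, forall T, T0 <= T -> exists L : list (nat * Z), NoDup L /\
    (forall q, In q L -> (fst q < n)%nat /\ K (fst q) (snd q) /\ Rabs (IZR (snd q)) <= a * T + B) /\ INR n * (c * T) <= INR (length L).
Proof.
  induction n as [|n IH]; intros H.
  - exists 0, 0. intros T _. exists []. split; [constructor|]. split; [intros q []|simpl; lra].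
  - destruct IH as [T1 [B1 H1]]; [intros; apply H; lia|]. destruct (H n (Nat.lt_succ_diag_r n)) as [T2 [B2 H2]].
    exists (Rmax T1 T2), (Rmax B1 B2). intros T HT.
    pose proof (Rmax_l T1 T2). pose proof (Rmax_r T1 T2). pose proof (Rmax_l B1 B2). pose proof (Rmax_r B1 B2).
    destruct (H1 T ltac:(lra)) as [L [L1 [L2 L3]]]. destruct (H2 T ltac:(lra)) as [l [l1 [l2 l3]]].
    exists (map (fun j => (n, j)) l ++ L). split; [|split].
    + apply NoDup_app; auto.
      * apply NoDup_map_NoDup_ForallPairs; auto. intros i j _ _ E. congruence.
      * intros q Hq1 Hq2. apply in_map_iff in Hq1. destruct Hq1 as [j [<- _]]. apply L2 in Hq2. simpl in Hq2. lia.
    + intros q Hq. apply in_app_or in Hq. destruct Hq as [Hq|Hq].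
      * apply in_map_iff in Hq. destruct Hq as [j [<- Hj]]. apply l2 in Hj. simpl. repeat split; try lia; try tauto. lra.
      * apply L2 in Hq. repeat split; try lia; try tauto. lra.
    + rewrite length_app, length_map, plus_INR, S_INR. lra.
Qed.

Lemma not_NoDup_map {X Y} (F : X -> Y) (L : list X) : NoDup L -> ~ NoDup (map F L) ->
  exists a b, In a L /\ In b L /\ a <> b /\ F a = F b.
Proof.
  intros Hnd Hn. apply NNPP. intros C. apply Hn. apply NoDup_map_NoDup_ForallPairs; auto.
  intros a b Ha Hb E. apply NNPP. intros C'. apply C. exists a, b. auto.
Qed.

(** Pigeonhole: the [n] sets supply at least [n * c * T] pairs, whose images lie in an interval of
    length [2 * d * a * T] up to a constant; for large [T] two images coincide. *)
Lemma dense_collision n c a d e (K : nat -> Z -> Prop) (G : nat -> Z -> Z) : 0 < c -> 0 <= d -> 0 <= a ->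
  (forall i, (i < n)%nat -> dense c a (K i)) ->
  (forall i j, (i < n)%nat -> K i j -> Rabs (IZR (G i j)) <= d * Rabs (IZR j) + e) ->
  2 * d * a < INR n * c ->
  exists i j i' j', (i < n)%nat /\ (i' < n)%nat /\ K i j /\ K i' j' /\ (i, j) <> (i', j') /\ G i j = G i' j'.
Proof.
  intros Hc Hd Ha HK HG Hn. destruct (dense_union n c a K HK) as [T0 [B0 HB]].
  set (gap := INR n * c - 2 * d * a). assert (Hgap : 0 < gap) by (unfold gap; lra).
  set (B := Rabs B0). set (e1 := Rabs e).
  assert (HB0 : B0 <= B /\ 0 <= B) by (split; [apply Rle_abs|apply Rabs_pos]).
  assert (He1 : e <= e1 /\ 0 <= e1) by (split; [apply Rle_abs|apply Rabs_pos]).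
  set (E := 2 * (d * B + e1) + 4).
  set (T := Rmax (Rmax T0 0) (E / gap)).
  assert (HT0 : T0 <= T /\ 0 <= T /\ E / gap <= T).
  { unfold T. pose proof (Rmax_l (Rmax T0 0) (E / gap)). pose proof (Rmax_r (Rmax T0 0) (E / gap)). pose proof (Rmax_l T0 0). pose proof (Rmax_r T0 0). lra. }
  destruct HT0 as [HT0 [HT1 HT2]].
  destruct (HB T HT0) as [L [L1 [L2 L3]]].
  set (F := fun q : nat * Z => G (fst q) (snd q)).
  assert (Hnd : ~ NoDup (map F L)).
  { intros Hnd. set (X := d * (a * T + B) + e1).
    assert (HX : 0 <= X).
    { unfold X. assert (0 <= d * (a * T + B)); [|lra]. apply Rmult_le_pos; auto. assert (0 <= a * T) by now apply Rmult_le_pos. lra. }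
    destruct (floor_cell 1 X Rlt_0_1) as [k Hk]. rewrite !Rmult_1_r in Hk.
    assert (Hk0 : (0 <= k)%Z).
    { assert (-1 < IZR k) by lra. apply lt_IZR in H. lia. }
    assert (Hincl : incl (map F L) (zrange (Z.to_nat k))).
    { intros z Hz. apply in_map_iff in Hz. destruct Hz as [q [<- Hq]]. destruct (L2 q Hq) as [Q1 [Q2 Q3]].
      pose proof (HG _ _ Q1 Q2) as Q4. apply In_zrange. rewrite Z2Nat.id by auto.
      assert (d * Rabs (IZR (snd q)) <= d * (a * T + B)) by (apply Rmult_le_compat_l; auto; lra).
      assert (Rabs (IZR (F q)) < IZR k + 1) by (unfold F, X in *; lra).
      rewrite <- abs_IZR, <- plus_IZR in H0. apply lt_IZR in H0. lia. }
    pose proof (NoDup_incl_length Hnd Hincl) as Hl. rewrite length_map in Hl.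
    unfold zrange in Hl. rewrite length_map, length_seq in Hl. apply le_INR in Hl.
    rewrite plus_INR, mult_INR, (INR_IZR_INZ (Z.to_nat k)), Z2Nat.id in Hl by auto. simpl (INR 2) in Hl. simpl (INR 1) in Hl.
    assert (gap * T <= 2 * (d * B + e1) + 1).
    { unfold gap. replace ((INR n * c - 2 * d * a) * T) with (INR n * (c * T) - 2 * (d * (a * T))) by ring. unfold X in Hk. lra. }
    assert (E <= gap * T). { apply Rmult_le_reg_r with (/ gap). now apply Rinv_0_lt_compat. replace (gap * T * / gap) with T by (field; lra). exact HT2. }
    unfold E in H0. lra. }
  destruct (not_NoDup_map F L L1 Hnd) as [q [q' [Hq [Hq' [Hne HE]]]]].
  destruct (L2 q Hq) as [Q1 [Q2 _]]. destruct (L2 q' Hq') as [Q1' [Q2' _]].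
  exists (fst q), (snd q), (fst q'), (snd q'). repeat split; auto.
  rewrite <- !surjective_pairing. exact Hne.
Qed.

Definition difference (p : Z -> R) (c : Z -> CC) (h : R) : Prop :=
  exists i j, c i <> RtoC 0 /\ c j <> RtoC 0 /\ h = p i - p j.

(** Neighbouring cells are handled by the separation; for [|i - j| >= 2] the cells alone give
    [rho * (|i - j| - 1)], which is at least half of [rho * |i - j|]. *)
Lemma separated_linear rho p c i j : cells rho p -> separated rho p c -> c i <> RtoC 0 -> c j <> RtoC 0 -> i <> j ->
  rho / 2 * Rabs (IZR (i - j)) <= Rabs (p i - p j).
Proof.
  intros [Hr Hp] Hs Hi Hj Hij. specialize (Hs i j Hi Hj Hij).
  destruct (Z.eq_dec (Z.abs (i - j)) 1) as [E|E].
  - rewrite <- abs_IZR, E. lra.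
  - assert (H2 : 2 <= Rabs (IZR (i - j))) by (rewrite <- abs_IZR; apply IZR_le; lia).
    pose proof (Hp i) as A. pose proof (Hp j) as B. rewrite minus_IZR in *.
    assert (rho * (Rabs (IZR i - IZR j) - 1) <= Rabs (p i - p j)).
    { unfold Rabs at 1. destruct (Rcase_abs (IZR i - IZR j)).
      - rewrite <- Rabs_Ropp. eapply Rle_trans; [|apply Rle_abs]. nra.
      - eapply Rle_trans; [|apply Rle_abs]. nra. }
    nra.
Qed.

Lemma cells_index_bound rho p j u T : cells rho p -> Rabs (p j - u) <= T -> Rabs (IZR j) <= / rho * T + (Rabs u + rho) / rho.
Proof.
  intros [Hr Hp] H. specialize (Hp j).
  assert (A : Rabs (IZR j) * rho <= T + Rabs u + rho).
  { rewrite <- (Rabs_pos_eq rho) at 1 by lra. rewrite <- Rabs_mult.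
    replace (IZR j * rho) with ((p j - u) + u + (IZR j * rho - p j)) by ring.
    eapply Rle_trans; [apply Rabs_triang|]. apply Rplus_le_compat; [|apply Rabs_le; lra].
    eapply Rle_trans; [apply Rabs_triang|]. lra. }
  apply Rmult_le_reg_r with rho; auto.
  replace ((/ rho * T + (Rabs u + rho) / rho) * rho) with (T + Rabs u + rho) by (field; lra). exact A.
Qed.

(** For each difference [h] the product [c(x) c(x + h)] is somewhere nonzero and has a gap
    independent of [h], so the points [x] with [x] and [x + h] both in the support have density at
    least [c1]. If there were too many [h] in a bounded interval, two of them would share both [x]
    and [x + h]. *)
Lemma differences_bounded rho p c sig kap W : selfdual rho p c sig kap -> 0 <= W ->
  exists M : nat, forall t hs, NoDup hs -> (forall h, In h hs -> difference p c h /\ t <= h <= t + W) -> (length hs <= M)%nat.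
Proof.
  intros H HW. assert (H' := H). destruct H' as [Hp [Hs _]]. assert (Hr : 0 < rho) by apply Hp.
  destruct (selfdual_bounded _ _ _ _ _ H) as [A [HA HcA]].
  (* The density supplied by [gap_density] for gap parameter [rho / 4] and spacing [rho / 2]. *)
  set (c1 := (rho / 4) ^ 2 * (rho / 2) / 400).
  assert (Hc1 : 0 < c1).
  { unfold c1, Rdiv. repeat apply Rmult_lt_0_compat; lra. }
  destruct (archimed (W / rho)) as [U1 U2]. set (Wn := (up (W / rho) + 2)%Z) in *.
  assert (HWn : 2 < IZR Wn).
  { unfold Wn. rewrite plus_IZR. assert (0 <= W / rho) by (apply Rle_mult_inv_pos; auto). lra. }
  destruct (exists_nat_gt (2 * IZR Wn * (/ rho) / c1)) as [M [_ HM]].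
  exists M. intros t hs Hnd Hhs. apply Nat.nlt_ge. intros Hlen.
  set (h := fun i => nth i hs 0).
  assert (Hh : forall i, (i < length hs)%nat -> difference p c (h i) /\ t <= h i <= t + W).
  { intros i Hi. apply Hhs, nth_In; auto. }
  set (K := fun i j => Cmult (c j) (val p c (p j + h i)) <> RtoC 0).
  assert (HKc : forall i j, K i j -> c j <> RtoC 0 /\ val p c (p j + h i) <> RtoC 0).
  { intros i j HK. split; intros E; apply HK; rewrite E; ring. }
  assert (HK : forall i, (i < length hs)%nat -> dense c1 (/ rho) (K i)).
  { intros i Hi. destruct (Hh i Hi) as [[i1 [j1 [D1 [D2 D3]]]] _].
    assert (Hb : forall j, Cmod (Cmult (c j) (val p c (p j + h i))) <= A * A).
    { intros j. rewrite Cmod_mult. apply Rmult_le_compat; try apply Cmod_ge_0; auto. apply val_bound; auto. }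
    destruct (gap_density rho p (fun j => Cmult (c j) (val p c (p j + h i))) (A * A) (rho / 2) (rho / 4) (rho / 2) (fun j => j) j1)
      as [T0 [HT0 HT]]; auto; try lra.
    - now apply Rmult_le_pos.
    - apply (selfdual_product_gap _ _ _ _ _ (h i) H).
    - intros a b Ha Hb' Hab. split; auto. apply (separated_linear rho p c); auto; [exact (proj1 (HKc i a Ha))|exact (proj1 (HKc i b Hb'))].
    - rewrite D3. replace (p j1 + (p i1 - p j1)) with (p i1) by ring. rewrite (val_p rho) by auto.
      apply Cmult_neq_0; auto.
    - exists T0, ((Rabs (p j1) + rho) / rho). intros T HTT. destruct (HT T HTT) as [l [L1 [L2 L3]]].
      exists l. split; [auto|]. split.
      + intros j Hj. destruct (L2 j Hj) as [L4 L5]. split; auto. now apply (cells_index_bound rho p).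
      + unfold c1. lra. }
  assert (Hidx : forall u, exists j, val p c u <> RtoC 0 -> p j = u).
  { intros u. destruct (classic (val p c u <> RtoC 0)) as [V|V].
    - destruct (val_nonzero p c u V) as [j [E _]]. exists j; auto.
    - exists 0%Z. intros; contradiction. }
  set (idx := fun u => proj1_sig (constructive_indefinite_description _ (Hidx u))).
  assert (Hidx' : forall u, val p c u <> RtoC 0 -> p (idx u) = u).
  { intros u. unfold idx. destruct (constructive_indefinite_description _ (Hidx u)) as [j Hj]. exact Hj. }
  destruct (floor_cell rho t Hr) as [s Hsf].
  set (ix := fun i j => idx (p j + h i)).
  assert (Hix : forall i j, K i j -> p (ix i j) = p j + h i) by (intros i j HKij; apply Hidx', HKc; exact HKij).
  (* Encodes the index of [x] and the relative cell of [x + h] in one integer: the second summand is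
     a remainder modulo [Wn]. The [+ 2] in [Wn] accounts for the position of [x] in its cell and of
     [t] in its cell. *)
  set (G := fun i j => (j * Wn + (ix i j - j - s))%Z).
  assert (Hrem : forall i j, (i < length hs)%nat -> K i j -> (0 <= ix i j - j - s < Wn)%Z).
  { intros i j Hi HKij. pose proof (Hix i j HKij) as Hx.
    destruct (Hh i Hi) as [_ Hb]. destruct Hp as [_ Hp]. pose proof (Hp j) as P1. pose proof (Hp (ix i j)) as P2.
    rewrite Hx in P2. set (j' := ix i j) in *.
    split.
    - assert (A1 : -1 < IZR (j' - j - s)) by (rewrite !minus_IZR; nra). apply lt_IZR in A1. lia.
    - apply lt_IZR. rewrite !minus_IZR. unfold Wn. rewrite plus_IZR.
      apply Rmult_lt_reg_r with rho; auto.
      assert (W < IZR (up (W / rho)) * rho).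
      { replace W with (W / rho * rho) at 1 by (field; lra). apply Rmult_lt_compat_r; lra. }
      nra. }
  assert (HGb : forall i j, (i < length hs)%nat -> K i j -> Rabs (IZR (G i j)) <= IZR Wn * Rabs (IZR j) + IZR Wn).
  { intros i j Hi HKij. specialize (Hrem i j Hi HKij). unfold G. rewrite plus_IZR, mult_IZR.
    eapply Rle_trans; [apply Rabs_triang|]. rewrite Rabs_mult, (Rabs_pos_eq (IZR Wn)) by lra.
    assert (Rabs (IZR (ix i j - j - s)) <= IZR Wn).
    { rewrite <- abs_IZR. apply IZR_le. lia. }
    lra. }
  destruct (dense_collision (length hs) c1 (/ rho) (IZR Wn) (IZR Wn) K G) as [i [j [i' [j' [Hi [Hi' [HKi [HKi' [Hne HE]]]]]]]]]; auto; try lra.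
  - apply Rlt_le, Rinv_0_lt_compat; auto.
  - assert (INR M <= INR (length hs)) by (apply le_INR; lia).
    apply Rmult_lt_reg_r with (/ c1). now apply Rinv_0_lt_compat.
    replace (INR (length hs) * c1 * / c1) with (INR (length hs)) by (field; lra). unfold Rdiv in HM. lra.
  - pose proof (Hrem i j Hi HKi) as R1. pose proof (Hrem i' j' Hi' HKi') as R2. unfold G in HE.
    assert (Ej : j = j') by nia. subst j'.
    assert (Ek : ix i j = ix i' j) by lia.
    assert (Eh : h i = h i').
    { pose proof (Hix i j HKi) as V1. pose proof (Hix i' j HKi') as V2. rewrite Ek in V1. lra. }
    apply Hne. f_equal. apply (proj1 (NoDup_nth hs 0) Hnd); auto.
Qed.

Lemma finite_of_bounded {X} (P : X -> Prop) (M : nat) :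
  (forall l, NoDup l -> (forall x, In x l -> P x) -> (length l <= M)%nat) -> exists l, forall x, P x -> In x l.
Proof.
  intros H. assert (Q : forall n, (n <= S M)%nat -> (exists l, NoDup l /\ (forall x, In x l -> P x) /\ length l = n) \/ exists l, forall x, P x -> In x l).
  { induction n as [|n IH]; intros Hn.
    - left. exists []. split; [constructor|]. split; [intros x []|auto].
    - destruct IH as [[l [L1 [L2 L3]]]|IH]; [lia| |right; auto].
      destruct (classic (exists x, P x /\ ~ In x l)) as [[x [Hx1 Hx2]]|C].
      + left. exists (x :: l). split; [constructor; auto|]. split; [|simpl; lia]. intros z [<-|Hz]; auto.
      + right. exists l. intros x Hx. apply NNPP. intros C'. apply C. now exists x. }
  destruct (Q (S M) (Nat.le_refl _)) as [[l [L1 [L2 L3]]]|Q']; auto.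
  specialize (H l L1 L2). lia.
Qed.

(** * Simultaneous approximation and walks *)

(** Dirichlet's box principle. The bound [Q] is fixed before the number to be approximated, as the
    iteration in [dirichlet_list] demands. *)
Lemma dirichlet_one (x eta : R) : 0 < eta -> exists Q : nat, (0 < Q)%nat /\ / INR Q <= eta /\
  forall x, exists (q : nat) (k : Z), (1 <= q <= Q)%nat /\ Rabs (INR q * x - IZR k) <= eta.
Proof.
  intros He. destruct (exists_nat_gt (/ eta)) as [Q [HQ0 HQ]].
  assert (HQp : 0 < INR Q) by now apply lt_0_INR.
  assert (HQe : / INR Q <= eta).
  { rewrite <- (Rinv_inv eta). apply Rinv_le_contravar; [now apply Rinv_0_lt_compat|lra]. }
  exists Q. split; [auto|]. split; auto. clear x. intros x.
  assert (Hfl : forall i : nat, exists k : Z, IZR k <= INR i * x < IZR k + 1).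
  { intros i. destruct (floor_cell 1 (INR i * x) Rlt_0_1) as [k Hk]. exists k. lra. }
  set (fl := fun i => proj1_sig (constructive_indefinite_description _ (Hfl i))).
  assert (Hf : forall i, IZR (fl i) <= INR i * x < IZR (fl i) + 1).
  { intros i. unfold fl. destruct (constructive_indefinite_description _ (Hfl i)) as [k Hk]. exact Hk. }
  assert (Hbx : forall i : nat, exists b : nat, INR b <= INR Q * (INR i * x - IZR (fl i)) < INR b + 1).
  { intros i. specialize (Hf i). destruct (floor_cell 1 (INR Q * (INR i * x - IZR (fl i))) Rlt_0_1) as [k Hk].
    assert (0 <= k)%Z. { assert (-1 < IZR k) by nra. apply lt_IZR in H. lia. }
    exists (Z.to_nat k). rewrite INR_IZR_INZ, Z2Nat.id by auto. lra. }
  set (bx := fun i => proj1_sig (constructive_indefinite_description _ (Hbx i))).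
  assert (Hb : forall i, INR (bx i) <= INR Q * (INR i * x - IZR (fl i)) < INR (bx i) + 1).
  { intros i. unfold bx. destruct (constructive_indefinite_description _ (Hbx i)) as [k Hk]. exact Hk. }
  assert (Hnd : ~ NoDup (map bx (seq 0 (S Q)))).
  { intros Hnd. assert (Hincl : incl (map bx (seq 0 (S Q))) (seq 0 Q)).
    { intros b Hb'. apply in_map_iff in Hb'. destruct Hb' as [i [<- _]]. apply in_seq. split; [lia|].
      apply INR_lt. specialize (Hb i). specialize (Hf i). rewrite Nat.add_0_l. nra. }
    pose proof (NoDup_incl_length Hnd Hincl) as L. rewrite length_map, !length_seq in L. lia. }
  destruct (not_NoDup_map bx _ (seq_NoDup (S Q) 0) Hnd) as [i [j [Hi [Hj [Hne E]]]]].
  assert (W : forall i j : nat, (i < j)%nat -> (j <= Q)%nat -> bx i = bx j -> exists (q : nat) (k : Z), (1 <= q <= Q)%nat /\ Rabs (INR q * x - IZR k) <= eta).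
  { clear i j Hi Hj Hne E. intros i j Hij HjQ E. exists (j - i)%nat, (fl j - fl i)%Z. split; [lia|].
    rewrite minus_INR, minus_IZR by lia. pose proof (Hb i) as B1. pose proof (Hb j) as B2. rewrite E in B1.
    replace ((INR j - INR i) * x - (IZR (fl j) - IZR (fl i))) with ((INR j * x - IZR (fl j)) - (INR i * x - IZR (fl i))) by ring.
    set (u := INR j * x - IZR (fl j)) in *. set (v := INR i * x - IZR (fl i)) in *.
    apply Rle_trans with (/ INR Q); auto. apply Rmult_le_reg_l with (INR Q); auto. rewrite Rinv_r by lra.
    rewrite <- (Rabs_pos_eq (INR Q)) by lra. rewrite <- Rabs_mult. apply Rabs_le. lra. }
  apply in_seq in Hi. apply in_seq in Hj.
  destruct (Nat.lt_total i j) as [L|[L|L]]; [apply (W i j); auto; lia|contradiction|apply (W j i); auto; lia].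
Qed.

(** The numbers treated earlier are approximated within [eta / Q], so multiplying [t] by some
    [q <= Q] to accommodate the next one keeps them within [eta]. *)
Lemma dirichlet_list (B : list R) : forall eta Tm, 0 < eta -> exists t, Tm <= t /\ 0 < t /\
  forall b, In b B -> exists k : Z, Rabs (t * b - IZR k) <= eta.
Proof.
  induction B as [|b B IH]; intros eta Tm He.
  - exists (Rmax Tm 1). split; [apply Rmax_l|]. split; [|intros b []]. pose proof (Rmax_r Tm 1). lra.
  - destruct (dirichlet_one 0 eta He) as [Q [HQ0 [_ HQ]]].
    assert (HQp : 0 < INR Q) by now apply lt_0_INR.
    destruct (IH (eta / INR Q) (Rmax Tm 0)) as [t [Ht1 [Ht2 Ht3]]]; [now apply Rdiv_lt_0_compat|].
    pose proof (Rmax_l Tm 0). pose proof (Rmax_r Tm 0).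
    destruct (HQ (t * b)) as [q [k [Hq Hk]]].
    assert (Hq1 : 1 <= INR q) by (replace 1 with (INR 1) by reflexivity; apply le_INR; lia).
    assert (Hq2 : INR q <= INR Q) by (apply le_INR; lia).
    exists (INR q * t). split; [nra|]. split; [nra|]. intros a [<-|Ha].
    + exists k. now rewrite Rmult_assoc.
    + destruct (Ht3 a Ha) as [m Hm]. exists (Z.of_nat q * m)%Z. rewrite mult_IZR, <- INR_IZR_INZ.
      replace (INR q * t * a - INR q * IZR m) with (INR q * (t * a - IZR m)) by ring.
      rewrite Rabs_mult, Rabs_pos_eq by lra. apply Rle_trans with (INR Q * (eta / INR Q)).
      * apply Rmult_le_compat; auto; try lra. apply Rabs_pos.
      * apply Req_le. field. lra.
Qed.

Lemma discrete_ivt (f : nat -> R) n v e : 0 < e -> f 0%nat <= v -> v <= f n ->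
  (forall k, f (S k) - f k <= e) -> exists i, (i <= n)%nat /\ v <= f i < v + e.
Proof.
  intros He H0. induction n as [|n IH]; intros Hn Hs.
  - exists 0%nat. split; [lia|]. lra.
  - destruct (Rlt_dec (f (S n)) (v + e)) as [L|L].
    + exists (S n). split; [lia|]. lra.
    + destruct IH as [i [Hi1 Hi2]]; auto. { specialize (Hs n). lra. } exists i. split; [lia|auto].
Qed.

(* A walk whose residues mod 1 are determined by finitely many values cannot wind around the circle. *)
Lemma walk_confined (th h : nat -> R) (t e : R) (M : nat) : 0 < e -> INR (M + 2) * e < 1 ->
  (forall k, Rabs (th (S k) - th k) <= e) -> (forall k, exists z : Z, t * h k - th k = IZR z) ->
  (forall l : list nat, NoDup (map h l) -> (length l <= M)%nat) ->
  forall n, Rabs (th n - th 0%nat) <= INR (M + 1) * e.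
Proof.
  intros He HM Hs Hz Hc n.
  assert (Up : forall f : nat -> R, (forall k, Rabs (f (S k) - f k) <= e) -> (forall i j, h i = h j -> exists z : Z, f i - f j = IZR z) ->
     f n - f 0%nat <= INR (M + 1) * e).
  { intros f Hf Hfz. apply Rnot_lt_le. intros L.
    assert (Hivt : forall l, exists i, (l <= M)%nat -> f 0%nat + INR l * e <= f i < f 0%nat + INR l * e + e).
    { intros l. destruct (le_dec l M) as [Hl|Hl]; [|exists 0%nat; intros; contradiction].
      destruct (discrete_ivt f n (f 0%nat + INR l * e) e) as [i [_ Hi]]; auto.
      - pose proof (pos_INR l). nra.
      - assert (INR l <= INR (M + 1)) by (apply le_INR; lia). nra.
      - intros k. specialize (Hf k). apply Rabs_le_between in Hf. lra.
      - exists i; auto. }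
    set (k := fun l => proj1_sig (constructive_indefinite_description _ (Hivt l))).
    assert (Hk : forall l, (l <= M)%nat -> f 0%nat + INR l * e <= f (k l) < f 0%nat + INR l * e + e).
    { intros l. unfold k. destruct (constructive_indefinite_description _ (Hivt l)) as [i Hi]. exact Hi. }
    assert (Hnd : NoDup (map h (map k (seq 0 (S M))))).
    { rewrite map_map. apply NoDup_map_NoDup_ForallPairs; [|apply seq_NoDup].
      intros a b Ha Hb E. apply in_seq in Ha. apply in_seq in Hb.
      assert (Ka := Hk a ltac:(lia)). assert (Kb := Hk b ltac:(lia)).
      destruct (Hfz _ _ E) as [z Hz'].
      assert (Ba : INR a <= INR M) by (apply le_INR; lia). assert (Bb : INR b <= INR M) by (apply le_INR; lia).
      pose proof (pos_INR a). pose proof (pos_INR b). rewrite plus_INR in HM. simpl (INR 2) in HM.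
      assert (Z0 : z = 0%Z).
      { assert (-1 < IZR z < 1) by (rewrite <- Hz'; nra). destruct H1 as [Z1 Z2]. apply lt_IZR in Z1. apply lt_IZR in Z2. lia. }
      subst z. destruct (Nat.lt_total a b) as [Lab|[Lab|Lab]]; auto; exfalso.
      - assert (INR a + 1 <= INR b) by (rewrite <- S_INR; apply le_INR; lia). nra.
      - assert (INR b + 1 <= INR a) by (rewrite <- S_INR; apply le_INR; lia). nra. }
    specialize (Hc _ Hnd). rewrite length_map, length_seq in Hc. lia. }
  apply Rabs_le. split.
  - assert (A := Up (fun k => - th k)). cbv beta in A.
    assert (- th n - - th 0%nat <= INR (M + 1) * e); [|lra]. apply A.
    + intros k. replace (- th (S k) - - th k) with (- (th (S k) - th k)) by ring. now rewrite Rabs_Ropp.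
    + intros i j E. destruct (Hz i) as [z1 Z1], (Hz j) as [z2 Z2]. exists (z1 - z2)%Z. rewrite minus_IZR, <- Z1, <- Z2, E. ring.
  - apply Up; auto. intros i j E. destruct (Hz i) as [z1 Z1], (Hz j) as [z2 Z2]. exists (z2 - z1)%Z. rewrite minus_IZR, <- Z1, <- Z2, E. ring.
Qed.

Lemma quasi_additive_nat (g : Z -> R) e : 0 <= e -> (forall k m, Rabs (g (k + m)%Z - g k - g m) <= e) ->
  forall (n : nat) m, Rabs (g (Z.of_nat (S n) * m)%Z - INR (S n) * g m) <= INR n * e.
Proof.
  intros He H n m. induction n as [|n IH].
  - replace (Z.of_nat 1 * m)%Z with m by lia. simpl. rewrite Rmult_1_l, Rminus_diag, Rabs_R0. lra.
  - replace (Z.of_nat (S (S n)) * m)%Z with (Z.of_nat (S n) * m + m)%Z by lia.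
    specialize (H (Z.of_nat (S n) * m)%Z m). rewrite (S_INR (S n)).
    replace (g (Z.of_nat (S n) * m + m)%Z - (INR (S n) + 1) * g m) with
      ((g (Z.of_nat (S n) * m + m)%Z - g (Z.of_nat (S n) * m)%Z - g m) + (g (Z.of_nat (S n) * m)%Z - INR (S n) * g m)) by ring.
    assert (E : INR (S n) * e = INR n * e + e) by (rewrite S_INR; ring).
    eapply Rle_trans; [apply Rabs_triang|]. lra.
Qed.

(* Hyers-Ulam stability on the integers; the slope is found by Fekete's argument. *)
Lemma quasi_additive_slope (g : Z -> R) e : 0 <= e -> (forall k m, Rabs (g (k + m)%Z - g k - g m) <= e) ->
  exists l, forall m, Rabs (g m - l * IZR m) <= 3 * e.
Proof.
  intros He H. pose proof (quasi_additive_nat g e He H) as Q.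
  (* Comparing [g] at a product of two arguments in both ways shows that every lower estimate of the
     slope is below every upper one; the supremum of the lower estimates serves as slope. *)
  assert (Cmp : forall m n : nat, (g (Z.of_nat (S m)) - e) / INR (S m) <= (g (Z.of_nat (S n)) + e) / INR (S n)).
  { intros m n. pose proof (Q n (Z.of_nat (S m))) as A. pose proof (Q m (Z.of_nat (S n))) as B.
    rewrite Z.mul_comm in B. apply Rabs_le_between in A. apply Rabs_le_between in B.
    assert (Pm : 0 < INR (S m)) by (apply lt_0_INR; lia). assert (Pn : 0 < INR (S n)) by (apply lt_0_INR; lia).
    apply Rmult_le_reg_r with (INR (S m) * INR (S n)); [now apply Rmult_lt_0_compat|].
    replace ((g (Z.of_nat (S m)) - e) / INR (S m) * (INR (S m) * INR (S n))) with (INR (S n) * (g (Z.of_nat (S m)) - e)) by (field; lra).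
    replace ((g (Z.of_nat (S n)) + e) / INR (S n) * (INR (S m) * INR (S n))) with (INR (S m) * (g (Z.of_nat (S n)) + e)) by (field; lra).
    assert (INR n * e <= INR (S n) * e) by (apply Rmult_le_compat_r; auto; apply le_INR; lia).
    assert (INR m * e <= INR (S m) * e) by (apply Rmult_le_compat_r; auto; apply le_INR; lia). lra. }
  set (E := fun x => exists m : nat, x = (g (Z.of_nat (S m)) - e) / INR (S m)).
  destruct (completeness E) as [l [Hl1 Hl2]].
  - exists ((g (Z.of_nat 1) + e) / INR 1). intros x [m ->]. apply (Cmp m 0%nat).
  - exists ((g (Z.of_nat 1) - e) / INR 1). now exists 0%nat.
  - assert (Pos : forall m : nat, Rabs (g (Z.of_nat (S m)) - l * INR (S m)) <= e).
    { intros m. assert (Pm : 0 < INR (S m)) by (apply lt_0_INR; lia).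
      assert (A : (g (Z.of_nat (S m)) - e) / INR (S m) <= l) by (apply Hl1; now exists m).
      assert (B : l <= (g (Z.of_nat (S m)) + e) / INR (S m)) by (apply Hl2; intros x [k ->]; apply Cmp).
      apply (Rmult_le_compat_r (INR (S m))) in A; [|lra]. apply (Rmult_le_compat_r (INR (S m))) in B; [|lra].
      replace ((g (Z.of_nat (S m)) - e) / INR (S m) * INR (S m)) with (g (Z.of_nat (S m)) - e) in A by (field; lra).
      replace ((g (Z.of_nat (S m)) + e) / INR (S m) * INR (S m)) with (g (Z.of_nat (S m)) + e) in B by (field; lra).
      apply Rabs_le. lra. }
    assert (Zero : Rabs (g 0%Z) <= e).
    { specialize (H 0%Z 0%Z). simpl in H. replace (g 0%Z - g 0%Z - g 0%Z) with (- g 0%Z) in H by ring. now rewrite Rabs_Ropp in H. }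
    exists l. intros m. destruct (Z.lt_total m 0) as [L|[->|L]].
    + specialize (Pos (Z.to_nat (- m - 1))). replace (Z.of_nat (S (Z.to_nat (- m - 1)))) with (- m)%Z in Pos by lia.
      rewrite INR_IZR_INZ in Pos. replace (Z.of_nat (S (Z.to_nat (- m - 1)))) with (- m)%Z in Pos by lia. rewrite opp_IZR in Pos.
      specialize (H m (- m)%Z). rewrite Z.add_opp_diag_r in H.
      replace (g m - l * IZR m) with (- (g 0%Z - g m - g (- m)%Z) + g 0%Z + - (g (- m)%Z - l * - IZR m)) by ring.
      eapply Rle_trans; [apply Rabs_triang|]. rewrite Rabs_Ropp.
      assert (Rabs (- (g 0%Z - g m - g (- m)%Z) + g 0%Z) <= 2 * e); [|lra].
      eapply Rle_trans; [apply Rabs_triang|]. rewrite Rabs_Ropp. lra.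
    + rewrite Rmult_0_r, Rminus_0_r. lra.
    + specialize (Pos (Z.to_nat (m - 1))). rewrite INR_IZR_INZ in Pos.
      replace (Z.of_nat (S (Z.to_nat (m - 1)))) with m in Pos by lia. lra.
Qed.

Lemma integer_primitive (u : Z -> Z) : exists P : Z -> Z, forall k, P (k + 1)%Z = (P k + u k)%Z.
Proof.
  set (S1 := fix S1 (n : nat) : Z := match n with O => 0%Z | S m => (S1 m + u (Z.of_nat m))%Z end).
  set (S2 := fix S2 (n : nat) : Z := match n with O => 0%Z | S m => (S2 m - u (- Z.of_nat m - 1))%Z end).
  exists (fun k => if Z_le_gt_dec 0 k then S1 (Z.to_nat k) else S2 (Z.to_nat (- k))).
  intros k. destruct (Z_le_gt_dec 0 k) as [L|L]; destruct (Z_le_gt_dec 0 (k + 1)) as [L'|L']; try lia.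
  - replace (Z.to_nat (k + 1)) with (S (Z.to_nat k)) by lia. simpl. now rewrite Z2Nat.id.
  - replace (k + 1)%Z with 0%Z by lia. replace (Z.to_nat (- k)) with 1%nat by lia. simpl.
    replace k with (-1)%Z by lia. lia.
  - replace (Z.to_nat (- k)) with (S (Z.to_nat (- (k + 1)))) by lia. simpl.
    replace (- Z.of_nat (Z.to_nat (- (k + 1))) - 1)%Z with k by lia. lia.
Qed.

(** * Periods of a self-dual measure *)

(* Along a relatively dense sequence [x k], the walk [t x k] reduced mod 1 has small steps, and its increments over
   a fixed time take boundedly many values mod 1; so it is linear in [k] up to a small error, and correcting [t] by
   the slope gives [y]. *)
Lemma selfdual_almost_period rho p c sig kap eta : selfdual rho p c sig kap -> (exists j, c j <> RtoC 0) -> 0 < eta ->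
  exists y, 0 < y /\ forall i j, c i <> RtoC 0 -> c j <> RtoC 0 -> exists k : Z, Rabs ((p i - p j) * y - IZR k) <= eta.
Proof.
  intros H Hne Heta. destruct (selfdual_relatively_dense _ _ _ _ _ H Hne) as [R0 [HR0 Hdense]].
  set (R2 := 4 * R0). assert (HR2 : 0 < R2) by (unfold R2; lra).
  destruct (differences_bounded _ _ _ _ _ (16 * R0) H) as [M HM]; [lra|].
  destruct (finite_of_bounded (fun h => difference p c h /\ - (8 * R0) <= h <= - (8 * R0) + 16 * R0) M) as [B HB].
  { intros l L1 L2. apply (HM (- (8 * R0))); auto. }
  assert (HB' : forall i j, c i <> RtoC 0 -> c j <> RtoC 0 -> Rabs (p i - p j) <= 8 * R0 -> In (p i - p j) B).
  { intros i j Hi Hj Hij. apply HB. apply Rabs_le_between in Hij. split; [exists i, j; auto|lra]. }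
  set (e' := Rmin eta 1). assert (He' : 0 < e' <= 1) by (unfold e', Rmin; destruct (Rle_dec eta 1); lra).
  assert (He'' : e' <= eta) by apply Rmin_l.
  pose proof (pos_INR M) as HM0. set (m1 := INR M) in *.
  (* The walk and slope errors total at most about [23 * (m1 + 3) * e2]; the factor 100 brings them
     below [e' / 2]. *)
  set (e2 := e' / (100 * (m1 + 3))).
  assert (He2 : 0 < e2) by (apply Rdiv_lt_0_compat; lra).
  assert (He2' : 100 * (m1 + 3) * e2 = e') by (unfold e2; field; lra). clearbody e2.
  set (e1 := 2 * (m1 + 1) * e2). assert (He1 : 0 < e1) by (unfold e1; apply Rmult_lt_0_compat; lra).
  (* The lower bound on [t] guarantees that it stays positive after the slope correction, whose
     modulus is at most [/ R2]. *)
  destruct (dirichlet_list B e2 (/ R2 + 1) He2) as [t [Ht [Ht0 HtB]]].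
  destruct (choice (fun (k : Z) j => c j <> RtoC 0 /\ Rabs (p j - IZR k * R2) <= R0)) as [jx Hjx].
  { intros k. apply Hdense. }
  set (x := fun k => p (jx k)).
  assert (Hx : forall k, Rabs (x k - IZR k * R2) <= R0) by (intros k; apply Hjx).
  assert (Hdx : forall k m, Rabs (x (k + m)%Z - x k - IZR m * R2) <= 2 * R0).
  { intros k m. pose proof (Hx k) as A. pose proof (Hx (k + m)%Z) as A'. rewrite plus_IZR in A'.
    apply Rabs_le_between in A. apply Rabs_le_between in A'. apply Rabs_le. lra. }
  destruct (choice (fun (k : Z) (u : Z) => Rabs (t * (x (k + 1)%Z - x k) - IZR u) <= e2)) as [u Hu].
  { intros k. apply HtB. apply HB'; try apply Hjx. pose proof (Hdx k 1%Z) as A. unfold x in A.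
    apply Rabs_le_between in A. apply Rabs_le. unfold R2 in A. lra. }
  destruct (integer_primitive u) as [P HP].
  (* [P] accumulates the integers nearest to the increments of [t * x k], so [th] is a real lift of
     the residues mod 1 with steps at most [e2]. *)
  set (th := fun k => t * x k - IZR (P k)).
  assert (Hth : forall k, Rabs (th (k + 1)%Z - th k) <= e2).
  { intros k. specialize (Hu k). unfold th. rewrite HP, plus_IZR.
    replace (t * x (k + 1)%Z - (IZR (P k) + IZR (u k)) - (t * x k - IZR (P k))) with (t * (x (k + 1)%Z - x k) - IZR (u k)) by ring. exact Hu. }
  assert (Hcount : forall (m : Z) (f : nat -> Z) l, NoDup (map (fun n => x (f n + m)%Z - x (f n)) l) -> (length l <= M)%nat).
  { intros m f l Hl. rewrite <- (length_map (fun n => x (f n + m)%Z - x (f n)) l). apply (HM (IZR m * R2 - 2 * R0)); auto.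
    intros h Hh. apply in_map_iff in Hh. destruct Hh as [n [<- _]]. split.
    - exists (jx (f n + m)%Z), (jx (f n)). split; [apply Hjx|]. split; [apply Hjx|]. reflexivity.
    - specialize (Hdx (f n) m). apply Rabs_le_between in Hdx. lra. }
  (* For fixed [m] the increment of [th] over time [m] is itself a slow walk whose residues are
     determined by boundedly many differences, hence it is nearly constant; [f] walks forwards or
     backwards through the integers. This is the quasi-additivity of [th]. *)
  assert (Hwalk : forall (m : Z) (f : nat -> Z), (forall n, (f (S n) = f n + 1 \/ f n = f (S n) + 1)%Z) -> f 0%nat = 0%Z ->
    forall n, Rabs ((th (f n + m)%Z - th (f n)) - (th m - th 0%Z)) <= e1).
  { intros m f Hf Hf0 n. set (th' := fun n => th (f n + m)%Z - th (f n)).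
    assert (E0 : th m - th 0%Z = th' 0%nat) by (unfold th'; now rewrite Hf0). rewrite E0.
    replace e1 with (INR (M + 1) * (2 * e2)) by (rewrite plus_INR; unfold e1; simpl (INR 1); fold m1; ring).
    apply (walk_confined th' (fun n => x (f n + m)%Z - x (f n)) t (2 * e2) M).
    - lra.
    - rewrite plus_INR. fold m1. simpl (INR 2). nra.
    - intros k. unfold th'. destruct (Hf k) as [E|E].
      + rewrite E. replace (f k + 1 + m)%Z with (f k + m + 1)%Z by lia.
        pose proof (Hth (f k)) as A. pose proof (Hth (f k + m)%Z) as A'. apply Rabs_le_between in A. apply Rabs_le_between in A'.
        apply Rabs_le. lra.
      + rewrite E. replace (f (S k) + 1 + m)%Z with (f (S k) + m + 1)%Z by lia.
        pose proof (Hth (f (S k))) as A. pose proof (Hth (f (S k) + m)%Z) as A'. apply Rabs_le_between in A. apply Rabs_le_between in A'.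
        apply Rabs_le. lra.
    - intros k. exists (P (f k + m) - P (f k))%Z. rewrite minus_IZR. unfold th', th. ring.
    - apply Hcount. }
  destruct (quasi_additive_slope (fun k => th k - th 0%Z) e1) as [l Hl]; [lra| |].
  { intros k m. replace (th (k + m)%Z - th 0%Z - (th k - th 0%Z) - (th m - th 0%Z)) with ((th (k + m)%Z - th k) - (th m - th 0%Z)) by ring.
    destruct (Z_le_gt_dec 0 k) as [L|L].
    - assert (A := Hwalk m Z.of_nat ltac:(intros; lia) eq_refl (Z.to_nat k)). now rewrite Z2Nat.id in A by lia.
    - assert (A := Hwalk m (fun n => (- Z.of_nat n)%Z) ltac:(intros; cbv beta; lia) eq_refl (Z.to_nat (- k))). cbv beta in A.
      now replace (- Z.of_nat (Z.to_nat (- k)))%Z with k in A by lia. }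
  cbv beta in Hl.
  assert (Hl1 : Rabs l <= e2 + 3 * e1).
  { pose proof (Hl 1%Z) as A. pose proof (Hth 0%Z) as A'. simpl (0 + 1)%Z in A'. apply Rabs_le_between in A. apply Rabs_le_between in A'.
    apply Rabs_le. lra. }
  assert (Hsmall : e2 + 3 * e1 <= 1) by (unfold e1; nra).
  set (L := l / R2).
  assert (HLb : forall b r, Rabs b <= r * R2 -> Rabs (L * b) <= (e2 + 3 * e1) * r).
  { intros b r Hb. replace (L * b) with (l * (b / R2)) by (unfold L; field; lra). rewrite Rabs_mult.
    apply Rmult_le_compat; auto using Rabs_pos. unfold Rdiv. rewrite Rabs_mult, (Rabs_pos_eq (/ R2)) by (apply Rlt_le, Rinv_0_lt_compat; auto).
    apply Rmult_le_reg_r with R2; auto. rewrite Rmult_assoc, Rinv_l by lra. lra. }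
  assert (HL : Rabs L <= / R2).
  { replace L with (L * 1) by ring. eapply Rle_trans; [apply (HLb 1 (/ R2))|].
    - rewrite Rabs_R1, Rinv_l; lra.
    - assert (0 < / R2) by now apply Rinv_0_lt_compat. nra. }
  exists (t - L). apply Rabs_le_between in HL. split; [lra|].
  (* Every [p i] is compared with a nearby [x k]: their difference lies in the finite list [B], and
     removing the slope makes [th k] almost independent of [k]. *)
  assert (Key : forall i, c i <> RtoC 0 -> exists k : Z, Rabs (p i * (t - L) - th 0%Z - IZR k) <= e' / 2).
  { intros i Hi. destruct (floor_cell R2 (p i) HR2) as [k Hk].
    assert (Hpk : Rabs (p i - x k) <= 8 * R0).
    { pose proof (Hx k) as A. apply Rabs_le_between in A. apply Rabs_le. unfold R2 in *. lra. }
    destruct (HtB (p i - x k)) as [z Hz]. { apply HB'; auto. apply Hjx. }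
    exists (z + P k)%Z. rewrite plus_IZR.
    replace (p i * (t - L) - th 0%Z - (IZR z + IZR (P k))) with
      ((t * (p i - x k) - IZR z) - L * (p i - x k) + ((th k - th 0%Z - l * IZR k) - L * (x k - IZR k * R2))).
    2:{ unfold th at 1, L. field. lra. }
    assert (A1 : Rabs (L * (p i - x k)) <= (e2 + 3 * e1) * 2) by (apply HLb; unfold R2; lra).
    assert (A2 : Rabs (L * (x k - IZR k * R2)) <= (e2 + 3 * e1) * (/ 4)) by (apply HLb; eapply Rle_trans; [apply Hx|unfold R2; lra]).
    pose proof (Hl k) as A3.
    assert (A4 : e2 + (e2 + 3 * e1) * 2 + (3 * e1 + (e2 + 3 * e1) * / 4) <= e' / 2) by (unfold e1; nra).
    apply Rabs_le_between in A1. apply Rabs_le_between in A2. apply Rabs_le_between in A3. apply Rabs_le_between in Hz.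
    apply Rabs_le. lra. }
  intros i j Hi Hj. destruct (Key i Hi) as [k1 K1], (Key j Hj) as [k2 K2]. exists (k1 - k2)%Z. rewrite minus_IZR.
  apply Rabs_le_between in K1. apply Rabs_le_between in K2. apply Rabs_le. lra.
Qed.

Definition in_orbit (p : Z -> R) (c : Z -> CC) (x0 y : R) (k : Z) : Prop := exists j, c j <> RtoC 0 /\ p j = x0 + IZR k * y.

(* All [sig p_j] lie within [1 / (8 y)] of one translate of [Z / y], which is the gap needed to apply [gap_density]. *)
Lemma orbit_dense rho p c sig kap y x0 : selfdual rho p c sig kap -> 0 < y ->
  (forall i j, c i <> RtoC 0 -> c j <> RtoC 0 -> exists k : Z, Rabs ((p i - p j) * y - IZR k) <= / 8) ->
  (exists k, in_orbit p c x0 y k) -> dense (/ 25600) 1 (in_orbit p c x0 y).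
Proof.
  intros H Hy Hap [k0 [j0 [Hj0 E0]]]. assert (H' := H). destruct H' as [Hp [Hs [Ht [Hsig [Hk Hid]]]]].
  destruct (selfdual_bounded _ _ _ _ _ H) as [A [HA HcA]].

  set (P := in_progression x0 y).
  assert (HP : forall j, restrict P p c j <> RtoC 0 -> exists k : Z, p j = x0 + IZR k * y) by (intros j Hj; apply restrict_nonzero in Hj; apply Hj).
  destruct (choice (fun j (k : Z) => restrict P p c j <> RtoC 0 -> p j = x0 + IZR k * y)) as [q Hq].
  { intros j. destruct (classic (restrict P p c j <> RtoC 0)) as [C|C]; [destruct (HP j C) as [k Ek]; now exists k|exists 0%Z; intros; contradiction]. }
  assert (Hw : 0 < / (8 * y)) by (apply Rinv_0_lt_compat; lra).
  (* The frequency [t0] lies midway between neighbouring points of [sig * p j0 + Z / y]; the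
     spectrum stays within [/ (8 * y)] of that set, so [t0] and its vicinity are free. *)
  destruct (gap_density rho p (restrict P p c) A (sig * p j0 - / (2 * y)) (/ (8 * y)) y q j0) as [T0 [HT0 HT]]; auto.
  - intros j. unfold restrict. destruct (decide (P (p j))); auto. rewrite Cmod_0; auto.
  - apply (selfdual_progression_gap rho p c sig kap); auto; [lra|]. intros s m t Hc Htt.
    destruct (Hap s j0 Hc Hj0) as [k Hk1].
    apply Rmult_le_reg_r with y; auto.
    replace (Rabs (sig * p s - (t + IZR m / y)) * y) with (Rabs ((sig * p s - (t + IZR m / y)) * y)) by (rewrite Rabs_mult, (Rabs_pos_eq y); lra).
    set (t0 := sig * p j0 - / (2 * y)) in *.
    assert (Htt' : Rabs ((t - t0) * y) <= / 8).
    { rewrite Rabs_mult, (Rabs_pos_eq y) by lra. replace (/ 8) with (/ (8 * y) * y) by (field; lra). apply Rmult_le_compat_r; lra. }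
    replace (/ (8 * y) * y) with (/ 8) by (field; lra).
    replace ((sig * p s - (t + IZR m / y)) * y) with (sig * ((p s - p j0) * y - IZR k) + / 2 - (t - t0) * y + (sig * IZR k - IZR m)) by (unfold t0; field; lra).
    assert (Hk2 : Rabs (sig * ((p s - p j0) * y - IZR k)) <= / 8) by (rewrite sig_abs; auto).
    assert (Hz : exists z : Z, sig * IZR k - IZR m = IZR z).
    { assert (E : sig = 1 \/ sig = -1) by (destruct (Rmult_integral (sig - 1) (sig + 1)); [lra|left; lra|right; lra]).
      destruct E as [-> | ->]; [exists (k - m)%Z|exists (- k - m)%Z]; rewrite minus_IZR, ?opp_IZR; ring. }
    destruct Hz as [z ->]. apply Rabs_le_between in Htt'. apply Rabs_le_between in Hk2.
    destruct (Z_le_gt_dec 0 z) as [L|L].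
    + apply IZR_le in L. eapply Rle_trans; [|apply Rle_abs]. lra.
    + assert (L' : IZR z <= -1) by (apply IZR_le; lia). rewrite <- Rabs_Ropp. eapply Rle_trans; [|apply Rle_abs]. lra.
  - intros i j Hi Hj Hij. pose proof (Hq i Hi) as E1. pose proof (Hq j Hj) as E2.
    split.
    + intros E. apply Hij, (cells_inj rho p); auto. rewrite E1, E2, E. reflexivity.
    + apply Req_le. rewrite E1, E2, minus_IZR. rewrite <- (Rabs_pos_eq y) at 1 by lra. rewrite <- Rabs_mult. f_equal. ring.
  - unfold restrict. replace (decide (P (p j0))) with true; auto. symmetry. apply decide_true. exists k0; auto.
  - exists (T0 / y), (Rabs (IZR k0)). intros T HTT.
    assert (HTy : T0 <= y * T) by (apply Rmult_le_reg_r with (/ y); [now apply Rinv_0_lt_compat|replace (y * T * / y) with T by (field; lra); exact HTT]).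
    destruct (HT (y * T) HTy) as [l [L1 [L2 L3]]].
    exists (map q l). split; [|split].
    + apply NoDup_map_NoDup_ForallPairs; auto. intros i j Hi Hj E. apply L2 in Hi. apply L2 in Hj.
      destruct Hi as [Hi _], Hj as [Hj _]. apply (cells_inj rho p); auto. rewrite (Hq i Hi), (Hq j Hj), E. reflexivity.
    + intros k Hk'. apply in_map_iff in Hk'. destruct Hk' as [j [<- Hj]]. destruct (L2 j Hj) as [L4 L5]. specialize (Hq j L4). split.
      * exists j. split; auto. apply restrict_nonzero in L4. apply L4.
      * rewrite Hq, E0 in L5. replace (x0 + IZR (q j) * y - (x0 + IZR k0 * y)) with (y * (IZR (q j) - IZR k0)) in L5 by ring.
        rewrite Rabs_mult, (Rabs_pos_eq y) in L5 by lra. apply Rmult_le_reg_l in L5; auto.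
        replace (IZR (q j)) with ((IZR (q j) - IZR k0) + IZR k0) by ring. eapply Rle_trans; [apply Rabs_triang|lra].
    (* [25600 = 8 ^ 2 * 400]: in units of the step [y] the density no longer depends on [y]. *)
    + rewrite length_map. replace (/ 25600 * T) with ((/ (8 * y)) ^ 2 * y * (y * T) / 400) by (field; lra). exact L3.
Qed.

(** Let [k] be the integer near [x]. Three errors of [/ 5] stay below 1, so by induction the integer
    near [n * x] is [n * k], and every multiple of [x - k] is at most [/ 5]; this forces [x = k]. *)
Lemma near_integer_multiples x : (forall q : Z, exists k : Z, Rabs (IZR q * x - IZR k) <= / 5) -> exists k : Z, x = IZR k.
Proof.
  intros H. destruct (H 1%Z) as [k Hk]. rewrite Rmult_1_l in Hk. exists k.
  assert (A : forall n : nat, Rabs (INR n * (x - IZR k)) <= / 5).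
  { induction n as [|n IH].
    - simpl. rewrite Rmult_0_l, Rabs_R0. lra.
    - destruct (H (Z.of_nat (S n))) as [m Hm]. rewrite <- INR_IZR_INZ in Hm.
      assert (E : m = (Z.of_nat (S n) * k)%Z).
      { assert (B : -1 < IZR (m - Z.of_nat (S n) * k) < 1).
        { rewrite minus_IZR, mult_IZR, <- INR_IZR_INZ. rewrite S_INR in *.
          apply Rabs_le_between in Hm. apply Rabs_le_between in IH. apply Rabs_le_between in Hk. lra. }
        destruct B as [B1 B2]. apply lt_IZR in B1. apply lt_IZR in B2. lia. }
      rewrite E, mult_IZR, <- INR_IZR_INZ in Hm. rewrite Rmult_minus_distr_l. exact Hm. }
  apply NNPP. intros C. assert (D : 0 < Rabs (x - IZR k)) by (apply Rabs_pos_lt; lra).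
  destruct (exists_nat_gt (/ Rabs (x - IZR k))) as [n [_ Hn]]. specialize (A n).
  rewrite Rabs_mult, Rabs_pos_eq in A by apply pos_INR.
  apply (Rmult_lt_compat_r (Rabs (x - IZR k))) in Hn; auto. rewrite Rinv_l in Hn; lra.
Qed.

Lemma fact_multiple m n : (1 <= m <= n)%nat -> exists d, (fact n = m * d)%nat.
Proof.
  intros [H1 H2]. induction H2 as [|n H2 IH].
  - destruct m as [|m]; [lia|]. exists (fact m). reflexivity.
  - destruct IH as [d Hd]. exists (S n * d)%nat. change (fact (S n)) with (S n * fact n)%nat. rewrite Hd. lia.
Qed.

(** For every integer [q] a collision among the sums [k + i * q] yields orbit indices differing by
    [(i' - i) * q], so [(i' - i) * q * y ^ 2] is close to an integer. As [i' - i] divides [N], all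
    multiples of [N * y ^ 2] are close to integers, which makes it an integer; the period is
    [N * y], with square [N * (N * y ^ 2)]. *)
Lemma selfdual_sqrt_period rho p c sig kap : selfdual rho p c sig kap -> (exists j, c j <> RtoC 0) ->
  exists n : nat, (0 < n)%nat /\ forall i j, c i <> RtoC 0 -> c j <> RtoC 0 ->
    exists k : Z, Rabs ((p i - p j) * sqrt (INR n) - IZR k) <= / 8.
Proof.
  (* The pigeonhole requires [n * / 25600 > 2]. *)
  intros H Hne. destruct (exists_nat_gt (2 * 25600)) as [n [_ Hn]].
  assert (HN : 1 <= INR (fact n)) by (replace 1 with (INR 1) by reflexivity; apply le_INR; pose proof (lt_O_fact n); lia).
  set (N := fact n) in *.
  (* This precision survives multiplication by a divisor of [N], and by [N] itself, with error at
     most [/ 8]. *)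
  destruct (selfdual_almost_period _ _ _ _ _ (/ (8 * INR N)) H Hne) as [y [Hy Hap]]. { apply Rinv_0_lt_compat; lra. }
  assert (HNe : INR N * / (8 * INR N) = / 8) by (field; lra).
  assert (He8 : / (8 * INR N) <= / 8) by (apply Rinv_le_contravar; lra).
  assert (Hap' : forall i j, c i <> RtoC 0 -> c j <> RtoC 0 -> exists k : Z, Rabs ((p i - p j) * y - IZR k) <= / 8).
  { intros i j Hi Hj. destruct (Hap i j Hi Hj) as [k Hk]. exists k. lra. }
  destruct Hne as [j0 Hj0]. set (K := in_orbit p c (p j0) y).
  assert (HK : dense (/ 25600) 1 K).
  { apply (orbit_dense rho p c sig kap); auto. exists 0%Z, j0. split; auto. lra. }
  assert (Hint : exists k : Z, INR N * (y * y) = IZR k).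
  { apply near_integer_multiples. intros q.
    destruct (dense_collision n (/ 25600) 1 1 (INR n * Rabs (IZR q)) (fun _ => K) (fun i k => (k + Z.of_nat i * q)%Z))
      as [i [k [i' [k' [Hi [Hi' [HKk [HKk' [Hd HE]]]]]]]]]; auto; try lra.
    - intros i k Hi _. rewrite plus_IZR, mult_IZR, <- INR_IZR_INZ. eapply Rle_trans; [apply Rabs_triang|].
      rewrite Rabs_mult, (Rabs_pos_eq (INR i)) by apply pos_INR. rewrite Rmult_1_l. apply Rplus_le_compat_l.
      apply Rmult_le_compat_r; [apply Rabs_pos|]. apply le_INR; lia.
    - assert (W : forall (i i' : nat) k k', K k -> K k' -> (i < i')%nat -> (i' < n)%nat -> (k + Z.of_nat i * q = k' + Z.of_nat i' * q)%Z ->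
        exists z : Z, Rabs (IZR q * (INR N * (y * y)) - IZR z) <= / 5).
      { clear - Hap HNe HN. intros i i' k k' [j [Hj Ej]] [j' [Hj' Ej']] L1 L2 E.
        destruct (fact_multiple (i' - i) n) as [d Hd]; [lia|]. fold N in Hd.
        destruct (Hap j j' Hj Hj') as [z Hz]. exists (Z.of_nat d * z)%Z. rewrite mult_IZR, <- INR_IZR_INZ.
        replace ((p j - p j') * y) with (IZR (k - k') * (y * y)) in Hz by (rewrite Ej, Ej', minus_IZR; ring).
        replace (k - k')%Z with (Z.of_nat (i' - i) * q)%Z in Hz by (rewrite Nat2Z.inj_sub by lia; lia).
        rewrite mult_IZR, <- INR_IZR_INZ in Hz.
        replace (IZR q * (INR N * (y * y)) - INR d * IZR z) with (INR d * (INR (i' - i) * IZR q * (y * y) - IZR z)) by (rewrite Hd, mult_INR; ring).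
        rewrite Rabs_mult, Rabs_pos_eq by apply pos_INR.
        assert (Hdn : INR d <= INR N) by (apply le_INR; nia).
        apply Rle_trans with (INR N * / (8 * INR N)); [|lra]. apply Rmult_le_compat; auto using pos_INR, Rabs_pos. }
      destruct (Nat.lt_total i i') as [L|[->|L]].
      + apply (W i i' k k'); auto.
      + exfalso. apply Hd. f_equal. lia.
      + apply (W i' i k' k); auto. }
  destruct Hint as [k Hk].
  assert (Hpos : 0 < INR N * (INR N * (y * y))) by (repeat apply Rmult_lt_0_compat; lra).
  exists (Z.to_nat (Z.of_nat N * k)).
  assert (E : INR (Z.to_nat (Z.of_nat N * k)) = (INR N * y) * (INR N * y)).
  { assert (P : 0 < IZR (Z.of_nat N * k)) by (rewrite mult_IZR, <- INR_IZR_INZ, <- Hk; auto). apply lt_IZR in P.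
    rewrite INR_IZR_INZ, Z2Nat.id by lia. rewrite mult_IZR, <- INR_IZR_INZ, <- Hk. ring. }
  split.
  - apply INR_lt. rewrite E. simpl (INR 0). lra.
  - rewrite E, sqrt_square by (apply Rmult_le_pos; lra). intros i j Hi Hj. destruct (Hap i j Hi Hj) as [z Hz].
    exists (Z.of_nat N * z)%Z. rewrite mult_IZR, <- INR_IZR_INZ.
    replace ((p i - p j) * (INR N * y) - INR N * IZR z) with (INR N * ((p i - p j) * y - IZR z)) by ring.
    rewrite Rabs_mult, (Rabs_pos_eq (INR N)) by lra. rewrite <- HNe. apply Rmult_le_compat_l; lra.
Qed.

(** * Combs spanning a self-dual measure *)

Lemma finite_uniform {X} (Q : X -> R -> Prop) (l : list X) :
  (forall a e e', 0 < e' -> e' <= e -> Q a e -> Q a e') -> (forall a, In a l -> exists e, 0 < e /\ Q a e) ->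
  exists e, 0 < e /\ forall a, In a l -> Q a e.
Proof.
  intros Hd H. induction l as [|b l IH].
  - exists 1. split; [lra|]. intros a [].
  - destruct IH as [e [He IHe]]. { intros a Ha. apply H. now right. }
    destruct (H b) as [e' [He' Hb]]; [now left|].
    assert (Hm : 0 < Rmin e e') by now apply Rmin_glb_lt.
    exists (Rmin e e'). split; auto. intros a [<-|Ha].
    + apply (Hd b e'); auto. apply Rmin_r.
    + apply (Hd a e); auto. apply Rmin_l.
Qed.

(** For each pair the distances depend only on the residue [r] of [x - x'] modulo [y]: the least
    nonzero one is the smaller of [r] and [y - r], or [y] if [r = 0]. *)
Lemma progressions_separated (X : list R) y : 0 < y -> exists e, 0 < e /\
  forall x x' (m : Z), In x X -> In x' X -> x + IZR m * y <> x' -> e <= Rabs (x + IZR m * y - x').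
Proof.
  intros Hy.
  destruct (finite_uniform (fun (q : R * R) e => forall m : Z, fst q + IZR m * y <> snd q -> e <= Rabs (fst q + IZR m * y - snd q)) (list_prod X X)) as [e [He H]].
  - intros a e e' _ L H m Hm. eapply Rle_trans; [exact L|auto].
  - intros [x x'] _. simpl. destruct (floor_cell y (x - x') Hy) as [q Hq]. set (r := x - x' - IZR q * y).
    assert (Hr : 0 <= r < y) by (unfold r; lra).
    assert (E : forall m, x + IZR m * y - x' = r + IZR (m + q) * y) by (intros m; rewrite plus_IZR; unfold r; ring).
    assert (Hz : forall z : Z, z = 0%Z \/ 1 <= IZR z \/ IZR z <= -1).
    { intros z. destruct (Z.lt_total z 0) as [L|[L|L]]; [right; right; apply IZR_le; lia|now left|right; left; apply IZR_le; lia]. }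
    exists (if Req_EM_T r 0 then y else Rmin r (y - r)). destruct (Req_EM_T r 0) as [E0|E0].
    + split; auto. intros m Hm. rewrite E. destruct (Hz (m + q)%Z) as [L|[L|L]].
      * exfalso. apply Hm. specialize (E m). rewrite L, E0 in E. lra.
      * eapply Rle_trans; [|apply Rle_abs]. nra.
      * rewrite <- Rabs_Ropp. eapply Rle_trans; [|apply Rle_abs]. nra.
    + split; [apply Rmin_glb_lt; lra|]. intros m _. rewrite E. pose proof (Rmin_l r (y - r)). pose proof (Rmin_r r (y - r)).
      destruct (Hz (m + q)%Z) as [L|[L|L]].
      * rewrite L. eapply Rle_trans; [|apply Rle_abs]. lra.
      * eapply Rle_trans; [|apply Rle_abs]. nra.
      * rewrite <- Rabs_Ropp. eapply Rle_trans; [|apply Rle_abs]. nra.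
  - exists e. split; auto. intros x x' m Hx Hx' Hm. apply (H (x, x')); auto. now apply in_prod.
Qed.

Lemma csum_unique n (u : nat -> CC) i0 : (i0 < n)%nat -> (forall i, (i < n)%nat -> i <> i0 -> u i = RtoC 0) -> csum n u = u i0.
Proof.
  intros Hi H. induction n as [|n IH]; [lia|]. cbn [csum]. destruct (Nat.eq_dec i0 n) as [->|D].
  - rewrite csum_0; [ring|]. intros i L. apply H; lia.
  - rewrite IH by (try lia; intros; apply H; lia). rewrite (H n) by lia. ring.
Qed.

(** Symmetric summation is tied to the order of the index, but one family has finite support here,
    so matched terms can be split off one by one. [Q] is a relation because indices along the line
    and along a progression correspond only partially. *)
Lemma Zs_reindex (Q : Z -> Z -> Prop) (l : list Z) :
  (forall j j' k, Q j k -> Q j' k -> j = j') -> (forall j k k', Q j k -> Q j k' -> k = k') ->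
  forall u v : Z -> CC, summable u -> summable v -> (forall j, u j <> RtoC 0 -> In j l) ->
  (forall j, u j <> RtoC 0 -> exists k, Q j k) -> (forall k, v k <> RtoC 0 -> exists j, Q j k) ->
  (forall j k, Q j k -> u j = v k) -> Zs u = Zs v.
Proof.
  intros F1 F2. induction l as [|j0 l IH]; intros u v Hu Hv Hl H1 H2 H3.
  - assert (U : forall j, u j = RtoC 0) by (intros j; apply NNPP; intros C; destruct (Hl j C)).
    rewrite !Zs_0; auto. intros k. apply NNPP. intros C. destruct (H2 k C) as [j Hj]. apply C. rewrite <- (H3 j k Hj). apply U.
  - destruct (classic (u j0 = RtoC 0)) as [C|C].
    + apply IH; auto. intros j Hj. destruct (Hl j Hj) as [<-|L]; [contradiction|auto].
    + destruct (H1 j0 C) as [k0 Hk0]. rewrite (Zs_split u j0), (Zs_split v k0), (H3 j0 k0 Hk0) by auto. f_equal.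
      assert (Sm : forall (w : Z -> CC) i, summable w -> summable (fun j => if Z.eq_dec j i then RtoC 0 else w j)).
      { intros w i Hw. apply (summable_le _ w); auto. intros j. destruct (Z.eq_dec j i); [rewrite Cmod_0; apply Cmod_ge_0|lra]. }
      apply IH; auto.
      * intros j Hj. destruct (Z.eq_dec j j0) as [->|D]; [congruence|]. destruct (Hl j Hj) as [<-|L]; [congruence|auto].
      * intros j Hj. destruct (Z.eq_dec j j0) as [->|D]; [congruence|auto].
      * intros k Hk. destruct (Z.eq_dec k k0) as [->|D]; [congruence|auto].
      * intros j k Hjk. destruct (Z.eq_dec j j0) as [->|D], (Z.eq_dec k k0) as [->|D']; auto.
        -- exfalso. apply D'. now apply (F2 j0).
        -- exfalso. apply D. now apply (F1 j j0 k0).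
Qed.

Lemma class_split (x : nat -> R) n y p c g :
  (forall i i' k k', (i < n)%nat -> (i' < n)%nat -> x i + IZR k * y = x i' + IZR k' * y -> i = i') ->
  (forall j, c j <> RtoC 0 -> exists i, (i < n)%nat /\ in_progression (x i) y (p j)) ->
  summable (fun j => Cmult (c j) (g (p j))) ->
  Zs (fun j => Cmult (c j) (g (p j))) = csum n (fun i => Zs (fun j => Cmult (restrict (in_progression (x i) y) p c j) (g (p j)))).
Proof.
  intros Hd Hc Hs. rewrite <- Zs_csum.
  - apply Zs_ext. intros j. destruct (classic (c j = RtoC 0)) as [C|C].
    + rewrite csum_0; [rewrite C; ring|]. intros i _. unfold restrict. destruct (decide _); rewrite ?C; ring.
    + destruct (Hc j C) as [i0 [Hi0 Hin]]. rewrite (csum_unique n _ i0); auto.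
      * unfold restrict. now rewrite (proj2 (decide_true _) Hin).
      * intros i Hi Hne. unfold restrict. destruct (decide (in_progression (x i) y (p j))) eqn:E; [|ring].
        apply (proj1 (decide_true _)) in E. destruct E as [k E], Hin as [k' E']. exfalso. apply Hne.
        apply (Hd i i0 k k'); auto. congruence.
  - intros i _. apply (summable_le _ (fun j => Cmult (c j) (g (p j)))); auto. intros j. unfold restrict.
    destruct (decide _); [lra|]. rewrite Cmult_0_l, Cmod_0. apply Cmod_ge_0.
Qed.

(** Each class that meets the support has density at least [/ 25600] per step, and distinct classes
    are disjoint; the pigeonhole on cell indices bounds their number. *)
Lemma selfdual_classes rho p c sig kap y : selfdual rho p c sig kap -> 0 < y ->
  (forall i j, c i <> RtoC 0 -> c j <> RtoC 0 -> exists k : Z, Rabs ((p i - p j) * y - IZR k) <= / 8) ->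
  exists X, NoDup X /\ (forall x, In x X -> 0 <= x < y) /\
    forall j, c j <> RtoC 0 -> exists x, In x X /\ in_progression x y (p j).
Proof.
  intros H Hy Hap. assert (Hp : cells rho p) by apply H. assert (Hr : 0 < rho) by apply Hp.
  set (P := fun x => 0 <= x < y /\ exists k, in_orbit p c x y k).
  destruct (exists_nat_gt (2 * (y / rho) * 25600)) as [M [_ HM]].
  destruct (finite_of_bounded P M) as [l Hl].
  { intros l Hnd Hlp. apply Nat.nlt_ge. intros HlM. set (x := fun i => nth i l 0).
    assert (Hx : forall i, (i < length l)%nat -> P (x i)) by (intros i Hi; apply Hlp, nth_In; auto).
    destruct (choice (fun (q : nat * Z) (j : Z) => in_orbit p c (x (fst q)) y (snd q) -> p j = x (fst q) + IZR (snd q) * y)) as [G HG].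
    { intros [i k]. simpl. destruct (classic (in_orbit p c (x i) y k)) as [[j [_ E]]|C]; [exists j; auto|exists 0%Z; intros; contradiction]. }
    destruct (dense_collision (length l) (/ 25600) 1 (y / rho) (2 * y / rho + 1) (fun i => in_orbit p c (x i) y) (fun i k => G (i, k)))
      as [i [k [i' [k' [Hi [Hi' [HKi [HKi' [Hne HE]]]]]]]]]; try lra.
    - apply Rlt_le, Rdiv_lt_0_compat; auto.
    - intros i Hi. apply (orbit_dense rho p c sig kap); auto. apply Hx; auto.
    - intros i k Hi HK. specialize (HG (i, k) HK). cbn [fst snd] in HG. destruct (Hx i Hi) as [Hb _].
      pose proof (proj2 Hp (G (i, k))) as HpG. rewrite HG in HpG. set (z := IZR (G (i, k))) in *.
      apply Rmult_le_reg_r with rho; auto.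
      replace ((y / rho * Rabs (IZR k) + (2 * y / rho + 1)) * rho) with (y * Rabs (IZR k) + 2 * y + rho) by (field; lra).
      replace (Rabs z * rho) with (Rabs (z * rho)) by (rewrite Rabs_mult, (Rabs_pos_eq rho); lra).
      assert (Rabs (IZR k * y) = y * Rabs (IZR k)) by (rewrite Rabs_mult, (Rabs_pos_eq y); lra).
      pose proof (Rle_abs (IZR k * y)). pose proof (Rle_abs (- (IZR k * y))) as A. rewrite Rabs_Ropp in A.
      apply Rabs_le. lra.
    - assert (INR M < INR (length l)) by (apply lt_INR; auto). lra.
    - apply Hne. pose proof (HG (i, k) HKi) as E1. pose proof (HG (i', k') HKi') as E2. cbn [fst snd] in *. rewrite HE in E1.
      destruct (Hx i Hi) as [B1 _], (Hx i' Hi') as [B2 _]. rewrite E2 in E1.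
      assert (B : -1 < IZR (k - k') < 1) by (rewrite minus_IZR; split; apply Rmult_lt_reg_r with y; lra).
      destruct B as [B3 B4]. apply lt_IZR in B3. apply lt_IZR in B4. assert (Ek : k = k') by lia. subst k'.
      f_equal. apply (proj1 (NoDup_nth l 0) Hnd); auto. unfold x in E1. lra. }
  exists (filter (fun x => decide (P x)) (nodup Req_EM_T l)). split; [apply NoDup_filter, NoDup_nodup|]. split.
  - intros x Hx. apply filter_In in Hx. destruct Hx as [_ Hx]. apply (proj1 (decide_true _)) in Hx. apply Hx.
  - intros j Hj. destruct (floor_cell y (p j) Hy) as [k Hk]. set (x := p j - IZR k * y).
    assert (Px : P x) by (split; [unfold x; lra|]; exists k, j; split; auto; unfold x; ring).
    exists x. split; [apply filter_In; split; [apply nodup_In; auto|now apply decide_true]|]. exists k. unfold x. ring.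
Qed.

Definition comb_span (y : R) (mu : measure) : Prop :=
  exists n C r s, meq mu (lincomb n C (fun i => comb (r i) (s i) y)).

Lemma comb_span_meq y mu nu : meq mu nu -> comb_span y nu -> comb_span y mu.
Proof. intros E [n [C [r [s H]]]]. exists n, C, r, s. eapply meq_trans; eauto. Qed.

Lemma comb_span_plus y mu nu : comb_span y mu -> comb_span y nu -> comb_span y (fun f => Cplus (mu f) (nu f)).
Proof.
  intros [n [C [r [s H]]]] [n' [C' [r' [s' H']]]].
  set (glue := fun (X : Type) (a b : nat -> X) i => if lt_dec i n then a i else b (i - n)%nat).
  exists (n + n')%nat, (glue _ C C'), (glue _ r r'), (glue _ s s'). intros f Hf. rewrite H, H' by auto.
  unfold lincomb. rewrite csum_add. f_equal.
  - apply csum_ext. intros i Hi. unfold glue. destruct (lt_dec i n); [auto|lia].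
  - apply csum_ext. intros i Hi. unfold glue. destruct (lt_dec (n + i) n); [lia|]. now replace (n + i - n)%nat with i by lia.
Qed.

Lemma comb_span_csum y n (F : nat -> measure) : (forall i, (i < n)%nat -> comb_span y (F i)) ->
  comb_span y (fun f => csum n (fun i => F i f)).
Proof.
  induction n as [|n IH]; intros H.
  - exists 0%nat, (fun _ => RtoC 0), (fun _ => 0), (fun _ => 0). intros f _. reflexivity.
  - apply (comb_span_plus y (fun f => csum n (fun i => F i f)) (F n)); auto.
Qed.

(* On the class of [x + y Z] with [y^2] an integer the characters [e^{-2 pi i sig u p_j}], [u = x' + k y], depend on
   the class of [p_j] only through a character of [u]; so the coefficients are trigonometric polynomials along each class. *)
Lemma selfdual_comb_span rho p c sig kap : selfdual rho p c sig kap -> (exists j, c j <> RtoC 0) ->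
  exists n, (0 < n)%nat /\ comb_span (sqrt (INR n)) (dmeas p c).
Proof.
  intros H Hne. destruct (selfdual_sqrt_period _ _ _ _ _ H Hne) as [n0 [Hn0 Hap]].
  exists n0. split; auto. set (y := sqrt (INR n0)) in *.
  assert (Hn0' : 0 < INR n0) by now apply lt_0_INR.
  assert (Hy : 0 < y) by now apply sqrt_lt_R0. assert (Hyy : y * y = INR n0) by (apply sqrt_sqrt; lra).
  destruct (selfdual_classes _ _ _ _ _ y H Hy Hap) as [X [HX1 [HX2 HX3]]].
  assert (H' := H). destruct H' as [Hp [Hs [Ht [Hsig [Hk Hid]]]]]. assert (Hr : 0 < rho) by apply Hp.
  set (n := length X). set (x := fun i => nth i X 0).
  assert (HxX : forall i, (i < n)%nat -> In (x i) X) by (intros i Hi; apply nth_In; auto).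
  assert (Hdist : forall i i' k k', (i < n)%nat -> (i' < n)%nat -> x i + IZR k * y = x i' + IZR k' * y -> i = i').
  { intros i i' k k' Hi Hi' E. pose proof (HX2 _ (HxX i Hi)) as B1. pose proof (HX2 _ (HxX i' Hi')) as B2.
    assert (B : -1 < IZR (k - k') < 1) by (rewrite minus_IZR; split; apply Rmult_lt_reg_r with y; lra).
    destruct B as [B3 B4]. apply lt_IZR in B3. apply lt_IZR in B4. assert (Ek : k = k') by lia. subst k'.
    apply (proj1 (NoDup_nth X 0) HX1); auto. unfold x in E. lra. }
  assert (Hcov : forall j, c j <> RtoC 0 -> exists i, (i < n)%nat /\ in_progression (x i) y (p j)).
  { intros j Hj. destruct (HX3 j Hj) as [z [Hz1 Hz2]]. destruct (In_nth X z 0 Hz1) as [i [Hi <-]]. exists i. auto. }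
  destruct (progressions_separated X y Hy) as [e0 [He0 Hsep]].
  (* Below the distance of any two distinct points of the progressions, so a bump of width [e] at
     [u] detects only [u] itself. *)
  set (e := Rmin e0 (rho / 2)). assert (He : 0 < e) by (apply Rmin_glb_lt; lra).
  assert (Hee : e <= e0) by apply Rmin_l. assert (Her : e <= rho / 2) by apply Rmin_r.
  (* The part of the window series at [x i'] from class [i]; it does not depend on the position [k]
     along the class of [i']. *)
  set (D := fun i i' => Zs (fun j => Cmult (restrict (in_progression (x i) y) p c j)
               (Cmult (cexpi (- (2 * PI * sig * x i' * p j))) (window sig e (p j))))).
  assert (Hval : forall i' k, (i' < n)%nat ->
    Cmult kap (val p c (x i' + IZR k * y)) = csum n (fun i => Cmult (cexpi (- (2 * PI * sig * x i * (IZR k * y)))) (D i i'))).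
  { intros i' k Hi'. set (u := x i' + IZR k * y).
    rewrite <- (bump_sum_val rho p c e u Hp Hs He Her).
    2:{ intros j Hj Hlt. destruct (Hcov j Hj) as [i [Hi [m Em]]]. apply NNPP. intros C.
        assert (e0 <= Rabs (x i + IZR (m - k) * y - x i')).
        { apply Hsep; auto. rewrite minus_IZR. intros E. apply C. unfold u. rewrite Em. lra. }
        replace (x i + IZR (m - k) * y - x i') with (p j - u) in H0 by (rewrite minus_IZR; unfold u; rewrite Em; ring). lra. }
    rewrite <- (window_identity0 rho p c sig kap e u H He).
    assert (Hsum : forall v, summable (fun j => Cmult (c j) (Cmult (cexpi (- (2 * PI * sig * v * p j))) (window sig e (p j))))).
    { intros v. apply (summable_rapid rho p c (fun t => Cmult (cexpi (- (2 * PI * sig * v * t))) (window sig e t))); auto using cells_spread.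
      apply rapid_mult; [|now apply rapid_window]. exists 1. intros t. rewrite Cmod_cexpi. lra. }
    rewrite (class_split x n y p c (fun t => Cmult (cexpi (- (2 * PI * sig * u * t))) (window sig e t)) Hdist Hcov (Hsum u)).
    apply csum_ext. intros i Hi. unfold D. rewrite <- Zs_scal.
    2:{ apply (summable_le _ _ (Hsum (x i'))). intros j. unfold restrict. destruct (decide _); [lra|]. rewrite Cmult_0_l, Cmod_0. apply Cmod_ge_0. }
    apply Zs_ext. intros j. unfold restrict. destruct (decide (in_progression (x i) y (p j))) eqn:E; [|ring].
    apply (proj1 (decide_true _)) in E. destruct E as [m Em].
    (* The cross term of [k * y] and [m * y] in the phase is an integer multiple of [2 * PI],
       because [y * y] is the integer [n0]. *)
    assert (Hsg : exists z : Z, sig * IZR k * IZR m * INR n0 = IZR z).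
    { assert (E : sig = 1 \/ sig = -1) by (destruct (Rmult_integral (sig - 1) (sig + 1)); [lra|left; lra|right; lra]).
      destruct E as [-> | ->]; [exists (k * m * Z.of_nat n0)%Z|exists (- (k * m * Z.of_nat n0))%Z]; rewrite ?opp_IZR, !mult_IZR, <- INR_IZR_INZ; ring. }
    destruct Hsg as [z Hz].
    replace (- (2 * PI * sig * u * p j)) with (- (2 * PI * sig * x i * (IZR k * y)) + - (2 * PI * sig * x i' * p j) + 2 * PI * IZR (- z)).
    { rewrite !cexpi_plus, cexpi_2PI_IZR. ring. }
    rewrite opp_IZR, <- Hz, <- Hyy. unfold u. rewrite Em. ring. }
  assert (Hki : forall a b, Cmult kap a = b -> a = Cmult (Cinv kap) b) by (intros a b <-; field; exact Hk).
  apply (comb_span_meq y _ (fun f => csum n (fun i' => Zs (fun k => Cmult (val p c (x i' + IZR k * y)) (f (comb_pt (x i') y k)))))).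
  - intros f Hf. unfold dmeas. pose proof (summable_Cc rho p c f (cells_spread _ _ Hp) Hf) as Hsf.
    rewrite (class_split x n y p c f Hdist Hcov Hsf). apply csum_ext. intros i Hi.
    destruct (Cc_spread_finite rho p f (cells_spread _ _ Hp) Hf) as [M HM].
    apply (Zs_reindex (fun j k => p j = x i + IZR k * y) (zrange M)).
    + intros j j' k E E'. apply (cells_inj rho p); auto. congruence.
    + intros j k k' E E'. apply eq_IZR, (Rmult_eq_reg_r y); lra.
    + apply (summable_le _ _ Hsf). intros j. unfold restrict. destruct (decide _); [lra|]. rewrite Cmult_0_l, Cmod_0. apply Cmod_ge_0.
    + apply (summable_Cc y (comb_pt (x i) y) (fun k => val p c (x i + IZR k * y))); auto. now apply spread_comb.
    + intros j Hj. apply In_zrange. apply Z.nlt_ge. intros L. apply Hj. rewrite HM by auto. ring.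
    + intros j Hj. assert (Hj' : restrict (in_progression (x i) y) p c j <> RtoC 0) by (intros E; apply Hj; rewrite E; ring).
      apply restrict_nonzero in Hj'. apply Hj'.
    + intros k Hk'. destruct (val_nonzero p c (x i + IZR k * y)) as [j [Ej _]]; [|now exists j]. intros E. apply Hk'. rewrite E. ring.
    + intros j k E. unfold restrict, comb_pt. rewrite <- E, (val_p rho) by auto.
      replace (decide (in_progression (x i) y (p j))) with true; auto. symmetry. apply decide_true. now exists k.
  - apply comb_span_csum. intros i' Hi'.
    (* Class [i] acts on class [i'] through the character of frequency [- sig * x i]; the extra
       phase corrects for evaluating it at the position rather than at [k * y]. *)
    exists n, (fun i => Cmult (Cinv kap) (Cmult (cexpi (2 * PI * sig * x i * x i')) (D i i'))), (fun i => - sig * x i), (fun _ => x i').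
    intros f Hf. unfold lincomb, comb, dmeas.
    assert (Hsc : forall r, summable (fun k => Cmult (comb_cf r (x i') y k) (f (comb_pt (x i') y k)))).
    { intros r. apply (summable_Cc y); auto. now apply spread_comb. }
    rewrite (csum_ext n _ (fun i => Zs (fun k => Cmult (Cmult (Cinv kap) (Cmult (cexpi (2 * PI * sig * x i * x i')) (D i i')))
       (Cmult (comb_cf (- sig * x i) (x i') y k) (f (comb_pt (x i') y k)))))) by (intros; now rewrite Zs_scal).
    rewrite <- Zs_csum by (intros; now apply summable_scal). apply Zs_ext. intros k.
    rewrite (Hki _ _ (Hval i' k Hi')). rewrite (Cmult_comm _ (f _)), (Cmult_assoc (f _)), <- csum_scal.
    apply csum_ext. intros i Hi. unfold comb_cf, comb_pt.
    replace (2 * PI * (- sig * x i) * (x i' + IZR k * y)) with (- (2 * PI * sig * x i * x i') + - (2 * PI * sig * x i * (IZR k * y))) by ring.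
    rewrite cexpi_plus. pose proof (cexpi_opp_l (2 * PI * sig * x i * x i')) as E.
    set (E1 := cexpi (- (2 * PI * sig * x i * x i'))) in *. set (E2 := cexpi (2 * PI * sig * x i * x i')) in *.
    set (F := f _). set (W := cexpi _).
    transitivity (Cmult (Cmult E1 E2) (Cmult F (Cmult (Cinv kap) (Cmult W (D i i'))))); [rewrite E; ring|ring].
Qed.

(** * Convolution *)

Lemma cexpi_lipschitz a b : Cmod (cexpi a - cexpi b)%C <= 2 * Rabs (a - b).
Proof.
  replace (cexpi a - cexpi b)%C with (Cmult (cexpi b) (cexpi (a - b) - 1)%C).
  2:{ replace (cexpi a) with (Cmult (cexpi b) (cexpi (a - b))) by (rewrite <- cexpi_plus; f_equal; ring). ring. }
  rewrite Cmod_mult, Cmod_cexpi, Rmult_1_l. eapply Rle_trans; [apply Cmod_le_sum|]. simpl. set (d := a - b).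
  assert (E : cos d + - (1) = - (2 * sin (d / 2) * sin (d / 2))).
  { replace d with (2 * (d / 2)) at 1 by field. rewrite cos_2a_sin. ring. }
  pose proof (Rabs_sin_le d). pose proof (Rabs_sin_le (d / 2)) as A.
  replace (Rabs (d / 2)) with (Rabs d / 2) in A by (unfold Rdiv; rewrite Rabs_mult, (Rabs_pos_eq (/ 2)); lra).
  assert (B : Rabs (sin (d / 2)) <= 1) by (apply Rabs_le; apply SIN_bound). pose proof (Rabs_pos (sin (d / 2))).
  replace (sin d + - 0) with (sin d) by ring.
  rewrite E, Rabs_Ropp, !Rabs_mult, (Rabs_pos_eq 2) by lra. nra.
Qed.

(** * Uniform continuity in two variables and exchange of integrals *)

Definition bounded_unif (F : R -> R -> CC) : Prop :=
  (exists B, 0 <= B /\ forall x t, Cmod (F x t) <= B) /\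
  forall e, 0 < e -> exists d, 0 < d /\ forall x x' t t', Rabs (x - x') < d -> Rabs (t - t') < d -> Cmod (F x t - F x' t')%C <= e.

Lemma bounded_unif_mult F G : bounded_unif F -> bounded_unif G -> bounded_unif (fun x t => Cmult (F x t) (G x t)).
Proof.
  intros [[A [HA0 HA]] UF] [[B [HB0 HB]] UG]. split.
  - exists (A * B). split; [now apply Rmult_le_pos|]. intros x t. rewrite Cmod_mult. apply Rmult_le_compat; auto; apply Cmod_ge_0.
  - intros e He. set (e' := e / (A + B + 1)). assert (He' : 0 < e') by (apply Rdiv_lt_0_compat; lra).
    destruct (UF e' He') as [d [Hd H1]], (UG e' He') as [d' [Hd' H2]].
    exists (Rmin d d'). split; [now apply Rmin_glb_lt|]. intros x x' t t' Hx Ht.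
    pose proof (Rmin_l d d'). pose proof (Rmin_r d d').
    specialize (H1 x x' t t' ltac:(lra) ltac:(lra)). specialize (H2 x x' t t' ltac:(lra) ltac:(lra)).
    replace (F x t * G x t - F x' t' * G x' t')%C with (F x t * (G x t - G x' t') + (F x t - F x' t') * G x' t')%C by ring.
    eapply Rle_trans; [apply Cmod_triangle|]. rewrite !Cmod_mult. specialize (HA x t). specialize (HB x' t').
    pose proof (Cmod_ge_0 (F x t)). pose proof (Cmod_ge_0 (G x' t')).
    apply Rle_trans with (A * e' + e' * B).
    + apply Rplus_le_compat; apply Rmult_le_compat; auto; apply Cmod_ge_0.
    + assert (E : e' * (A + B + 1) = e) by (unfold e'; field; lra). nra.
Qed.

Lemma bounded_unif_Cc g a b : Cc g -> Rabs a <= 1 -> Rabs b <= 1 -> bounded_unif (fun x t => g (a * x + b * t)).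
Proof.
  intros Hg Ha Hb. split.
  - destruct (Cc_bounded g Hg) as [B [HB0 HB]]. exists B; auto.
  - intros e He. destruct (Cc_unif_cont g Hg e He) as [d [Hd H]]. exists (d / 2). split; [lra|].
    intros x x' t t' Hx Ht. apply H. replace (a * x + b * t - (a * x' + b * t')) with (a * (x - x') + b * (t - t')) by ring.
    eapply Rle_lt_trans; [apply Rabs_triang|]. rewrite !Rabs_mult. pose proof (Rabs_pos (x - x')). pose proof (Rabs_pos (t - t')). nra.
Qed.

Lemma bounded_unif_cexpi a : bounded_unif (fun x t => cexpi (a * x)).
Proof.
  split.
  - exists 1. split; [lra|]. intros. rewrite Cmod_cexpi. lra.
  - intros e He. pose proof (Rabs_pos a). exists (e / (2 * (Rabs a + 1))). split; [apply Rdiv_lt_0_compat; lra|].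
    intros x x' t _ Hx _. eapply Rle_trans; [apply cexpi_lipschitz|].
    replace (a * x - a * x') with (a * (x - x')) by ring. rewrite Rabs_mult.
    assert (E : e / (2 * (Rabs a + 1)) * (2 * (Rabs a + 1)) = e) by (field; lra).
    set (d := e / (2 * (Rabs a + 1))) in *. pose proof (Rabs_pos (x - x')). nra.
Qed.

Definition unif_cont2 (F : R -> R -> R) : Prop :=
  forall e, 0 < e -> exists d, 0 < d /\ forall x x' t t', Rabs (x - x') < d -> Rabs (t - t') < d -> Rabs (F x t - F x' t') <= e.

Lemma unif_cont2_swap F : unif_cont2 F -> unif_cont2 (fun t x => F x t).
Proof. intros H e He. destruct (H e He) as [d [Hd H']]. exists d. auto. Qed.

Lemma unif_cont2_continuous F t : unif_cont2 F -> forall x, continuous (fun x => F x t) x.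
Proof.
  intros H x P [e HP]. destruct (H (e / 2)) as [d [Hd H']]; [pose proof (cond_pos e); lra|]. exists (mkposreal d Hd).
  intros y Hy. apply HP. apply Rle_lt_trans with (e / 2); [|pose proof (cond_pos e); lra].
  apply (H' y x t t). exact Hy. rewrite Rminus_diag, Rabs_R0. exact Hd.
Qed.

Lemma bounded_unif_components F : bounded_unif F -> unif_cont2 (fun x t => fst (F x t)) /\ unif_cont2 (fun x t => snd (F x t)).
Proof.
  intros [_ HF]. split; intros e He; destruct (HF e He) as [d [Hd H]]; exists d; split; auto;
    intros x x' t t' Hx Ht; (eapply Rle_trans; [|apply (H x x' t t'); auto]).
  - apply (Rabs_fst_le (F x t - F x' t')%C). - apply (Rabs_snd_le (F x t - F x' t')%C).
Qed.

Lemma continuous_RInt_param F a b : unif_cont2 F -> forall t, continuous (fun t => RInt (fun z => F z t) a b) t.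
Proof.
  intros H t P [e HP].
  assert (Hc : forall s, forall z, continuous (fun z => F z s) z) by (intros; now apply unif_cont2_continuous).
  pose proof (Rabs_pos (b - a)).
  destruct (H (e / 2 / (Rabs (b - a) + 1))) as [d [Hd H']]. { pose proof (cond_pos e). apply Rdiv_lt_0_compat; lra. }
  exists (mkposreal d Hd). intros s Hs. apply HP.
  assert (Bd : forall a b, a <= b -> Rabs (RInt (fun z => F z s) a b - RInt (fun z => F z t) a b) <= (b - a) * (e / 2 / (Rabs (b - a) + 1)) ->
     Rabs (RInt (fun z => F z s) a b - RInt (fun z => F z t) a b) < e).
  { clear -e. intros a b L B. rewrite (Rabs_pos_eq (b - a)) in B by lra.
    assert (E : (b - a) * (e / 2 / (b - a + 1)) < e); [|lra].
    pose proof (cond_pos e). apply Rmult_lt_reg_r with (b - a + 1); [lra|].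
    replace ((b - a) * (e / 2 / (b - a + 1)) * (b - a + 1)) with ((b - a) * e / 2) by (field; lra).
    assert (0 <= (b - a) * e) by (apply Rmult_le_pos; lra). lra. }
  assert (Bd' : forall a' b', a' <= b' -> Rabs (b' - a') = Rabs (b - a) -> Rabs (RInt (fun z => F z s) a' b' - RInt (fun z => F z t) a' b') < e).
  { intros a' b' L E. apply Bd; auto.
    assert (E0 : @eq R (RInt (fun z => 1 * F z s + (-1) * F z t) a' b') (RInt (fun z => F z s) a' b' - RInt (fun z => F z t) a' b')).
    { rewrite RInt_lin by auto. ring. }
    rewrite <- E0.
    apply abs_RInt_le_const; auto.
    - apply continuous_ex_RInt. intros z. apply (continuous_plus (V := R_NormedModule) (fun z => 1 * F z s) (fun z => -1 * F z t));
        apply (continuous_scal_r (V := R_NormedModule)); apply Hc.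
    - intros z _. replace (1 * F z s + -1 * F z t) with (F z s - F z t) by ring. rewrite E. apply H'; [|exact Hs].
      rewrite Rminus_diag, Rabs_R0. exact Hd. }
  change (Rabs (RInt (fun z => F z s) a b - RInt (fun z => F z t) a b) < e).
  destruct (Rle_dec a b) as [L|L]; [now apply Bd'|].
  assert (Sw : forall s, RInt (fun z => F z s) a b = - RInt (fun z => F z s) b a).
  { intros s'. rewrite <- (opp_RInt_swap (fun z => F z s') b a); [reflexivity|]. apply continuous_ex_RInt, Hc. }
  rewrite !Sw. replace (- RInt (fun z => F z s) b a - - RInt (fun z => F z t) b a) with (- (RInt (fun z => F z s) b a - RInt (fun z => F z t) b a)) by ring.
  rewrite Rabs_Ropp. apply Bd'; [lra|apply Rabs_minus_sym].
Qed.

Lemma is_derive_RInt_continuous (g : R -> R) a x : (forall y, continuous g y) -> is_derive (fun x => RInt g a x) x (g x).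
Proof.
  intros Hg. apply (is_derive_RInt (V := R_NormedModule) g (fun x => RInt g a x) a x); auto.
  apply filter_forall. intros y. apply (RInt_correct (V := R_CompleteNormedModule)), continuous_ex_RInt, Hg.
Qed.

(** Regarded as functions of the upper limit [b], both sides have the same derivative and vanish at
    [a]. *)
Lemma fubini F a b c d : a < b -> unif_cont2 F ->
  @eq R (RInt (fun x => RInt (fun t => F x t) c d) a b) (RInt (fun t => RInt (fun x => F x t) a b) c d).
Proof.
  intros Hab HF.
  assert (Hc1 : forall t x, continuous (fun x => F x t) x) by (intros; now apply unif_cont2_continuous).
  assert (HD : forall u v, Derive (fun z => RInt (fun w => F w v) a z) u = F u v).
  { intros u v. apply is_derive_unique, (is_derive_RInt_continuous (fun w => F w v)), Hc1. }
  set (G := fun x : R => RInt (fun t => RInt (fun z => F z t) a x) c d : R).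
  set (H := fun x : R => RInt (fun x' => RInt (fun t => F x' t) c d) a x : R).
  assert (HG : forall x, is_derive G x (RInt (fun t => F x t) c d)).
  { intros x. replace (RInt (fun t => F x t) c d) with (RInt (fun t => Derive (fun z => RInt (fun w => F w t) a z) x) c d).
    2:{ apply RInt_extR. intros t. apply HD. }
    apply (is_derive_RInt_param (fun x t => RInt (fun z => F z t) a x)).
    - apply filter_forall. intros y t _. exists (F y t). apply (is_derive_RInt_continuous (fun w => F w t)), Hc1.
    - intros t _ e. destruct (HF (e / 2)) as [dl [Hdl HF']]; [pose proof (cond_pos e); lra|]. exists (mkposreal dl Hdl).
      intros u v Hu Hv. rewrite !HD. apply Rle_lt_trans with (e / 2); [|pose proof (cond_pos e); lra]. apply HF'; auto.
    - apply filter_forall. intros y. apply continuous_ex_RInt, continuous_RInt_param, HF. }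
  assert (HH : forall x, is_derive H x (RInt (fun t => F x t) c d)).
  { intros x. apply (is_derive_RInt_continuous (fun x' => RInt (fun t => F x' t) c d)).
    apply (continuous_RInt_param (fun t x => F x t)), unif_cont2_swap, HF. }
  assert (E : G a - H a = G b - H b).
  { apply (eq_is_derive (V := R_NormedModule) (fun x => G x - H x) a b); auto. intros t _.
    pose proof (is_derive_minus G H t _ _ (HG t) (HH t)) as Z. rewrite (minus_eq_zero (G := R_AbelianGroup)) in Z. exact Z. }
  assert (Ga : G a = 0).
  { unfold G. rewrite (RInt_extR _ (fun _ => 0)). rewrite RInt_const. unfold scal; simpl; unfold mult; simpl. ring.
    intros t. exact (RInt_point (V := R_CompleteNormedModule) a (fun z => F z t)). }
  assert (Ha : H a = 0) by exact (RInt_point (V := R_CompleteNormedModule) a _).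
  change (H b = G b). lra.
Qed.

Lemma fubini_cint F a b c d : a < b -> bounded_unif F ->
  cint a b (fun x => cint c d (fun t => F x t)) = cint c d (fun t => cint a b (fun x => F x t)).
Proof.
  intros Hab HF. apply bounded_unif_components in HF. destruct HF as [H1 H2]. unfold cint. apply C_eq; cbn [fst].
  - apply (fubini (fun x t => fst (F x t))); auto. - apply (fubini (fun x t => snd (F x t))); auto.
Qed.

Lemma cint_scal (f : R -> CC) c a b : (forall x, continuous f x) -> cint a b (fun x => Cmult c (f x)) = Cmult c (cint a b f).
Proof.
  intros Hf. assert (E : forall f : R -> CC, (fun x => Cmult c (f x)) = (fun x => Cplus (Cmult c (f x)) (RtoC 0))).
  { intros g. apply functional_extensionality; intros; ring. }
  rewrite E, (cint_lin f (fun _ => RtoC 0)); auto; [|intros; apply continuous_const].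
  replace (cint a b (fun _ => RtoC 0)) with (RtoC 0); [ring|].
  unfold cint. apply C_eq; symmetry; apply RInt_vanish; auto.
Qed.

Lemma Cc_conv_arg g h x : Cc g -> Cc h -> Cc (fun y => Cmult (g (x - y)) (h y)).
Proof.
  intros Hg Hh. apply (Cc_mult (fun y => g (x - y))); auto. intros y.
  apply (continuous_ext (fun y => g (-1 * y + x)) (fun y => g (x - y))); [intros; f_equal; ring|].
  apply continuous_affine, Cc_cont, Hg.
Qed.

Lemma conv_cint g h K x : Cc g -> Cc h -> 0 <= K -> (forall y, K <= Rabs y -> h y = RtoC 0) ->
  conv g h x = cint (- K) K (fun y => Cmult (g (x - y)) (h y)).
Proof.
  intros Hg Hh HK0 HK. unfold conv. apply integral_cint; auto.
  - apply Cc_conv_arg; auto. - intros y Hy. rewrite HK by auto. ring.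
Qed.

Lemma bounded_unif_conv g h : Cc g -> Cc h -> bounded_unif (fun x y => Cmult (g (x - y)) (h y)).
Proof.
  intros Hg Hh. apply (bounded_unif_mult (fun x y => g (x - y)) (fun x y => h y)).
  - assert (H := bounded_unif_Cc g 1 (-1) Hg). replace (fun x y => g (x - y)) with (fun x y => g (1 * x + -1 * y)).
    + apply H; [rewrite Rabs_R1|rewrite Rabs_left]; lra.
    + do 2 (apply functional_extensionality; intros); f_equal; ring.
  - assert (H := bounded_unif_Cc h 0 1 Hh). replace (fun _ y : R => h y) with (fun x y => h (0 * x + 1 * y)).
    + apply H; [rewrite Rabs_R0|rewrite Rabs_R1]; lra.
    + do 2 (apply functional_extensionality; intros); f_equal; ring.
Qed.

Lemma conv_support g h K x : (forall y, K <= Rabs y -> g y = RtoC 0) -> (forall y, K <= Rabs y -> h y = RtoC 0) ->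
  2 * K <= Rabs x -> forall y, Cmult (g (x - y)) (h y) = RtoC 0.
Proof.
  intros Hg Hh Hx y. destruct (Rle_dec K (Rabs y)) as [L|L].
  - rewrite Hh by auto. ring.
  - rewrite Hg; [ring|]. pose proof (Rabs_triang (x - y) y). replace (x - y + y) with x in H by ring. lra.
Qed.

Lemma common_support g h : Cc g -> Cc h -> exists K, 0 < K /\ (forall y, K <= Rabs y -> g y = RtoC 0) /\ (forall y, K <= Rabs y -> h y = RtoC 0).
Proof.
  intros Hg Hh. destruct (Cc_support g Hg) as [K [HK0 HK]], (Cc_support h Hh) as [L [HL0 HL]]. exists (Rmax K L).
  pose proof (Rmax_l K L). pose proof (Rmax_r K L). split; [lra|]. split; intros; [apply HK|apply HL]; lra.
Qed.

Lemma Cc_conv g h : Cc g -> Cc h -> Cc (conv g h).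
Proof.
  intros Hg Hh. destruct (common_support g h Hg Hh) as [K [HK0 [HKg HKh]]].
  pose proof (bounded_unif_components _ (bounded_unif_conv g h Hg Hh)) as [U1 U2]. split.
  - intros x. apply (continuous_ext (fun x => cint (- K) K (fun y => Cmult (g (x - y)) (h y))) (conv g h)).
    + intros z. symmetry. apply conv_cint; auto; lra.
    + apply continuous_C. split.
      * apply (continuous_RInt_param (fun y x => fst (Cmult (g (x - y)) (h y)))). now apply unif_cont2_swap in U1.
      * apply (continuous_RInt_param (fun y x => snd (Cmult (g (x - y)) (h y)))). now apply unif_cont2_swap in U2.
  - exists (2 * K). intros x Hx. unfold conv.
    replace (fun y => Cmult (g (x - y)) (h y)) with (fun _ : R => RtoC 0); [apply integral_0|].
    apply functional_extensionality; intros y. symmetry. apply (conv_support g h K); auto; lra.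
Qed.

Lemma fourier_conv g h xi : Cc g -> Cc h -> fourier (conv g h) xi = Cmult (fourier g xi) (fourier h xi).
Proof.
  intros Hg Hh. destruct (common_support g h Hg Hh) as [K [HK0 [HKg HKh]]].
  set (e := fun x => cexpi (- 2 * PI * x * xi)).
  assert (Ue : bounded_unif (fun x _ => e x)).
  { replace (fun x _ : R => e x) with (fun x _ : R => cexpi ((- 2 * PI * xi) * x)); [apply bounded_unif_cexpi|].
    do 2 (apply functional_extensionality; intros). unfold e. f_equal. ring. }
  assert (HF : bounded_unif (fun x y => Cmult (e x) (Cmult (g (x - y)) (h y)))).
  { apply (bounded_unif_mult (fun x _ => e x)); auto. now apply bounded_unif_conv. }
  assert (Out : forall x, 2 * K <= Rabs x -> conv g h x = RtoC 0).
  { intros x Hx. unfold conv. replace (fun y => Cmult (g (x - y)) (h y)) with (fun _ : R => RtoC 0); [apply integral_0|].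
    apply functional_extensionality; intros y. symmetry. apply (conv_support g h K); auto. }
  unfold fourier at 1. rewrite (integral_cint _ (2 * K)); [| |intros x Hx; rewrite Out by auto; ring|lra].
  2:{ intros; apply Cc_cont, Cc_fourier_arg, Cc_conv; auto. }
  replace (fun x => Cmult (cexpi (- 2 * PI * x * xi)) (conv g h x)) with (fun x => cint (- K) K (fun y => Cmult (e x) (Cmult (g (x - y)) (h y)))).
  2:{ apply functional_extensionality; intros x. rewrite (cint_scal (fun y => Cmult (g (x - y)) (h y))) by (intros; apply Cc_cont, Cc_conv_arg; auto).
      unfold e. f_equal. symmetry. apply conv_cint; auto; lra. }
  rewrite fubini_cint by (auto; lra).
  replace (fun t => cint (- (2 * K)) (2 * K) (fun x => Cmult (e x) (Cmult (g (x - t)) (h t)))) with (fun t => Cmult (fourier g xi) (Cmult (e t) (h t))).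
  - rewrite (cint_scal (fun t => Cmult (e t) (h t))) by (intros; apply Cc_cont, (Cc_fourier_arg h xi); auto).
    f_equal. unfold fourier, e. rewrite (integral_cint (fun x => Cmult (cexpi (- 2 * PI * x * xi)) (h x)) K); auto; try lra.
    + intros; apply Cc_cont, Cc_fourier_arg; auto.
    + intros x Hx. rewrite HKh by auto. ring.
  - apply functional_extensionality; intros t.
    transitivity (integral (fun x => Cmult (h t) (Cmult (e x) (g (1 * x + - t))))).
    + pose proof (Cc_affine g 1 (- t) ltac:(lra) Hg) as Hg'.
      replace (fun x => Cmult (h t) (Cmult (e x) (g (1 * x + - t)))) with (fun x => Cmult (e x) (Cmult (h t) (g (1 * x + - t)))) by (apply functional_extensionality; intros; ring).
      change (Cmult (fourier g xi) (Cmult (e t) (h t)) = fourier (fun x => Cmult (h t) (g (1 * x + - t))) xi).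
      rewrite (fourier_scal (fun x => g (1 * x + - t))), (fourier_affine g 1 (- t)) by (auto; lra).
      rewrite Rabs_R1, Rinv_1. replace (xi / 1) with xi by field. unfold e.
      replace (2 * PI * - t * xi) with (- 2 * PI * t * xi) by ring. ring.
    + rewrite (integral_cint _ (2 * K)).
      * f_equal. apply functional_extensionality; intros x. replace (1 * x + - t) with (x - t) by ring. ring.
      * intros x. replace (fun x => Cmult (h t) (Cmult (e x) (g (1 * x + - t)))) with (fun x => Cmult (e x) (Cmult (h t) (g (1 * x + - t)))) by (apply functional_extensionality; intros; ring).
        apply Cc_cont, (Cc_fourier_arg (fun x => Cmult (h t) (g (1 * x + - t))) xi), (Cc_scal (h t) (fun x => g (1 * x + - t))), (Cc_affine g); auto; lra.
      * intros x Hx. replace (1 * x + - t) with (x - t) by ring. pose proof (conv_support g h K x HKg HKh Hx t) as E.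
        transitivity (Cmult (e x) (Cmult (g (x - t)) (h t))); [ring|]. rewrite E. ring.
      * lra.
Qed.

Lemma Cc_conj_reflect g : Cc g -> Cc (fun x => Cconj (g (- x))).
Proof.
  intros Hg. assert (H : Cc (fun x => g (-1 * x + 0))) by (apply Cc_affine; auto; lra). destruct H as [Hc [K HK]]. split.
  - intros x. specialize (Hc x). apply continuous_C in Hc. apply continuous_C. unfold fre, fim in *. simpl in *.
    destruct Hc as [H1 H2]. split.
    + revert H1. apply continuous_ext. intros; do 2 f_equal; ring.
    + apply (continuous_ext (fun t => - snd (g (-1 * t + 0)))).
      * intros; do 3 f_equal; ring.
      * apply (continuous_opp (V := R_NormedModule)), H2.
  - exists K. intros x Hx. replace (- x) with (-1 * x + 0) by ring. rewrite HK by auto. ceq; ring.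
Qed.

Lemma cint_conj a b (f : R -> CC) : (forall x, continuous f x) -> cint a b (fun x => Cconj (f x)) = Cconj (cint a b f).
Proof.
  intros Hf. unfold cint, Cconj. ceq. reflexivity.
  replace (- RInt (fim f) a b) with ((-1) * RInt (fim f) a b) by ring. rewrite <- RInt_scalR by now apply fim_cont.
  apply RInt_extR. intros x. unfold fim, Cconj. simpl. ring.
Qed.

Lemma fourier_conj_reflect g y : Cc g -> fourier (fun x => Cconj (g (- x))) y = Cconj (fourier g y).
Proof.
  intros Hg. destruct (Cc_support g Hg) as [K [HK0 HK]]. pose proof (Cc_conj_reflect g Hg) as Hg'.
  replace (fourier (fun x => Cconj (g (- x))) y) with (fourier (fun x => Cconj (g (- - x))) (- y)).
  2:{ rewrite (fourier_reflect (fun x => Cconj (g (- x)))) by auto. now rewrite Ropp_involutive. }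
  unfold fourier. rewrite (integral_cint (fun x => Cmult (cexpi (- 2 * PI * x * y)) (g x)) K), <- cint_conj; try lra.
  - rewrite (integral_cint _ K); try lra.
    + f_equal. apply functional_extensionality; intros x. rewrite Cmult_conj, Ropp_involutive. f_equal.
      unfold cexpi, Cconj. simpl. replace (- 2 * PI * x * - y) with (- (- 2 * PI * x * y)) by ring. now rewrite cos_neg, sin_neg.
    + intros x. apply Cc_cont, (Cc_fourier_arg (fun x => Cconj (g (- - x)))), (Cc_conj_reflect (fun x => g (- x))).
      replace (fun x => g (- x)) with (fun x => g (-1 * x + 0)) by (apply functional_extensionality; intros; f_equal; ring).
      apply Cc_affine; auto; lra.
    + intros x Hx. rewrite HK by now rewrite Ropp_involutive. ceq; ring.
  - intros; apply Cc_cont, Cc_fourier_arg, Hg.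
  - intros; apply Cc_cont, Cc_fourier_arg, Hg.
  - intros x Hx. rewrite HK by auto. ring.
Qed.

(* Poisson summation for the autocorrelation, whose transform is [|g^|^2]. *)
Lemma fourier_square_summable g s al : Cc g -> al <> 0 ->
  exists B, forall M, zsumR M (fun m => Cmod (fourier g (s + IZR m * al)) ^ 2) <= B.
Proof.
  intros Hg Ha.
  set (g1 := fun x => Cmult (cexpi (2 * PI * (- s / al) * x)) (g (/ al * x + 0))).
  assert (Hia : / al <> 0) by now apply Rinv_neq_0_compat.
  assert (Hg0 : Cc (fun x => g (/ al * x + 0))) by now apply Cc_affine.
  assert (Hg1 : Cc g1).
  { unfold g1. apply (Cc_mult (fun x => cexpi (2 * PI * (- s / al) * x))); auto. intros; apply continuous_cexpi. }
  assert (F1 : forall m : Z, fourier g1 (IZR m) = Cmult (RtoC (Rabs al)) (fourier g (s + IZR m * al))).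
  { intros m. unfold g1. rewrite (fourier_mod (fun x => g (/ al * x + 0))), (fourier_affine g (/ al) 0) by auto.
    rewrite Rmult_0_r, Rmult_0_l, cexpi_0, Cmult_1_l. rewrite Rabs_inv, Rinv_inv. f_equal. f_equal. field. auto. }
  destruct (poisson_summable_nonneg (conv g1 (fun x => Cconj (g1 (- x)))) (fun m => Rabs al ^ 2 * Cmod (fourier g (s + IZR m * al)) ^ 2)) as [B HB].
  - apply Cc_conv; auto. now apply Cc_conj_reflect.
  - intros m. apply Rmult_le_pos; apply pow2_ge_0.
  - intros m. rewrite fourier_conv, fourier_conj_reflect, <- Cmod2_conj, F1, Cmod_mult, Cmod_R, Rabs_Rabsolu; auto.
    + f_equal. ring. + now apply Cc_conj_reflect.
  - assert (Hp : 0 < Rabs al ^ 2) by (apply pow_lt, Rabs_pos_lt; auto). exists (/ Rabs al ^ 2 * B). intros M.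
    specialize (HB M). rewrite zsumR_scal in HB. apply Rmult_le_reg_l with (Rabs al ^ 2); auto.
    replace (Rabs al ^ 2 * (/ Rabs al ^ 2 * B)) with B by (field; now apply Rabs_no_R0). exact HB.
Qed.

Lemma in_conv_span_Cc f : in_conv_span f -> Cc f.
Proof.
  intros [k [c [g [h [H E]]]]]. replace f with (fun x => csum k (fun i => Cmult (c i) (conv (g i) (h i) x))).
  - apply (Cc_csum k (fun i x => Cmult (c i) (conv (g i) (h i) x))). intros i Hi. destruct (H i Hi). apply (Cc_scal (c i) (conv (g i) (h i))). now apply Cc_conv.
  - apply functional_extensionality; auto.
Qed.

(** The transform of a convolution is a product, bounded by the sum of the squares of its factors;
    each square is summable along the progression. *)
Lemma conv_span_fourier_summable f s al : in_conv_span f -> al <> 0 -> summable (fun m => fourier f (s + IZR m * al)).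
Proof.
  intros [k [c [g [h [H E]]]]] Ha.
  assert (F : forall y, fourier f y = csum k (fun i => Cmult (c i) (Cmult (fourier (g i) y) (fourier (h i) y)))).
  { intros y. replace f with (fun x => csum k (fun i => Cmult (c i) (conv (g i) (h i) x))) by (apply functional_extensionality; auto).
    clear E. induction k as [|k IH]; [apply fourier_0|]. cbn [csum]. rewrite <- IH by auto.
    destruct (H k) as [Hg Hh]; [lia|]. rewrite (fourier_plus (fun x => csum k (fun i => Cmult (c i) (conv (g i) (h i) x)))).
    - rewrite (fourier_scal (conv (g k) (h k))), fourier_conv by (auto; now apply Cc_conv). reflexivity.
    - apply (Cc_csum k (fun i x => Cmult (c i) (conv (g i) (h i) x))). intros i Hi. destruct (H i) as [A B]; [lia|].
      apply (Cc_scal (c i) (conv (g i) (h i))). now apply Cc_conv.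
    - apply (Cc_scal (c k) (conv (g k) (h k))). now apply Cc_conv. }
  replace (fun m => fourier f (s + IZR m * al)) with
    (fun m => csum k (fun i => Cmult (c i) (Cmult (fourier (g i) (s + IZR m * al)) (fourier (h i) (s + IZR m * al))))) by (apply functional_extensionality; auto).
  apply (summable_csum k (fun i m => Cmult (c i) (Cmult (fourier (g i) (s + IZR m * al)) (fourier (h i) (s + IZR m * al))))).
  intros i Hi. destruct (H i Hi) as [Hg Hh]. apply summable_scal.
  destruct (fourier_square_summable (g i) s al Hg Ha) as [B1 H1], (fourier_square_summable (h i) s al Hh Ha) as [B2 H2].
  apply (summable_dom _ (fun m => Cmod (fourier (g i) (s + IZR m * al)) ^ 2 + Cmod (fourier (h i) (s + IZR m * al)) ^ 2) (B1 + B2)).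
  - intros M. rewrite zsumR_plus. specialize (H1 M). specialize (H2 M). lra.
  - assert (AG : forall a b, 0 <= a -> 0 <= b -> a * b <= a ^ 2 + b ^ 2) by (intros a b Ha' Hb'; nra).
    intros m. rewrite Cmod_mult. apply AG; apply Cmod_ge_0.
Qed.

Ltac mul_pos := repeat match goal with |- 0 <= _ * _ => apply Rmult_le_pos end; try apply Rabs_pos; lra.

Lemma continuous_C_eps (f : R -> CC) x : (forall e, 0 < e -> exists d, 0 < d /\ forall y, Rabs (y - x) < d -> Cmod (f y - f x)%C <= e) ->
  continuous f x.
Proof.
  intros H. apply continuous_C. split; intros P [e HP]; (destruct (H (e / 2)) as [d [Hd H']]; [pose proof (cond_pos e); lra|]);
    exists (mkposreal d Hd); intros y Hy; apply HP; specialize (H' y Hy); pose proof (cond_pos e).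
  - pose proof (Rabs_fst_le (f y - f x)%C) as A. change (Rabs (fst (f y - f x)%C) < e). lra.
  - pose proof (Rabs_snd_le (f y - f x)%C) as A. change (Rabs (snd (f y - f x)%C) < e). lra.
Qed.

Lemma continuous_fourier f : Cc f -> forall y, continuous (fourier f) y.
Proof.
  intros Hf y. destruct (Cc_support f Hf) as [K [HK0 HK]], (Cc_bounded f Hf) as [B [HB0 HB]].
  apply continuous_C_eps. intros e He. set (D := 4 * (K * (2 * (2 * PI * K) * B))).
  pose proof PI_RGT_0. assert (HD : 0 <= D) by (unfold D; mul_pos).
  exists (e / (D + 1)). split; [apply Rdiv_lt_0_compat; lra|]. intros z Hz.
  assert (Hd : D * Rabs (z - y) <= e).
  { apply Rle_trans with ((D + 1) * (e / (D + 1))); [|apply Req_le; field; lra].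
    apply Rmult_le_compat; auto; try lra. apply Rabs_pos. }
  assert (E : (fourier f z - fourier f y)%C = integral (fun x => Cplus (Cmult (RtoC (-1)) (Cmult (cexpi (- 2 * PI * x * y)) (f x))) (Cmult (cexpi (- 2 * PI * x * z)) (f x)))).
  { rewrite integral_lin by now apply Cc_fourier_arg. unfold fourier. ring. }
  rewrite E. apply Rle_trans with (4 * (K * (2 * (2 * PI * K) * Rabs (z - y) * B))); [|unfold D in Hd; lra].
  apply integral_bound; try lra.
  - apply (Cc_plus (fun x => Cmult (RtoC (-1)) (Cmult (cexpi (- 2 * PI * x * y)) (f x)))); [|now apply Cc_fourier_arg].
    apply (Cc_scal (RtoC (-1)) (fun x => Cmult (cexpi (- 2 * PI * x * y)) (f x))). now apply Cc_fourier_arg.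
  - intros x Hx. rewrite HK by auto. ring.
  - intros x. destruct (Rle_dec K (Rabs x)) as [L|L].
    + rewrite HK by auto. replace (Cplus _ _) with (RtoC 0) by ring. rewrite Cmod_0.
      mul_pos.
    + replace (Cplus _ _) with (Cmult (cexpi (- 2 * PI * x * z) - cexpi (- 2 * PI * x * y))%C (f x)) by ring.
      rewrite Cmod_mult. apply Rmult_le_compat; auto; try apply Cmod_ge_0.
      eapply Rle_trans; [apply cexpi_lipschitz|]. replace (- 2 * PI * x * z - - 2 * PI * x * y) with (- (2 * PI) * x * (z - y)) by ring.
      rewrite !Rabs_mult, Rabs_Ropp, Rabs_mult, (Rabs_pos_eq 2), (Rabs_pos_eq PI) by lra.
      apply Rle_trans with (2 * (2 * PI) * Rabs (z - y) * Rabs x); [apply Req_le; ring|].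
      replace (2 * (2 * PI * K) * Rabs (z - y)) with (2 * (2 * PI) * Rabs (z - y) * K) by ring.
      apply Rmult_le_compat_l; [mul_pos|lra].
Qed.

Lemma cutoff_bounds N x : 0 <= cutoff N x <= 1.
Proof. unfold cutoff. split; [apply Rmax_l|]. apply Rmax_lub; [lra|apply Rmin_l]. Qed.

Lemma cutoff_1 N x : Rabs x <= INR N -> cutoff N x = 1.
Proof. intros H. unfold cutoff. rewrite Rmin_left by lra. apply Rmax_right. lra. Qed.

Lemma cutoff_0 N x : INR N + 1 <= Rabs x -> cutoff N x = 0.
Proof. intros H. unfold cutoff. apply Rmax_left. eapply Rle_trans; [apply Rmin_r|lra]. Qed.

Lemma cutoff_lipschitz N x y : Rabs (cutoff N x - cutoff N y) <= Rabs (x - y).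
Proof.
  unfold cutoff. pose proof (Rabs_triang_inv x y) as A. pose proof (Rabs_triang_inv y x) as A'. rewrite (Rabs_minus_sym y x) in A'.
  set (a := Rabs x) in *. set (b := Rabs y) in *. set (d := Rabs (x - y)) in *. set (n := INR N).
  apply Rabs_le. unfold Rmax, Rmin. repeat destruct (Rle_dec _ _); lra.
Qed.

Lemma Cc_cutoff N (F : R -> CC) : (forall x, continuous F x) -> Cc (fun x => Cmult (RtoC (cutoff N x)) (F x)).
Proof.
  intros HF. split.
  - intros x. apply (continuous_Cmult (fun x => RtoC (cutoff N x)) F); auto. apply continuous_C_eps. intros e He.
    exists e. split; auto. intros y Hy. rewrite <- RtoC_minus, Cmod_R. pose proof (cutoff_lipschitz N y x). lra.
  - exists (INR N + 1). intros x Hx. rewrite cutoff_0 by lra. ring.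
Qed.

Lemma dmeas_cutoff p c (F : R -> CC) : summable (fun j => Cmult (c j) (F (p j))) ->
  clim (fun N => dmeas p c (fun x => Cmult (RtoC (cutoff N x)) (F x))) (dmeas p c F).
Proof.
  intros [B HB]. unfold dmeas.
  apply (Zs_dominated (fun N j => Cmult (c j) (Cmult (RtoC (cutoff N (p j))) (F (p j)))) (fun j => Cmult (c j) (F (p j))) _ B HB).
  - intros N j. rewrite !Cmod_mult, Cmod_R. pose proof (cutoff_bounds N (p j)). rewrite Rabs_pos_eq by lra.
    pose proof (Cmod_ge_0 (c j)). pose proof (Cmod_ge_0 (F (p j))). apply Rmult_le_compat_l; nra.
  - intros j. destruct (exists_nat_gt (Rabs (p j))) as [N0 [_ HN0]].
    eapply clim_ext_from with (N0 := N0); [|apply clim_const]. intros N HN. cbv beta.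
    rewrite cutoff_1; [ring|]. apply le_INR in HN. lra.
Qed.

(** * Mollifiers and their action on measures *)

Definition mollifier (n : nat) (y : R) : CC := Cmult (RtoC (INR (S n) / bump_mass)) (RtoC (bump01 (INR (S n) * y + 0))).

Lemma Cc_bump01 : Cc (fun t => RtoC (bump01 t)).
Proof.
  split.
  - intros x. apply continuous_C. split; [apply bump01_cont|apply continuous_const].
  - exists 1. intros x Hx. rewrite bump01_out; auto. unfold Rabs in Hx. destruct (Rcase_abs x); [left|right]; lra.
Qed.

Lemma Cc_mollifier n : Cc (mollifier n).
Proof.
  apply (Cc_scal _ (fun y => RtoC (bump01 (INR (S n) * y + 0)))), (Cc_affine (fun t => RtoC (bump01 t))); [|apply Cc_bump01].
  apply not_0_INR. discriminate.
Qed.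

Lemma mollifier_out n y : y <= 0 \/ / INR (S n) <= y -> mollifier n y = RtoC 0.
Proof.
  intros H. unfold mollifier. assert (Hn : 0 < INR (S n)) by (apply lt_0_INR; lia).
  rewrite bump01_out; [ring|]. destruct H as [H|H]; [left; nra|right].
  apply (Rmult_le_compat_l (INR (S n))) in H; [|lra]. rewrite Rinv_r in H; lra.
Qed.

Lemma integral_mollifier n : integral (mollifier n) = RtoC 1.
Proof.
  assert (Hn : 0 < INR (S n)) by (apply lt_0_INR; lia). pose proof bump_mass_pos as Hb.
  assert (E : integral (fun t => RtoC (bump01 t)) = RtoC bump_mass).
  { rewrite (integral_cint _ 1); try lra.
    - unfold cint. apply C_eq; cbn [fst snd RtoC].
      + change (@eq R (RInt bump01 (-(1)) 1) bump_mass). rewrite <- (RInt_Chasles bump01 (-(1)) 0 1) by (apply continuous_ex_RInt, bump01_cont).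
        rewrite (RInt_vanish bump01 (-(1)) 0). unfold plus; simpl; unfold bump_mass; ring.
        intros x Hx. rewrite Rmax_right in Hx by lra. apply bump01_out. lra.
      + apply RInt_vanish. reflexivity.
    - apply Cc_bump01.
    - intros x Hx. rewrite bump01_out; auto. unfold Rabs in Hx. destruct (Rcase_abs x); [left|right]; lra. }
  unfold mollifier.
  assert (Hc : Cc (fun y => RtoC (bump01 (INR (S n) * y + 0)))) by (apply (Cc_affine (fun t => RtoC (bump01 t))); [lra|apply Cc_bump01]).
  replace (fun y => Cmult (RtoC (INR (S n) / bump_mass)) (RtoC (bump01 (INR (S n) * y + 0)))) with
    (fun y => Cplus (Cmult (RtoC (INR (S n) / bump_mass)) (RtoC (bump01 (INR (S n) * y + 0)))) (RtoC 0)) by (apply functional_extensionality; intros; ring).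
  rewrite (integral_lin _ (fun _ => RtoC 0)), integral_0 by (auto; apply Cc_0).
  rewrite (integral_affine (fun t => RtoC (bump01 t))), E by (try lra; apply Cc_bump01).
  rewrite Rabs_pos_eq, Cplus_0_r, <- !RtoC_mult by lra. f_equal. field. lra.
Qed.

(** [D] appears instead of 1 because [integral_bound] works with the supremum of the integrand. The
    supremum of the mollifier grows like [n], but its support shrinks like [/ n], so the product
    stays bounded. *)
Lemma mollifier_approx : exists D, 0 <= D /\ forall n (phi : R -> CC) e, (forall y, continuous phi y) -> 0 <= e ->
  (forall y, 0 <= y <= / INR (S n) -> Cmod (phi y - phi 0)%C <= e) ->
  Cmod (integral (fun y => Cmult (phi y) (mollifier n y)) - phi 0)%C <= D * e.
Proof.
  destruct (Cc_bounded _ Cc_bump01) as [B [HB0 HB]]. pose proof bump_mass_pos as Hb.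
  exists (4 * (B / bump_mass)). split. { apply Rmult_le_pos; [lra|]. apply Rle_mult_inv_pos; auto. }
  intros n phi e Hphi He H. assert (Hn : 0 < INR (S n)) by (apply lt_0_INR; lia).
  assert (Hi : 0 < / INR (S n)) by now apply Rinv_0_lt_compat.
  pose proof (Cc_mollifier n) as Hm. pose proof (Cc_mult phi _ Hphi Hm) as Hpm.
  assert (E : (integral (fun y => Cmult (phi y) (mollifier n y)) - phi 0)%C =
     integral (fun y => Cplus (Cmult (- phi 0)%C (mollifier n y)) (Cmult (phi y) (mollifier n y)))).
  { rewrite integral_lin, integral_mollifier by auto. ring. }
  rewrite E. replace (4 * (B / bump_mass) * e) with (4 * (/ INR (S n) * (e * (INR (S n) / bump_mass * B)))) by (field; lra).
  apply integral_bound; try lra.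
  - apply (Cc_plus (fun y => Cmult (- phi 0)%C (mollifier n y))); auto. now apply Cc_scal.
  - intros x Hx. rewrite mollifier_out; [ring|]. unfold Rabs in Hx. destruct (Rcase_abs x); [left|right]; lra.
  - intros y. replace (Cplus _ _) with (Cmult (phi y - phi 0)%C (mollifier n y)) by ring. rewrite Cmod_mult.
    assert (Hmb : Cmod (mollifier n y) <= INR (S n) / bump_mass * B).
    { unfold mollifier. rewrite Cmod_mult. specialize (HB (INR (S n) * y + 0)).
      assert (0 < INR (S n) / bump_mass) by now apply Rdiv_lt_0_compat.
      rewrite Cmod_R, Rabs_pos_eq by lra. apply Rmult_le_compat_l; lra. }
    destruct (Rle_dec 0 y) as [L|L]; [destruct (Rle_dec y (/ INR (S n))) as [L'|L']|].
    + apply Rmult_le_compat; auto; apply Cmod_ge_0.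
    + rewrite (mollifier_out n y), Cmod_0, Rmult_0_r by (right; lra). pose proof (Cmod_ge_0 (mollifier n y)). apply Rmult_le_pos; lra.
    + rewrite (mollifier_out n y), Cmod_0, Rmult_0_r by (left; lra). pose proof (Cmod_ge_0 (mollifier n y)). apply Rmult_le_pos; lra.
Qed.

Lemma exists_mollifier_index d : 0 < d -> exists N, forall n, (N <= n)%nat -> / INR (S n) < d.
Proof.
  intros Hd. destruct (exists_nat_gt (/ d)) as [N [_ HN]]. exists N. intros n Hn. apply le_INR in Hn.
  assert (0 < / d) by now apply Rinv_0_lt_compat.
  rewrite <- (Rinv_inv d). apply Rinv_lt_contravar; rewrite S_INR; [apply Rmult_lt_0_compat|]; lra.
Qed.

Lemma measure_conv_mollifier mu g : is_measure mu -> Cc g -> clim (fun n => mu (conv g (mollifier n))) (mu g).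
Proof.
  intros Hmu Hg. destruct mollifier_approx as [D [HD0 HD]]. destruct (Cc_support g Hg) as [K [HK0 HK]].
  destruct (measure_bound mu (2 * (K + 1)) Hmu) as [A [HA0 HA]].
  intros e He. set (e' := e / (2 * (A * D + 1))).
  assert (HAD : 0 <= A * D) by now apply Rmult_le_pos.
  assert (He' : 0 < e') by (apply Rdiv_lt_0_compat; lra).
  destruct (Cc_unif_cont g Hg e' He') as [d [Hd Hu]]. destruct (exists_mollifier_index d Hd) as [N HN].
  exists N. intros n Hn. specialize (HN n Hn). pose proof (Cc_mollifier n) as Hm. pose proof (Cc_conv g _ Hg Hm) as Hcv.
  rewrite <- measure_minus by auto.
  apply Rle_lt_trans with (A * (D * e')).
  - apply HA.
    + now apply Cc_minus.
    + intros x Hx. rewrite (HK x) by lra. replace (conv g (mollifier n) x) with (RtoC 0); [ring|]. symmetry. unfold conv.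
      replace (fun y => Cmult (g (x - y)) (mollifier n y)) with (fun _ : R => RtoC 0); [apply integral_0|].
      apply functional_extensionality; intros y. symmetry. apply (conv_support g (mollifier n) (K + 1)); try lra.
      * intros z Hz. apply HK. lra.
      * intros z Hz. apply mollifier_out. assert (/ INR (S n) <= 1).
        { rewrite <- Rinv_1. apply Rinv_le_contravar; [lra|]. rewrite S_INR. pose proof (pos_INR n). lra. }
        unfold Rabs in Hz. destruct (Rcase_abs z); [left|right]; lra.
    + apply Rmult_le_pos; lra.
    + intros x. unfold conv. specialize (HD n (fun y => g (x - y)) e'). cbv beta in HD.
      rewrite Rminus_0_r in HD. apply HD; try lra.
      * intros y. apply (continuous_ext (fun y => g (-1 * y + x)) (fun y => g (x - y))); [intros; f_equal; ring|].
        apply continuous_affine, Cc_cont, Hg.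
      * intros y Hy. apply Hu. replace (x - y - x) with (- y) by ring. rewrite Rabs_Ropp, Rabs_pos_eq; lra.
  - assert (E : e' * (2 * (A * D + 1)) = e) by (unfold e'; field; lra). nra.
Qed.

Lemma fourier_mollifier : (exists D, 0 <= D /\ forall n y, Cmod (fourier (mollifier n) y) <= D) /\
  forall y, clim (fun n => fourier (mollifier n) y) (RtoC 1).
Proof.
  destruct mollifier_approx as [D [HD0 HD]].
  assert (Hc : forall y x, continuous ((fun x => cexpi (- 2 * PI * x * y)) : R -> CC) x).
  { intros y x. apply (continuous_ext (fun x => cexpi ((- 2 * PI * y) * x))); [intros; f_equal; ring|]. apply continuous_cexpi. }
  assert (H : forall n y e, 0 <= e -> (forall x, 0 <= x <= / INR (S n) -> Cmod (cexpi (- 2 * PI * x * y) - RtoC 1)%C <= e) ->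
    Cmod (fourier (mollifier n) y - RtoC 1)%C <= D * e).
  { intros n y e He Hx. specialize (HD n (fun x => cexpi (- 2 * PI * x * y)) e (Hc y) He). cbv beta in HD.
    replace (- 2 * PI * 0 * y) with 0 in HD by ring. rewrite cexpi_0 in HD. apply HD, Hx. }
  split.
  - exists (D * 2 + 1). split; [lra|]. intros n y.
    replace (fourier (mollifier n) y) with ((fourier (mollifier n) y - RtoC 1) + RtoC 1)%C by ring.
    eapply Rle_trans; [apply Cmod_triangle|]. rewrite Cmod_1. apply Rplus_le_compat_r. apply H; [lra|]. intros x _.
    eapply Rle_trans; [apply Cmod_triangle|]. rewrite Cmod_opp, Cmod_cexpi, Cmod_1. lra.
  - intros y e He. pose proof PI_RGT_0. pose proof (Rabs_pos y).
    set (L := D * (2 * (2 * PI * Rabs y))). assert (HL : 0 <= L) by (unfold L; mul_pos).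
    destruct (exists_mollifier_index (e / (L + 1))) as [N HN]; [apply Rdiv_lt_0_compat; lra|].
    exists N. intros n Hn. specialize (HN n Hn). assert (Hi : 0 < / INR (S n)) by (apply Rinv_0_lt_compat, lt_0_INR; lia).
    apply Rle_lt_trans with (D * (2 * (2 * PI * Rabs y) * / INR (S n))).
    + apply H; [mul_pos|]. intros x Hx. rewrite <- cexpi_0. eapply Rle_trans; [apply cexpi_lipschitz|].
      replace (- 2 * PI * x * y - 0) with (- (2 * PI * y * x)) by ring. rewrite Rabs_Ropp, !Rabs_mult, (Rabs_pos_eq 2), (Rabs_pos_eq PI), (Rabs_pos_eq x) by lra.
      apply Rle_trans with (2 * (2 * PI * Rabs y) * x); [apply Req_le; ring|]. apply Rmult_le_compat_l; [mul_pos|lra].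
    + replace (D * (2 * (2 * PI * Rabs y) * / INR (S n))) with (L * / INR (S n)) by (unfold L; ring).
      apply Rle_lt_trans with (L * (e / (L + 1))); [apply Rmult_le_compat_l; lra|].
      apply Rmult_lt_reg_r with (L + 1); [lra|]. replace (L * (e / (L + 1)) * (L + 1)) with (L * e) by (field; lra). nra.
Qed.

(** * Strict eigenmeasures *)

(** The strict equation is applied to [g] convolved with mollifiers. On the left the measures
    converge, on the right dominated convergence applies because the transforms of the mollifiers
    are bounded and tend to 1. The inverse transform in the definition becomes [sig = -1], and
    solving for the transform gives [kap = / lam]. *)
Lemma strict_selfdual mu muh lam rho p c : strict_FT mu muh -> meq muh (mscale lam mu) -> lam <> RtoC 0 ->
  cells rho p -> separated rho p c -> tame p c -> meq mu (dmeas p c) -> selfdual rho p c (-1) (Cinv lam).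
Proof.
  intros [Hmu [Hmuh HS]] Hm Hlam Hp Hs Ht Hd.
  assert (Step1 : forall g n, testfun g -> mu (conv g (mollifier n)) = Cmult lam (dmeas p c (icheck (conv g (mollifier n))))).
  { intros g n Hg. assert (HgC := testfun_Cc g Hg). set (f := conv g (mollifier n)).
    assert (Hf : Cc f) by (apply Cc_conv; [auto|apply Cc_mollifier]).
    assert (Hspan : in_conv_span f).
    { exists 1%nat, (fun _ => RtoC 1), (fun _ => g), (fun _ => mollifier n). split.
      - intros i _. split; [auto|apply Cc_mollifier]. - intros x. cbn [csum]. unfold f. ring. }
    destruct (HS f Hspan) as [_ Hext].
    assert (Hcont : forall x, continuous (icheck f) x).
    { intros x. apply (continuous_ext (fun y => fourier f (-1 * y + 0)) (icheck f)).
      - intros y. unfold icheck. f_equal. ring. - apply continuous_affine, continuous_fourier, Hf. }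
    apply (clim_unique (fun N => muh (fun x => Cmult (RtoC (cutoff N x)) (icheck f x)))).
    - apply clim_filterlim, Hext.
    - eapply clim_ext_from with (N0 := 0%nat) (u := fun N => Cmult lam (dmeas p c (fun x => Cmult (RtoC (cutoff N x)) (icheck f x)))).
      + intros N _. pose proof (Cc_cutoff N _ Hcont) as HC. rewrite Hm by auto. unfold mscale. now rewrite Hd.
      + apply (clim_scal lam (fun N => dmeas p c (fun x => Cmult (RtoC (cutoff N x)) (icheck f x)))), dmeas_cutoff.
        apply (summable_rapid rho); auto using cells_spread.
        (* The mollified function need not be smooth, but its transform is a rapidly decreasing
           function times a bounded one. *)
        assert (E : icheck f = fun y => Cmult (fourier (mollifier n) (- y)) (fourier (fun x => g (- x)) y)).
        { apply functional_extensionality; intros y. unfold icheck, f. rewrite fourier_conv, fourier_reflect by (auto using Cc_mollifier). ring. }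
        rewrite E. apply rapid_mult.
        * destruct fourier_mollifier as [[D [_ HD]] _]. exists D. intros y. apply HD.
        * apply rapid_fourier. replace (fun x => g (- x)) with (fun x => g (-1 * x + 0)) by (apply functional_extensionality; intros; f_equal; ring).
          apply testfun_affine; auto; lra. }
  assert (Step2 : forall g, testfun g -> mu g = Cmult lam (dmeas p c (icheck g))).
  { intros g Hg. assert (HgC := testfun_Cc g Hg).
    apply (clim_unique (fun n => mu (conv g (mollifier n)))); [now apply measure_conv_mollifier|].
    eapply clim_ext_from with (N0 := 0%nat) (u := fun n => Cmult lam (dmeas p c (icheck (conv g (mollifier n))))).
    { intros n _. symmetry. now apply Step1. }
    apply (clim_scal lam (fun n => dmeas p c (icheck (conv g (mollifier n))))).
    destruct fourier_mollifier as [[D [HD0 HD]] HL].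
    assert (Hr : rapid (icheck g)).
    { replace (icheck g) with (fourier (fun x => g (- x))) by (apply functional_extensionality; intros y; now apply fourier_reflect).
      apply rapid_fourier. replace (fun x => g (- x)) with (fun x => g (-1 * x + 0)) by (apply functional_extensionality; intros; f_equal; ring).
      apply testfun_affine; auto; lra. }
    destruct (summable_rapid rho p c _ (cells_spread _ _ Hp) Ht Hr) as [B HB]. unfold dmeas.
    apply (Zs_dominated (fun n j => Cmult (c j) (icheck (conv g (mollifier n)) (p j))) (fun j => Cmult (c j) (icheck g (p j)))
      (fun j => D * Cmod (Cmult (c j) (icheck g (p j)))) (D * B)).
    - intros M. rewrite zsumR_scal. apply Rmult_le_compat_l; auto.
    - intros n j. unfold icheck. rewrite fourier_conv by (auto using Cc_mollifier). rewrite !Cmod_mult. specialize (HD n (- p j)).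
      apply Rle_trans with (D * (Cmod (c j) * Cmod (fourier g (- p j)))); [|lra].
      replace (Cmod (c j) * (Cmod (fourier g (- p j)) * Cmod (fourier (mollifier n) (- p j)))) with (Cmod (fourier (mollifier n) (- p j)) * (Cmod (c j) * Cmod (fourier g (- p j)))) by ring.
      apply Rmult_le_compat_r; auto. apply Rmult_le_pos; apply Cmod_ge_0.
    - intros j. unfold icheck.
      replace (Cmult (c j) (fourier g (- p j))) with (Cmult (Cmult (c j) (fourier g (- p j))) (RtoC 1)) by ring.
      eapply clim_ext_from with (N0 := 0%nat) (u := fun n => Cmult (Cmult (c j) (fourier g (- p j))) (fourier (mollifier n) (- p j))).
      + intros n _. rewrite fourier_conv by (auto using Cc_mollifier). ring.
      + apply (clim_scal _ (fun n => fourier (mollifier n) (- p j))), HL. }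
  split; [auto|]. split; [auto|]. split; [auto|]. split; [ring|]. split.
  { intros E. apply Hlam. replace lam with (Cmult (Cmult lam lam) (Cinv lam)) by (field; auto). rewrite E. ring. }
  intros f Hf. pose proof (testfun_affine f (-1) 0 ltac:(lra) Hf) as Hg. specialize (Step2 _ Hg).
  assert (E : icheck (fun x => f (-1 * x + 0)) = fourier f).
  { apply functional_extensionality; intros y. unfold icheck. rewrite fourier_affine by (try lra; now apply testfun_Cc).
    rewrite Rabs_left, Rmult_0_r, Rmult_0_l, cexpi_0 by lra. replace (/ - -1) with 1 by field. replace (- y / -1) with y by field. ring. }
  rewrite E in Step2. rewrite Hd in Step2 by now apply testfun_Cc.
  transitivity (Cmult (Cinv lam) (Cmult lam (dmeas p c (fourier f)))); [field; auto|]. rewrite <- Step2. unfold dmeas. f_equal.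
  apply Zs_ext. intros j. do 2 f_equal. ring.
Qed.

Definition combF (F : R -> R -> R -> measure) n C (r s : nat -> R) y : measure := lincomb n C (fun i => F (r i) (s i) y).

Lemma FT_combs n C r s y : 0 < y ->
  FT_meas (combF comb n C r s y) (combF comb_F1 n C r s y) /\ FT_meas (combF comb_F1 n C r s y) (combF comb_F2 n C r s y) /\
  FT_meas (combF comb_F2 n C r s y) (combF comb_F3 n C r s y) /\ FT_meas (combF comb_F3 n C r s y) (combF comb n C r s y).
Proof.
  intros Hy. split; [|split; [|split]]; apply FT_meas_lincomb; intros i _.
  - now apply FT_comb. - now apply FT_comb_F1. - now apply FT_comb_F2. - now apply FT_comb_F3.
Qed.

Lemma combF_reflect n C r s y f : 0 < y -> Cc f ->
  combF comb_F2 n C r s y f = combF comb n C r s y (fun x => f (- x)) /\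
  combF comb_F3 n C r s y f = combF comb_F1 n C r s y (fun x => f (- x)).
Proof.
  intros Hy Hf. pose proof (Rinv_0_lt_compat _ Hy). unfold combF, lincomb. split; apply csum_ext; intros i _; f_equal.
  - apply comb_reflect; auto.
  - unfold comb_F3, comb_F1, mscale. f_equal. rewrite <- (Ropp_involutive (s i)) at 1. apply comb_reflect; auto.
Qed.

Lemma mscale_mscale a b mu : meq (mscale a (mscale b mu)) (mscale (Cmult a b) mu).
Proof. intros f _. unfold mscale. ring. Qed.

Lemma eigen_power lam mu a : FT_meas mu (mscale lam mu) -> FT_meas (mscale a mu) (mscale (Cmult a lam) mu).
Proof. intros H. eapply FT_meas_meq; [apply meq_refl|apply mscale_mscale|now apply FT_meas_scal]. Qed.

(** On combs the strict identity is Poisson summation, which requires only that the transform be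
    summable along the progression; convolutions satisfy this. *)
Lemma strict_of_eigen mu lam y : 0 < y -> Cpow lam 4 = RtoC 1 -> comb_span y mu -> FT_meas mu (mscale lam mu) ->
  strict_FT mu (mscale lam mu).
Proof.
  intros Hy Hlam [n [C [r [s Hspan]]]] HF. destruct (FT_combs n C r s y Hy) as [T0 [T1 _]].
  assert (E1 : meq (mscale lam mu) (combF comb_F1 n C r s y)).
  { apply (FT_meas_unique mu); auto. eapply FT_meas_meq; [apply meq_sym, Hspan|apply meq_refl|exact T0]. }
  assert (E2 : meq (mscale (Cmult lam lam) mu) (combF comb_F2 n C r s y)).
  { apply (FT_meas_unique (mscale lam mu)); [now apply eigen_power|]. eapply FT_meas_meq; [apply meq_sym, E1|apply meq_refl|exact T1]. }
  split; [apply HF|]. split; [apply HF|]. intros f Hf. assert (HfC := in_conv_span_Cc f Hf). pose proof (Cc_reflect f HfC) as HfR.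
  assert (Hw : icheck f = fourier (fun x => f (- x))) by (apply functional_extensionality; intros z; symmetry; now apply fourier_reflect).
  assert (Hcont : forall x, continuous (icheck f) x) by (intros x; rewrite Hw; now apply continuous_fourier).
  assert (Hsum : forall i, summable (fun m => Cmult (comb_cf (r i) (s i) y m) (icheck f (comb_pt (s i) y m)))).
  { intros i. apply (summable_le _ (fun m => fourier f (- s i + IZR m * - y))).
    - apply conv_span_fourier_summable; auto; lra.
    - intros m. unfold comb_cf. rewrite Cmod_mult, Cmod_cexpi, Rmult_1_l. unfold icheck, comb_pt. apply Req_le. do 2 f_equal. ring. }
  split.
  - assert (Hb : forall k, exists B, 0 <= B /\ forall g, Cc g -> (forall x, Cmod (g x) <= Cmod (icheck f x)) ->
      Cmod (csum k (fun i => Cmult (C i) (comb (r i) (s i) y g))) <= B).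
    { induction k as [|k [B [HB0 HB]]].
      - exists 0. split; [lra|]. intros. simpl. rewrite Cmod_0. lra.
      - destruct (Hsum k) as [D HD]. assert (HD0 : 0 <= D) by (eapply Rle_trans; [apply Cmod_ge_0|apply (HD 0%nat)]).
        exists (B + Cmod (C k) * D). split. { pose proof (Cmod_ge_0 (C k)). nra. }
        intros g Hg Hgw. cbn [csum]. eapply Rle_trans; [apply Cmod_triangle|]. apply Rplus_le_compat; [now apply HB|].
        rewrite Cmod_mult. apply Rmult_le_compat_l; [apply Cmod_ge_0|]. unfold comb, dmeas. apply (Zs_bound _ _ _ HD).
        intros m. rewrite !Cmod_mult. apply Rmult_le_compat_l; [apply Cmod_ge_0|auto]. }
    destruct (Hb n) as [B [HB0 HB]]. exists (Cmod lam * B). intros g Hg Hgw. unfold mscale. rewrite Cmod_mult.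
    apply Rmult_le_compat_l; [apply Cmod_ge_0|]. rewrite Hspan by auto. now apply HB.
  - apply clim_filterlim.
    (* Two transforms reflect a combination of combs, so [lam ^ 2 * mu] is the reflection of [mu];
       together with [lam ^ 4 = 1] this turns the eigen equation into the inverse form. *)
    assert (V : mu f = Cmult lam (csum n (fun i => Cmult (C i) (dmeas (comb_pt (s i) y) (comb_cf (r i) (s i) y) (icheck f))))).
    { transitivity (Cmult lam (combF comb_F1 n C r s y (fun x => f (- x)))).
      - rewrite <- E1 by auto. unfold mscale. rewrite (Hspan _ HfR).
        change (mu f = Cmult lam (Cmult lam (combF comb n C r s y (fun x => f (- x))))).
        destruct (combF_reflect n C r s y f Hy HfC) as [<- _]. rewrite <- E2 by auto. unfold mscale.
        transitivity (Cmult (Cpow lam 4) (mu f)); [rewrite Hlam; ring|simpl; ring].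
      - f_equal. unfold combF, lincomb. apply csum_ext. intros i _. f_equal. rewrite Hw.
        specialize (Hsum i). rewrite Hw in Hsum. symmetry. apply comb_poisson; auto. }
    rewrite V.
    eapply clim_ext_from with (N0 := 0%nat) (u := fun N => Cmult lam (csum n (fun i => Cmult (C i) (comb (r i) (s i) y (fun x => Cmult (RtoC (cutoff N x)) (icheck f x)))))).
    { intros N _. unfold mscale. f_equal. rewrite Hspan by now apply Cc_cutoff. reflexivity. }
    apply (clim_scal lam (fun N => csum n (fun i => Cmult (C i) (comb (r i) (s i) y (fun x => Cmult (RtoC (cutoff N x)) (icheck f x)))))).
    apply (clim_csum n (fun i N => Cmult (C i) (comb (r i) (s i) y (fun x => Cmult (RtoC (cutoff N x)) (icheck f x))))). intros i _.
    apply (clim_scal (C i) (fun N => comb (r i) (s i) y (fun x => Cmult (RtoC (cutoff N x)) (icheck f x)))). now apply dmeas_cutoff.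
Qed.

(* [F mu] is [lam^-1] times the reflection [R mu]; on combs [F^2 = R] and [F^3 = R F], so [F (R mu) = R (F mu) = lam^-1 mu],
   whence [R mu = F^2 mu = lam^-2 mu]. *)
Lemma eigen_of_selfdual_reflected mu lam rho p c y : Cpow lam 4 = RtoC 1 -> 0 < y -> is_measure mu -> meq mu (dmeas p c) ->
  selfdual rho p c (-1) (Cinv lam) -> comb_span y mu -> FT_meas mu (mscale lam mu).
Proof.
  intros Hlam Hy Hmu Hd H [n [C [r [s Hspan]]]]. destruct (FT_combs n C r s y Hy) as [T0 [T1 [T2 _]]].
  assert (Hp : cells rho p) by apply H. assert (Ht : tame p c) by apply H.
  assert (Hl0 : lam <> RtoC 0).
  { intros E. rewrite E in Hlam. simpl in Hlam. injection Hlam. lra. }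
  assert (HT : tempered_ext mu (dmeas p c)).
  { apply (tempered_ext_meq (dmeas p c)); [now apply meq_sym|]. apply (tempered_ext_dmeas rho); auto using cells_spread. }
  set (nu := combF comb_F1 n C r s y).
  assert (F0 : FT_meas mu nu) by (eapply FT_meas_meq; [apply meq_sym, Hspan|apply meq_refl|exact T0]).
  assert (Hnu : is_measure nu) by apply F0.
  set (rmu := combF comb_F2 n C r s y). assert (Hrmu : is_measure rmu) by apply T1.
  assert (Er : forall f, Cc f -> rmu f = mu (fun x => f (- x))).
  { intros f Hf. unfold rmu. rewrite (proj1 (combF_reflect n C r s y f Hy Hf)). symmetry. apply Hspan. now apply Cc_reflect. }
  assert (E1 : meq nu (mscale (Cinv lam) rmu)).
  { apply measure_eq_of_testfun; auto. { eapply is_measure_meq; [|apply (is_measure_lin (Cinv lam) rmu (fun _ => RtoC 0)); auto].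
      - intros f _. unfold mscale. ring. - destruct FT_meas_0; auto. }
    intros f Hf. assert (HfC := testfun_Cc f Hf). destruct F0 as [_ [_ [T [HT1 HT2]]]]. rewrite HT2 by auto.
    rewrite (tempered_ext_unique mu T (dmeas p c)) by (auto; now apply schwartz_fourier).
    unfold mscale. rewrite Er by auto. rewrite (Hd _ (Cc_reflect f HfC)). destruct H as [_ [_ [_ [_ [_ H]]]]]. rewrite H by auto.
    f_equal. unfold dmeas. apply Zs_ext. intros j. do 2 f_equal. ring. }
  assert (E3 : meq (combF comb_F3 n C r s y) (mscale (Cinv lam) mu)).
  { intros f Hf. rewrite (proj2 (combF_reflect n C r s y f Hy Hf)). pose proof (Cc_reflect f Hf) as HfR.
    change (nu (fun x => f (- x)) = mscale (Cinv lam) mu f). rewrite (E1 _ HfR). unfold mscale. f_equal. rewrite Er by auto.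
    f_equal. apply functional_extensionality; intros. f_equal. ring. }
  assert (E2 : meq rmu (mscale (Cmult (Cinv lam) (Cinv lam)) mu)).
  { apply (FT_meas_unique (mscale (Cinv lam) rmu)).
    - eapply FT_meas_meq; [exact E1|apply meq_refl|exact T1].
    - eapply FT_meas_meq; [apply meq_refl| |apply FT_meas_scal; exact T2].
      eapply meq_trans; [|apply mscale_mscale]. intros f Hf. unfold mscale at 1 2. f_equal. now apply E3. }
  eapply FT_meas_meq; [apply meq_refl| |exact F0].
  intros f Hf. rewrite E1 by auto. unfold mscale. rewrite E2 by auto. unfold mscale.
  transitivity (Cmult (Cpow lam 4) (Cmult (Cinv lam) (Cmult (Cmult (Cinv lam) (Cinv lam)) (mu f)))); [rewrite Hlam; ring|simpl; field; auto].
Qed.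

(** * Measures carried by finitely many progressions *)

Definition carried (P : R -> Prop) (mu : measure) : Prop := forall f, Cc f -> (forall x, P x -> f x = RtoC 0) -> mu f = RtoC 0.

Lemma carried_comb r s y z X : 0 < y -> In s X -> (exists m : Z, y = IZR m * z) ->
  carried (fun u => exists x, In x X /\ in_progression x z u) (comb r s y).
Proof.
  intros Hy Hs [m Em] f Hf H. unfold comb, dmeas. apply Zs_0. intros j. rewrite H; [ring|].
  exists s. split; auto. exists (j * m)%Z. unfold comb_pt. rewrite mult_IZR, Em. ring.
Qed.

(** Every support point is a limit of points of the progressions, whose distinct points have
    distance at least [e]; choosing approximations finer than both [e] and the distance of two
    support points keeps these apart. *)
Lemma uniformly_discrete_carried X z mu : 0 < z -> carried (fun u => exists x, In x X /\ in_progression x z u) mu ->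
  uniformly_discrete (in_supp mu).
Proof.
  intros Hz Hc. destruct (progressions_separated X z Hz) as [e [He Hsep]].
  assert (Near : forall x d, in_supp mu x -> 0 < d -> exists a k, In a X /\ Rabs (a + IZR k * z - x) < d).
  { intros x d Hx Hd. destruct (Hx d Hd) as [f [Hf [Hf0 Hf1]]]. apply NNPP. intros N. apply Hf1, Hc; auto.
    intros u [a [Ha [k ->]]]. apply Hf0. apply Rnot_lt_le. intros L. apply N. now exists a, k. }
  exists (e / 2). split; [lra|]. intros x x' Hx Hx' Hne.
  assert (Hd0 : 0 < Rabs (x - x')) by (apply Rabs_pos_lt; lra). set (D := Rabs (x - x')) in *.
  pose proof (Rmin_l (e / 4) (D / 4)). pose proof (Rmin_r (e / 4) (D / 4)).
  assert (Hd : 0 < Rmin (e / 4) (D / 4)) by (apply Rmin_glb_lt; lra). set (d := Rmin (e / 4) (D / 4)) in *.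
  destruct (Near x d Hx Hd) as [a [k [Ha Hk]]], (Near x' d Hx' Hd) as [a' [k' [Ha' Hk']]].
  assert (T : Rabs (a + IZR k * z - (a' + IZR k' * z)) <= D + 2 * d).
  { replace (a + IZR k * z - (a' + IZR k' * z)) with ((a + IZR k * z - x) + (x - x') + - (a' + IZR k' * z - x')) by ring.
    eapply Rle_trans; [apply Rabs_triang|]. rewrite Rabs_Ropp. pose proof (Rabs_triang (a + IZR k * z - x) (x - x')). unfold D in *. lra. }
  destruct (Req_EM_T (a + IZR k * z) (a' + IZR k' * z)) as [E|E].
  - exfalso. assert (D <= 2 * d); [|lra].
    unfold D. replace (x - x') with (- (a + IZR k * z - x) + (a' + IZR k' * z - x')) by (rewrite E; ring).
    eapply Rle_trans; [apply Rabs_triang|]. rewrite Rabs_Ropp. lra.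
  - specialize (Hsep a a' (k - k')%Z Ha Ha'). rewrite minus_IZR in Hsep.
    replace (a + (IZR k - IZR k') * z - a') with (a + IZR k * z - (a' + IZR k' * z)) in Hsep by ring.
    assert (e <= D + 2 * d); [|lra]. eapply Rle_trans; [apply Hsep|exact T]. intros E'. apply E. lra.
Qed.

(** * Eigenmeasures with uniformly discrete support *)

Lemma discrete_data mu : is_measure mu -> nontrivial mu -> transformable mu -> uniformly_discrete (in_supp mu) ->
  exists rho p c, cells rho p /\ separated rho p c /\ tame p c /\ meq mu (dmeas p c) /\ exists j, c j <> RtoC 0.
Proof.
  intros Hmu [f0 [Hf0 Hnz]] [nu [_ [_ [T [HT _]]]]] HU.
  destruct (ud_measure_rep mu Hmu HU) as [rho [p [c [Hp [Hs [Hc Hrep]]]]]].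
  exists rho, p, c. split; [auto|]. split; [auto|]. split; [|split; [exact Hrep|]].
  - destruct (tempered_bump_growth mu T rho HT (proj1 Hp)) as [A [N [HA H]]]. exists A, N. split; auto. intros j.
    destruct (classic (c j = RtoC 0)) as [E|E].
    + rewrite E, Cmod_0. apply Rmult_le_pos; auto. apply pow_le. pose proof (Rabs_pos (p j)). lra.
    + rewrite (Hc j E) at 1. apply H.
  - apply NNPP. intros C. apply Hnz. rewrite Hrep by auto. apply Zs_0. intros j.
    assert (E : c j = RtoC 0) by (apply NNPP; intros C'; apply C; now exists j). rewrite E. ring.
Qed.

Lemma root_nonzero lam : Cpow lam 4 = RtoC 1 -> lam <> RtoC 0.
Proof. intros H E. rewrite E in H. simpl in H. injection H. lra. Qed.

Lemma eigen_comb_span mu lam : is_measure mu -> transformable mu -> Cpow lam 4 = RtoC 1 ->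
  uniformly_discrete (in_supp mu) -> eigenmeasure mu lam ->
  exists n, (0 < n)%nat /\ comb_span (sqrt (INR n)) mu /\ FT_meas mu (mscale lam mu).
Proof.
  intros Hmu Htr Hlam HU [Hnt [nu [HF HE]]].
  destruct (discrete_data mu Hmu Hnt Htr HU) as [rho [p [c [Hp [Hs [Ht [Hd Hne]]]]]]].
  assert (Hsd : selfdual rho p c 1 lam).
  { split; [auto|]. split; [auto|]. split; [auto|]. split; [ring|]. split; [now apply root_nonzero|].
    intros f Hf. assert (HfC := testfun_Cc f Hf). destruct HF as [_ [_ [T [HT HTf]]]].
    rewrite <- (tempered_ext_unique mu T (dmeas p c)); auto; [|
      apply (tempered_ext_meq (dmeas p c)); [now apply meq_sym|]; apply (tempered_ext_dmeas rho); auto using cells_spread|now apply schwartz_fourier].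
    rewrite <- HTf, HE by auto. unfold mscale. rewrite Hd by auto. f_equal. unfold dmeas. apply Zs_ext. intros j. now rewrite Rmult_1_l. }
  destruct (selfdual_comb_span _ _ _ _ _ Hsd Hne) as [n [Hn HS]]. exists n. split; [auto|]. split.
  - now apply (comb_span_meq _ _ (dmeas p c)).
  - eapply FT_meas_meq; [apply meq_refl|exact HE|exact HF].
Qed.

Lemma strict_eigen_comb_span mu lam : is_measure mu -> transformable mu -> Cpow lam 4 = RtoC 1 ->
  uniformly_discrete (in_supp mu) -> strict_eigenmeasure mu lam -> FT_meas mu (mscale lam mu).
Proof.
  intros Hmu Htr Hlam HU [Hnt [muh [HF HE]]].
  destruct (discrete_data mu Hmu Hnt Htr HU) as [rho [p [c [Hp [Hs [Ht [Hd Hne]]]]]]].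
  pose proof (strict_selfdual mu muh lam rho p c HF HE (root_nonzero lam Hlam) Hp Hs Ht Hd) as Hsd.
  destruct (selfdual_comb_span _ _ _ _ _ Hsd Hne) as [n [Hn HS]].
  apply (eigen_of_selfdual_reflected mu lam rho p c (sqrt (INR n))); auto.
  - apply sqrt_lt_R0. now apply lt_0_INR.
  - now apply (comb_span_meq _ _ (dmeas p c)).
Qed.

Lemma proj4_meq lam a b c d a' b' c' d' : meq a a' -> meq b b' -> meq c c' -> meq d d' ->
  meq (proj4 lam a b c d) (proj4 lam a' b' c' d').
Proof. intros H1 H2 H3 H4 f Hf. unfold proj4. now rewrite H1, H2, H3, H4. Qed.

(** On an eigenmeasure the powers of [lam] cancel, and each of the four summands is a quarter of
    [mu]. *)
Lemma proj4_eigen mu lam : Cpow lam 4 = RtoC 1 ->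
  meq mu (proj4 lam (mscale (RtoC (/ 4)) mu) (mscale (Cmult (RtoC (/ 4)) lam) mu)
    (mscale (Cmult (Cmult (RtoC (/ 4)) lam) lam) mu) (mscale (Cmult (Cmult (Cmult (RtoC (/ 4)) lam) lam) lam) mu)).
Proof.
  intros Hlam f _. apply root_nonzero in Hlam. unfold proj4, mscale. simpl.
  transitivity (Cmult (RtoC (4 * / 4)) (mu f)).
  - replace (4 * / 4) with 1 by field. ring.
  - rewrite RtoC_mult. field. auto.
Qed.

Definition comb_orbit (lam : CC) (r s y : R) : measure :=
  proj4 lam (comb r s y) (comb_F1 r s y) (comb_F2 r s y) (comb_F3 r s y).

Lemma proj4_combF lam n C r s y f :
  proj4 lam (combF comb n C r s y) (combF comb_F1 n C r s y) (combF comb_F2 n C r s y) (combF comb_F3 n C r s y) f =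
  lincomb n C (fun i => comb_orbit lam (r i) (s i) y) f.
Proof.
  unfold proj4, combF, lincomb. rewrite <- !csum_scal, <- !csum_plus. apply csum_ext. intros i _. unfold comb_orbit, proj4. ring.
Qed.

(** Uniqueness of the transform identifies the unspecified iterates, one after the other, with the
    explicit orbit of the comb. *)
Lemma is_Ycomb_orbit r s y lam Y : 0 < y -> is_Ycomb r s y lam Y -> meq Y (comb_orbit lam r s y).
Proof.
  intros Hy [Z [Z1 [Z2 [Z3 [HZ [F1 [F2 [F3 HY]]]]]]]]. eapply meq_trans; [exact HY|].
  pose proof (is_Zcomb_meq r s y Z Hy HZ) as E0.
  assert (E1 : meq Z1 (comb_F1 r s y)).
  { apply (FT_meas_unique Z); auto. eapply FT_meas_meq; [apply meq_sym, E0|apply meq_refl|now apply FT_comb]. }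
  assert (E2 : meq Z2 (comb_F2 r s y)).
  { apply (FT_meas_unique Z1); auto. eapply FT_meas_meq; [apply meq_sym, E1|apply meq_refl|now apply FT_comb_F1]. }
  assert (E3 : meq Z3 (comb_F3 r s y)).
  { apply (FT_meas_unique Z2); auto. eapply FT_meas_meq; [apply meq_sym, E2|apply meq_refl|now apply FT_comb_F2]. }
  now apply proj4_meq.
Qed.

(** The transform permutes the four orbit terms cyclically, and the weights fit because the inverse
    of [lam ^ 3] is [lam]. *)
Lemma eigen_combs lam n C r s y : 0 < y -> Cpow lam 4 = RtoC 1 ->
  FT_meas (lincomb n C (fun i => comb_orbit lam (r i) (s i) y)) (mscale lam (lincomb n C (fun i => comb_orbit lam (r i) (s i) y))).
Proof.
  intros Hy Hlam. destruct (FT_combs n C r s y Hy) as [T0 [T1 [T2 T3]]].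
  eapply FT_meas_meq; [| |exact (FT_meas_proj4 lam _ _ _ _ _ T0 T1 T2 T3)].
  - intros f _. apply proj4_combF.
  - intros f _. unfold mscale. rewrite <- proj4_combF. unfold proj4.
    assert (Hl := root_nonzero lam Hlam).
    assert (E : Cinv (Cpow lam 3) = lam).
    { transitivity (Cmult (Cpow lam 4) (Cinv (Cpow lam 3))); [rewrite Hlam; ring|simpl; field; auto]. }
    rewrite E at 1. simpl. field. auto.
Qed.

(** As [sqrt n] is [n] times its inverse, the combs of step [sqrt n] also lie on translates of the
    finer lattice of step [/ sqrt n], and one step serves all four terms. *)
Lemma carried_comb_orbit lam r s n X : (0 < n)%nat -> incl [r; s; - r; - s] X ->
  carried (fun u => exists x, In x X /\ in_progression x (/ sqrt (INR n)) u) (comb_orbit lam r s (sqrt (INR n))).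
Proof.
  intros Hn HX. set (y := sqrt (INR n)). assert (Hn' : 0 < INR n) by now apply lt_0_INR.
  assert (Hy : 0 < y) by now apply sqrt_lt_R0. pose proof (Rinv_0_lt_compat _ Hy) as Hyi.
  assert (M1 : exists m : Z, y = IZR m * / y).
  { exists (Z.of_nat n). rewrite <- INR_IZR_INZ. apply Rmult_eq_reg_r with y; [|lra].
    rewrite Rmult_assoc, Rinv_l, Rmult_1_r by lra. apply sqrt_sqrt. lra. }
  assert (M2 : exists m : Z, / y = IZR m * / y) by (exists 1%Z; ring).
  intros f Hf H. unfold comb_orbit, proj4, comb_F1, comb_F2, comb_F3, mscale.
  rewrite (carried_comb r s y (/ y) X), (carried_comb (- s) r (/ y) (/ y) X), (carried_comb (- r) (- s) y (/ y) X), (carried_comb s (- r) (/ y) (/ y) X);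
    auto; try (apply HX; simpl; tauto). ring.
Qed.

Lemma carried_lincomb P n C mus : (forall i, (i < n)%nat -> carried P (mus i)) -> carried P (lincomb n C mus).
Proof. intros H f Hf Hz. unfold lincomb. apply csum_0. intros i Hi. rewrite H; auto. ring. Qed.

Theorem theorem6p3 (mu : measure) (lam : Complex.C) :
  is_measure mu -> nontrivial mu -> transformable mu ->
  Cpow lam 4 = 1%C ->
  let cond1 := uniformly_discrete (in_supp mu) /\ eigenmeasure mu lam in
  let cond1' := uniformly_discrete (in_supp mu) /\ strict_eigenmeasure mu lam in
  let cond2 :=
    exists (n k : nat) (c : nat -> Complex.C) (r s : nat -> R)
           (Z : nat -> measure) (nu nu1 nu2 nu3 : measure),
      (0 < n)%nat /\
      (forall i, (i < k)%nat -> is_Zcomb (r i) (s i) (sqrt (INR n)) (Z i)) /\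
      meq nu (lincomb k c Z) /\
      FT_meas nu nu1 /\ FT_meas nu1 nu2 /\ FT_meas nu2 nu3 /\
      meq mu (proj4 lam nu nu1 nu2 nu3) in
  let cond3 :=
    exists (n k : nat) (c : nat -> Complex.C) (r s : nat -> R) (Y : nat -> measure),
      (0 < n)%nat /\
      (forall i, (i < k)%nat -> is_Ycomb (r i) (s i) (sqrt (INR n)) lam (Y i)) /\
      meq mu (lincomb k c Y) in
  (cond1 <-> cond2) /\ (cond2 <-> cond3) /\ (cond1 <-> cond1').
Proof.
  intros Hmu Hnt Htr Hlam cond1 cond1' cond2 cond3.
  assert (Hy : forall n, (0 < n)%nat -> 0 < sqrt (INR n)) by (intros n Hn; now apply sqrt_lt_R0, lt_0_INR).
  assert (H12 : cond1 -> cond2).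
  { intros [HU HE]. destruct (eigen_comb_span mu lam Hmu Htr Hlam HU HE) as [n [Hn [[k [C [r [s HS]]]] HF]]].
    (* The witness [nu] is a quarter of [mu], whose iterated transforms are multiples of [mu]. *)
    exists n, k, (fun i => Cmult (RtoC (/ 4)) (C i)), r, s, (fun i => comb (r i) (s i) (sqrt (INR n))).
    exists (mscale (RtoC (/ 4)) mu), (mscale (Cmult (RtoC (/ 4)) lam) mu), (mscale (Cmult (Cmult (RtoC (/ 4)) lam) lam) mu),
      (mscale (Cmult (Cmult (Cmult (RtoC (/ 4)) lam) lam) lam) mu).
    split; [auto|]. split. { intros i _. apply is_Zcomb_comb; auto. } split.
    { intros f Hf. unfold mscale. rewrite HS by auto. unfold lincomb. rewrite <- csum_scal. apply csum_ext. intros i _. ring. }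
    split; [now apply eigen_power|]. split; [now apply eigen_power|]. split; [now apply eigen_power|]. now apply proj4_eigen. }
  assert (H23 : cond2 -> cond3).
  { intros [n [k [C [r [s [Z [nu [nu1 [nu2 [nu3 [Hn [HZ [E0 [F1 [F2 [F3 HE]]]]]]]]]]]]]]]].
    set (y := sqrt (INR n)) in *. assert (Hyn : 0 < y) by now apply Hy. destruct (FT_combs k C r s y Hyn) as [T0 [T1 [T2 _]]].
    exists n, k, C, r, s, (fun i => comb_orbit lam (r i) (s i) y). split; [auto|]. split.
    - intros i _. exists (comb (r i) (s i) y), (comb_F1 (r i) (s i) y), (comb_F2 (r i) (s i) y), (comb_F3 (r i) (s i) y).
      split; [now apply is_Zcomb_comb|]. split; [now apply FT_comb|]. split; [now apply FT_comb_F1|]. split; [now apply FT_comb_F2|]. apply meq_refl.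
    - assert (D0 : meq nu (combF comb k C r s y)).
      { eapply meq_trans; [exact E0|]. intros f Hf. apply csum_ext. intros i Hi. f_equal. now apply is_Zcomb_meq; auto. }
      assert (D1 : meq nu1 (combF comb_F1 k C r s y)).
      { apply (FT_meas_unique nu); auto. eapply FT_meas_meq; [apply meq_sym, D0|apply meq_refl|exact T0]. }
      assert (D2 : meq nu2 (combF comb_F2 k C r s y)).
      { apply (FT_meas_unique nu1); auto. eapply FT_meas_meq; [apply meq_sym, D1|apply meq_refl|exact T1]. }
      assert (D3 : meq nu3 (combF comb_F3 k C r s y)).
      { apply (FT_meas_unique nu2); auto. eapply FT_meas_meq; [apply meq_sym, D2|apply meq_refl|exact T2]. }
      eapply meq_trans; [exact HE|]. eapply meq_trans; [apply (proj4_meq lam _ _ _ _ _ _ _ _ D0 D1 D2 D3)|].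
      intros f _. apply proj4_combF. }
  assert (H31 : cond3 -> cond1).
  { intros [n [k [C [r [s [Y [Hn [HY HE]]]]]]]]. set (y := sqrt (INR n)) in *. assert (Hyn : 0 < y) by now apply Hy.
    assert (E : meq mu (lincomb k C (fun i => comb_orbit lam (r i) (s i) y))).
    { eapply meq_trans; [exact HE|]. intros f Hf. apply csum_ext. intros i Hi. f_equal. apply is_Ycomb_orbit; auto. }
    split.
    (* All offsets of the four orbit terms of every comb; the support is close to progressions of
       step [/ y] through them. *)
    - set (X := flat_map (fun i => [r i; s i; - r i; - s i]) (seq 0 k)).
      apply (uniformly_discrete_carried X (/ y)); [now apply Rinv_0_lt_compat|].
      intros f Hf H. rewrite E by auto. revert f Hf H. apply carried_lincomb. intros i Hi. apply carried_comb_orbit; auto.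
      intros x Hx. apply in_flat_map. exists i. split; auto. apply in_seq. lia.
    - split; auto. exists (mscale lam mu). split; [|apply meq_refl].
      eapply FT_meas_meq; [apply meq_sym, E| |exact (eigen_combs lam k C r s y Hyn Hlam)].
      intros f Hf. unfold mscale. now rewrite E. }
  split; [split; auto|]. split; [split; auto|]. split; intros [HU HE]; (split; [auto|]).
  - destruct (eigen_comb_span mu lam Hmu Htr Hlam HU HE) as [n [Hn [HS HF]]]. split; auto. exists (mscale lam mu). split; [|apply meq_refl].
    apply (strict_of_eigen mu lam (sqrt (INR n))); auto.
  - split; auto. exists (mscale lam mu). split; [|apply meq_refl]. now apply strict_eigen_comb_span.
Qed.
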